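(* Suppose that $\mathbf E Z=0$ and that $Z$ is multivariate regularly varying with index $\alpha>1$ and spectral probability measure $\mathbf S$ on $\mathfrak N_d$. Suppose there is $D\in[1,\infty)$ with $\|\sigma(x)-\sigma(y)\|\vee\|a(x)-a(y)\|\le D\|x-y\|$ for all $x,y\in\mathbb R^m$. Let $I\subset\mathbb R^m$ be an open bounded set with $0\in I$, and suppose: $a(0)=0$; for all $x\in I\setminus\{0\}$, $y_t(x)\in I$ for all $t\ge0$ and $\lim_{t\to\infty}y_t(x)=0$; and for all $\epsilon>0$ small enough the inner product $a(x)\cdot x<0$ for all $x\in\bar B_\epsilon(0)\setminus\{0\}$. Let $b\in(0,\infty)$. Suppose that $\mathcal J^I_b<\infty$, that $I^c$ is bounded away from $\mathcal G^{(\mathcal J^I_b-1)|b}(\epsilon)$ for some (and hence all) $\epsilon>0$ small enough, and that $\check{\mathbf C}^{(\mathcal J^I_b)|b}(\partial I)=0$. Then $C^I_b:=\check{\mathbf C}^{(\mathcal J^I_b)|b}(I^c)<\infty$. Furthermore, if $C^I_b\in(0,\infty)$, then for any $\epsilon>0$, $t\ge0$ and measurable $B\subseteq I^c$, $$\limsup_{\eta\downarrow0}\sup_{x\in I_\epsilon}\mathbf P\Big(C^I_b\,\eta\,\lambda^{\mathcal J^I_b}(\eta)\,\tau^{\eta|b}(x)>t;\ X^{\eta|b}_{\tau^{\eta|b}(x)}(x)\in B\Big)\le\frac{\check{\mathbf C}^{(\mathcal J^I_b)|b}(B^-)}{C^I_b}\,e^{-t},$$ $$\liminf_{\eta\downarrow0}\inf_{x\in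 I_\epsilon}\mathbf P\Big(C^I_b\,\eta\,\lambda^{\mathcal J^I_b}(\eta)\,\tau^{\eta|b}(x)>t;\ X^{\eta|b}_{\tau^{\eta|b}(x)}(x)\in B\Big)\ge\frac{\check{\mathbf C}^{(\mathcal J^I_b)|b}(B^\circ)}{C^I_b}\,e^{-t}.$$ Otherwise, $C^I_b=0$, and $$\limsup_{\eta\downarrow0}\sup_{x\in I_\epsilon}\mathbf P\Big(\eta\,\lambda^{\mathcal J^I_b}(\eta)\,\tau^{\eta|b}(x)\le t\Big)=0\qquad\text{for all }\epsilon>0,\ t\ge0.$$
   Context: $\|\cdot\|$ is the Euclidean norm (operator norm for matrices); $u\vee v=\max$, $u\wedge v=\min$; $\bar B_r(x)$ is the closed ball of radius $r$ in $\mathbb R^m$; $B^\circ,B^-$ are interior and closure, $\partial I$ the boundary, $I^c$ the complement. Two sets are bounded away from each other if the infimum of distances between their points is positive. $\mathbb M$-convergence. For a metric space $(\mathbb S,\mathbf d)$ and Borel $\mathbb C\subseteq\mathbb S$, let $\mathbb C^r=\{y:\inf_{c\in\mathbb C}\mathbf d(c,y)\le r\}$; $\nu_n\to\nu$ in $\mathbb M(\mathbb S\setminus\mathbb C)$ (Borel measures on $\mathbb S\setminus\mathbb C$ finite on $\mathbb S\setminus\mathbb C^r$ for all $r>0$) means $\int f\,d\nu_n\to\int f\,d\nu$ for all non-negative bounded continuous $f$ on $\mathbb S\setminus\mathbb C$ vanishing on $\mathbb C^r$ for some $r>0$. Noise. $Z,Z_1,Z_2,\dots$ are iid random vectors in $\mathbb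 R^d$; $H(x)=\mathbf P(\|Z\|>x)$; $\lambda(\eta)=\eta^{-1}H(\eta^{-1})$, $\lambda^k(\eta)=(\lambda(\eta))^k$. $\mathfrak N_d$ is the unit sphere of $\mathbb R^d$; $\Phi(x)=(\|x\|,x/\|x\|)$ for $x\ne0$, $\Phi(0)=(0,(1,0,\dots,0))$; $\nu_\alpha$ is the Borel measure on $(0,\infty)$ with $\nu_\alpha[x,\infty)=x^{-\alpha}$. ''$Z$ is multivariate regularly varying with index $\alpha$ and spectral measure $\mathbf S$'' means: $\lim_{x\to\infty}H(tx)/H(x)=t^{-\alpha}$ for all $t>0$, and with $(R,\Theta)=\Phi(Z)$, $\mathbf P((x^{-1}R,\Theta)\in\cdot)/H(x)\to\nu_\alpha\times\mathbf S$ in $\mathbb M\big(([0,\infty)\times\mathfrak N_d)\setminus(\{0\}\times\mathfrak N_d)\big)$ as $x\to\infty$. Process. $a:\mathbb R^m\to\mathbb R^m$, $\sigma:\mathbb R^m\to\mathbb R^{m\times d}$; $\varphi_b(w)=(\frac b{\|w\|}\wedge1)w$ for $w\ne0$, $\varphi_b(0)=0$. $X^{\eta|b}_0(x)=x$, $X^{\eta|b}_j(x)=X^{\eta|b}_{j-1}(x)+\varphi_b\big(\eta a(X^{\eta|b}_{j-1}(x))+\eta\sigma(X^{\eta|b}_{j-1}(x))Z_j\big)$, $j\ge1$. $\tau^{\eta|b}(x)=\min\{j\ge0:X^{\eta|b}_j(x)\notin I\}$ (events involving $X^{\eta|b}_{\tau^{\eta|b}(x)}(x)$ are understood on $\{\tau^{\eta|b}(x)<\infty\}$).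 $y_t(x)$ solves $y_0(x)=x$, $dy_t(x)/dt=a(y_t(x))$. $I_\epsilon=\{y\in\mathbb R^m:\ \|x-y\|<\epsilon\Rightarrow x\in I\}$. Perturbed ODE. $E^{k\uparrow}=\{(t_1,\dots,t_k)\in E^k:t_1<\dots<t_k\}$. For $k\ge1$, $x\in\mathbb R^m$, $W=(w_1,\dots,w_k)\in\mathbb R^{d\times k}$, $V=(v_1,\dots,v_k)\in\mathbb R^{m\times k}$, $\mathbf t=(t_1,\dots,t_k)\in(0,\infty)^{k\uparrow}$, let $\xi$ solve on $[0,t_k+1]$: $\xi_0=x$; $d\xi_s/ds=a(\xi_s)$ for $s\notin\{t_1,\dots,t_k\}$; $\xi_s=\xi_{s-}+v_j+\varphi_b(\sigma(\xi_{s-}+v_j)w_j)$ if $s=t_j$. Define $\bar g^{(k)|b}(x,W,V,\mathbf t)=\xi_{t_k}$, $\check g^{(k)|b}(x,W,\mathbf t)=\bar g^{(k)|b}(x,W,(0,\dots,0),\mathbf t)$, and $\bar g^{(0)|b}(x)=\check g^{(0)|b}(x)=x$. Coverage sets. For $k\ge1$, $\epsilon\ge0$: $\mathcal G^{(k)|b}(\epsilon)$ is the set of all $\bar g^{(k-1)|b}\big(v_1+\varphi_b(\sigma(v_1)w_1),(w_2,\dots,w_k),(v_2,\dots,v_k),\mathbf t\big)$ with $(w_1,\dots,w_k)\in\mathbb R^{d\times k}$, $v_1,\dots,v_k\in\bar B_\epsilon(0)$, $\mathbf t\in(0,\infty)^{(k-1)\uparrow}$; $\mathcal G^{(0)|b}(\epsilon)=\bar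 B_\epsilon(0)$; $\mathcal G^{(k)|b}=\mathcal G^{(k)|b}(0)$. $\mathcal J^I_b=\min\{k\ge1:\mathcal G^{(k)|b}\cap I^c\ne\emptyset\}$ ($\min\emptyset=\infty$). Limit measure. $((\nu_\alpha\times\mathbf S)\circ\Phi)(E)=(\nu_\alpha\times\mathbf S)(\Phi(E))$ for Borel $E\subseteq\mathbb R^d\setminus\{0\}$; $\mathcal L^{k\uparrow}_\infty$ is Lebesgue measure restricted to $(0,\infty)^{k\uparrow}$ (for $k=0$ there is no time integration); $$\check{\mathbf C}^{(k)|b}(\cdot)=\int\mathbb I\big\{\check g^{(k-1)|b}(\varphi_b(\sigma(0)w_1),(w_2,\dots,w_k),\mathbf t)\in\cdot\big\}\,((\nu_\alpha\times\mathbf S)\circ\Phi)^k(dW)\times\mathcal L^{(k-1)\uparrow}_\infty(d\mathbf t).$$ *)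

(* Defs.v *)
From HB Require Import structures.
From mathcomp Require Import all_boot all_order all_algebra.
From mathcomp Require Import all_classical all_reals all_analysis.

Set Implicit Arguments.
Unset Strict Implicit.
Unset Printing Implicit Defensive.

Import Order.TTheory GRing.Theory Num.Theory.
Import numFieldNormedType.Exports.

Local Open Scope classical_set_scope.
Local Open Scope ring_scope.

(* The library lacks this join on products, needed to form borel (T * U). *)
HB.instance Definition _ (T U : ptopologicalType) := Pointed.on (T * U)%type.

Notation borel T := (g_sigma_algebraType (@open T)).

(* The library norm `|x| on matrices is the sup norm; it induces the same
   topology as the Euclidean norm below, so open, closure, interior and limits
   are the library's. *)
Section euclidean.
Context {R : realType}.

Definition dot n (x y : 'cV[R]_n) : R := \sum_i x i ord0 * y i ord0.

Definition enorm n (x : 'cV[R]_n) : R := Num.sqrt (dot x x).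

Definition eball n (r : R) (x : 'cV[R]_n) : set 'cV[R]_n :=
  [set y | enorm (y - x) <= r].

Definition opnorm m d (A : 'M[R]_(m, d)) : R :=
  sup [set enorm (A *m v) | v in [set v : 'cV[R]_d | enorm v <= 1]].

Definition esphere n : set 'cV[R]_n := [set x | enorm x = 1].

Definition bounded_away n (A B : set 'cV[R]_n) : Prop :=
  (0 < ereal_inf [set (enorm (x - y))%:E | x in A & y in B])%E.

Definition shrink n (I : set 'cV[R]_n) (e : R) : set 'cV[R]_n :=
  [set y | forall x, enorm (x - y) < e -> I x].

Definition boundary n (A : set 'cV[R]_n) : set 'cV[R]_n :=
  closure A `\` interior A.

(* At w = 0 this is 0, whatever the value of b / 0. *)
Definition clip n (b : R) (w : 'cV[R]_n) : 'cV[R]_n :=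
  Num.min (b / enorm w) 1 *: w.

End euclidean.

(* The space is a subset S of an ambient topological space T, with metric dist
   on S; a Borel measure on S `\` C is given by a set function on T, of which
   only the values inside S `\` C matter. *)
Section M_convergence.
Context {R : realType} {T : ptopologicalType}.
Variables (dist : T -> T -> R) (S C : set T).

Definition fattening (r : R) : set T :=
  [set y | S y /\ (ereal_inf [set (dist c y)%:E | c in C] <= r%:E)%E].

Definition in_M (mu : set (borel T) -> \bar R) : Prop :=
  forall r : R, 0 < r -> (mu (S `\` fattening r) < +oo)%E.

Definition M_cvg {U : Type} (F : set_system U)
    (mu_ : U -> set (borel T) -> \bar R) (mu : set (borel T) -> \bar R) : Prop :=
  [/\ (\forall u \near F, in_M (mu_ u)), in_M mu &
      forall f : T -> R,
        {within S `\` C, continuous f} ->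
        (exists M, forall x, (S `\` C) x -> 0 <= f x <= M) ->
        (exists2 r, 0 < r &
           forall x, (S `\` C) x -> fattening r x -> f x = 0) ->
        (\int[mu_ u]_(x in S `\` C) (f x)%:E)%E @[u --> F]
          --> (\int[mu]_(x in S `\` C) (f x)%:E)%E].

End M_convergence.

Section noise.
Context {R : realType} {disp : measure_display} {Omega : measurableType disp}.
Variables (P : probability Omega R) (d : nat).

Definition iid (Z : nat -> Omega -> 'cV[R]_d) : Prop :=
  [/\ forall j, measurable_fun setT (Z j : Omega -> borel 'cV[R]_d),
      forall j (A : set (borel 'cV[R]_d)), measurable A ->
        P (Z j @^-1` A) = P (Z 0%N @^-1` A) &
      forall (s : seq nat) (A : nat -> set (borel 'cV[R]_d)),
        uniq s -> (forall j, measurable (A j)) ->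
        fine (P (\bigcap_(j in [set` s]) (Z j @^-1` A j)))
          = \prod_(j <- s) fine (P (Z j @^-1` A j))].

Definition tail (Y : Omega -> 'cV[R]_d) (x : R) : R :=
  fine (P [set w | x < enorm (Y w)]).

Definition lambda (Y : Omega -> 'cV[R]_d) (eta : R) : R :=
  eta^-1 * tail Y eta^-1.

Definition Phi (x : 'cV[R]_d) : R * 'cV[R]_d :=
  if x == 0 then (0, \col_i ((i == 0%N :> nat)%:R)) else (enorm x, (enorm x)^-1 *: x).

(* For alpha > 0 these equations determine the measure, which is regarded as a
   measure on the line carried by the positive half-line. *)
Definition is_nu_alpha (alpha : R)
    (nu : {measure set (measurableTypeR R) -> \bar R}) : Prop :=
  nu `]-oo, 0%R]%classic = 0%E /\
  forall x : R, 0 < x -> nu `[x, +oo[%classic = (x `^ (- alpha))%:E.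

Definition polar_dist (p q : R * 'cV[R]_d) : R :=
  Num.max `|p.1 - q.1| (enorm (p.2 - q.2)).

Definition polar_space : set (R * 'cV[R]_d) :=
  [set r | 0 <= r] `*` @esphere R d.

Definition polar_origin : set (R * 'cV[R]_d) := [set 0] `*` @esphere R d.

Definition regularly_varying (Y : Omega -> 'cV[R]_d) (alpha : R)
    (nu : set (measurableTypeR R) -> \bar R)
    (S : set (borel 'cV[R]_d) -> \bar R) : Prop :=
  (forall t : R, 0 < t ->
     tail Y (t * x) / tail Y x @[x --> +oo] --> t `^ (- alpha)) /\
  M_cvg polar_dist polar_space polar_origin +oo
    (fun (x : R) A => ((tail Y x)^-1%:E *
       P [set w | A ((x^-1 * (Phi (Y w)).1)%R, (Phi (Y w)).2)])%E)
    (nu \x S)%E.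

(* The measure (nu x S) o Phi on the punctured space, extended by 0 at the
   origin. *)
Definition polar_measure (nu : set (measurableTypeR R) -> \bar R)
    (S : set (borel 'cV[R]_d) -> \bar R) : set (borel 'cV[R]_d) -> \bar R :=
  fun E => (nu \x S)%E (Phi @` (E `\ 0)).

End noise.

(* k-fold product measure, by the same iterated integration as the library's
   binary product m1 \x m2. *)
Fixpoint power_measure {R : realType} {disp} {T : measurableType disp}
    (mu : set T -> \bar R) (k : nat) : set (k.-tuple T) -> \bar R :=
  match k with
  | 0 => fun A => \d_[tuple] A
  | k'.+1 => fun A =>
      (\int[mu]_x power_measure mu (fun s : k'.-tuple T => A [tuple of x :: s]))%E
  end.

Section dynamics.
Context {R : realType} (m d : nat).
Variables (a : 'cV[R]_m -> 'cV[R]_m) (sigma : 'cV[R]_m -> 'M[R]_(m, d)).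

(* Derivative relative to D: one-sided at an end point of an interval D. *)
Definition has_deriv_within (D : set R) (f : R -> 'cV[R]_m) (s : R)
    (v : 'cV[R]_m) : Prop :=
  h^-1 *: (f (s + h) - f s) @[h --> within [set h | D (s + h)] 0^'] --> v.

Definition ode_sol (x : 'cV[R]_m) (y : R -> 'cV[R]_m) : Prop :=
  y 0 = x /\
  forall t, 0 <= t -> has_deriv_within `[0, +oo[%classic y t (a (y t)).

Definition increasing_times (k : nat) : set (k.-tuple R) :=
  [set t | (forall i, 0 < tnth t i) /\
           (forall i j : 'I_k, (i < j)%N -> tnth t i < tnth t j)].

Variable b : R.

Definition perturbed_sol (k : nat) (x : 'cV[R]_m)
    (W : k.-tuple 'cV[R]_d) (V : k.-tuple 'cV[R]_m) (t : k.-tuple R)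
    (xi : R -> 'cV[R]_m) : Prop :=
  [/\ xi 0 = x,
      forall s, 0 <= s <= last 0 t + 1 -> s \notin t ->
        has_deriv_within `[0, last 0 t + 1]%classic xi s (a (xi s)) &
      forall j : 'I_k,
        xi u @[u --> (tnth t j)^'+] --> xi (tnth t j) /\
        exists l : 'cV[R]_m,
          xi u @[u --> (tnth t j)^'-] --> l /\
          xi (tnth t j) =
            l + tnth V j + clip b (sigma (l + tnth V j) *m tnth W j)].

(* Under Lipschitz a and sigma and increasing times the solution exists and is
   unique, so the default value x of xget is then irrelevant. *)
Definition gbar (k : nat) (x : 'cV[R]_m)
    (W : k.-tuple 'cV[R]_d) (V : k.-tuple 'cV[R]_m) (t : k.-tuple R)
    : 'cV[R]_m :=
  if k == 0%N then x
  else xget x [set z | exists2 xi, perturbed_sol x W V t xi & xi (last 0 t) = z].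

Definition gcheck (k : nat) (x : 'cV[R]_m)
    (W : k.-tuple 'cV[R]_d) (t : k.-tuple R) : 'cV[R]_m :=
  gbar x W [tuple of nseq k 0] t.

Definition coverage (k : nat) (e : R) : set 'cV[R]_m :=
  match k with
  | 0 => eball e 0
  | k'.+1 =>
      [set z | exists (W : k'.+1.-tuple 'cV[R]_d) (V : k'.+1.-tuple 'cV[R]_m)
                      (t : k'.-tuple R),
         [/\ (forall i, eball e 0 (tnth V i)), increasing_times t &
             z = gbar (thead V + clip b (sigma (thead V) *m thead W))
                      [tuple of behead W] [tuple of behead V] t]]
  end.

(* J is the (finite) minimum defining the number of jumps needed to leave I. *)
Definition is_jump_number (I : set 'cV[R]_m) (J : nat) : Prop :=
  let K := [set k | (1 <= k)%N /\ coverage k 0 `&` ~` I !=set0] in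
  K J /\ forall k, K k -> (J <= k)%N.

(* Only meaningful for k >= 1; the value at k = 0 is a dummy. *)
Definition Ccheck (mu : set (borel 'cV[R]_d) -> \bar R) (k : nat)
    (A : set 'cV[R]_m) : \bar R :=
  match k with
  | 0 => 0%E
  | k'.+1 =>
      (\int[power_measure mu (k := k'.+1)]_W
       \int[power_measure lebesgue_measure (k := k')]_(t in @increasing_times k')
         (\1_A (gcheck (clip b (sigma 0 *m thead W)) [tuple of behead W] t))%:E)%E
  end.

Variables (Omega : Type) (Z : nat -> Omega -> 'cV[R]_d).

Fixpoint X (eta : R) (x : 'cV[R]_m) (j : nat) (w : Omega) : 'cV[R]_m :=
  match j with
  | 0 => x
  | j'.+1 => let y := X eta x j' w in
      y + clip b (eta *: a y + eta *: (sigma y *m Z j'.+1 w))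
  end.

(* Equal to +oo when the chain never leaves I. *)
Definition tau (I : set 'cV[R]_m) (eta : R) (x : 'cV[R]_m) (w : Omega) : \bar R :=
  ereal_inf [set (j%:R)%:E | j in [set j : nat | ~ I (X eta x j w)]].

Definition exit_location_in (I : set 'cV[R]_m) (eta : R) (x : 'cV[R]_m)
    (B : set 'cV[R]_m) : set Omega :=
  [set w | exists j : nat, tau I eta x w = (j%:R)%:E /\ B (X eta x j w)].

End dynamics.

(* Supremum and infimum in [0, 1] of a family of probabilities, so that the
   empty family has supremum 0 and infimum 1. *)
Definition prob_sup {R : realType} {T : Type} (A : set T) (p : T -> \bar R) :=
  maxe 0%E (ereal_sup (p @` A)).

Definition prob_inf {R : realType} {T : Type} (A : set T) (p : T -> \bar R) :=
  mine 1%E (ereal_inf (p @` A)).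

(* Main.v *)
(* On the time scale 1/eta the chain follows the flow of a, which is attracted
   to 0, except when an increment eta Z is large; large increments arrive at
   rate lambda(eta) and their rescaled law tends to the polar measure.  For the
   truncated noise an exponential supermartingale shows that between large jumps
   the chain leaves a tube around the flow with probability smaller than any
   power of lambda.  Decomposing along the first large jump therefore gives, by
   induction on the number of jumps, that from a neighbourhood of 0 the
   probability of leaving I within T/eta steps into A is lambda^J T (C(A) + o(1)).
   The coverage condition keeps every path with fewer than J jumps at a positive
   distance from the complement of I, which makes all the intensities finite and
   justifies dominated convergence.  The chain then performs nearly independent
   cycles of T/eta steps, each ending near 0, so the number of cycles before
   exit is asymptotically geometric, whence the exponential law, and the exit
   point is distributed as C(.)/C(I^c). *)
Require Import Defs.
From HB Require Import structures.
From mathcomp Require Import all_boot all_order all_algebra.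
From mathcomp Require Import all_classical all_reals all_analysis.
From mathcomp Require Import measurable_realfun.
From mathcomp Require Import ring lra.
Import Order.TTheory GRing.Theory Num.Theory.
Import numFieldNormedType.Exports.
Set Implicit Arguments.
Unset Strict Implicit.
Unset Printing Implicit Defensive.
Local Open Scope classical_set_scope.
Local Open Scope ring_scope.

(** The argument runs on the one-step operator [Kop] rather than on path space. Exit probabilities
    are iterates of this operator, so decomposing at a jump or at a return is an induction on the
    number of steps, without stopping times or conditioning; only at the end do product measures
    identify the iterates with probabilities of the chain. The supermartingale is the sum over
    coordinates of exp(theta (S_i - eps)) + exp(theta (-S_i - eps)), S being the accumulated noise
    and theta = K log(1/eta). Mean zero and a moment of order p in (1, 2], p < alpha, bound its
    growth per step by 1 + eta, while its initial value, of order eta^(K eps), is negligible against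
    lambda^j once K eps >= (alpha + 1) j + 1. The coverage condition is recast as a recursive
    predicate [safe], closed and hence compact, whose margin is halved at each jump of the
    induction; this makes the estimates uniform in the starting point. They need a margin, so cycles
    live in a set K strictly inside I. Entering the shell between K and I counts as leaving, and
    continuous bumps that also charge the boundary show that the shell has asymptotic intensity
    C(boundary) = 0. *)

Lemma near_ex2 T (F : set_system T) (FF : ProperFilter F) (P Q : set T) :
  F P -> F Q -> exists x, P x /\ Q x.
Proof. by move=> FP FQ; have [x] := filter_ex (filterI FP FQ); exists x. Qed.

(** * Euclidean norm, operator norm and clipping *)

Section norms.
Context {R : realType}.
Implicit Types (n : nat).

Lemma dotC n (x y : 'cV[R]_n) : dot x y = dot y x.
Proof. by apply: eq_bigr => i _; rewrite mulrC. Qed.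

Lemma dotDl n (x y z : 'cV[R]_n) : dot (x + y) z = dot x z + dot y z.
Proof. by rewrite /dot -big_split; apply: eq_bigr => i _; rewrite mxE mulrDl. Qed.

Lemma dotZl n (k : R) (x z : 'cV[R]_n) : dot (k *: x) z = k * dot x z.
Proof. by rewrite /dot mulr_sumr; apply: eq_bigr => i _; rewrite mxE mulrA. Qed.

Lemma dotNl n (x z : 'cV[R]_n) : dot (- x) z = - dot x z.
Proof. by rewrite -scaleN1r dotZl mulN1r. Qed.

Lemma dotBl n (x y z : 'cV[R]_n) : dot (x - y) z = dot x z - dot y z.
Proof. by rewrite dotDl dotNl. Qed.

Lemma dotDr n (x y z : 'cV[R]_n) : dot z (x + y) = dot z x + dot z y.
Proof. by rewrite dotC dotDl !(dotC z). Qed.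

Lemma dotBr n (x y z : 'cV[R]_n) : dot z (x - y) = dot z x - dot z y.
Proof. by rewrite dotC dotBl !(dotC z). Qed.

Lemma dotZr n (k : R) (x z : 'cV[R]_n) : dot z (k *: x) = k * dot z x.
Proof. by rewrite dotC dotZl dotC. Qed.

Lemma dot_ge0 n (x : 'cV[R]_n) : 0 <= dot x x.
Proof. by apply: sumr_ge0 => i _; rewrite -expr2 sqr_ge0. Qed.

Lemma enorm_ge0 n (x : 'cV[R]_n) : 0 <= enorm x.
Proof. exact: sqrtr_ge0. Qed.

Lemma sqr_enorm n (x : 'cV[R]_n) : enorm x ^+ 2 = dot x x.
Proof. by rewrite sqr_sqrtr// dot_ge0. Qed.

Lemma coord_le_enorm n (x : 'cV[R]_n) i : `|x i ord0| <= enorm x.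
Proof.
rewrite -sqrtr_sqr ler_sqrt ?dot_ge0//.
rewrite /dot (bigD1 i)//= -expr2 lerDl.
by apply: sumr_ge0 => j _; rewrite -expr2 sqr_ge0.
Qed.

Lemma norm_le_enorm n (x : 'cV[R]_n) : `|x| <= enorm x.
Proof.
rewrite [leLHS]/Num.norm /= mx_normrE; apply/bigmax_leP; split; first exact: enorm_ge0.
by move=> [i j] _ /=; rewrite (ord1 j); exact: coord_le_enorm.
Qed.

Lemma coord_le_norm n (x : 'cV[R]_n) i j : `|x i j| <= `|x|.
Proof.
rewrite [leRHS]/Num.norm /= mx_normrE.
exact: (le_bigmax _ (fun ij : 'I_n * 'I_1 => `|x ij.1 ij.2|) (i, j)).
Qed.

Lemma enorm_le_norm n (x : 'cV[R]_n) : enorm x <= n%:R * `|x|.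
Proof.
rewrite -(ler_pXn2r (_ : 0 < 2)%N)// ?nnegrE ?enorm_ge0 ?mulr_ge0//.
rewrite sqr_enorm /dot; apply: (@le_trans _ _ (\sum_(i < n) `|x| ^+ 2)).
  apply: ler_sum => i _; rewrite -expr2 -real_normK ?num_real//.
  by rewrite ler_pXn2r ?nnegrE// coord_le_norm.
rewrite sumr_const card_ord -[X in X <= _]mulr_natl exprMn.
apply: ler_wpM2r; first exact: sqr_ge0.
by rewrite -natrX ler_nat; case: n {x} => // n; rewrite leq_pmulr.
Qed.

Lemma enorm0 n : enorm (0 : 'cV[R]_n) = 0.
Proof. by rewrite /enorm /dot big1 ?sqrtr0// => i _; rewrite mxE mul0r. Qed.

Lemma enorm_eq0 n (x : 'cV[R]_n) : enorm x = 0 -> x = 0.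
Proof.
by move=> x0; apply/eqP; rewrite -normr_le0 -x0 norm_le_enorm.
Qed.

Lemma enorm_gt0 n (x : 'cV[R]_n) : x != 0 -> 0 < enorm x.
Proof.
move=> x0; rewrite lt_def enorm_ge0 andbT; apply: contra x0.
by move=> /eqP/enorm_eq0 ->.
Qed.

Lemma enormZ n (k : R) (x : 'cV[R]_n) : enorm (k *: x) = `|k| * enorm x.
Proof.
by rewrite /enorm dotZl dotZr mulrA -expr2 sqrtrM ?sqr_ge0// sqrtr_sqr.
Qed.

Lemma enormN n (x : 'cV[R]_n) : enorm (- x) = enorm x.
Proof. by rewrite -scaleN1r enormZ normrN1 mul1r. Qed.

Lemma enormB n (x y : 'cV[R]_n) : enorm (x - y) = enorm (y - x).
Proof. by rewrite -enormN opprB. Qed.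

Lemma dot_le_enorm n (x y : 'cV[R]_n) : dot x y <= enorm x * enorm y.
Proof.
have [->|y0] := eqVneq y 0.
  rewrite enorm0 mulr0 /dot big1// => i _; by rewrite mxE mulr0.
have [->|x0] := eqVneq x 0.
  rewrite enorm0 mul0r /dot big1// => i _; by rewrite mxE mul0r.
have := dot_ge0 (enorm y *: x - enorm x *: y).
rewrite dotBl !dotBr !dotZl !dotZr (dotC y x) -!sqr_enorm => h.
have yp := enorm_gt0 y0; have xp := enorm_gt0 x0.
have : 0 <= 2 * (enorm x * enorm y) * (enorm x * enorm y - dot x y).
  by apply: le_trans h _; rewrite le_eqVlt; apply/orP; left; apply/eqP; ring.
by rewrite pmulr_rge0 ?subr_ge0// !mulr_gt0.
Qed.

Lemma enorm_triangle n (x y : 'cV[R]_n) : enorm (x + y) <= enorm x + enorm y.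
Proof.
rewrite -(ler_pXn2r (_ : 0 < 2)%N)// ?nnegrE ?enorm_ge0 ?addr_ge0 ?enorm_ge0//.
rewrite sqrrD !sqr_enorm dotDl !dotDr (dotC y x).
have := dot_le_enorm x y; lra.
Qed.

Lemma enorm_sub_triangle n (y x z : 'cV[R]_n) :
  enorm (x - z) <= enorm (x - y) + enorm (y - z).
Proof. by have := enorm_triangle (x - y) (y - z); rewrite addrA subrK. Qed.

Lemma ler_dist_enorm n (x y : 'cV[R]_n) : `|enorm x - enorm y| <= enorm (x - y).
Proof.
have := enorm_triangle (x - y) y; have := enorm_triangle (y - x) x.
rewrite !subrK (enormB y) => h1 h2.
by rewrite ler_norml; apply/andP; split; lra.
Qed.

Lemma enorm_le_add n (x y : 'cV[R]_n) : enorm x <= enorm y + enorm (x - y).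
Proof. by have := enorm_triangle (x - y) y; rewrite subrK addrC. Qed.

Lemma enorm_continuous n : continuous (@enorm R n : 'cV[R]_n -> R).
Proof.
move=> x; apply/(@cvgrPdist_lt _ _ _ _ (nbhs_filter x)) => e e0.
have n0 : 0 < n%:R + 1 :> R by rewrite ltr_wpDl.
near=> y; apply: le_lt_trans (ler_dist_enorm _ _) _.
apply: le_lt_trans (enorm_le_norm _) _.
have : `|x - y| < e / (n%:R + 1).
  by near: y; apply/nbhs_ballP; exists (e / (n%:R + 1)); rewrite /= ?divr_gt0// -ball_normE.
rewrite ltr_pdivlMr// => h; apply: le_lt_trans h.
by rewrite mulrC ler_wpM2l// lerDl.
Unshelve. all: by end_near. Qed.

(** Comparison with the sup norm in both directions makes Euclidean balls a neighbourhood base; with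
    [cvg_enormP] this is how the later epsilon arguments reach the topology. *)
Lemma nbhs_enormP n (x : 'cV[R]_n) (A : set 'cV[R]_n) :
  nbhs x A <-> exists2 e, 0 < e & forall y, enorm (y - x) < e -> A y.
Proof.
split=> [|[e e0 eA]].
  move=> /nbhs_ballP[e /= e0 eA]; exists e => // y yx; apply: eA.
  rewrite -ball_normE /ball_/=; apply: le_lt_trans yx.
  by rewrite enormB; exact: norm_le_enorm.
have /= /cvgrPdist_lt/(_ e e0) := @enorm_continuous n 0.
move=> /nbhs_ballP[r /= r0 rA].
apply/nbhs_ballP; exists r => //= y yx; apply: eA.
have := rA (y - x); rewrite -!ball_normE /ball_/= enorm0 sub0r normrN.
rewrite sub0r normrN ger0_norm ?enorm_ge0//; apply.
by rewrite -normrN opprB; move: yx; rewrite -ball_normE.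
Qed.

Lemma near_enorm n (x : 'cV[R]_n) e : 0 < e -> \forall y \near x, enorm (y - x) < e.
Proof. by move=> e0; apply/nbhs_enormP; exists e. Qed.

Lemma cvg_enormP n T (F : set_system T) (FF : Filter F) (f : T -> 'cV[R]_n) (l : 'cV[R]_n) :
  f @ F --> l <-> forall e, 0 < e -> \forall t \near F, enorm (f t - l) < e.
Proof.
split=> [fl e e0|h].
  exact: (fl _ (near_enorm l e0)).
by move=> A /nbhs_enormP[e e0 eA]; rewrite /= /nbhs/=; near=> t; apply: eA; near: t; exact: h.
Unshelve. all: by end_near. Qed.

Lemma eball_closed n r (x : 'cV[R]_n) : closed (eball r x).
Proof.
have -> : eball r x = (fun y => enorm (y - x)) @^-1` [set t | t <= r] by [].
apply: closed_comp; last exact: closed_le.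
move=> y _; apply: continuous_comp; last exact: enorm_continuous.
apply/(@cvg_enormP _ _ _ (nbhs_filter y)) => e e0; near=> t.
by rewrite opprB addrA subrK; near: t; exact: near_enorm.
Unshelve. all: by end_near.
Qed.

(** Heine-Borel is available for row vectors; transposition, a homeomorphism, carries it over. *)
Lemma cV_bounded_closed_compact n (A : set 'cV[R]_n) M :
  A `<=` eball M 0 -> closed A -> compact A.
Proof.
move=> AM cA.
have ct p q : continuous (@trmx R p q).
  move=> x B /nbhs_ballP[e /= e0 eB]; apply/nbhs_ballP; exists e => //= y xy.
  apply: eB; move: xy; rewrite /ball/= => -[_ xy]; split=> // i j.
  by rewrite !mxE; exact: xy.
have -> : A = (@trmx R 1 n) @` ((@trmx R 1 n) @^-1` A).
  rewrite predeqE => y; split=> [Ay|[z Az <-//]].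
  by exists (y^T); rewrite /= ?trmxK.
apply: continuous_compact; first by apply: continuous_subspaceT; exact: ct.
apply: bounded_closed_compact; last by apply: closed_comp => // x _; exact: ct.
exists M; split; first exact: num_real.
move=> r Mr x /= /AM; rewrite /eball/= subr0 => xM.
apply: le_trans (ltW Mr).
rewrite [leLHS]/Num.norm /= mx_normrE; apply/bigmax_leP; split.
  exact: le_trans (enorm_ge0 _) xM.
move=> [i j] _ /=; rewrite (ord1 i); apply: le_trans xM.
by have := coord_le_enorm (x^T) j; rewrite mxE.
Qed.

Lemma eball_compact n r (x : 'cV[R]_n) : compact (eball r x).
Proof.
apply: (@cV_bounded_closed_compact _ _ (r + enorm x)); last exact: eball_closed.
move=> y; rewrite /eball/= subr0 => yx; apply: le_trans (enorm_le_add _ x) _.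
by rewrite addrC lerD2r.
Qed.

Lemma shrink_closed n (I : set 'cV[R]_n) e : closed (shrink I e).
Proof.
rewrite -openC openE => x /= /existsNP[z /not_implyP[zx Iz]].
apply/nbhs_enormP; exists (e - enorm (z - x)); first by rewrite subr_gt0.
move=> y yx /(_ z) h; apply: Iz; apply: h.
by apply: le_lt_trans (enorm_sub_triangle x _ _) _; rewrite (enormB x) -ltrBrDl.
Qed.

Lemma shrink_sub n (I : set 'cV[R]_n) e : 0 < e -> shrink I e `<=` I.
Proof. by move=> e0 x; apply; rewrite subrr enorm0. Qed.

Lemma le_shrink n (I : set 'cV[R]_n) e1 e2 : e1 <= e2 -> shrink I e2 `<=` shrink I e1.
Proof. by move=> e12 x Ix z zx; apply: Ix; exact: lt_le_trans e12. Qed.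

Lemma shrinkD n (I : set 'cV[R]_n) e r (x y : 'cV[R]_n) :
  shrink I e x -> enorm (y - x) <= r -> shrink I (e - r) y.
Proof.
move=> Ix yx z zy; apply: Ix; apply: le_lt_trans (enorm_sub_triangle y _ _) _.
by rewrite -ltrBrDr; apply: lt_le_trans zy _; rewrite lerD2l lerN2.
Qed.

Lemma shrink_compact n (I : set 'cV[R]_n) e M :
  0 < e -> I `<=` eball M 0 -> compact (shrink I e).
Proof.
move=> e0 IM; apply: cV_bounded_closed_compact; last exact: shrink_closed.
by move=> x /(shrink_sub e0)/IM; exact.
Qed.

Lemma open_shrink n (I : set 'cV[R]_n) x : open I -> I x ->
  exists2 e, 0 < e & shrink I e x.
Proof.
move=> /[swap] Ix; rewrite openE => /(_ _ Ix)/nbhs_enormP[e e0 eI].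
by exists e.
Qed.

Lemma opnorm_has_sup m d (A : 'M[R]_(m, d)) :
  has_sup [set enorm (A *m v) | v in [set v : 'cV[R]_d | enorm v <= 1]].
Proof.
split; first by exists (enorm (A *m 0)), 0 => //=; rewrite enorm0.
exists (m%:R * \sum_i \sum_j `|A i j|) => _ [v /= v1 <-].
apply: le_trans (enorm_le_norm _) _; rewrite ler_wpM2l//.
rewrite [leLHS]/Num.norm /= mx_normrE; apply/bigmax_leP; split.
  by apply: sumr_ge0 => i _; exact: sumr_ge0.
move=> [i k] _ /=; rewrite mxE (bigD1 i)//=.
apply: le_trans (ler_norm_sum _ _ _) _; rewrite -[leLHS]addr0 lerD//.
  apply: ler_sum => j _; rewrite normrM ler_piMr// (ord1 k).
  by rewrite (le_trans _ v1)// coord_le_enorm.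
by apply: sumr_ge0 => l _; exact: sumr_ge0.
Qed.

Lemma opnorm_ge0 m d (A : 'M[R]_(m, d)) : 0 <= opnorm A.
Proof.
apply: le_trans (enorm_ge0 (A *m 0)) _.
by apply: ub_le_sup; [exact: (opnorm_has_sup A).2|exists 0 => //=; rewrite enorm0].
Qed.

Lemma enorm_mulmx m d (A : 'M[R]_(m, d)) (v : 'cV[R]_d) :
  enorm (A *m v) <= opnorm A * enorm v.
Proof.
have [->|v0] := eqVneq v 0; first by rewrite mulmx0 !enorm0 mulr0.
have vp := enorm_gt0 v0.
rewrite -ler_pdivrMr//.
have -> : enorm (A *m v) / enorm v = enorm (A *m ((enorm v)^-1 *: v)).
  by rewrite -scalemxAr enormZ ger0_norm ?invr_ge0 ?enorm_ge0// mulrC.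
apply: ub_le_sup; first exact: (opnorm_has_sup A).2.
exists ((enorm v)^-1 *: v) => //=.
by rewrite enormZ ger0_norm ?invr_ge0 ?enorm_ge0// mulVf// gt_eqF.
Qed.

Lemma enorm_clip_le n b (w : 'cV[R]_n) : 0 <= b -> enorm (clip b w) <= enorm w.
Proof.
move=> b0; rewrite enormZ ler_piMl ?enorm_ge0// ger0_norm.
  by rewrite ge_min lexx orbT.
by rewrite le_min ler01 andbT divr_ge0// enorm_ge0.
Qed.

Lemma enorm_clip_leb n b (w : 'cV[R]_n) : 0 <= b -> enorm (clip b w) <= b.
Proof.
move=> b0; have [->|w0] := eqVneq w 0; first by rewrite /clip scaler0 enorm0.
have wp := enorm_gt0 w0.
rewrite enormZ ger0_norm; last by rewrite le_min ler01 andbT divr_ge0// enorm_ge0.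
rewrite -ler_pdivlMr//; by rewrite ge_min lexx.
Qed.

Lemma clip_id n b (w : 'cV[R]_n) : enorm w <= b -> clip b w = w.
Proof.
move=> wb; have [->|w0] := eqVneq w 0; first by rewrite /clip scaler0.
by rewrite /clip min_r ?scale1r// ler_pdivlMr ?mul1r ?enorm_gt0.
Qed.

Lemma clip0 n b : clip b (0 : 'cV[R]_n) = 0.
Proof. by rewrite /clip scaler0. Qed.

(** With |u| <= |w| and |w| > b, the difference splits into (b/|w|)(u - w) and a radial rest along
    u, each of norm at most |u - w|. This gives the factor 2 instead of the sharp 1, by norms
    alone. *)
Lemma clip_lipschitz n b (u w : 'cV[R]_n) : 0 <= b ->
  enorm (clip b u - clip b w) <= 2 * enorm (u - w).
Proof.
move=> b0; wlog uw : u w / enorm u <= enorm w.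
  move=> h; have [/h//|/ltW/h] := leP (enorm u) (enorm w).
  by rewrite enormB (enormB w).
have [w0|wb] := leP (enorm w) b.
  rewrite !clip_id// ?(le_trans uw)// ler_peMl ?enorm_ge0//; lra.
have wp : 0 < enorm w by exact: le_lt_trans wb.
have cw : clip b w = (b / enorm w) *: w.
  by rewrite /clip min_l// ler_pdivrMr// mul1r ltW.
have -> : clip b u - clip b w =
    (b / enorm w) *: (u - w) + (clip b u - (b / enorm w) *: u).
  by rewrite cw scalerBr [RHS]addrC addrA subrK.
apply: le_trans (enorm_triangle _ _) _.
have bw0 : 0 <= b / enorm w by rewrite divr_ge0// ltW.
have bw1 : b / enorm w <= 1 by rewrite ler_pdivrMr// mul1r ltW.
have -> : 2 * enorm (u - w) = enorm (u - w) + enorm (u - w) by ring.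
apply: lerD; first by rewrite enormZ ger0_norm// ler_piMl// enorm_ge0.
rewrite -scalerBl enormZ.
have [->|u0] := eqVneq u 0; first by rewrite enorm0 mulr0 enorm_ge0.
have up := enorm_gt0 u0.
have uwd : enorm w - enorm u <= enorm (u - w).
  by have := ler_dist_enorm w u; rewrite (enormB w); apply: le_trans; exact: ler_norm.
have mb : b / enorm w <= Num.min (b / enorm u) 1.
  by rewrite le_min bw1 andbT ler_wpM2l// lef_pV2 ?posrE.
rewrite ger0_norm ?subr_ge0//.
apply: le_trans uwd; have [h|h] := leP (b / enorm u) 1.
  rewrite ler_pdivrMr// mul1r in h.
  rewrite mulrBl divfK ?gt_eqF//.
  have -> : b - b / enorm w * enorm u = b / enorm w * (enorm w - enorm u).
    by rewrite mulrBr divfK ?gt_eqF//.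
  by rewrite ler_piMl// subr_ge0.
rewrite ltr_pdivlMr// mul1r in h.
have -> : (1 - b / enorm w) * enorm u = enorm u / enorm w * (enorm w - b).
  by field; rewrite gt_eqF.
have h2 : enorm u / enorm w <= 1 by rewrite ler_pdivrMr// mul1r.
apply: (@le_trans _ _ (enorm u / enorm w * (enorm w - b) + b - enorm u)).
  lra.
have : (1 - enorm u / enorm w) * (b - enorm w) <= 0.
  by rewrite mulr_ge0_le0// ?subr_ge0// subr_le0 ltW.
have -> : enorm u / enorm w * (enorm w - b) = enorm u / enorm w * enorm w - enorm u / enorm w * b by ring.
by move: (enorm u / enorm w) => q; lra.
Qed.

Lemma clip_continuous n b : 0 <= b -> continuous (clip b : 'cV[R]_n -> 'cV[R]_n).
Proof.
move=> b0 x; apply/(@cvg_enormP _ _ _ (nbhs_filter x)) => e e0; near=> y.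
apply: le_lt_trans (clip_lipschitz _ _ b0) _.
rewrite -ltr_pdivlMl//; near: y; apply: near_enorm.
by rewrite mulr_gt0// invr_gt0.
Unshelve. all: by end_near. Qed.

End norms.

(** * The flow *)

Section derivatives.
Context {R : realType} {n : nat}.
Implicit Types (f g : R -> 'cV[R]_n) (v w : 'cV[R]_n).

(** The first-order expansion, with a bound that includes h = 0: it adds up under sums and avoids
    the division in [has_deriv_within]. *)
Definition deriv_at f (s : R) v := forall e, 0 < e -> exists2 r, 0 < r &
  forall h, `|h| < r -> enorm (f (s + h) - f s - h *: v) <= e * `|h|.

Definition cont_on (p q : R) f := forall s, p <= s <= q -> forall e, 0 < e ->
  exists2 r, 0 < r & forall t, p <= t <= q -> `|t - s| < r -> enorm (f t - f s) < e.

Lemma has_deriv_withinP (A : set R) f s v : has_deriv_within A f s v ->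
  forall e, 0 < e -> exists2 r, 0 < r &
  forall h, `|h| < r -> A (s + h) -> enorm (f (s + h) - f s - h *: v) <= e * `|h|.
Proof.
move=> /(@cvg_enormP _ _ _ _ (within_filter _ _)) fv e e0; have := fv e e0.
rewrite /within /= => /nbhs_ballP[r /= r0 rf]; exists r => // h hr Ah.
have [->|h0] := eqVneq h 0.
  by rewrite addr0 subrr scale0r subrr enorm0 normr0 mulr0.
have hr' : ball 0 r h by rewrite -ball_normE/= sub0r normrN.
have := rf h hr' h0 Ah => /ltW.
have -> : f (s + h) - f s - h *: v = h *: (h^-1 *: (f (s + h) - f s) - v).
  by rewrite scalerBr scalerA mulfV// scale1r.
by rewrite enormZ mulrC ler_pM2r// normr_gt0.
Qed.

Lemma has_deriv_at (A : set R) f s v : has_deriv_within A f s v ->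
  nbhs s A -> deriv_at f s v.
Proof.
move=> /has_deriv_withinP fv /nbhs_ballP[r' /= r'0 rA] e /fv[r r0 rf].
exists (Num.min r r'); first by rewrite lt_min r0.
move=> h; rewrite lt_min => /andP[hr hr']; apply: rf => //; apply: rA.
by rewrite -ball_normE/= opprD addrA subrr sub0r normrN.
Qed.

Lemma has_deriv_cont (A : set R) f s v : has_deriv_within A f s v ->
  forall e, 0 < e -> exists2 r, 0 < r &
  forall t, A t -> `|t - s| < r -> enorm (f t - f s) < e.
Proof.
move=> /has_deriv_withinP /(_ 1 ltr01)[r r0 rf] e e0.
have v0 : 0 < enorm v + 1 by rewrite ltr_wpDl// enorm_ge0.
exists (Num.min r (e / (enorm v + 1))); first by rewrite lt_min r0 divr_gt0.
move=> t At; rewrite lt_min => /andP[tr]; rewrite ltr_pdivlMr// => te.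
have := rf (t - s) tr; rewrite addrCA subrr addr0 => /(_ At) h.
apply: le_lt_trans te; rewrite mulrDr mulr1 -enormZ.
have /le_trans -> // := enorm_le_add (f t - f s) ((t - s) *: v).
by rewrite !enormZ lerD2l -[leRHS]mul1r.
Qed.

(** Transfers the expansion to the library derivative of a scalar function, so that the mean value
    theorem and the monotonicity criterion apply to inner products with a path. *)
Lemma deriv_at_is_derive (phi : R -> R) (s v : R) :
  (forall e, 0 < e -> exists2 r, 0 < r &
    forall h, `|h| < r -> `|phi (s + h) - phi s - h * v| <= e * `|h|) ->
  is_derive s 1 phi v.
Proof.
move=> H.
have cv : h^-1 *: ((phi \o shift s) (h *: (1 : R)) - phi s) @[h --> 0^'] --> v.
  apply/cvgrPdist_le => e e0; have [r r0 rf] := H e e0.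
  near=> h.
  have h0 : h != 0 by near: h; exact: nbhs_dnbhs_neq.
  have hr : `|h| < r by near: h; exact: dnbhs0_lt.
  rewrite /= [h *: _]mulr1 (addrC h).
  have := rf h hr.
  have -> : phi (s + h) - phi s - h * v = - h * (v - h^-1 *: (phi (s + h) - phi s)).
    by rewrite mulNr mulrBr /GRing.scale/= mulrA mulfV// mul1r opprB.
  by rewrite normrM normrN mulrC ler_pM2r// normr_gt0.
split; first by apply/cvg_ex; exists v.
exact/cvg_lim.
Unshelve. all: by end_near. Qed.

Lemma deriv_at_dot f s v u : deriv_at f s v -> is_derive s 1 (fun t => dot u (f t)) (dot u v).
Proof.
move=> fv; apply: deriv_at_is_derive => e e0.
have u0 : 0 < enorm u + 1 by rewrite ltr_wpDl// enorm_ge0.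
have [r r0 rf] := fv (e / (enorm u + 1)) (divr_gt0 e0 u0).
exists r => // h /rf hr.
have -> : dot u (f (s + h)) - dot u (f s) - h * dot u v = dot u (f (s + h) - f s - h *: v).
  by rewrite !dotBr dotZr.
have h1 : `|dot u (f (s + h) - f s - h *: v)| <= enorm u * enorm (f (s + h) - f s - h *: v).
  rewrite ler_norml dot_le_enorm andbT -(enormN u) lerNl.
  by rewrite -dotNl dot_le_enorm.
apply: le_trans h1 _.
have := ler_wpM2l (enorm_ge0 u) hr => /le_trans -> //.
rewrite mulrA ler_wpM2r// mulrA ler_pdivrMr// mulrC ler_wpM2l// ?ltW//.
by rewrite ltrDl.
Qed.

Lemma cont_on_dot f p q u : cont_on p q f ->
  {within `[p, q], continuous (fun t => dot u (f t))}.
Proof.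
move=> cf; apply/subspace_continuousP => s; rewrite /= in_itv/= => spq.
apply/(@cvgrPdist_lt _ _ _ _ (within_filter _ _)) => e e0.
have u0 : 0 < enorm u + 1 by rewrite ltr_wpDl// enorm_ge0.
have [r r0 rf] := cf s spq (e / (enorm u + 1)) (divr_gt0 e0 u0).
apply/nbhs_ballP; exists r => //= t; rewrite -ball_normE/= => st.
rewrite in_itv/= => tpq.
have := rf t tpq; rewrite distrC => /(_ st); rewrite ltr_pdivlMr// => h.
rewrite distrC -dotBr; apply: le_lt_trans h.
have : `|dot u (f t - f s)| <= enorm u * enorm (f t - f s).
  rewrite ler_norml dot_le_enorm andbT -(enormN u) lerNl.
  by rewrite -dotNl dot_le_enorm.
move=> /le_trans -> //; by rewrite mulrC ler_wpM2l ?enorm_ge0// lerDl.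
Qed.

Lemma deriv_at_sub f g s v w : deriv_at f s v -> deriv_at g s w ->
  deriv_at (fun t => f t - g t) s (v - w).
Proof.
move=> fv gw e e0; have e2 : 0 < e / 2 by rewrite divr_gt0.
have [r r0 rf] := fv _ e2; have [r' r'0 rg] := gw _ e2.
exists (Num.min r r'); first by rewrite lt_min r0.
move=> h; rewrite lt_min => /andP[/rf hf /rg hg].
have -> : f (s + h) - g (s + h) - (f s - g s) - h *: (v - w) =
  (f (s + h) - f s - h *: v) - (g (s + h) - g s - h *: w).
  by apply/matrixP => i j; rewrite !mxE; ring.
apply: le_trans (enorm_triangle _ _) _; rewrite enormN.
by have := lerD hf hg; rewrite -mulrDl -splitr.
Qed.

Lemma cont_on_sub f g p q : cont_on p q f -> cont_on p q g ->
  cont_on p q (fun t => f t - g t).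
Proof.
move=> cf cg s spq e e0; have e2 : 0 < e / 2 by rewrite divr_gt0.
have [r r0 rf] := cf s spq _ e2; have [r' r'0 rg] := cg s spq _ e2.
exists (Num.min r r'); first by rewrite lt_min r0.
move=> t tpq; rewrite lt_min => /andP[/(rf _ tpq) hf /(rg _ tpq) hg].
have -> : f t - g t - (f s - g s) = (f t - f s) - (g t - g s).
  by apply/matrixP => i j; rewrite !mxE; ring.
apply: le_lt_trans (enorm_triangle _ _) _; rewrite enormN.
by have := ltrD hf hg; rewrite -splitr.
Qed.

Lemma deriv_at_sqr f s v : deriv_at f s v ->
  is_derive s 1 (fun t => dot (f t) (f t)) (2 * dot (f s) v).
Proof.
move=> fv; apply: deriv_at_is_derive => e e0.
pose c := (enorm v + 1) ^+ 2 + 2 * enorm (f s) + 1.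
have c0 : 0 < c.
  rewrite /c ltr_wpDl// addr_ge0// ?sqr_ge0// mulr_ge0// enorm_ge0//.
have [r r0 rf] := fv (Num.min 1 (e / c)) ltac:(by rewrite lt_min ltr01 divr_gt0).
exists (Num.min r (e / c)); first by rewrite lt_min r0 divr_gt0.
move=> h; rewrite lt_min => /andP[/rf hr hec].
set x := f (s + h) - f s in hr *.
have -> : dot (f (s + h)) (f (s + h)) - dot (f s) (f s) - h * (2 * dot (f s) v) =
   dot x x + 2 * dot (f s) (x - h *: v).
  have -> : f (s + h) = f s + x by rewrite /x addrCA subrr addr0.
  clearbody x; rewrite dotBr dotZr dotDl !dotDr (dotC x (f s)); ring.
have m1 : Num.min 1 (e / c) <= 1 by rewrite ge_min lexx.
have m2 : Num.min 1 (e / c) <= e / c by rewrite ge_min lexx orbT.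
have xh : enorm x <= (enorm v + 1) * `|h|.
  apply: le_trans (enorm_le_add x (h *: v)) _; rewrite enormZ mulrDl mul1r.
  rewrite mulrC lerD2l; apply: le_trans hr _; by rewrite ler_piMl.
have hr2 : enorm (x - h *: v) <= e / c * `|h| by apply: le_trans hr _; rewrite ler_wpM2r.
have h1 : `|dot (f s) (x - h *: v)| <= enorm (f s) * (e / c * `|h|).
  have : `|dot (f s) (x - h *: v)| <= enorm (f s) * enorm (x - h *: v).
    rewrite ler_norml dot_le_enorm andbT -(enormN (f s)) lerNl.
    by rewrite -dotNl dot_le_enorm.
  by move/le_trans; apply; rewrite ler_wpM2l// enorm_ge0.
have h2 : dot x x <= (enorm v + 1) ^+ 2 * (e / c * `|h|).
  rewrite -sqr_enorm; apply: (@le_trans _ _ (((enorm v + 1) * `|h|) ^+ 2)).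
    by rewrite ler_pXn2r ?nnegrE ?enorm_ge0// mulr_ge0// addr_ge0// enorm_ge0.
  rewrite exprMn ler_wpM2l ?sqr_ge0// expr2 ler_wpM2r// ltW//.
apply: le_trans (ler_normD _ _) _.
rewrite (ger0_norm (dot_ge0 x)) normrM (ger0_norm (_ : 0 <= 2 :> R))//.
have -> : e * `|h| = c * (e / c * `|h|) by field; rewrite gt_eqF.
have k0 : 0 <= e / c * `|h| by rewrite mulr_ge0// ltW// divr_gt0.
move: h1 h2 k0; rewrite /c; move: (e / _ * _) => k h1 h2 k0.
rewrite !mulrDl mul1r; lra.
Qed.

Lemma cont_on_sqr f p q : cont_on p q f ->
  {within `[p, q], continuous (fun t => dot (f t) (f t))}.
Proof.
move=> cf; apply/subspace_continuousP => s; rewrite /= in_itv/= => spq.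
apply/(@cvgrPdist_lt _ _ _ _ (within_filter _ _)) => e e0.
pose c := 2 * enorm (f s) + 1.
have c0 : 0 < c by rewrite /c ltr_wpDl// mulr_ge0// enorm_ge0.
have [r r0 rf] := cf s spq (Num.min 1 (e / c)) ltac:(by rewrite lt_min ltr01 divr_gt0).
apply/nbhs_ballP; exists r => //= t; rewrite -ball_normE/= => st.
rewrite in_itv/= => tpq.
have := rf t tpq; rewrite distrC => /(_ st); rewrite lt_min => /andP[h1].
rewrite ltr_pdivlMr// => h2.
apply: le_lt_trans h2.
have -> : dot (f s) (f s) - dot (f t) (f t) = - (dot (f t - f s) (f t - f s) + 2 * dot (f s) (f t - f s)).
  rewrite !dotBl !dotBr (dotC (f t) (f s)); ring.
rewrite normrN; apply: le_trans (ler_normD _ _) _.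
rewrite (ger0_norm (dot_ge0 _)) normrM (ger0_norm (_ : 0 <= 2 :> R))//.
rewrite /c mulrDr mulr1 addrC; apply: lerD.
  rewrite mulrCA ler_wpM2l// mulrC.
  rewrite ler_norml dot_le_enorm andbT -(enormN (f s)) lerNl.
  by rewrite -dotNl dot_le_enorm.
by rewrite -sqr_enorm expr2 ler_piMl ?enorm_ge0// ltW.
Qed.

(** The scalar mean value theorem is applied to the inner product of f with the increment u = f q -
    f p, which turns |u|^2 into q - p times an inner product of u with a derivative. *)
Lemma le_norm_deriv f p q M (df : R -> 'cV[R]_n) : p <= q ->
  (forall s, p < s < q -> deriv_at f s (df s)) ->
  (forall s, p < s < q -> enorm (df s) <= M) -> cont_on p q f ->
  enorm (f q - f p) <= M * (q - p).
Proof.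
move=> pq fd dM cf; move: pq; rewrite le_eqVlt => /predU1P[->|pq].
  by rewrite !subrr enorm0 mulr0.
set u := f q - f p.
have [u0|u0] := eqVneq u 0.
  rewrite u0 enorm0 mulr_ge0 ?subr_ge0 ?(ltW pq)//.
  have h : p < (p + q) / 2 < q by rewrite !midf_lt.
  by apply: le_trans (dM _ h); rewrite enorm_ge0.
have [|c] := @MVT R (fun t => dot u (f t)) (fun t => dot u (df t)) p q pq _ (cont_on_dot (u := u) cf).
  by move=> x; rewrite in_itv/= => /fd/deriv_at_dot.
rewrite in_itv/= => /dM cM.
rewrite -dotBr -/u => h.
have up := enorm_gt0 u0.
rewrite -(ler_pM2l up) -expr2 sqr_enorm h mulrA ler_wpM2r ?subr_ge0 ?(ltW pq)//.
by apply: le_trans (dot_le_enorm _ _) _; rewrite ler_wpM2l ?enorm_ge0.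
Qed.

(* e^{-2Ds} |f-g|^2 is nonincreasing. *)
Lemma gronwall_ode (a : 'cV[R]_n -> 'cV[R]_n) (D : R) f g p q :
  (forall x y, enorm (a x - a y) <= D * enorm (x - y)) -> p <= q ->
  (forall s, p < s < q -> deriv_at f s (a (f s))) ->
  (forall s, p < s < q -> deriv_at g s (a (g s))) ->
  cont_on p q f -> cont_on p q g ->
  enorm (f q - g q) <= expR (D * (q - p)) * enorm (f p - g p).
Proof.
move=> aD pq fd gd cf cg.
pose w t := f t - g t.
pose phi := (fun t => dot (w t) (w t)) * (fun t => expR (- (2 * D) * t)).
have dphi s : p < s < q -> is_derive s 1 phi
   (dot (w s) (w s) *: (expR (- (2 * D) * s) * (- (2 * D))) +
    expR (- (2 * D) * s) *: (2 * dot (w s) (a (f s) - a (g s)))).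
  move=> spq.
  have h1 := deriv_at_sqr (deriv_at_sub (fd s spq) (gd s spq)).
  have h2 : is_derive s 1 (fun t : R => expR (- (2 * D) * t)) (expR (- (2 * D) * s) * (- (2 * D))).
    have h3 : is_derive s (1 : R) (fun t : R => - (2 * D) * t) (- (2 * D)).
      have := @is_deriveZ _ _ _ (@id R) (- (2 * D)) s 1 _ (is_derive_id s 1).
      by rewrite [_ *: _]mulr1.
    have := @is_derive1_comp _ expR _ s _ _ (is_derive_expR _) h3.
    by rewrite mulrC.
  exact: is_deriveM.
have cphi : {within `[p, q], continuous phi}.
  move=> s; apply: continuousM; first exact: (cont_on_sqr (cont_on_sub cf cg)).
  move: s; apply: continuous_subspaceT => s.
  apply: continuous_comp; last exact: continuous_expR.
  by apply: cvgM; [exact: cvg_cst|exact: cvg_id].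
have hphi : phi q <= phi p.
  apply: (@ler0_derive1_le_cc R phi p q _ _ cphi); rewrite ?in_itv/= ?lexx ?pq//.
    by move=> s; rewrite in_itv/= => /dphi [].
  move=> s; rewrite in_itv/= => /dphi h; rewrite derive1E derive_val.
  rewrite /GRing.scale/=.
  have : dot (w s) (a (f s) - a (g s)) <= D * dot (w s) (w s).
    apply: le_trans (dot_le_enorm _ _) _; rewrite -sqr_enorm expr2 mulrA (mulrC D).
    by rewrite -mulrA ler_wpM2l ?enorm_ge0.
  have := expR_gt0 (- (2 * D) * s); set E := expR _; set A := dot _ _; set B := dot _ _.
  move=> E0 AB; have : E * (A - D * B) <= 0 by rewrite mulr_ge0_le0 ?subr_le0// ltW.
  nra.
have {hphi} : enorm (w q) ^+ 2 <= (expR (D * (q - p)) * enorm (w p)) ^+ 2.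
  rewrite exprMn !sqr_enorm.
  have h : dot (w q) (w q) * expR (- (2 * D) * q) <= dot (w p) (w p) * expR (- (2 * D) * p) := hphi.
  rewrite -(ler_pM2r (expR_gt0 (- (2 * D) * q))); apply: le_trans h _.
  rewrite -expRM_natl mulrAC -expRD mulrC.
  by rewrite le_eqVlt; apply/orP; left; apply/eqP; congr (expR _ * _); ring.
by rewrite ler_pXn2r ?nnegrE ?enorm_ge0// mulr_ge0 ?expR_ge0 ?enorm_ge0.
Qed.

End derivatives.

Section flow.
Context {R : realType} {m : nat}.
Variables (a : 'cV[R]_m -> 'cV[R]_m) (D : R).
Hypothesis aD : forall x y, enorm (a x - a y) <= D * enorm (x - y).
Hypothesis D0 : 0 <= D.
Variable y_ : R -> 'cV[R]_m -> 'cV[R]_m.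
Hypothesis y_flow : forall x, ode_sol a x (y_ ^~ x).

Lemma flow0 x : y_ 0 x = x. Proof. by have [] := y_flow x. Qed.

Lemma flow_deriv x t : 0 < t -> deriv_at (y_ ^~ x) t (a (y_ t x)).
Proof.
move=> t0; have [_ /(_ t (ltW t0)) h] := y_flow x; apply: has_deriv_at h _.
have : nbhs t `]0, +oo[%classic.
  by apply: open_nbhs_nbhs; split; [exact: interval_open|rewrite /= in_itv/= t0].
apply: filterS => s; rewrite /= !in_itv/= !andbT; exact: ltW.
Qed.

Lemma flow_cont x p q : 0 <= p -> cont_on p q (y_ ^~ x).
Proof.
move=> p0 s /andP[ps sq] e e0; have [_ /(_ s (le_trans p0 ps)) h] := y_flow x.
have [r r0 rf] := has_deriv_cont h e0; exists r => // t /andP[pt _] ts.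
by apply: rf => //; rewrite /= in_itv/= (le_trans p0).
Qed.

Lemma flow_lip x x' t : 0 <= t ->
  enorm (y_ t x - y_ t x') <= expR (D * t) * enorm (x - x').
Proof.
move=> t0; have := @gronwall_ode _ _ a D (y_ ^~ x) (y_ ^~ x') 0 t aD t0.
rewrite subr0 !flow0; apply.
- by move=> s /andP[s0 _]; exact: flow_deriv.
- by move=> s /andP[s0 _]; exact: flow_deriv.
- exact: flow_cont.
- exact: flow_cont.
Qed.

Lemma flow_unique x f q : 0 <= q -> f 0 = x ->
  (forall s, 0 < s < q -> deriv_at f s (a (f s))) -> cont_on 0 q f -> f q = y_ q x.
Proof.
move=> q0 f0 fd cf; apply/eqP; rewrite -subr_eq0; apply/eqP/enorm_eq0.
apply: le_anti; rewrite enorm_ge0 andbT.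
have := @gronwall_ode _ _ a D f (y_ ^~ x) 0 q aD q0 fd _ cf (@flow_cont x 0 q _).
rewrite flow0 f0 subrr enorm0 mulr0; apply => // s /andP[s0 _]; exact: flow_deriv.
Qed.

Lemma flow_semi x s t : 0 <= s -> 0 <= t -> y_ t (y_ s x) = y_ (s + t) x.
Proof.
move=> s0 t0; apply/esym.
apply: (@flow_unique _ (fun t => y_ (s + t) x)) => //.
- by rewrite addr0.
- move=> u /andP[u0 ut] e e0.
  have [r r0 rf] := @flow_deriv x (s + u) (ltr_wpDl s0 u0) e e0.
  by exists r => // h /rf; rewrite addrA.
- move=> u /andP[u0 ut] e e0.
  have := @flow_cont x s (s + t) s0 (s + u); rewrite lerDl u0 lerD2l ut => /(_ isT e e0).
  move=> [r r0 rf]; exists r => // v /andP[v0 vt] uv; apply: rf.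
    by rewrite lerDl v0 lerD2l.
  by rewrite opprD addrACA subrr add0r.
Qed.

Lemma flow_zero t : a 0 = 0 -> 0 <= t -> y_ t 0 = 0.
Proof.
move=> a0 t0; apply/esym; apply: (@flow_unique 0 (cst 0)) => //.
- move=> s _ e e0; exists 1 => // h _; rewrite /cst a0 scaler0 !subr0 enorm0.
  by rewrite mulr_ge0// ltW.
- by move=> s _ e e0; exists 1 => // h _ _; rewrite /cst subrr enorm0.
Qed.

(** [ode_sol] says nothing at negative times, so these are frozen at 0. Continuity in time at a
    fixed point combines with the Lipschitz bound in the initial state. *)
Lemma flow_continuous : continuous (fun p : R * 'cV[R]_m => y_ (Num.max 0 p.1) p.2).
Proof.
move=> [s x]; apply/(@cvg_enormP _ _ _ _ (nbhs_filter (s, x))) => e e0 /=.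
have e2 : 0 < e / 2 by rewrite divr_gt0.
have s0 : 0 <= Num.max 0 s by rewrite le_max lexx.
have [r r0 rf] := @flow_cont x 0 (Num.max 0 s + 1) (lexx _) (Num.max 0 s)
  ltac:(by rewrite s0 lerDl ler01) _ e2.
pose C := expR (D * (Num.max 0 s + 1)).
have C0 : 0 < C := expR_gt0 _.
exists (ball s (Num.min 1 r), [set z | enorm (z - x) < e / 2 / C]); rewrite /=.
  split; first by apply: nbhsx_ballx; rewrite lt_min ltr01.
  by apply: near_enorm; rewrite divr_gt0.
move=> [t z] /= []; rewrite -ball_normE/= lt_min => /andP[st1 str] zx.
have mm : `|Num.max 0 t - Num.max 0 s| <= `|s - t|.
  rewrite distrC; have := ler_norm (s - t); have := ler_norm (- (s - t)); rewrite normrN.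
  by rewrite ler_norml /Num.max; case: ifPn; case: ifPn; rewrite -?leNgt => *; lra.
have t1 : Num.max 0 t <= Num.max 0 s + 1.
  have := le_trans (ler_norm _) mm; lra.
have t0 : 0 <= Num.max 0 t by rewrite le_max lexx.
apply: le_lt_trans (enorm_sub_triangle (y_ (Num.max 0 t) x) _ _) _.
rewrite (splitr e); apply: ltrD; last first.
  by apply: rf; [rewrite t0 t1|exact: le_lt_trans str].
apply: le_lt_trans (flow_lip _ _ t0) _.
rewrite ltr_pdivlMr// in zx; apply: le_lt_trans zx.
rewrite mulrC ler_wpM2l ?enorm_ge0// ler_expR ler_wpM2l//.
Qed.

Lemma flow_continuous_time x : continuous (fun t : R => y_ (Num.max 0 t) x).
Proof.
move=> u; apply: (@continuous_comp _ _ _ (fun t : R => (t, x))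
  (fun p : R * 'cV[R]_m => y_ (Num.max 0 p.1) p.2)).
  apply: (@cvg_pair _ _ _ (nbhs u) (nbhs u) (nbhs x) _ _ _ id (fun=> x)).
    exact: cvg_id.
  exact: cvg_cst.
exact: flow_continuous.
Qed.

(** Subtracting the linear motion leaves a path with derivative a(y_t) - a(y_s), of norm at most D
    M1 h; the mean value inequality serves once for this bound and once for the error. *)
Lemma flow_euler x M1 s h : (forall t, 0 <= t -> enorm (a (y_ t x)) <= M1) ->
  0 <= s -> 0 <= h ->
  enorm (y_ (s + h) x - y_ s x - h *: a (y_ s x)) <= D * M1 * h ^+ 2.
Proof.
move=> aM s0 h0.
have tm t : s <= t -> enorm (y_ t x - y_ s x) <= M1 * (t - s).
  move=> st; apply: (@le_norm_deriv _ _ (y_ ^~ x) s t M1 (fun u => a (y_ u x))) => //.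
  - by move=> u /andP[su _]; apply: flow_deriv; exact: le_lt_trans su.
  - by move=> u /andP[su _]; apply: aM; rewrite (le_trans s0)// ltW.
  - exact: flow_cont.
pose g t := y_ t x - (t - s) *: a (y_ s x).
have -> : y_ (s + h) x - y_ s x - h *: a (y_ s x) = g (s + h) - g s.
  rewrite /g subrr scale0r subr0 (addrC s) addrK.
  by rewrite addrAC.
have -> : D * M1 * h ^+ 2 = D * M1 * h * (s + h - s) by rewrite (addrC s) addrK; ring.
apply: (@le_norm_deriv _ _ g s (s + h) _ (fun u => a (y_ u x) - a (y_ s x))).
- by rewrite lerDl.
- move=> u /andP[su _]; apply: deriv_at_sub.
    by apply: flow_deriv; exact: le_lt_trans su.
  move=> e e0; exists 1 => // k _.
  have -> : (u + k - s) *: a (y_ s x) - (u - s) *: a (y_ s x) - k *: a (y_ s x) = 0.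
    by rewrite -scalerBl -scalerBl; rewrite (_ : u + k - s - (u - s) - k = 0) ?scale0r//; ring.
  by rewrite enorm0 mulr_ge0// ltW.
- move=> u /andP[su us]; apply: le_trans (aD _ _) _; rewrite -mulrA ler_wpM2l//.
  apply: le_trans (tm _ (ltW su)) _; rewrite ler_wpM2l//; last by rewrite lerBlDl ltW.
  exact: le_trans (enorm_ge0 _) (aM _ s0).
- apply: cont_on_sub; first exact: flow_cont.
  move=> u _ e e0; pose c := enorm (a (y_ s x)) + 1.
  have c0 : 0 < c by rewrite /c ltr_wpDl// enorm_ge0.
  exists (e / c); first by rewrite divr_gt0.
  move=> t _; rewrite ltr_pdivlMr// => h1; rewrite -scalerBl enormZ.
  have -> : t - s - (u - s) = t - u by ring.
  by apply: le_lt_trans h1; rewrite ler_wpM2l// /c lerDl.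
Qed.

(** If the path were outside at time t, let s be the last time before t with norm at most r. Shortly
    after s the norm lies in (r, e0], where inwardness makes the squared norm nonincreasing, a
    contradiction. *)
Lemma flow_ball e0 r x t : (forall x, enorm x <= e0 -> x <> 0 -> dot (a x) x < 0) ->
  a 0 = 0 -> 0 <= r < e0 -> enorm x <= r -> 0 <= t -> enorm (y_ t x) <= r.
Proof.
move=> aneg a0 /andP[r0 re] xr t0; rewrite leNgt; apply/negP => ytr.
pose A := [set s | 0 <= s <= t /\ enorm (y_ s x) <= r].
have A0 : A 0 by split; [rewrite lexx|rewrite flow0].
have As : has_sup A by split; [exists 0|exists t => s [/andP[]]].
pose s := sup A.
have s0 : 0 <= s by apply: ub_le_sup => //; case: As.
have st : s <= t by apply: ge_sup; [exists 0|move=> u [/andP[]]].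
have ys : enorm (y_ s x) <= r.
  rewrite leNgt; apply/negP => ysr.
  have [d d0 df] := @flow_cont x 0 t (lexx _) s ltac:(by rewrite s0) (enorm (y_ s x) - r)
    ltac:(by rewrite subr_gt0).
  have [u Au us] := sup_adherent d0 As; have [/andP[u0 ut] yu] := Au.
  have us' : u <= s by apply: ub_le_sup => //; case: As.
  have := df u; rewrite u0 ut => /(_ isT); rewrite distrC ger0_norm ?subr_ge0//.
  rewrite ltrBlDr addrC -ltrBlDr => /(_ us) h.
  by have := enorm_le_add (y_ s x) (y_ u x); rewrite enormB; lra.
have st' : s < t.
  rewrite lt_neqAle st andbT; apply/eqP => ste; move: ys; rewrite ste.
  by rewrite leNgt ytr.
have [d d0 df] := @flow_cont x 0 t (lexx _) s ltac:(by rewrite s0) (e0 - enorm (y_ s x))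
    ltac:(by rewrite subr_gt0; exact: le_lt_trans re).
(* Up to s + d/2 continuity keeps the path within e0, so inwardness applies. *)
pose u := Num.min t (s + d / 2).
have d2 : d / 2 < d by lra.
have su : s < u by rewrite lt_min st' ltrDl divr_gt0.
have ut : u <= t by rewrite ge_min lexx.
have usd : u <= s + d / 2 by rewrite ge_min lexx orbT.
have yv v : s < v <= u -> r < enorm (y_ v x) <= e0.
  move=> /andP[sv vu]; have v0 : 0 <= v by exact: le_trans (ltW sv).
  have vt : v <= t by exact: le_trans ut.
  apply/andP; split.
    rewrite ltNge; apply/negP => yvr; move: sv; apply/negP; rewrite -leNgt.
    by apply: ub_le_sup; [case: As|split=> //; rewrite v0].
  have vd : `|v - s| < d by rewrite ger0_norm; lra.
  have h : enorm (y_ v x - y_ s x) < e0 - enorm (y_ s x) by apply: df vd; rewrite v0.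
   have := enorm_le_add (y_ v x) (y_ s x); lra.
have := yv u; rewrite su lexx => /(_ isT)/andP[+ _]; apply/negP; rewrite -leNgt.
rewrite -(ler_pXn2r (_ : 0 < 2)%N) ?nnegrE ?enorm_ge0//.
apply: (@le_trans _ _ (enorm (y_ s x) ^+ 2)); last first.
  by rewrite ler_pXn2r ?nnegrE ?enorm_ge0.
rewrite !sqr_enorm.
pose phi v := dot (y_ v x) (y_ v x).
have dphi v : s < v < u -> is_derive v 1 phi (2 * dot (y_ v x) (a (y_ v x))).
  move=> /andP[sv _]; apply: deriv_at_sqr; apply: flow_deriv; exact: le_lt_trans sv.
apply: (@ler0_derive1_le_cc R phi s u); rewrite ?in_itv/= ?lexx ?(ltW su)//.
- by move=> v; rewrite in_itv/= => /dphi [].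
- move=> v; rewrite in_itv/= => svu; have h := dphi v svu; rewrite derive1E derive_val.
  have /andP[sv vu] := svu.
  have /andP[rv ve] : r < enorm (y_ v x) <= e0 by apply: yv; rewrite sv ltW.
  rewrite mulr_ge0_le0// dotC ltW// aneg// => y0.
  by move: rv; rewrite y0 enorm0 ltNge r0.
- exact/cont_on_sqr/flow_cont.
Qed.

End flow.

(** * Uniform attraction to the origin *)

Section attraction.
Context {R : realType} {m : nat}.
Variables (a : 'cV[R]_m -> 'cV[R]_m) (D : R).
Hypothesis aD : forall x y, enorm (a x - a y) <= D * enorm (x - y).
Hypothesis D0 : 0 <= D.
Variable y_ : R -> 'cV[R]_m -> 'cV[R]_m.
Hypothesis y_flow : forall x, ode_sol a x (y_ ^~ x).
Variables (U : set 'cV[R]_m) (U_open : open U) (M : R) (IM : U `<=` eball M 0) (U0 : U 0).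
Hypothesis a0 : a 0 = 0.
Hypothesis I_attracted : forall x, U x -> x <> 0 ->
     (forall t, 0 <= t -> U (y_ t x)) /\ y_ t x @[t --> +oo] --> (0 : 'cV[R]_m).
Variable e0 : R.
Hypothesis e0_gt0 : 0 < e0.
Hypothesis a_inward : forall x : 'cV[R]_m, enorm x <= e0 -> x <> 0 -> dot (a x) x < 0.

Let flow_ball0 r x t : 0 <= r < e0 -> enorm x <= r -> 0 <= t -> enorm (y_ t x) <= r.
Proof. exact: flow_ball. Qed.

Lemma flow_in x t : U x -> 0 <= t -> U (y_ t x).
Proof.
move=> Ix t0; have [->|/eqP x0] := eqVneq x 0; first by rewrite (flow_zero aD).
by have [h _] := I_attracted Ix x0; exact: h.
Qed.

Lemma flow_to0 x r : U x -> 0 < r -> exists2 T, 0 <= T & enorm (y_ T x) < r.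
Proof.
move=> Ix r0; have [->|/eqP x0] := eqVneq x 0.
  by exists 0 => //; rewrite (flow_zero aD)// enorm0.
have [_ /(@cvg_enormP _ _ _ _ _)/(_ r r0)] := I_attracted Ix x0.
move=> h; have [T [T0 hT]] := near_ex2 _ (nbhs_pinfty_ge (num_real (0:R))) h.
by exists T => //; move: hT; rewrite subr0.
Qed.

(** Up to some time T the orbit of x is a compact part of the open set and Gronwall carries its
    margin to nearby orbits; from T on, [flow_ball] traps all of them in a small ball around 0. *)
Lemma flow_near_safe x r : U x -> 0 < r -> exists c T d, [/\ 0 < c, 0 <= T, 0 < d &
  forall x', enorm (x' - x) < d -> (forall t, 0 <= t -> shrink U c (y_ t x')) /\
     (forall t, T <= t -> enorm (y_ t x') <= r)].
Proof.
move=> Ix r0.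
have [ci ci0 Ici] := open_shrink U_open U0.
(* Within the requested r, below e0 so that the ball is invariant, and within half of the margin ci
   at the origin. *)
pose r1 := Num.min r (Num.min (e0 / 2) (ci / 2)).
have r10 : 0 < r1 by rewrite !lt_min r0 !divr_gt0.
have r1e : 0 <= r1 < e0.
  have h1 : e0 / 2 < e0 by rewrite ltr_pdivrMr// ltr_pMr// ltr1n.
  by rewrite (ltW r10)/=; apply: le_lt_trans h1; rewrite /r1 !ge_min lexx orbT.
have [T T0 yT] := flow_to0 Ix (divr_gt0 r10 (ltr0Sn R 1)).
have [c c0 cI] : exists2 c, 0 < c & forall t, 0 <= t <= T -> shrink U c (y_ t x).
  have /compact_near_coveringP/(_ R (0^'+)) := @segment_compact R 0 T.
  move=> /(_ (fun c t => shrink U c (y_ (Num.max 0 t) x)) _) h.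
  have {}h : \forall c \near 0^'+, `[0, T] `<=` (fun t => shrink U c (y_ (Num.max 0 t) x)).
    apply: h => t; rewrite /= in_itv/= => /andP[t0 tT].
    have [c c0 Ic] := open_shrink U_open (flow_in Ix t0).
    have ct : continuous (fun t : R => y_ (Num.max 0 t) x).
      exact: (flow_continuous_time aD).
    have /(@cvg_enormP _ _ _ _ (nbhs_filter t))/(_ (c / 2) (divr_gt0 c0 (ltr0Sn R 1))) h := ct t.
    exists ([set u | enorm (y_ (Num.max 0 u) x - y_ (Num.max 0 t) x) < c / 2], [set k | k < c / 2]).
      by split => //=; apply: nbhs_right_lt; rewrite divr_gt0.
    move=> [u k] /= [hu kc]; apply: (@le_shrink _ _ _ _ (c - c / 2)); first lra.
    apply: shrinkD Ic _; move: hu; rewrite (max_r t0); exact: ltW.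
  have [c [c0 cI]] := near_ex2 _ (nbhs_right_gt (0 : R)) h.
  exists c => // t /andP[t0 tT]; rewrite -(max_r t0).
  by have := cI t; rewrite /= in_itv/= t0 tT; exact.
pose E := expR (D * T).
have E0 : 0 < E := expR_gt0 _.
exists (Num.min (c / 2) (ci / 2)), T, (Num.min (c / 2) (r1 / 2) / E); split => //.
- by rewrite lt_min !divr_gt0.
- by rewrite divr_gt0// lt_min !divr_gt0.
- move=> x' x'd.
  have dd t : 0 <= t <= T -> enorm (y_ t x' - y_ t x) < Num.min (c / 2) (r1 / 2).
    move=> /andP[t0 tT]; rewrite ltr_pdivlMr// in x'd; apply: le_lt_trans x'd.
    apply: le_trans (flow_lip aD y_flow _ _ t0) _.
    by rewrite mulrC ler_wpM2l ?enorm_ge0// ler_expR ler_wpM2l.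
  have yT' : enorm (y_ T x') <= r1.
    have := dd T; rewrite T0 lexx lt_min => /(_ isT)/andP[_ h].
    by have := enorm_le_add (y_ T x') (y_ T x); lra.
  have late t : T <= t -> enorm (y_ t x') <= r1.
    move=> Tt; have -> : t = T + (t - T) by rewrite addrC subrK.
    rewrite -(flow_semi aD y_flow)// ?subr_ge0//.
    by apply: flow_ball0; rewrite ?subr_ge0.
  split => t tT; last by apply: le_trans (late t tT) _; rewrite /r1 ge_min lexx.
  have [tT'|/ltW/late h] := leP t T.
    have := dd t; rewrite tT tT' lt_min => /(_ isT)/andP[h _].
    apply: (@le_shrink _ _ _ _ (c - c / 2)).
      by rewrite ge_min; apply/orP; left; lra.
    by apply: shrinkD (ltW h); apply: cI; rewrite tT.
  apply: (@le_shrink _ _ _ _ (ci - ci / 2)).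
    by rewrite ge_min; apply/orP; right; lra.
  apply: shrinkD Ici _; rewrite subr0; apply: le_trans h _.
  by rewrite /r1 !ge_min lexx !orbT.
Qed.

(* Compactness makes the attraction and the distance to the boundary uniform. *)
Lemma flow_uniform c r : 0 < c -> 0 < r -> exists c' T, [/\ 0 < c', 0 <= T &
  forall x, shrink U c x -> (forall t, 0 <= t -> shrink U c' (y_ t x)) /\
     (forall t, T <= t -> enorm (y_ t x) <= r)].
Proof.
move=> c0 r0.
have /compact_near_coveringP/(_ R (0^'+)) := shrink_compact c0 IM.
(* One parameter k tending to 0 carries both unknowns, the margin k and the time k^-1, so that a
   single compactness argument yields both. *)
move=> /(_ (fun k x => (forall t, 0 <= t -> shrink U k (y_ t x)) /\
     (forall t, k^-1 <= t -> enorm (y_ t x) <= r)) (at_right_proper_filter 0)) h.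
have [|k [k0 hk]] := near_ex2 _ (nbhs_right_gt (0 : R)) (h _); last first.
  by exists k, k^-1; rewrite invr_ge0 ltW.
move=> x /(shrink_sub c0) Ix; have [k [T [d [k0 T0 d0 kT]]]] := flow_near_safe Ix r0.
exists ([set x' | enorm (x' - x) < d], [set l | 0 < l /\ l < Num.min k (T + 1)^-1]).
  split => /=; first exact: near_enorm.
  apply: filterI; first exact: nbhs_right_gt.
  by apply: nbhs_right_lt; rewrite lt_min k0 invr_gt0 ltr_wpDl.
move=> [x' l] /= [/kT[h1 h2] [l0]]; rewrite lt_min => /andP[lk lT]; split.
  by move=> t /h1; apply: le_shrink; exact: ltW.
move=> t lt; apply: h2; apply: le_trans lt.
have T1 : 0 < T + 1 by rewrite ltr_wpDl.
have : T + 1 <= l^-1 by rewrite -[leLHS]invrK lef_pV2 ?posrE ?invr_gt0// ltW.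
by apply: le_trans; rewrite lerDl.
Qed.

End attraction.

(** * Perturbed paths and coverage sets *)

Section perturbed.
Context {R : realType} {m d : nat}.
Variables (a : 'cV[R]_m -> 'cV[R]_m) (sigma : 'cV[R]_m -> 'M[R]_(m, d)) (D : R).
Hypothesis aD : forall x y, enorm (a x - a y) <= D * enorm (x - y).
Hypothesis D0 : 0 <= D.
Variable y_ : R -> 'cV[R]_m -> 'cV[R]_m.
Hypothesis y_flow : forall x, ode_sol a x (y_ ^~ x).
Variable b : R.

Definition jump (x : 'cV[R]_m) (w : 'cV[R]_d) := x + clip b (sigma x *m w).

Lemma jumpE x w : jump x w = x + clip b (sigma x *m w).
Proof. by []. Qed.

Definition mark := (R * 'cV[R]_m * 'cV[R]_d)%type.

(* State after the last of the marks (time, deviation, noise), starting from x at time s. *)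
Fixpoint path_end (s : R) x (l : seq mark) :=
  if l is q :: l' then path_end q.1.1 (jump (y_ (q.1.1 - s) x + q.1.2) q.2) l' else x.

(** The right-continuous trajectory that ends in [path_end]; it is the witness for existence of a
    solution. *)
Fixpoint path_at (s : R) x (l : seq mark) (u : R) :=
  if l is q :: l' then
    if u < q.1.1 then y_ (u - s) x
    else path_at q.1.1 (jump (y_ (q.1.1 - s) x + q.1.2) q.2) l' u
  else y_ (u - s) x.

Definition times (l : seq mark) := [seq q.1.1 | q <- l].

Definition jumps_at (xi : R -> 'cV[R]_m) (q : mark) :=
  xi u @[u --> q.1.1^'+] --> xi q.1.1 /\
  exists2 l : 'cV[R]_m, xi u @[u --> q.1.1^'-] --> l & xi q.1.1 = jump (l + q.1.2) q.2.

Definition right_cont (xi : R -> 'cV[R]_m) s := forall e, 0 < e -> exists2 r, 0 < r &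
  forall u, s <= u < s + r -> enorm (xi u - xi s) < e.

Lemma flow_shift_deriv s x u : s < u -> deriv_at (fun v => y_ (v - s) x) u (a (y_ (u - s) x)).
Proof.
move=> su e e0; have [r r0 rf] := flow_deriv y_flow x (t := u - s) ltac:(by rewrite subr_gt0) e0.
by exists r => // h /rf; rewrite (addrAC u h).
Qed.

Lemma flow_shift_cont s x q : cont_on s q (fun v => y_ (v - s) x).
Proof.
move=> u /andP[su uq] e e0.
have [|r r0 rf] := flow_cont y_flow x (p := 0) (q := q - s) (lexx _) (s := u - s) _ e0.
  by rewrite subr_ge0 su lerD2r.
exists r => // t /andP[st tq] tu; apply: rf; first by rewrite subr_ge0 st lerD2r.
by rewrite opprB addrA subrK.
Qed.

Lemma flow_shift_right s x : right_cont (fun v => y_ (v - s) x) s.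
Proof.
move=> e e0; have [|r r0 rf] := @flow_shift_cont s x (s + 1) s _ e e0.
  by rewrite lexx lerDl ler01.
exists (Num.min 1 r); first by rewrite lt_min ltr01.
move=> u /andP[su]; rewrite -ltrBlDl lt_min => /andP[u1 ur]; apply: rf.
  by rewrite su -lerBlDl ltW.
by rewrite ger0_norm// subr_ge0.
Qed.

Lemma path_at_start s x l : path <%R s (times l) -> path_at s x l s = x.
Proof.
by case: l => [_|q l /= /andP[->]]; rewrite /= subrr (flow0 y_flow).
Qed.

Lemma path_at_right s x l : path <%R s (times l) -> right_cont (path_at s x l) s.
Proof.
case: l => [_|q l pl]; first exact: flow_shift_right.
move=> e e0; rewrite (path_at_start _ pl); move: pl => /= /andP[sq _].
have [r r0 rf] := @flow_shift_right s x e e0.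
exists (Num.min r (q.1.1 - s)); first by rewrite lt_min r0 subr_gt0.
move=> u /andP[su]; rewrite -ltrBlDl lt_min ltrBlDl => /andP[ur].
rewrite ltrD2r => uq; rewrite uq.
by have := rf u; rewrite su ur subrr (flow0 y_flow); apply.
Qed.

Lemma path_at_deriv s x l u : path <%R s (times l) -> s <= u -> u \notin times l ->
  forall e, 0 < e -> exists2 r, 0 < r &
  forall h, `|h| < r -> s <= u + h ->
    enorm (path_at s x l (u + h) - path_at s x l u - h *: a (path_at s x l u)) <= e * `|h|.
Proof.
elim: l s x => [|q l IH] s x pl su ul e e0.
  have [_ /(_ (u - s))] := y_flow x; rewrite subr_ge0 => /(_ su)/has_deriv_withinP/(_ e e0).
  move=> [r r0 rf]; exists r => // h hr suh /=.
  have := rf h hr; rewrite /= in_itv/= andbT (addrAC u h); apply.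
  by rewrite addrAC subr_ge0.
move: pl ul => /= /andP[sq pl]; rewrite inE negb_or => /andP[uq ul].
have [uq'|qu] := ltP u q.1.1.
  have [_ /(_ (u - s))] := y_flow x; rewrite subr_ge0 => /(_ su)/has_deriv_withinP/(_ e e0).
  move=> [r r0 rf]; exists (Num.min r (q.1.1 - u)); first by rewrite lt_min r0 subr_gt0.
  move=> h; rewrite lt_min => /andP[hr hq] suh.
  rewrite -ltrBrDl (le_lt_trans (ler_norm _) hq).
  have := rf h hr; rewrite /= in_itv/= andbT (addrAC u h); apply.
  by rewrite addrAC subr_ge0.
have qu' : q.1.1 < u by rewrite lt_def uq.
have [r r0 rf] := IH q.1.1 (jump (y_ (q.1.1 - s) x + q.1.2) q.2) pl qu ul e e0.
exists (Num.min r (u - q.1.1)); first by rewrite lt_min r0 subr_gt0.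
move=> h; rewrite lt_min => /andP[hr hq] _.
have quh : q.1.1 <= u + h.
  by have := ler_norm (- h); rewrite normrN; lra.
by rewrite ltNge quh /=; apply: rf.
Qed.

Lemma path_at_jumps s x l q : path <%R s (times l) -> q \in l -> jumps_at (path_at s x l) q.
Proof.
elim: l s x => [//|p l IH] s x /= /andP[sp pl]; rewrite inE => /predU1P[->|ql].
  split.
    rewrite ltxx (path_at_start _ pl).
    apply/(@cvg_enormP _ _ _ _ _) => e e0.
    have [r r0 rf] := path_at_right (jump (y_ (p.1.1 - s) x + p.1.2) p.2) pl e0.
    near=> u.
    have pu : p.1.1 < u by near: u; exact: nbhs_right_gt.
    rewrite (ltNge u) (ltW pu) /=; have := rf u; rewrite (path_at_start _ pl) (ltW pu); apply.
    by near: u; apply: nbhs_right_lt; rewrite ltrDl.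
  rewrite ltxx (path_at_start _ pl); exists (y_ (p.1.1 - s) x) => //.
  apply/(@cvg_enormP _ _ _ _ _) => e e0.
  have [|r r0 rf] := @flow_shift_cont s x p.1.1 p.1.1 _ e e0; first by rewrite ltW/=.
  near=> u.
  have up : u < p.1.1 by near: u; exact: nbhs_left_lt.
  rewrite up; apply: rf; last first.
    rewrite distrC ger0_norm ?subr_ge0 ?(ltW up)// ltrBlDr -ltrBlDl.
    by near: u; apply: nbhs_left_gt; rewrite ltrBlDl ltrDr.
  by rewrite (ltW up) andbT ltW//; near: u; exact: nbhs_left_gt.
have pq : p.1.1 < q.1.1.
  have : q.1.1 \in times l by apply/mapP; exists q.
  by move: pl; rewrite lt_path_sortedE => /andP[/allP h _] /h.
have [h1 [z h2 h3]] := IH p.1.1 (jump (y_ (p.1.1 - s) x + p.1.2) p.2) pl ql.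
have qp : (q.1.1 < p.1.1) = false by rewrite ltNge ltW.
split.
  rewrite /= qp; apply: cvg_trans h1; apply: near_eq_cvg; near=> u.
  have qu : q.1.1 < u by near: u; exact: nbhs_right_gt.
  by rewrite ltNge (le_trans (ltW pq) (ltW qu)).
exists z; last by rewrite qp.
apply: cvg_trans h2; apply: near_eq_cvg; near=> u.
have qu : p.1.1 < u by near: u; exact: nbhs_left_gt.
by rewrite ltNge (ltW qu).
Unshelve. all: by end_near. Qed.

(** Induction on the marks: up to the next mark Gronwall identifies the solution with the flow,
    hence its left limit with the end value of the flow, and the jump rule fixes the next state.
    Only right continuity is asked at the start, as that is what a jump leaves behind. *)
Lemma path_unique xi s x l : path <%R s (times l) -> xi s = x -> right_cont xi s ->
  (forall u, s < u < last s (times l) -> u \notin times l -> deriv_at xi u (a (xi u))) ->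
  (forall q, q \in l -> jumps_at xi q) ->
  xi (last s (times l)) = path_end s x l.
Proof.
elim: l s x => [//|q l IH] s x /= /andP[sq pl] xis xir xid xij.
have ql : q.1.1 <= last q.1.1 (times l).
  move: pl; rewrite lt_path_sortedE => /andP[/allP h _].
  have [->//|/negP] := eqVneq l [::].
  case: (lastP (times l)) h => [//|l' z] h _; rewrite last_rcons ltW// h//.
  by rewrite mem_rcons inE eqxx.
have [qr [z zl qz]] := xij q ltac:(by rewrite inE eqxx).
have zE : z = y_ (q.1.1 - s) x.
  (* Taking the left limit as value at the jump time makes the path continuous on the closed
     interval, as Gronwall requires. *)
  pose g u := if u < q.1.1 then xi u else z.
  have : enorm (g q.1.1 - y_ (q.1.1 - s) x) <= expR (D * (q.1.1 - s)) * enorm (g s - y_ (s - s) x).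
    apply: (@gronwall_ode _ _ a D g (fun v => y_ (v - s) x) s q.1.1 aD (ltW sq)).
    - move=> u /andP[su uq] e e0.
      have [||r r0 rf] := xid u _ _ e e0.
      + by rewrite su (lt_le_trans uq).
      + rewrite inE negb_or lt_eqF//=; apply/negP => ul.
        move: pl; rewrite lt_path_sortedE => /andP[/allP h _].
        by move: (h _ ul); rewrite ltNge (ltW uq).
      exists (Num.min r (q.1.1 - u)); first by rewrite lt_min r0 subr_gt0.
      move=> h; rewrite lt_min => /andP[hr hq].
      by rewrite /g uq -ltrBrDl (le_lt_trans (ler_norm _) hq); exact: rf.
    - by move=> u /andP[su _]; exact: flow_shift_deriv.
    - move=> u /andP[su uq] e e0.
      move: uq; rewrite le_eqVlt => /predU1P[->|uq].
        have /(@cvg_enormP _ _ _ _ _)/(_ e e0)/nbhs_ballP[r /= r0 rf] := zl.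
        exists r => // t /andP[st tq] tr; rewrite /g ltxx.
        have [tq'|_] := ltP t q.1.1; last by rewrite subrr enorm0.
        apply: (rf t) => //; by rewrite -ball_normE/= distrC.
      move: su; rewrite le_eqVlt => /predU1P[<-|su].
        have [r r0 rf] := xir e e0.
        exists (Num.min r (q.1.1 - s)); first by rewrite lt_min r0 subr_gt0.
        move=> t /andP[st tq]; rewrite ger0_norm ?subr_ge0// lt_min => /andP[tr].
        rewrite ltrD2r => tq'; rewrite /g sq tq'; apply: rf.
        by rewrite st -ltrBlDl.
      have [||r r0 rf] := xid u _ _ 1 ltr01.
      + by rewrite su (lt_le_trans uq).
      + rewrite inE negb_or lt_eqF//=; apply/negP => ul.
        move: pl; rewrite lt_path_sortedE => /andP[/allP h _].
        by move: (h _ ul); rewrite ltNge (ltW uq).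
      have v0 : 0 < enorm (a (xi u)) + 1 by rewrite ltr_wpDl// enorm_ge0.
      exists (Num.min (Num.min r (q.1.1 - u)) (e / (enorm (a (xi u)) + 1))).
        by rewrite !lt_min r0 subr_gt0 uq divr_gt0.
      move=> t _; rewrite !lt_min -andbA => /and3P[tr tq te]; rewrite /g uq.
      have tq' : t < q.1.1 by have := le_lt_trans (ler_norm _) tq; rewrite ltrD2r.
      rewrite tq'.
      have := rf (t - u) tr; rewrite addrCA subrr addr0 => h.
      rewrite ltr_pdivlMr// in te.
      apply: le_lt_trans te; rewrite mulrDr mulr1 -enormZ.
      apply: le_trans (enorm_le_add _ ((t - u) *: a (xi u))) _.
      by rewrite lerD2l -[leRHS]mul1r.
    - exact: flow_shift_cont.
  rewrite /g ltxx sq xis subrr (flow0 y_flow) subrr enorm0 mulr0 => h.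
  by apply/eqP; rewrite -subr_eq0; apply/eqP/enorm_eq0/le_anti; rewrite h enorm_ge0.
apply: IH => //.
- by rewrite qz zE.
- move=> e e0; have /(@cvg_enormP _ _ _ _ _)/(_ e e0)/nbhs_ballP[r /= r0 rf] := qr.
  exists r => // u /andP[]; rewrite le_eqVlt => /predU1P[<-|qu ur].
    by rewrite subrr enorm0.
  apply: rf => //; rewrite -ball_normE/= distrC ger0_norm ?subr_ge0 ?(ltW qu)//.
  by rewrite ltrBlDl.
- move=> u /andP[qu ul] unl; apply: xid; first by rewrite (lt_trans sq qu).
  by rewrite inE negb_or unl gt_eqF.
- by move=> p pl'; apply: xij; rewrite inE pl' orbT.
Qed.

Lemma path_end_shift h s x l :
  path_end (s + h) x [seq (q.1.1 + h, q.1.2, q.2) | q <- l] = path_end s x l.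
Proof.
elim: l s x => [//|q l IH] s x /=; rewrite IH.
by have -> : q.1.1 + h - (s + h) = q.1.1 - s by ring.
Qed.

Lemma increasing_path k (t : k.-tuple R) : increasing_times t <-> path <%R 0 t.
Proof.
rewrite lt_path_sortedE; split=> [[t0 tlt]|/andP[/allP t0 ts]].
  apply/andP; split; first by apply/allP => u /tnthP[i ->].
  rewrite lt_sorted_pairwise; apply/(pairwiseP 0) => i j.
  rewrite !inE size_tuple => ik jk ij.
  by have := tlt (Ordinal ik) (Ordinal jk) ij; rewrite (tnth_nth 0 t) (tnth_nth 0 t).
split=> [i|i j ij]; first by apply: t0; exact: mem_tnth.
move: ts; rewrite lt_sorted_pairwise => /(pairwiseP 0)/(_ i j).
by rewrite !inE size_tuple (tnth_nth 0 t i) (tnth_nth 0 t j); apply.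
Qed.

(** [path_at] solves the perturbed equation and [path_unique] makes all solutions end at the same
    point, so the choice made by [xget] is determined. *)
Lemma gbarE k x (W : k.-tuple 'cV[R]_d) (V : k.-tuple 'cV[R]_m) (t : k.-tuple R) :
  increasing_times t -> gbar a sigma b x W V t = path_end 0 x (zip (zip t V) W).
Proof.
move=> /increasing_path; rewrite /gbar; case: eqP => [k0|k0 pt].
  by subst k; rewrite (tuple0 t) (tuple0 V) (tuple0 W).
set l : seq mark := zip (zip t V) W.
have tl : times l = t.
  rewrite /times (_ : [seq q.1.1 | q <- l] = unzip1 (unzip1 l)); last by rewrite /unzip1 -map_comp.
  by rewrite /l !unzip1_zip// ?size_zip ?size_tuple ?minnn.
have pl : path <%R 0 (times l) by rewrite tl.
have memj (j : 'I_k) : (tnth t j, tnth V j, tnth W j) \in l.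
  have -> : (tnth t j, tnth V j, tnth W j) = nth (0, 0, 0) l j.
    rewrite /l nth_zip ?size_zip ?size_tuple ?minnn// nth_zip ?size_tuple//.
    by rewrite (tnth_nth 0) (tnth_nth 0 V) (tnth_nth 0 W).
  by apply: mem_nth; rewrite !size_zip !size_tuple !minnn.
have jmem q : q \in l -> exists j : 'I_k, q = (tnth t j, tnth V j, tnth W j).
  move=> /(nthP (0, 0, 0))[j]; rewrite !size_zip !size_tuple !minnn => jk <-.
  exists (Ordinal jk); rewrite (tnth_nth 0) (tnth_nth 0 V) (tnth_nth 0 W) /l.
  by rewrite nth_zip ?size_zip ?size_tuple ?minnn// nth_zip ?size_tuple.
have sol : perturbed_sol a sigma b x W V t (path_at 0 x l).
  split.
  - exact: path_at_start.
  - move=> s /andP[s0 sl] st.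
    apply/(@cvg_enormP _ _ _ _ (within_filter _ _)) => e e0.
    have [|r r0 rf] := @path_at_deriv 0 x l s pl s0 _ (e / 2) (divr_gt0 e0 (ltr0Sn R 1)).
      by rewrite tl.
    rewrite /within /=; apply/nbhs_ballP; exists r => // h; rewrite -ball_normE/= sub0r normrN => hr h0.
    rewrite in_itv/= => /andP[sh _].
    have hp : 0 < `|h| by rewrite normr_gt0.
    rewrite -(ltr_pM2l hp) -enormZ scalerBr scalerA mulfV// scale1r.
    apply: le_lt_trans (rf h hr sh) _.
    by rewrite mulrC ltr_pM2l// ltr_pdivrMr// ltr_pMr// ltr1n.
  - move=> j; have [h1 [z h2 h3]] := path_at_jumps x pl (memj j).
    by split => //; exists z.
case: xgetP => [z _ [xi [xi0 xid xij] <-]|/(_ (path_at 0 x l (last 0 t)))]; last first.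
  by case; exists (path_at 0 x l).
have last0 : 0 <= last 0 t.
  move: pt; rewrite lt_path_sortedE => /andP[/allP h _].
  have [->//|] := eqVneq (t : seq R) [::].
  case: (lastP (t : seq R)) h => [//|l' u] h _; rewrite last_rcons ltW// h//.
  by rewrite mem_rcons inE eqxx.
rewrite -[in LHS]tl; apply: path_unique => //.
- move=> e e0.
  have tnin0 : 0 \notin (t : seq R).
    apply/negP => h0; move: pt; rewrite lt_path_sortedE => /andP[/allP h _].
    by have := h _ h0; rewrite ltxx.
  have [|r r0 rf] := has_deriv_cont (xid 0 _ tnin0) e0; first by rewrite lexx ltW// ltr_wpDl.
  exists (Num.min r 1); first by rewrite lt_min r0/=.
  move=> u; rewrite add0r lt_min => /andP[u0 /andP[ur u1]]; apply: rf.
    by rewrite /= in_itv/= u0 (le_trans (ltW u1))// lerDr.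
  by rewrite subr0 ger0_norm.
- move=> u; rewrite tl => /andP[u0 ul] ut.
  have ul1 : u < last 0 t + 1 by rewrite (lt_trans ul)// ltrDl.
  apply: (has_deriv_at (xid u _ ut)); first by rewrite !ltW.
  have : nbhs u `]0, (last 0 t + 1)[%classic.
    by apply: open_nbhs_nbhs; split; [exact: interval_open|rewrite /= in_itv/= u0].
  by apply: filterS => s; rewrite /= !in_itv/= => /andP[/ltW-> /ltW->].
- move=> q /jmem[j ->]; have [h1 [z' [h2 h3]]] := xij j.
  by split => //; exists z'.
Qed.

(** Together with [coverage_inv], this trades the three parallel tuples for one list of marks. *)
Lemma coverageS k e l v w : path <%R 0 (times l) -> size l = k ->
  enorm v <= e -> (forall q, q \in l -> enorm q.1.2 <= e) ->
  coverage a sigma b k.+1 e (path_end 0 (jump v w) l).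
Proof.
move=> pl lk ve le.
have s1 : size [seq q.2 | q <- l] == k by rewrite size_map lk.
have s2 : size [seq q.1.2 | q <- l] == k by rewrite size_map lk.
have s3 : size (times l) == k by rewrite size_map lk.
exists [tuple of w :: Tuple s1], [tuple of v :: Tuple s2], (Tuple s3).
have it : increasing_times (Tuple s3) by apply/increasing_path.
split => //.
  move=> i; rewrite /eball/= subr0.
  have : tnth [tuple of v :: Tuple s2] i \in [tuple of v :: Tuple s2] by exact: mem_tnth.
  by rewrite inE => /predU1P[->//|/mapP[q ql ->]]; exact: le.
rewrite gbarE//= !theadE /jump.
have -> : zip (zip (times l) [seq q.1.2 | q <- l]) [seq q.2 | q <- l] = l.
  by elim: (l) => [//|[[t' v'] w'] l' /= ->].
by [].
Qed.

Lemma coverage_inv k e z : coverage a sigma b k.+1 e z -> exists v w l,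
  [/\ path <%R 0 (times l), size l = k, enorm v <= e,
      (forall q, q \in l -> enorm q.1.2 <= e) & z = path_end 0 (jump v w) l].
Proof.
move=> [W [V [t [Ve it ->]]]].
exists (thead V), (thead W), (zip (zip t [tuple of behead V]) [tuple of behead W]).
have sb (T : Type) (X : k.+1.-tuple T) : size [tuple of behead X] = k by rewrite size_tuple.
have sbh (T : Type) (X : k.+1.-tuple T) : size (behead X) = k by rewrite size_behead size_tuple.
split.
- rewrite /times.
  have -> : [seq q.1.1 | q <- zip (zip t [tuple of behead V]) [tuple of behead W]] = t.
    rewrite -[RHS](@unzip1_zip _ _ t (behead V)) ?size_tuple ?sbh//.
    rewrite -[in RHS](@unzip1_zip _ _ (zip t (behead V)) (behead W)) ?size_zip ?size_tuple ?sbh ?minnn//.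
    by rewrite /unzip1 -map_comp.
  exact/increasing_path.
- by rewrite !size_zip/= size_tuple !sbh !minnn.
- by have := Ve ord0; rewrite /eball/= subr0.
- move=> q /(nthP (0, 0, 0))[j]; rewrite !size_zip/= size_tuple !sbh !minnn => jk <-.
  rewrite !nth_zip ?size_zip/= ?size_tuple ?sbh ?minnn//= nth_behead.
  have jk' : (j.+1 < k.+1)%N by [].
  by have := Ve (Ordinal jk'); rewrite /eball/= subr0 (tnth_nth 0).
- exact: gbarE.
Qed.

(** An extra jump can be spent on nothing: the new path makes a zero jump at 0, rests there for one
    unit of time because a(0) = 0, then deviates by v and jumps by w as the given path did at its
    start. *)
Lemma coverage_mono k e : a 0 = 0 -> 0 <= e ->
  coverage a sigma b k e `<=` coverage a sigma b k.+1 e.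
Proof.
move=> a0 e0 z; case: k => [|k].
  rewrite /= {1}/eball/= subr0 => ze.
  rewrite (_ : z = path_end 0 (jump z 0) [::]); last by rewrite /= /jump mulmx0 clip0 addr0.
  exact: coverageS.
move=> /coverage_inv[v [w [l [pl lk ve le ->]]]].
pose l' : seq mark := (1, v, w) :: [seq (q.1.1 + 1, q.1.2, q.2) | q <- l].
rewrite (_ : path_end 0 (jump v w) l = path_end 0 (jump 0 0) l').
  apply: coverageS; rewrite ?enorm0//.
  - rewrite /= ltr01 /= /times -map_comp/=.
    have -> : [seq ((fun q : mark => q.1.1) \o (fun q : mark => (q.1.1 + 1, q.1.2, q.2))) i | i <- l]
       = [seq u + 1 | u <- times l] by rewrite -map_comp.
    rewrite (_ : path _ 1 _ = path <%R ((fun u : R => u + 1) 0) [seq (fun u : R => u + 1) u | u <- times l]); last by rewrite add0r.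
    by apply: (homo_path (f := fun u : R => u + 1)) pl => u u' uu'; rewrite ltrD2r.
  - by rewrite /= size_map lk.
  - by move=> q; rewrite inE => /predU1P[->//|/mapP[q' /le ? ->]].
rewrite /= /jump mulmx0 clip0 addr0 subr0 (flow_zero aD y_flow a0)// add0r.
by have := path_end_shift 1 0 (v + clip b (sigma v *m w)) l; rewrite add0r => ->.
Qed.

Lemma coverage_le k k' e : a 0 = 0 -> 0 <= e -> (k <= k')%N ->
  coverage a sigma b k e `<=` coverage a sigma b k' e.
Proof.
move=> a0 e0 /subnK <-; elim: (k' - k)%N => [//|n IH].
by apply: subset_trans IH _; rewrite addSn; exact: coverage_mono.
Qed.

End perturbed.

(** * Continuity of the jump map *)

Section jump_continuity.
Context {R : realType} {m d : nat}.
Variables (sigma : 'cV[R]_m -> 'M[R]_(m, d)) (D : R).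
Hypothesis sD : forall x y, opnorm (sigma x - sigma y) <= D * enorm (x - y).
Hypothesis D0 : 0 <= D.

Lemma opnorm_le_add (A B : 'M[R]_(m, d)) : opnorm A <= opnorm B + opnorm (A - B).
Proof.
apply: ge_sup; first by exists (enorm (A *m 0)), 0 => //=; rewrite enorm0.
move=> _ [v /= v1 <-].
rewrite -(subrK B A) mulmxDl addrC; apply: le_trans (enorm_triangle _ _) _.
rewrite addrK; apply: lerD; apply: le_trans (enorm_mulmx _ _) _.
  by rewrite ler_piMr// opnorm_ge0.
by rewrite ler_piMr// opnorm_ge0.
Qed.

Lemma enorm_sigma_sub x x' w w' : enorm (sigma x *m w - sigma x' *m w') <=
  D * enorm (x - x') * enorm w + opnorm (sigma x') * enorm (w - w').
Proof.
have -> : sigma x *m w - sigma x' *m w' =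
  (sigma x - sigma x') *m w + sigma x' *m (w - w').
  by rewrite mulmxBl mulmxBr addrA subrK.
apply: le_trans (enorm_triangle _ _) _; apply: lerD; last exact: enorm_mulmx.
by apply: le_trans (enorm_mulmx _ _) _; rewrite ler_wpM2r ?enorm_ge0.
Qed.

Lemma sigma_mul_continuous :
  continuous (fun p : 'cV[R]_m * 'cV[R]_d => sigma p.1 *m p.2).
Proof.
move=> [x w]; apply/(@cvg_enormP _ _ _ _ (nbhs_filter (x, w))) => e e0 /=.
pose A := D * (enorm w + 1) + 1; pose B := opnorm (sigma x) + 1.
have A0 : 0 < A by rewrite ltr_wpDl// mulr_ge0// addr_ge0 ?enorm_ge0.
have B0 : 0 < B by rewrite ltr_wpDl// opnorm_ge0.
exists ([set z | enorm (z - x) < e / 2 / A], [set u | enorm (u - w) < Num.min 1 (e / 2 / B)]).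
  by split => /=; apply: near_enorm; rewrite ?lt_min ?ltr01 !divr_gt0.
move=> [z u] /= [zx]; rewrite lt_min => /andP[u1 uw].
apply: le_lt_trans (enorm_sigma_sub _ _ _ _) _; rewrite (splitr e).
apply: ltrD.
  rewrite ltr_pdivlMr// in zx; apply: le_lt_trans zx.
  rewrite mulrAC mulrC ler_wpM2l ?enorm_ge0// /A.
  have := enorm_le_add u w => h; apply: (@le_trans _ _ (D * (enorm w + 1))); last by rewrite lerDl.
  by rewrite ler_wpM2l//; lra.
rewrite ltr_pdivlMr// in uw; apply: le_lt_trans uw.
by rewrite mulrC ler_wpM2l ?enorm_ge0// /B lerDl.
Qed.

Lemma jump_continuous b : 0 <= b ->
  continuous (fun p : 'cV[R]_m * 'cV[R]_d => jump sigma b p.1 p.2).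
Proof.
move=> b0 p; apply: cvgD; first exact: cvg_fst.
apply: (@continuous_comp _ _ _ (fun p : 'cV[R]_m * 'cV[R]_d => sigma p.1 *m p.2)).
  exact: sigma_mul_continuous.
exact: clip_continuous.
Qed.

Lemma enorm_jump_sub b x w : 0 <= b ->
  enorm (jump sigma b x w - x) <= opnorm (sigma x) * enorm w.
Proof.
move=> b0; rewrite /jump addrAC subrr add0r.
by apply: le_trans (enorm_clip_le _ b0) _; exact: enorm_mulmx.
Qed.

Lemma sigma_bounded M x : enorm x <= M -> opnorm (sigma x) <= opnorm (sigma 0) + D * M.
Proof.
move=> xM; apply: le_trans (opnorm_le_add _ (sigma 0)) _; rewrite lerD2l.
by apply: le_trans (sD _ _) _; rewrite subr0 ler_wpM2l.
Qed.

End jump_continuity.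

(** * Safe states *)

Section safe.
Context {R : realType} {m d : nat}.
Variables (a : 'cV[R]_m -> 'cV[R]_m) (sigma : 'cV[R]_m -> 'M[R]_(m, d)) (D : R).
Hypothesis aD : forall x y, enorm (a x - a y) <= D * enorm (x - y).
Hypothesis sD : forall x y, opnorm (sigma x - sigma y) <= D * enorm (x - y).
Hypothesis D0 : 0 <= D.
Variable y_ : R -> 'cV[R]_m -> 'cV[R]_m.
Hypothesis y_flow : forall x, ode_sol a x (y_ ^~ x).
Variable b : R.
Hypothesis b_gt0 : 0 < b.
Variables (U : set 'cV[R]_m) (c e : R).

(* k clipped jumps of arbitrary size, each taken after a deviation th * e from
   the flow, keep the path at distance th * c from the complement of U. *)
Fixpoint safe (k : nat) (th : R) (x : 'cV[R]_m) : Prop :=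
  (forall s, 0 <= s -> shrink U (th * c) (y_ s x)) /\
  (if k is k'.+1 then forall s v w, 0 <= s -> enorm v <= th * e ->
     safe k' th (jump sigma b (y_ s x + v) w) else True).

Hypotheses (c_gt0 : 0 < c) (e_gt0 : 0 < e).

Lemma safe_flow_in k th x s : safe k th x -> 0 <= s -> shrink U (th * c) (y_ s x).
Proof. by case: k => [|k] [h _]; exact: h. Qed.

Lemma safe_in k th x : safe k th x -> shrink U (th * c) x.
Proof. by move=> /safe_flow_in/(_ (lexx 0)); rewrite (flow0 y_flow). Qed.

Lemma safe_le_th k th th' x : th' <= th -> safe k th x -> safe k th' x.
Proof.
move=> th'th; elim: k x => [|k IH] x [h1 h2]; split=> //.
- by move=> s /h1; apply: le_shrink; rewrite ler_wpM2r// ltW.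
- by move=> s /h1; apply: le_shrink; rewrite ler_wpM2r// ltW.
- move=> s v w s0 ve; apply/IH/h2 => //; apply: le_trans ve _.
  by rewrite ler_wpM2r// ltW.
Qed.

Lemma safe_flow k th x s : 0 <= s -> safe k th x -> safe k th (y_ s x).
Proof.
move=> s0; case: k => [|k] [h1 h2]; split=> //.
- by move=> t t0; rewrite (flow_semi aD y_flow)//; apply: h1; rewrite addr_ge0.
- by move=> t t0; rewrite (flow_semi aD y_flow)//; apply: h1; rewrite addr_ge0.
- move=> t v w t0 ve; rewrite (flow_semi aD y_flow)//; apply: h2 => //.
  by rewrite addr_ge0.
Qed.

Lemma safe_jump k th x s z w : safe k.+1 th x -> 0 <= s ->
  enorm (z - y_ s x) <= th * e -> safe k th (jump sigma b z w).
Proof.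
by move=> [_ h] s0 zx; have := h s _ w s0 zx; rewrite addrC subrK.
Qed.

(** The recursion unfolds into an intersection of preimages of closed sets under continuous maps.
    Being bounded as well, the safe states form a compact set, which is the source of uniformity in
    the starting point. *)
Lemma safe_closed k th : closed [set x | safe k th x].
Proof.
have yc s : 0 <= s -> continuous (y_ s).
  move=> s0 x; apply/(@cvg_enormP _ _ _ _ (nbhs_filter x)) => r r0.
  have E0 := expR_gt0 (D * s).
  have := near_enorm x (divr_gt0 r0 E0); apply: filterS => z.
  rewrite ltr_pdivlMr// mulrC; apply: le_lt_trans; exact: (flow_lip aD y_flow).
have cl0 : closed [set x | forall s, 0 <= s -> shrink U (th * c) (y_ s x)].
  rewrite (_ : [set x | _] = \bigcap_(s in [set s | 0 <= s]) (y_ s @^-1` shrink U (th * c))).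
    apply: closed_bigI => s s0; apply: closed_comp; last exact: shrink_closed.
    by move=> x _; exact: yc.
  by apply/seteqP; split=> x h s s0; exact: h.
elim: k => [|k IH] /=.
  by rewrite (_ : [set x | _] = [set x | forall s, 0 <= s -> shrink U (th * c) (y_ s x)])//;
    apply/seteqP; split=> x /=; [case|].
rewrite (_ : [set x | _] = [set x | forall s, 0 <= s -> shrink U (th * c) (y_ s x)] `&`
  \bigcap_(q in [set q : R * 'cV[R]_m * 'cV[R]_d | 0 <= q.1.1 /\ enorm q.1.2 <= th * e])
    ((fun x => jump sigma b (y_ q.1.1 x + q.1.2) q.2) @^-1` [set x | safe k th x])).
  apply: closedI => //; apply: closed_bigI => -[[s v] w] /= [s0 ve].
  apply: closed_comp => //= x _.
  apply: (@continuous_comp _ _ _ (fun x => (y_ s x + v, w))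
    (fun p : 'cV[R]_m * 'cV[R]_d => jump sigma b p.1 p.2)); last first.
    exact/(jump_continuous sD)/ltW.
  apply: (@cvg_pair _ _ _ (nbhs x) (nbhs _) (nbhs w) _ _ _ (fun x => y_ s x + v) (fun=> w)).
    by apply: cvgD; [exact: yc|exact: cvg_cst].
  exact: cvg_cst.
apply/seteqP; split=> x /= [h1 h2]; split=> //.
  by move=> [[s v] w] /= [s0 ve]; exact: h2.
by move=> s v w s0 ve; exact: (h2 (s, v, w)).
Qed.

Lemma safe_compact k th M : 0 < th -> U `<=` eball M 0 -> compact [set x | safe k th x].
Proof.
move=> th0 UM; apply: (cV_bounded_closed_compact (M := M)); last exact: safe_closed.
by move=> x /safe_in/(shrink_sub (mulr_gt0 th0 c_gt0))/UM; exact.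
Qed.

Variable J : nat.
Hypothesis ball_safe0 : forall x s, enorm x <= e -> 0 <= s -> shrink U c (y_ s x).
Hypothesis ball_jump_safe : forall k v w, (k.+2 <= J)%N -> enorm v <= e ->
  safe k 1 (jump sigma b v w).
Hypothesis flow_uni : forall c r, 0 < c -> 0 < r -> exists c' T, [/\ 0 < c', 0 <= T &
  forall x, shrink U c x -> (forall t, 0 <= t -> shrink U c' (y_ t x)) /\
     (forall t, T <= t -> enorm (y_ t x) <= r)].

(** Up to a time T, Gronwall keeps the flow from z so close to that of the safe state that half of
    each margin survives. After T the flow from z is within th e / 2 of the origin, where
    [ball_jump_safe] takes over; it only asks that few enough jumps remain. *)
Lemma safe_nbhd th : 0 < th <= 1 -> exists2 e1, 0 < e1 & forall k x s z,
  (k < J)%N -> safe k th x -> 0 <= s -> enorm (z - y_ s x) <= e1 -> safe k (th / 2) z.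
Proof.
move=> /andP[th0 th1].
have th20 : 0 < th / 2 by rewrite divr_gt0.
have [c' [T [c'0 T0 hT]]] := flow_uni (mulr_gt0 th20 c_gt0) (mulr_gt0 th20 e_gt0).
pose E := expR (D * T); have E0 : 0 < E := expR_gt0 _.
have E1 : 1 <= E by rewrite -expR0 ler_expR mulr_ge0.
pose e1 := Num.min (th / 2 * c) (th / 2 * e) / E.
have e10 : 0 < e1 by rewrite divr_gt0// lt_min !mulr_gt0.
exists e1 => // k x s z kJ /(safe_flow) sx s0; have {sx} := sx s s0.
move: (y_ s x) => {}x sx zx.
have e1c : e1 <= th / 2 * c.
  by rewrite ler_pdivrMr// ge_min ler_peMr// mulr_ge0// ltW.
have ths : th * c = th / 2 * c + th / 2 * c by rewrite -mulrDl -splitr.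
have the : th * e = th / 2 * e + th / 2 * e by rewrite -mulrDl -splitr.
have zU : shrink U (th / 2 * c) z.
  apply: (@le_shrink _ _ _ _ (th * c - e1)); first by rewrite ths; lra.
  exact: shrinkD (safe_in sx) zx.
have [_ zT] := hT z zU.
have the1 : th / 2 * e <= e by rewrite ler_piMl ?(ltW e_gt0)//; lra.
have thc1 : th / 2 * c <= c by rewrite ler_piMl ?(ltW c_gt0)//; lra.
have near t : 0 <= t <= T -> enorm (y_ t z - y_ t x) <= Num.min (th / 2 * c) (th / 2 * e).
  move=> /andP[t0 tT]; apply: le_trans (flow_lip aD y_flow _ _ t0) _.
  rewrite ler_pdivlMr// in zx; apply: le_trans zx.
  by rewrite mulrC ler_wpM2l ?enorm_ge0// ler_expR ler_wpM2l.
have z0 t : 0 <= t -> shrink U (th / 2 * c) (y_ t z).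
  move=> t0; have [tT|/ltW Tt] := leP t T.
    apply: (@le_shrink _ _ _ _ (th * c - th / 2 * c)); first by rewrite ths; lra.
    apply: shrinkD (safe_flow_in sx t0) _.
    by have := near t; rewrite t0 tT le_min => /(_ isT)/andP[].
  apply: (le_shrink thc1).
  have := @ball_safe0 (y_ t z) 0; rewrite (flow0 y_flow); apply => //.
  exact: le_trans (zT _ Tt) the1.
case: k kJ sx => [|k] kJ sx; split=> // t v w t0 ve.
have [tT|/ltW Tt] := leP t T.
  apply: (@safe_le_th _ th); first lra.
  apply: (safe_jump (s := t) _ sx t0).
  have -> : y_ t z + v - y_ t x = (y_ t z - y_ t x) + v by rewrite addrAC.
  apply: le_trans (enorm_triangle _ _) _; rewrite the; apply: lerD => //.
  by have := near t; rewrite t0 tT le_min => /(_ isT)/andP[].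
apply: (@safe_le_th _ 1); first lra.
apply: ball_jump_safe => //; apply: le_trans (enorm_triangle _ _) _.
apply: le_trans (lerD (zT _ Tt) ve) _; rewrite -the ler_piMl// ltW//.
Qed.

(** Half of e pays for the distance of the flow from 0 and half for the deviation before the jump,
    whence the margin 1/2. *)
Lemma ball_safe x : (forall s, 0 <= s -> enorm (y_ s x) <= e / 2) -> (0 < J)%N ->
  safe J.-1 (1 / 2) x.
Proof.
move=> xe J0.
have h0 s : 0 <= s -> shrink U (1 / 2 * c) (y_ s x).
  move=> s0; apply: (@le_shrink _ _ _ _ c).
    by rewrite ler_piMl ?(ltW c_gt0)//; lra.
  have := @ball_safe0 (y_ s x) 0; rewrite (flow0 y_flow); apply => //.
  by apply: le_trans (xe _ s0) _; rewrite ler_pdivrMr// ler_peMr ?(ltW e_gt0)// ler1n.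
case: J J0 ball_jump_safe => // -[_ _|k _ bs] /=; split => // s v w s0 ve.
apply: (@safe_le_th _ 1); first lra.
apply: bs => //; apply: le_trans (enorm_triangle _ _) _.
by have := lerD (xe _ s0) ve; lra.
Qed.

End safe.

Section safe_coverage.
Context {R : realType} {m d : nat}.
Variables (a : 'cV[R]_m -> 'cV[R]_m) (sigma : 'cV[R]_m -> 'M[R]_(m, d)) (D : R).
Hypothesis aD : forall x y, enorm (a x - a y) <= D * enorm (x - y).
Hypothesis D0 : 0 <= D.
Variable y_ : R -> 'cV[R]_m -> 'cV[R]_m.
Hypothesis y_flow : forall x, ode_sol a x (y_ ^~ x).
Variable b : R.
Variables (U : set 'cV[R]_m) (c e : R).
Hypothesis a0 : a 0 = 0.

(** [safe] allows jumps at time 0 and several at the same time, whereas the times of a perturbed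
    path are positive and strictly increasing. Each jump is delayed a little and the motion during
    the delay is absorbed into the deviation, which may grow from e to e1. *)
Lemma path_safe c1 e1 k x : e < e1 ->
  (forall x, shrink U c1 x -> forall t, 0 <= t -> shrink U c (y_ t x)) ->
  (forall l, (size l <= k)%N -> path <%R 0 (times l) ->
     (forall q, q \in l -> enorm q.1.2 <= e1) ->
     shrink U c1 (path_end sigma y_ b 0 x l)) ->
  safe sigma y_ b U c e k 1 x.
Proof.
move=> ee1 cc1; elim: k x => [|k IH] x h.
  split=> // s s0; rewrite mul1r; apply: cc1 => //; exact: (h [::]).
split=> [s s0|s v w s0 ve].
  by rewrite mul1r; apply: cc1 => //; exact: (h [::]).
apply: IH => l lk pl le.
have [r r0 rf] := flow_cont y_flow x (p := 0) (q := s + 1) (lexx _) (s := s)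
   ltac:(by rewrite s0 lerDl ler01) (e := e1 - e) ltac:(by rewrite subr_gt0).
(* A delay during which the flow moves by less than e1 - e. *)
pose h' := Num.min 1 (r / 2).
have h'0 : 0 < h' by rewrite lt_min ltr01 divr_gt0.
have h'r : h' < r by rewrite gt_min; apply/orP; right; rewrite ltr_pdivrMr// ltr_pMr// ltr1n.
pose t := s + h'.
have t0 : 0 < t by rewrite ltr_wpDl.
pose v' := y_ s x + v - y_ t x.
pose l' : seq mark := (t, v', w) :: [seq (q.1.1 + t, q.1.2, q.2) | q <- l].
have -> : path_end sigma y_ b 0 (jump sigma b (y_ s x + v) w) l = path_end sigma y_ b 0 x l'.
  rewrite /= subr0 /v' addrCA subrr addr0.
  by have := path_end_shift sigma y_ b t 0 (jump sigma b (y_ s x + v) w) l; rewrite add0r => ->.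
apply: h.
- by rewrite /= size_map.
- rewrite /= t0 /= /times -map_comp/=.
  have -> : [seq ((fun q : mark => q.1.1) \o (fun q : mark => (q.1.1 + t, q.1.2, q.2))) i | i <- l]
     = [seq u + t | u <- times l] by rewrite -map_comp.
  rewrite (_ : path _ t _ = path <%R ((fun u : R => u + t) 0) [seq (fun u : R => u + t) u | u <- times l]); last by rewrite add0r.
  by apply: (homo_path (f := fun u : R => u + t)) pl => u u' uu'; rewrite ltrD2r.
- move=> q; rewrite inE => /predU1P[->/=|/mapP[q' /le ? ->//]].
  rewrite /v' addrAC -(subrK e e1) addrC; apply: le_trans (enorm_triangle _ _) _.
  rewrite addrC (addrC (e1 - e)); apply: lerD; first by rewrite mul1r in ve.
  rewrite (addrC (- _)) enormB; apply/ltW/rf; last by rewrite /t addrAC subrr add0r ger0_norm// ltW.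
  by rewrite (ltW t0) lerD2l ge_min lexx.
Qed.

Lemma bounded_away_shrink (A : set 'cV[R]_m) : bounded_away (~` U) A ->
  exists2 c1, 0 < c1 & A `<=` shrink U c1.
Proof.
rewrite /bounded_away => h.
have [c1 c10 c1h] : exists2 c1 : R, 0 < c1 & (c1%:E <=
    ereal_inf [set (enorm (x - y))%:E | x in ~` U & y in A])%E.
  (* An infinite infimum means that one of the two sets is empty; any positive margin then works. *)
  move: h; case: (ereal_inf _) => [r|_|//]; last by exists 1; rewrite ?leey.
  by rewrite lte_fin => r0; exists r.
exists c1 => // y Ay x xy; apply: contrapT => Ux.
have : (ereal_inf [set (enorm (x - y))%:E | x in ~` U & y in A] <= (enorm (x - y))%:E)%E.
  by apply: ereal_inf_lbound; exists x => //; exists y.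
by move=> /(le_trans c1h); rewrite lee_fin leNgt xy.
Qed.

(** A jump out of the e-ball followed by at most k others ends in a coverage set with at most J.-1
    jumps, contained in the one with exactly J.-1 by [coverage_le]; the slack between e and e1 is
    spent in [path_safe]. *)
Lemma coverage_ball_jump_safe J c1 e1 : 0 <= e -> e < e1 ->
  coverage a sigma b J.-1 e1 `<=` shrink U c1 ->
  (forall x, shrink U c1 x -> forall t, 0 <= t -> shrink U c (y_ t x)) ->
  forall k v w, (k.+2 <= J)%N -> enorm v <= e ->
  safe sigma y_ b U c e k 1 (jump sigma b v w).
Proof.
move=> e0 ee1 cov cc1 k v w kJ ve; apply: (path_safe ee1 cc1) => l lk pl le.
have e10 : 0 <= e1 by rewrite (le_trans e0) ?ltW.
have h := coverage_le (sigma := sigma) (b := b) aD y_flow (k := (size l).+1) (k' := J.-1) a0 e10.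
apply: cov; apply: h.
  by case: J kJ => // J' kJ; rewrite -ltnS; apply: leq_ltn_trans kJ; rewrite ltnS.
by apply: (coverageS sigma aD y_flow) => //; rewrite (le_trans ve) ?ltW.
Qed.

End safe_coverage.

(** * Measures on Euclidean spaces *)

Section countable_base.

(** Second countability, in the form that makes an open subset of a product a countable union of
    open boxes, hence measurable for the product of the Borel algebras. *)
Definition has_countable_base (T : topologicalType) :=
  exists (K : countType) (B : K -> set T), (forall k, open (B k)) /\
    forall x A, nbhs x A -> exists2 k, B k x & B k `<=` A.

Lemma countable_base_cV (R : realType) n : has_countable_base 'cV[R]_n.
Proof.
exists ('cV[rat]_n * rat)%type, (fun k => ball (map_mx ratr k.1 : 'cV[R]_n) (ratr k.2)).
split=> [k|x A /nbhs_ballP[e /= e0 eA]]; first exact: ball_open.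
have [r] := @rat_in_itvoo R 0 (e / 2) (divr_gt0 e0 (ltr0Sn R 1)).
rewrite in_itv/= => /andP[r0 re].
have h i : exists q : rat, `|x i ord0 - ratr q| < ratr r.
  have [|q] := @rat_in_itvoo R (x i ord0 - ratr r) (x i ord0 + ratr r).
    by rewrite ltrD2l gtrN.
  by rewrite in_itv/= => /andP[h1 h2]; exists q; rewrite ltr_norml; apply/andP; split; lra.
have xq : ball (map_mx ratr (\col_i sval (cid (h i))) : 'cV[R]_n) (ratr r) x.
  split=> // i j; rewrite (ord1 j) !mxE -ball_normE/= distrC.
  exact: (svalP (cid (h i))).
exists (\col_i sval (cid (h i)), r) => //= y qy; apply: eA.
have re2 : ratr r + ratr r <= e by rewrite (splitr e); apply: lerD; exact: ltW.
apply: le_ball re2 _ _; apply: ball_triangle qy; exact: ball_sym.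
Qed.

Lemma countable_base_R (R : realType) : has_countable_base R.
Proof.
exists (rat * rat)%type, (fun k => ball (ratr k.1 : R) (ratr k.2)).
split=> [k|x A /nbhs_ballP[e /= e0 eA]]; first exact: ball_open.
have [r] := @rat_in_itvoo R 0 (e / 2) (divr_gt0 e0 (ltr0Sn R 1)).
rewrite in_itv/= => /andP[r0 re].
have [|q] := @rat_in_itvoo R (x - ratr r) (x + ratr r).
  by rewrite ltrD2l gtrN.
rewrite in_itv/= => /andP[h1 h2].
have xq : ball (ratr q : R) (ratr r) x.
  by rewrite -ball_normE/= ltr_norml; apply/andP; split; lra.
exists (q, r) => //= y qy; apply: eA.
have re2 : ratr r + ratr r <= e by rewrite (splitr e); apply: lerD; exact: ltW.
apply: le_ball re2 _ _; apply: ball_triangle qy; exact: ball_sym.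
Qed.

End countable_base.

Section borel.

Lemma open_borel (T : ptopologicalType) (A : set (borel T)) : open (A : set T) -> measurable A.
Proof. exact: sub_sigma_algebra. Qed.

Lemma closed_borel (T : ptopologicalType) (A : set (borel T)) : closed (A : set T) -> measurable A.
Proof. by rewrite -openC => /open_borel/measurableC; rewrite setCK. Qed.

Lemma measurable_fun_borel d (X : measurableType d) (T : ptopologicalType) (f : X -> borel T) :
  (forall A : set T, open A -> measurable (f @^-1` A)) -> measurable_fun setT f.
Proof.
move=> h; apply: (@measurability _ _ X (borel T) setT f (@open T)) => // _ [A oA <-].
by rewrite setTI; exact: h.
Qed.

Lemma continuous_borel (T1 T2 : ptopologicalType) (f : T1 -> T2) :
  continuous f -> measurable_fun setT (f : borel T1 -> borel T2).
Proof.
move=> cf; apply: measurable_fun_borel => A oA; apply: open_borel.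
exact: open_comp.
Qed.

Lemma measurable_borelR (R : realType) :
  measurable_fun setT (@id R : measurableTypeR R -> borel R).
Proof. by apply: measurable_fun_borel => A oA; exact: open_measurable. Qed.

Lemma measurable_Rborel (R : realType) :
  measurable_fun setT (@id R : borel R -> measurableTypeR R).
Proof.
apply: (@measurability _ _ (borel R) (measurableTypeR R) setT id _ (RGenOInfty.measurableE R)) => _ [_ [x ->] <-].
by rewrite setTI; apply: open_borel; exact: interval_open.
Qed.

Lemma continuous_measurableR (R : realType) (T : ptopologicalType) (f : T -> R) :
  continuous f -> measurable_fun setT (f : borel T -> measurableTypeR R).
Proof.
move=> cf; apply: (measurableT_comp (@measurable_Rborel R) (continuous_borel cf)).
Qed.

Lemma open_borel_prod (T1 T2 : ptopologicalType) (A : set (borel T1 * borel T2)) :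
  has_countable_base T1 -> has_countable_base T2 ->
  open (A : set (T1 * T2)) -> measurable A.
Proof.
move=> [K1 [B1 [oB1 hB1]]] [K2 [B2 [oB2 hB2]]] oA.
pose F (k : K1 * K2) : set (borel T1 * borel T2) :=
  if `[< B1 k.1 `*` B2 k.2 `<=` A >] then B1 k.1 `*` B2 k.2 else set0.
have -> : A = \bigcup_k F k.
  apply/seteqP; split=> [[x1 x2] Ax|[x1 x2] [k _]]; last first.
    by rewrite /F; case: asboolP => // h; exact: h.
  move: oA; rewrite openE => /(_ _ Ax)[[V1 V2] /= [V1x V2x] V12].
  have [k1 k1x k1V] := hB1 _ _ V1x; have [k2 k2x k2V] := hB2 _ _ V2x.
  exists (k1, k2) => //; rewrite /F; case: asboolP => //= -[] [z1 z2] /= [z1k z2k].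
  by apply: V12; split; [exact: k1V|exact: k2V].
apply: countable_bigcupT_measurable; first exact: countableP.
move=> k; rewrite /F; case: asboolP => // _.
by apply: measurableX; exact: open_borel.
Qed.

Lemma continuous_borel_prod (T1 T2 T3 : ptopologicalType) (f : T1 * T2 -> T3) :
  has_countable_base T1 -> has_countable_base T2 -> continuous f ->
  measurable_fun setT (f : borel T1 * borel T2 -> borel T3).
Proof.
move=> c1 c2 cf; apply: measurable_fun_borel => A oA.
apply: open_borel_prod => //; exact: open_comp.
Qed.

Lemma measurable_continuous2 d (X : measurableType d) (T1 T2 T3 : ptopologicalType)
    (f : T1 * T2 -> T3) (g1 : X -> borel T1) (g2 : X -> borel T2) :
  has_countable_base T1 -> has_countable_base T2 -> continuous f ->
  measurable_fun setT g1 -> measurable_fun setT g2 ->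
  measurable_fun setT (fun x => f (g1 x, g2 x) : borel T3).
Proof.
move=> c1 c2 cf m1 m2.
apply: (measurableT_comp (continuous_borel_prod c1 c2 cf)).
exact: measurable_fun_pair.
Qed.

End borel.

(** * Integrals against set functions and product measures *)

Section raw_integral.
Local Open Scope ereal_scope.

Import HBNNSimple.

(** The integral evaluates its set function only on level sets of simple functions, which are
    measurable. Bare set functions such as [power_measure] and [polar_measure] can thus be replaced
    by measures that agree with them on measurable sets. *)
Lemma eq_raw_integral d (T : measurableType d) (R : realType) (D : set T)
    (m1 m2 : set T -> \bar R) (f : T -> \bar R) :
  (forall A, measurable A -> m1 A = m2 A) ->
  \int[m1]_(x in D) f x = \int[m2]_(x in D) f x.
Proof.
move=> m12; rewrite /integral.
have h g : [set sintegral m1 h | h in [set h : {nnsfun T >-> R} | forall x, (h x)%:E <= g x]] =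
    [set sintegral m2 h | h in [set h : {nnsfun T >-> R} | forall x, (h x)%:E <= g x]].
  have s (h : {nnsfun T >-> R}) : sintegral m1 h = sintegral m2 h.
    by apply: eq_fsbigr => r _; rewrite m12.
  by apply/seteqP; split=> _ [h hg <-]; exists h.
by congr (ereal_sup _ - ereal_sup _); rewrite h.
Qed.

End raw_integral.

Section sigma_finite_copy.
Context d (T : measurableType d) (R : realType) (m : {measure set T -> \bar R}).
Hypothesis sf : sigma_finite setT m.

Definition sigma_finite_copy : set T -> \bar R := m.

HB.instance Definition _ := Measure.copy sigma_finite_copy m.
HB.instance Definition _ := @Measure_isSigmaFinite.Build d T R sigma_finite_copy sf.

Lemma sigma_finite_exists :
  exists p : {sigma_finite_measure set T -> \bar R}, forall A, p A = m A.
Proof. by exists sigma_finite_copy. Qed.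

End sigma_finite_copy.

Lemma pushforward_exists d d' (T1 : measurableType d) (T2 : measurableType d') (R : realType)
  (m : {measure set T1 -> \bar R}) (f : T1 -> T2) : measurable_fun setT f ->
  exists q : {measure set T2 -> \bar R}, forall A, q A = m (f @^-1` A).
Proof.
by move=> mf; exists (measure_function_pushforward__canonical__measure_function_Measure m mf).
Qed.

Lemma integral_image_measure d d' (T1 : measurableType d) (T2 : measurableType d') (R : realType)
  (m : {measure set T1 -> \bar R}) (q : set T2 -> \bar R) (f : T1 -> T2) (g : T2 -> \bar R) :
  measurable_fun setT f -> (forall A, measurable A -> q A = m (f @^-1` A)) ->
  measurable_fun setT g -> (forall x, 0 <= g x)%E ->
  (\int[q]_x g x = \int[m]_x g (f x))%E.
Proof.
move=> mf qE mg g0; rewrite (@eq_raw_integral _ _ _ _ q (pushforward m f))//.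
by rewrite ge0_integral_pushforward.
Qed.

Lemma sigma_finite_prod d1 d2 (T1 : measurableType d1) (T2 : measurableType d2) (R : realType)
  (m1 : {sigma_finite_measure set T1 -> \bar R}) (m2 : {sigma_finite_measure set T2 -> \bar R}) :
  sigma_finite setT (m1 \x m2)%E.
Proof.
have /sigma_finiteP[F [TF ndF Foo]] := sigma_finiteT m1.
have /sigma_finiteP[G [TG ndG Goo]] := sigma_finiteT m2.
exists (fun n => F n `*` G n).
  rewrite -setXTT TF TG predeqE => -[x y]; split; last first.
    by move=> [n _ []/= ? ?]; split; exists n.
  move=> [/= [n _ Fnx] [k _ Gky]]; exists (maxn n k) => //; split.
    by move: x Fnx; exact/subsetPset/ndF/leq_maxl.
  by move: y Gky; exact/subsetPset/ndG/leq_maxr.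
move=> k; have [? ?] := Foo k; have [? ?] := Goo k.
split; first exact: measurableX.
by rewrite product_measure1E// lte_mul_pinfty// ge0_fin_numE.
Qed.

Section power_measure.
Local Open Scope ereal_scope.
Context {R : realType} {d : measure_display} {T : measurableType d}.

Lemma measurable_consX k : measurable_fun setT
  (fun p : T * k.-tuple T => [tuple of p.1 :: p.2]).
Proof. exact: measurable_cons. Qed.

Lemma measurable_cons1 k (x : T) : measurable_fun setT
  (fun s : k.-tuple T => [tuple of x :: s]).
Proof. by apply: measurable_cons => //; exact: measurable_cst. Qed.

Lemma measurable_thead k : measurable_fun setT (fun s : k.+1.-tuple T => thead s).
Proof. exact: measurable_tnth. Qed.

Variable mu : {sigma_finite_measure set T -> \bar R}.

(** On measurable sets the iterated integral is the image of a product measure under cons;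
    sigma-finiteness, which Tonelli needs at the next level, is carried along the induction. *)
Lemma power_measure_exists (mu' : set T -> \bar R) k :
  (forall A, measurable A -> mu' A = mu A) ->
  exists p : {sigma_finite_measure set (k.-tuple T) -> \bar R},
    forall A, measurable A -> power_measure mu' A = p A.
Proof.
move=> mu'E; elim: k => [|k [p pE]].
  have [|q qE] := @sigma_finite_exists _ _ _ (dirac ([tuple] : 0.-tuple T) : {measure set _ -> \bar R}).
    by apply: sigma_finiteT.
  by exists q => A mA; rewrite qE.
pose cns := fun s : T * k.-tuple T => [tuple of s.1 :: s.2].
have mcns : measurable_fun setT cns by exact: measurable_consX.
have [q qE] := pushforward_exists (mu \x p) mcns.
have [|q' q'E] := @sigma_finite_exists _ _ _ q.
  have [F FT Ffin] := sigma_finite_prod mu p.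
  pose unc := fun s : k.+1.-tuple T => (thead s, [tuple of behead s]).
  have munc : measurable_fun setT unc.
    by apply: measurable_fun_pair; [exact: measurable_thead|exact: measurable_behead].
  exists (fun n => unc @^-1` F n).
    by rewrite -preimage_bigcup -FT preimage_setT.
  move=> n; have [mF Fn] := Ffin n; split.
    by rewrite -[X in measurable X]setTI; exact: munc.
  rewrite qE -comp_preimage.
  have -> : unc \o cns = id.
    apply/funext => -[x s]; rewrite /unc /cns /= theadE; congr (_, _).
    exact/val_inj.
  by [].
exists q' => A mA; rewrite q'E qE /=.
rewrite (@eq_raw_integral _ _ _ _ mu' mu)//.
apply: eq_integral => x _; rewrite pE; last first.
  have := @measurable_cons1 k x measurableT _ mA; by rewrite setTI.
by congr (p _); apply/seteqP; split=> s; rewrite /xsection/= /cns/= ?inE.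
Qed.

Variable mu' : set T -> \bar R.
Hypothesis mu'E : forall A, measurable A -> mu' A = mu A.

Lemma power_integral0 (f : 0.-tuple T -> \bar R) : measurable_fun setT f ->
  \int[power_measure mu' (k := 0)]_s f s = f [tuple].
Proof.
move=> mf; rewrite (@eq_raw_integral _ _ _ _ _ (dirac ([tuple] : 0.-tuple T)))//.
by rewrite integral_dirac//= diracE in_setT mul1e.
Qed.

Lemma power_integral_cons k (f : k.+1.-tuple T -> \bar R) :
  measurable_fun setT f -> (forall s, 0 <= f s) ->
  \int[power_measure mu' (k := k.+1)]_s f s =
  \int[mu]_x \int[power_measure mu' (k := k)]_s f [tuple of x :: s].
Proof.
move=> mf f0; have [p pE] := power_measure_exists k mu'E.
rewrite (@integral_image_measure _ _ _ _ _ (mu \x p) _ _ _ (@measurable_consX k))//.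
  rewrite fubini_tonelli1//; last exact: (measurableT_comp mf (@measurable_consX k)).
  by apply: eq_integral => x _; rewrite /fubini_F; apply: eq_raw_integral => A mA; rewrite pE.
move=> A mA /=; rewrite (@eq_raw_integral _ _ _ _ mu' mu)//.
apply: eq_integral => x _; rewrite pE; last first.
  have := @measurable_cons1 k x measurableT _ mA; by rewrite setTI.
by congr (p _); apply/seteqP; split=> s; rewrite /xsection/= ?inE.
Qed.

Lemma measurable_power_integral k d' (X : measurableType d') (f : X * k.-tuple T -> \bar R) :
  measurable_fun setT f -> (forall p, 0 <= f p) ->
  measurable_fun setT (fun x => \int[power_measure mu' (k := k)]_s f (x, s)).
Proof.
move=> mf f0; have [p pE] := power_measure_exists k mu'E.
have := measurable_fun_fubini_tonelli_F (m2 := p) f mf f0.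
apply: eq_measurable_fun => x _.
by rewrite /fubini_F; apply: eq_raw_integral => A mA; rewrite pE.
Qed.

Lemma power_integral_swap k d' (X : measurableType d') (m : {sigma_finite_measure set X -> \bar R})
  (f : X * k.-tuple T -> \bar R) : measurable_fun setT f -> (forall p, 0 <= f p) ->
  \int[power_measure mu' (k := k)]_s \int[m]_x f (x, s) =
  \int[m]_x \int[power_measure mu' (k := k)]_s f (x, s).
Proof.
move=> mf f0; have [p pE] := power_measure_exists k mu'E.
rewrite (@eq_raw_integral _ _ _ _ _ p)// -(fubini_tonelli f)//.
by apply: eq_integral => x _; apply: eq_raw_integral => A mA; rewrite pE.
Qed.

End power_measure.

Lemma integral_mrestr dT (T : measurableType dT) (R : realType) (m : {measure set T -> \bar R})
    (D : set T) (mD : measurable D) (f : T -> \bar R) :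
  measurable_fun setT f -> (forall x, 0 <= f x)%E ->
  (\int[mrestr m mD]_x f x = \int[m]_(x in D) f x)%E.
Proof.
move=> mf f0.
rewrite (@ge0_negligible_integral _ _ _ (mrestr m mD) setT (~` D))//.
- rewrite setTD setCK; apply: eq_measure_integral => A mA AD.
  by rewrite /= /mrestr setIidl.
- exact: measurableC.
- by rewrite /= /mrestr setICl measure0.
Qed.

(** * The polar measure *)

Section polar.
Context {R : realType} {d : nat}.

Lemma measurable_enorm : measurable_fun setT (@enorm R d : borel 'cV[R]_d -> measurableTypeR R).
Proof. by apply: continuous_measurableR; exact: enorm_continuous. Qed.

Lemma measurable_origin : measurable ([set 0] : set (borel 'cV[R]_d)).
Proof.
have := measurable_enorm measurableT (measurable_set1 (0 : R)); rewrite setTI.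
congr measurable; apply/seteqP; split=> x /=; first exact: enorm_eq0.
by move=> ->; rewrite enorm0.
Qed.

Lemma scale_continuous : continuous (fun p : R * 'cV[R]_d => p.1 *: p.2).
Proof. exact: scale_continuous. Qed.

Local Notation RV := (measurableTypeR R * borel 'cV[R]_d)%type.

Definition polar_dom : set RV := [set p | 0 < p.1 /\ enorm p.2 = 1].

Lemma measurable_polar_dom : measurable polar_dom.
Proof.
have -> : polar_dom = [set r : measurableTypeR R | 0 < r] `*` (@esphere R d : set (borel 'cV[R]_d)).
  by apply/seteqP; split=> -[r v].
apply: measurableX.
  by rewrite (_ : [set _ | _] = `]0, +oo[%classic)//; apply/seteqP; split=> r; rewrite /= in_itv/= andbT.
apply: closed_borel; rewrite (_ : @esphere R d = (@enorm R d) @^-1` [set 1])//.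
by apply: closed_comp; [move=> x _; exact: enorm_continuous|exact: closed_eq].
Qed.

Lemma measurable_scale : measurable_fun setT (fun p : RV => p.1 *: p.2 : borel 'cV[R]_d).
Proof.
apply: (@measurable_continuous2 _ _ R 'cV[R]_d 'cV[R]_d (fun p => p.1 *: p.2)).
- exact: countable_base_R.
- exact: countable_base_cV.
- exact: scale_continuous.
- exact: (measurableT_comp (@measurable_borelR R) measurable_fst).
- exact: measurable_snd.
Qed.

Lemma Phi_polar (w : 'cV[R]_d) : w != 0 -> Phi w = (enorm w, (enorm w)^-1 *: w).
Proof. by rewrite /Phi => /negbTE ->. Qed.

(** The image under [Phi], discontinuous at 0, becomes a preimage under the continuous map (r, v) ->
    r v; measurability and the values of the measure are read off from this form. *)
Lemma Phi_image (E : set 'cV[R]_d) : @Phi R d @` (E `\ 0) = [set p | polar_dom p /\ E (p.1 *: p.2)].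
Proof.
apply/seteqP; split=> [_ [w [Ew /= /eqP w0] <-]|[r v] /= [[r0 v1] Erv]].
  have wp := enorm_gt0 w0.
  rewrite Phi_polar// /polar_dom/= scalerA divff ?gt_eqF// scale1r; split=> //; split=> //.
  by rewrite enormZ ger0_norm ?invr_ge0 ?ltW// mulVf// gt_eqF.
exists (r *: v); last first.
  have rv : enorm (r *: v) = r by rewrite enormZ v1 mulr1 ger0_norm// ltW.
  rewrite Phi_polar ?rv ?scalerA ?mulVf ?gt_eqF ?scale1r//.
  by apply/eqP => h; move: rv; rewrite h enorm0 => r0'; move: r0; rewrite -r0' ltxx.
split=> //= h; have : enorm (r *: v) = 0 by rewrite h enorm0.
by rewrite enormZ v1 mulr1 ger0_norm ?ltW// => r0'; move: r0; rewrite r0' ltxx.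
Qed.

Variables (nu : {measure set (measurableTypeR R) -> \bar R}) (alpha : R).
Hypothesis nu_alpha : is_nu_alpha alpha nu.
Variable S : probability (borel 'cV[R]_d) R.
Hypothesis S_sphere : S (@esphere R d) = 1%E.

Let M : {measure set RV -> \bar R} := (nu \x S)%E.

(** The measure is the image of nu x S, restricted to positive radii and unit directions, under (r,
    v) -> r v. The set |w| >= r has mass r^-alpha, so these sets, together with the null set {0},
    give sigma-finiteness. *)
Lemma polar_measure_exists : exists mu : {sigma_finite_measure set (borel 'cV[R]_d) -> \bar R},
  [/\ forall A, measurable A -> polar_measure nu S A = mu A,
     mu [set 0] = 0%E,
     forall r, 0 < r -> mu [set w | r <= enorm w] = (r `^ (- alpha))%:E &
     forall f : borel 'cV[R]_d -> \bar R, measurable_fun setT f -> (forall x, 0 <= f x)%E ->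
       (\int[mu]_x f x = \int[M]_(p in polar_dom) f (p.1 *: p.2))%E].
Proof.
pose mr : {measure set RV -> \bar R} := mrestr M measurable_polar_dom.
have [q qE] := pushforward_exists mr measurable_scale.
have qM A : q A = M [set p | polar_dom p /\ A (p.1 *: p.2)].
  by rewrite qE /mr /= /mrestr; congr (M _); apply/seteqP; split=> p /= [].
have q0 : q [set 0] = 0%E.
  rewrite qM (_ : [set p | _] = set0) ?measure0//; apply/seteqP; split=> // -[r v] /= [[r0 v1] h].
  have : enorm (r *: v) = 0 by rewrite h enorm0.
  by rewrite enormZ v1 mulr1 ger0_norm ?ltW// => r0'; move: r0; rewrite r0' ltxx.
have qr r : 0 < r -> q [set w | r <= enorm w] = (r `^ (- alpha))%:E.
  move=> r0; rewrite qM.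
  rewrite (_ : [set p | _] = `[r, +oo[%classic `*` (@esphere R d)).
    rewrite [LHS]product_measure1E//; last first.
      apply: closed_borel; rewrite (_ : @esphere R d = (@enorm R d) @^-1` [set 1])//.
      by apply: closed_comp; [move=> x _; exact: enorm_continuous|exact: closed_eq].
    rewrite -[RHS]mule1; congr (_ * _)%E; [exact: nu_alpha.2|exact: S_sphere].
  apply/seteqP; split=> -[s v] /=; rewrite in_itv/= andbT.
    by move=> [[s0 v1]]; rewrite enormZ v1 mulr1 ger0_norm// ltW.
  move=> [rs v1]; have s0 : 0 < s by exact: lt_le_trans rs.
  by rewrite enormZ v1 mulr1 ger0_norm// ltW.
have mC r : measurable ([set w | r <= enorm w] : set (borel 'cV[R]_d)).
  have := measurable_enorm measurableT (measurable_itv `[r, +oo[).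
  rewrite setTI (_ : _ @^-1` _ = [set w | r <= enorm w])//.
  by apply/seteqP; split=> x; rewrite /= in_itv/= andbT.
have [|mu muE] := @sigma_finite_exists _ _ _ q.
  (* The origin belongs to none of the sets |w| >= 1/n and takes index 0. *)
  exists (fun n => if n is n'.+1 then [set w | n'.+1%:R^-1 <= enorm w] else [set 0]).
    apply/seteqP; split=> // w _; have [->|w0] := eqVneq w 0; first by exists 0%N.
    have wp := enorm_gt0 w0.
    exists (Num.trunc (enorm w)^-1).+1 => //=.
    rewrite -[leRHS]invrK lef_pV2 ?posrE ?invr_gt0//.
    have wi : 0 <= (enorm w)^-1 by rewrite invr_ge0 ltW.
    by apply/ltW; case/andP: (Num.Theory.truncn_itv wi).
  case=> [|n].
    split; last by rewrite q0.
    exact: measurable_origin.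
  by split; [exact: mC|rewrite qr ?ltry// invr_gt0].
exists mu; split.
- by move=> A mA; rewrite muE qM /polar_measure Phi_image.
- by rewrite muE.
- by move=> r r0; rewrite muE qr.
- move=> f mf f0.
  rewrite (@eq_raw_integral _ _ _ _ mu q); last by move=> A _; exact: muE.
  rewrite (integral_image_measure measurable_scale (fun A _ => qE A) mf f0).
  have mfs : measurable_fun setT (fun p : RV => f (p.1 *: p.2)).
    exact: (measurableT_comp mf measurable_scale).
  exact: (integral_mrestr M measurable_polar_dom mfs (fun p => f0 _)).
Qed.

End polar.

(** * The scaling limit of the noise *)

Section scaling_limit.
Context {R : realType} {d : nat} {disp : measure_display} {Omega : measurableType disp}.
Variables (P : probability Omega R) (Z : Omega -> 'cV[R]_d).
Hypothesis mZ : measurable_fun setT (Z : Omega -> borel 'cV[R]_d).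

Local Notation RV := (measurableTypeR R * borel 'cV[R]_d)%type.

Lemma Phi_continuous (w : 'cV[R]_d) : w != 0 -> {for w, continuous (@Phi R d)}.
Proof.
move=> w0.
have near_nz : nbhs w (fun v : 'cV[R]_d => v != 0).
  have := near_enorm w (enorm_gt0 w0); apply: filterS => v vw.
  by apply/eqP => v0; move: vw; rewrite v0 sub0r enormN ltxx.
apply: (@cvg_trans _ ((fun v : 'cV[R]_d => (enorm v, (enorm v)^-1 *: v)) @ w)).
  apply: (@near_eq_cvg _ _ _ (nbhs_filter w)); apply: (@filterS _ _ (nbhs_filter w) _ _ _ near_nz) => v v0.
  exact/esym/Phi_polar.
rewrite Phi_polar//.
apply: (@cvg_pair _ _ _ (nbhs w) (nbhs (enorm w)) (nbhs ((enorm w)^-1 *: w)) _ _ _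
   (@enorm R d) (fun v : 'cV[R]_d => (enorm v)^-1 *: v)).
  exact: enorm_continuous.
apply: (@cvgZ _ _ _ (nbhs w) _ (fun v : 'cV[R]_d => (enorm v)^-1) id); last exact: cvg_id.
apply: (@cvgV _ _ (nbhs w)); first by rewrite gt_eqF// enorm_gt0.
exact: enorm_continuous.
Qed.

(** [Phi] is continuous off the origin, so the preimage of an open set is an open set, possibly with
    the origin added. *)
Lemma measurable_Phi_scaled x : measurable_fun setT
  ((fun w => (x^-1 * (Phi (Z w)).1, (Phi (Z w)).2)) : Omega -> borel (R * 'cV[R]_d)%type).
Proof.
pose h (v : 'cV[R]_d) : R * 'cV[R]_d := (x^-1 * (Phi v).1, (Phi v).2).
suff mh : measurable_fun setT (h : borel 'cV[R]_d -> borel (R * 'cV[R]_d)%type).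
  exact: (measurableT_comp mh mZ).
apply: measurable_fun_borel => A oA.
have -> : h @^-1` A = (h @^-1` A `\` [set 0]) `|` (h @^-1` A `&` [set 0]).
  apply/seteqP; split=> v /=; last by case=> [[]|[]].
  by move=> Av; have [v0|v0] := pselect (v = 0); [right|left].
apply: measurableU; last first.
  have [h0|h0] := pselect (A (h 0)).
    have -> : h @^-1` A `&` [set 0] = [set 0] by apply/seteqP; split=> v /= => [[]|->].
    exact: measurable_origin.
  suff -> : h @^-1` A `&` [set 0] = set0 by exact: measurable0.
  by apply/seteqP; split=> // v /= [+ v0]; rewrite v0.
apply: open_borel; rewrite openE => v /= [Av /eqP v0]; rewrite /interior.
have ch : {for v, continuous h}.
  have cP := Phi_continuous v0.
  apply: (@cvg_pair _ _ _ (nbhs v) (nbhs (x^-1 * (Phi v).1)) (nbhs (Phi v).2) _ _ _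
    (fun v => x^-1 * (Phi v).1) (fun v => (Phi v).2)).
    apply: (@cvgMr _ _ (nbhs v) _ (fun v => (Phi v).1)).
    exact: (cvg_comp _ _ cP cvg_fst).
  exact: (cvg_comp _ _ cP cvg_snd).
have h1 : nbhs v (h @^-1` A) by apply: ch; apply: open_nbhs_nbhs.
have h2 := near_enorm v (enorm_gt0 v0).
near=> u; split; first by near: u.
move=> u0; have : enorm (u - v) < enorm v by near: u.
by rewrite u0 sub0r enormN ltxx.
Unshelve. all: by end_near. Qed.

Lemma scaled_test (g : 'cV[R]_d -> R) x : g 0 = 0 -> 0 < x -> forall w,
  ((fun p : R * 'cV[R]_d => (g (p.1 *: p.2))%:E) \_ (polar_dom : set (R * 'cV[R]_d)))
    (x^-1 * (Phi (Z w)).1, (Phi (Z w)).2) = (g (x^-1 *: Z w))%:E.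
Proof.
move=> g0 x0 w; rewrite patchE; have [Z0|Z0] := eqVneq (Z w) 0.
  by rewrite Z0 /Phi eqxx/= mulr0 scale0r scaler0; case: ifPn => _; rewrite g0.
have zp := enorm_gt0 Z0.
rewrite Phi_polar//= mem_set/=; last first.
  split => /=; first by rewrite mulr_gt0// invr_gt0.
  by rewrite enormZ ger0_norm ?invr_ge0 ?ltW// mulVf// gt_eqF.
by rewrite scalerA -mulrA divff ?gt_eqF// mulr1.
Qed.

Lemma polar_domE : @polar_space R d `\` @polar_origin R d = polar_dom.
Proof.
apply/seteqP; split=> -[r v] /=.
  rewrite /polar_space /polar_origin/= => -[[r0 v1] /not_andP[] //].
  by move=> /eqP rn0; split => //=; rewrite lt_def rn0.
rewrite /polar_dom/= => -[r0 v1]; split; first by split => //=; exact: ltW.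
by move=> [/= r0' _]; move: r0; rewrite r0' ltxx.
Qed.

Lemma fattening_polar (r s : R) v :
  fattening (@polar_dist R d) (@polar_space R d) (@polar_origin R d) r (s, v) -> s <= r.
Proof.
move=> [[/= s0 v1] h]; rewrite -lee_fin; apply: le_trans h.
apply: le_ereal_inf_tmp => _ [[t u] [/= -> u1] <-].
by rewrite lee_fin /polar_dist/= sub0r normrN le_max (ger0_norm s0) lexx.
Qed.

Variables (nu : {measure set (measurableTypeR R) -> \bar R}) (alpha : R).
Variable S : probability (borel 'cV[R]_d) R.
Hypothesis Z_rv : regularly_varying P Z alpha nu S.
Variable mu : set (borel 'cV[R]_d) -> \bar R.
Hypothesis muE : forall f : borel 'cV[R]_d -> \bar R, measurable_fun setT f ->
  (forall x, 0 <= f x)%E ->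
  (\int[mu]_x f x = \int[nu \x S]_(p in polar_dom) f (p.1 *: p.2))%E.

Lemma raw_integral_mkcond {dT} {T : measurableType dT} (q : set T -> \bar R) D (h : T -> \bar R) :
  (\int[q]_(x in D) h x = \int[q]_x (h \_ D) x)%E.
Proof. by rewrite /integral patch_setT. Qed.

(** Regular variation is tested on (r, v) -> g (r v), which vanishes near the polar origin because
    |r v| = r for unit v. This moves the convergence from polar coordinates to vectors. *)
Lemma law_scaled_cvg (g : 'cV[R]_d -> R) r B : 0 < r -> continuous g ->
  (forall w, 0 <= g w <= B) -> (forall w, enorm w <= r -> g w = 0) ->
  ((tail P Z x)^-1%:E * \int[P]_w (g (x^-1 *: Z w))%:E)%E @[x --> +oo]
    --> (\int[mu]_w (g w)%:E)%E.
Proof.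
move=> r0 cg gB gr; have [_ [_ _]] := Z_rv.
have g0 : g 0 = 0 by apply: gr; rewrite enorm0 ltW.
pose f (p : R * 'cV[R]_d) := g (p.1 *: p.2).
have cf : continuous f.
  move=> p; apply: (@continuous_comp _ _ _ (fun p : R * 'cV[R]_d => p.1 *: p.2) g).
    exact: scale_continuous.
  exact: cg.
have mfb : measurable_fun setT ((fun p => (f p)%:E) : borel (R * 'cV[R]_d)%type -> \bar R).
  apply/measurable_EFinP; exact: continuous_measurableR.
have mgb : measurable_fun setT ((fun w => (g w)%:E) : borel 'cV[R]_d -> \bar R).
  apply/measurable_EFinP; exact: continuous_measurableR.
(* [M_cvg] integrates over the Borel algebra of the product, whereas [nu \x S] lives on the product
   of the Borel algebras; the identity is measurable from the latter to the former. *)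
have mid : measurable_fun setT (id : RV -> borel (R * 'cV[R]_d)%type).
  apply: measurable_fun_borel => A oA; rewrite preimage_id.
  have := open_borel_prod (@countable_base_R R) (@countable_base_cV R d) oA.
  move=> mA.
  have mi : measurable_fun setT (id : RV -> (borel R * borel 'cV[R]_d)%type).
    rewrite (_ : id = fun p : RV => (p.1 : borel R, p.2 : borel 'cV[R]_d)); last by apply/funext => -[].
    by apply: measurable_fun_pair; [exact: (measurableT_comp (@measurable_borelR R) measurable_fst)|exact: measurable_snd].
  by have := mi measurableT _ mA; rewrite setTI.
have mD : measurable (polar_dom : set (borel (R * 'cV[R]_d)%type)).
  rewrite (_ : polar_dom = [set p | 0 < p.1] `&` (fun p => enorm p.2) @^-1` [set 1]).
    apply: measurableI.
      apply: open_borel; apply: (@open_comp _ _ fst [set t : R | 0 < t]) => //.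
        by move=> p _; exact: cvg_fst.
    apply: closed_borel; apply: closed_comp; last exact: closed_eq.
    move=> p _; apply: (@continuous_comp _ _ _ snd (@enorm R d)); first exact: cvg_snd.
    exact: enorm_continuous.
  by apply/seteqP; split=> p.
have mfD : measurable_fun setT (((fun p => (f p)%:E) \_ polar_dom) : borel (R * 'cV[R]_d)%type -> \bar R).
  exact: ((@measurable_restrictT _ _ (borel (R * 'cV[R]_d)%type) _ (polar_dom : set (borel (R * 'cV[R]_d)%type)) (fun p => (f p)%:E) mD).1 (measurable_funTS mfb)).
have fD0 p : (0 <= ((fun p => (f p)%:E) \_ polar_dom) p)%E.
  by rewrite patchE; case: ifPn => // _; rewrite lee_fin; have /andP[] := gB (p.1 *: p.2).
move=> /(_ f); rewrite polar_domE => h.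
have hmu : (\int[(nu \x S)%E : set (borel (R * 'cV[R]_d)%type) -> \bar R]_(p in polar_dom) (f p)%:E =
    \int[mu]_w (g w)%:E)%E.
  rewrite muE//; last by move=> w; rewrite lee_fin; have /andP[] := gB w.
  rewrite raw_integral_mkcond.
  rewrite (@integral_image_measure _ _ RV (borel (R * 'cV[R]_d)%type) R (nu \x S)%E _ id)//.
  by rewrite [RHS]integral_mkcond.
have hx x : 0 < x -> (\int[(fun A : set (borel (R * 'cV[R]_d)%type) => ((tail P Z x)^-1%:E *
       P [set w | A ((x^-1 * (Phi (Z w)).1)%R, (Phi (Z w)).2)])%E)]_(p in polar_dom) (f p)%:E
   = (tail P Z x)^-1%:E * \int[P]_w (g (x^-1 *: Z w))%:E)%E.
  move=> x0.
  have t0 : 0 <= (tail P Z x)^-1 by rewrite invr_ge0 fine_ge0.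
  have [q qE] := pushforward_exists P (measurable_Phi_scaled x).
  rewrite raw_integral_mkcond (@eq_raw_integral _ _ _ _ _ (mscale (NngNum t0) q)); last first.
    by move=> A mA; rewrite /mscale/= qE.
  rewrite ge0_integral_mscale//=; congr (_ * _)%E.
  rewrite (@integral_image_measure _ _ _ _ _ P _ _ _ (measurable_Phi_scaled x))//.
  by apply: eq_integral => w _; exact: scaled_test.
rewrite -hmu.
have {}h := h (continuous_subspaceT cf).
apply: cvg_trans (h _ _).
- apply: near_eq_cvg; near=> x; rewrite hx//.
- by exists B => p _; exact: gB.
- exists r => // -[s v] [/= s0 v1] /fattening_polar sr; apply: gr.
  by rewrite enormZ v1 mulr1 ger0_norm// ltW.
Unshelve. all: by end_near. Qed.

End scaling_limit.

Section translation.
Context {R : realType}.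

(** The translate of Lebesgue measure has the right value on half-open intervals, and these
    determine it. *)
Lemma integral_translation (s : R) (f : measurableTypeR R -> \bar R) :
  measurable_fun setT f -> (forall t, 0 <= f t)%E ->
  (\int[lebesgue_measure]_(t in [set: measurableTypeR R]) f ((t : R) - s)%R = \int[lebesgue_measure]_(t in [set: measurableTypeR R]) f t)%E.
Proof.
move=> mf f0.
have mT : measurable_fun setT (fun t : measurableTypeR R => (t - s)%R : measurableTypeR R).
  by apply: continuous_measurable_fun => t; apply: cvgB; [exact: cvg_id|exact: cvg_cst].
have [q qE] := pushforward_exists (@lebesgue_measure R : {measure set (measurableTypeR R) -> \bar R}) mT.
rewrite [RHS](@eq_raw_integral _ _ _ _ _ q); last first.
  move=> A mA; apply: lebesgue_measure_unique => //.
  move=> _ [[u v] _ <-] /=; rewrite qE.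
  rewrite (_ : _ @^-1` _ = `]u + s, v + s]%classic).
    have iv (p r : R) : lebesgue_measure `]p, r]%classic = (if (p < r)%R then (r - p)%R%:E else 0%E).
      by rewrite lebesgue_measure_itv/= lte_fin EFinB.
    transitivity (if (u < v)%R then (v - u)%R%:E else 0%E); first exact: iv.
    by rewrite [RHS](iv (u + s) (v + s)) ltrD2r opprD addrACA subrr addr0.
  by apply/seteqP; split=> t; rewrite /= !in_itv/= ltrBrDr lerBlDr.
by rewrite (integral_image_measure mT (fun A _ => qE A) mf f0).
Qed.

End translation.

(** * Jump intensities as iterated integrals *)

Section iterated_integral.
Local Open Scope ereal_scope.
Context {R : realType} {m d : nat}.
Local Notation TR := (measurableTypeR R).
Local Notation Xm := (borel 'cV[R]_m).
Local Notation Xd := (borel 'cV[R]_d).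

Variable step : R -> 'cV[R]_m -> 'cV[R]_d -> 'cV[R]_m.
Hypothesis mstep : measurable_fun setT
  ((fun p => step p.1.1 p.1.2 p.2) : (TR * Xm * Xd)%type -> Xm).
Variable mu : {sigma_finite_measure set Xd -> \bar R}.

(** Waiting times replace increasing jump times: each level integrates one waiting time and one
    noise vector, weighted by the cutoff c, and restarts from the new state. *)
Fixpoint iter_int (c : R -> 'cV[R]_d -> R) (h : 'cV[R]_m -> \bar R) (k : nat) (x : 'cV[R]_m) : \bar R :=
  if k is k'.+1 then
    \int[lebesgue_measure]_(s in [set: TR]) \int[mu]_w ((c s w)%:E * iter_int c h k' (step s x w))
  else h x.

Definition cutoff (c : R -> 'cV[R]_d -> R) :=
  measurable_fun setT ((fun p => c p.1 p.2) : (TR * Xd)%type -> TR) /\ forall s w, (0 <= c s w <= 1)%R.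

Variable c : R -> 'cV[R]_d -> R.
Hypothesis cc : cutoff c.

Lemma cutoff_ge0 s w : 0 <= (c s w)%:E.
Proof. by rewrite lee_fin; have /andP[] := cc.2 s w. Qed.

Lemma iter_int_ge0 h k x : (forall x, 0 <= h x) -> 0 <= iter_int c h k x.
Proof.
move=> h0; elim: k x => [|k IH] x //=.
by apply: integral_ge0 => s _; apply: integral_ge0 => w _; rewrite mule_ge0 ?cutoff_ge0.
Qed.

Lemma measurable_step_integrand h dX (X : measurableType dX) (x : X -> Xm) :
  measurable_fun setT x -> measurable_fun setT (h : Xm -> \bar R) ->
  measurable_fun setT ((fun p => (c p.1.2 p.2)%:E * h (step p.1.2 (x p.1.1) p.2)) : (X * TR * Xd)%type -> \bar R).
Proof.
move=> mx mh; apply: emeasurable_funM.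
  apply/measurable_EFinP.
  apply: (@measurableT_comp _ _ _ _ _ _ _ _ (fun p : X * TR * Xd => (p.1.2, p.2)) cc.1).
  by apply: measurable_fun_pair; [exact: (measurableT_comp measurable_snd measurable_fst)|exact: measurable_snd].
apply: (measurableT_comp mh).
apply: (@measurableT_comp _ _ _ _ _ _ _ _ (fun p : X * TR * Xd => (p.1.2, x p.1.1, p.2)) mstep).
apply: measurable_fun_pair; last exact: measurable_snd.
apply: measurable_fun_pair; first exact: (measurableT_comp measurable_snd measurable_fst).
exact: (measurableT_comp mx (measurableT_comp measurable_fst measurable_fst)).
Qed.

Lemma measurable_iter_int h k : measurable_fun setT (h : Xm -> \bar R) -> (forall x, 0 <= h x) ->
  measurable_fun setT (iter_int c h k : Xm -> \bar R).
Proof.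
move=> mh h0; elim: k => //= k IH.
have m1 := measurable_step_integrand (@measurable_id _ Xm setT) IH.
have m2 := measurable_fun_fubini_tonelli_F (m2 := mu) _ m1
  (fun p => mule_ge0 (cutoff_ge0 _ _) (iter_int_ge0 k _ h0)).
apply: (measurable_fun_fubini_tonelli_F (m2 := @lebesgue_measure R) _ m2).
by move=> p; apply: integral_ge0 => w _; rewrite mule_ge0 ?cutoff_ge0 ?iter_int_ge0.
Qed.

Lemma measurable_iter_int_inner h k x : measurable_fun setT (h : Xm -> \bar R) -> (forall x, 0 <= h x) ->
  measurable_fun setT ((fun s => \int[mu]_w ((c s w)%:E * iter_int c h k (step s x w))) : TR -> \bar R).
Proof.
move=> mh h0.
have m1 := measurable_step_integrand (@measurable_cst _ _ TR _ setT (x : Xm)) (measurable_iter_int k mh h0).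
have m2 := measurable_fun_fubini_tonelli_F (m2 := mu) _ m1
  (fun p => mule_ge0 (cutoff_ge0 _ _) (iter_int_ge0 k _ h0)).
exact: (measurableT_comp m2 (measurable_fun_pair (@measurable_id _ TR setT) (@measurable_id _ TR setT))).
Qed.

Lemma measurable_iter_int_integrand h k s x : measurable_fun setT (h : Xm -> \bar R) -> (forall x, 0 <= h x) ->
  measurable_fun setT ((fun w => (c s w)%:E * iter_int c h k (step s x w)) : Xd -> \bar R).
Proof.
move=> mh h0.
have m1 := measurable_step_integrand (@measurable_cst _ _ TR _ setT (x : Xm)) (measurable_iter_int k mh h0).
have mp : measurable_fun setT ((fun w => ((s, s), w)) : Xd -> (TR * TR * Xd)%type).
  by apply: measurable_fun_pair; [exact: measurable_cst|exact: measurable_id].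
exact: (measurableT_comp m1 mp).
Qed.

End iterated_integral.

Section path_integral.
Local Open Scope ereal_scope.
Context {R : realType} {m d : nat}.
Local Notation TR := (measurableTypeR R).
Local Notation Xm := (borel 'cV[R]_m).
Local Notation Xd := (borel 'cV[R]_d).

Variable step : R -> 'cV[R]_m -> 'cV[R]_d -> 'cV[R]_m.
Hypothesis mstep : measurable_fun setT
  ((fun p => step p.1.1 p.1.2 p.2) : (TR * Xm * Xd)%type -> Xm).
Variable mu : {sigma_finite_measure set Xd -> \bar R}.

Variable mu' : set Xd -> \bar R.
Hypothesis mu'E : forall A, measurable A -> mu' A = mu A.
Variable h : 'cV[R]_m -> \bar R.
Hypothesis mh : measurable_fun setT (h : Xm -> \bar R).
Hypothesis h0 : forall x, 0 <= h x.

Definition after (s : R) (_ : 'cV[R]_d) : R := (0 < s)%R%:R.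

Fixpoint path_val (s : R) (x : 'cV[R]_m) (t : seq R) (W : seq 'cV[R]_d) : \bar R :=
  match t, W with
  | t1 :: t', w1 :: W' => ((s < t1)%R%:R)%:E * path_val t1 (step (t1 - s) x w1) t' W'
  | _, _ => h x
  end.

Lemma path_val_ge0 s x t W : 0 <= path_val s x t W.
Proof.
elim: t s x W => [|t1 t IH] s x [|w W] //=.
by rewrite mule_ge0// lee_fin ler0n.
Qed.

Lemma measurable_lt_indic dX (X : measurableType dX) (f g : X -> TR) :
  measurable_fun setT f -> measurable_fun setT g ->
  measurable_fun setT ((fun x => ((f x < g x)%R%:R)%:E) : X -> \bar R).
Proof.
move=> mf mg; apply/measurable_EFinP.
have mb : measurable_fun setT (fun b : bool => b%:R : TR) by exact: (@measurable_funTS).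
exact: (measurableT_comp mb (measurable_fun_ltr mf mg)).
Qed.

Lemma cutoff_after : cutoff after.
Proof.
split; last by move=> s w; rewrite /after ler0n lern1 leq_b1.
apply/measurable_EFinP; apply: measurable_lt_indic; first exact: measurable_cst.
exact: measurable_fst.
Qed.

Lemma measurable_path_val k : measurable_fun setT
  ((fun p => path_val p.1.1 p.1.2 p.2.1 p.2.2) :
    ((TR * Xm) * (k.-tuple TR * k.-tuple Xd))%type -> \bar R).
Proof.
elim: k => [|k IH].
  rewrite (_ : (fun p => _) = fun p : (TR * Xm) * (0.-tuple TR * 0.-tuple Xd) => h p.1.2); last first.
    by apply/funext => -[[s x] [t W]]; rewrite (tuple0 t).
  exact: (measurableT_comp mh (measurableT_comp measurable_snd measurable_fst)).
pose Y := ((TR * Xm) * (k.+1.-tuple TR * k.+1.-tuple Xd))%type.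
have m11 : measurable_fun setT (fun p : Y => p.1.1).
  exact: (measurableT_comp measurable_fst measurable_fst).
have m12 : measurable_fun setT (fun p : Y => p.1.2).
  exact: (measurableT_comp measurable_snd measurable_fst).
have m21 : measurable_fun setT (fun p : Y => p.2.1).
  exact: (measurableT_comp measurable_fst measurable_snd).
have m22 : measurable_fun setT (fun p : Y => p.2.2).
  exact: (measurableT_comp measurable_snd measurable_snd).
have mt : measurable_fun setT (fun p : Y => thead p.2.1 : TR).
  exact: (measurableT_comp (@measurable_thead _ TR k) m21).
have mw : measurable_fun setT (fun p : Y => thead p.2.2 : Xd).
  exact: (measurableT_comp (@measurable_thead _ Xd k) m22).
have mbt : measurable_fun setT (fun p : Y => [tuple of behead p.2.1] : k.-tuple TR).
  exact: (measurableT_comp (@measurable_behead _ TR k) m21).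
have mbw : measurable_fun setT (fun p : Y => [tuple of behead p.2.2] : k.-tuple Xd).
  exact: (measurableT_comp (@measurable_behead _ Xd k) m22).
have mB : measurable_fun setT (fun p : Y => (thead p.2.1 - p.1.1)%R : TR).
  exact: measurable_funB.
have ms : measurable_fun setT (fun p : Y => step (thead p.2.1 - p.1.1)%R p.1.2 (thead p.2.2) : Xm).
  apply: (@measurableT_comp _ _ _ _ _ _ _ _ (fun p : Y => ((thead p.2.1 - p.1.1)%R : TR, p.1.2, thead p.2.2)) mstep).
  by apply: measurable_fun_pair => //; exact: measurable_fun_pair.
have mI : measurable_fun setT (fun p : Y =>
    ((thead p.2.1 : TR, step (thead p.2.1 - p.1.1)%R p.1.2 (thead p.2.2) : Xm),
     ([tuple of behead p.2.1] : k.-tuple TR, [tuple of behead p.2.2] : k.-tuple Xd))).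
  by apply: measurable_fun_pair; apply: measurable_fun_pair.
have m1 := measurableT_comp IH mI.
have m2 := emeasurable_funM (measurable_lt_indic m11 mt) m1.
apply: eq_measurable_fun m2 => -[[s x] [t W]] _.
by case: (tupleP t) => t1 t'; case: (tupleP W) => w1 W'.
Qed.

(** On the left all noise integrals stand outside all time integrals. Peeling off one noise vector
    and one time, exchanging them with the remaining integrals by Tonelli and translating the first
    time by s interleaves them into the recursion. *)
Lemma path_integral k s x :
  \int[power_measure mu' (k := k)]_W \int[power_measure lebesgue_measure (k := k)]_t
     path_val s x (t : k.-tuple R) W = iter_int step mu after h k x.
Proof.
pose leb : {sigma_finite_measure set TR -> \bar R} := lebesgue_measure.
have lebE A : measurable A -> (lebesgue_measure : set TR -> \bar R) A = leb A by [].
have fixed j u y (W : j.-tuple Xd) : measurable_fun setT (fun t : j.-tuple TR => path_val u y t W).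
  have mp : measurable_fun setT (fun t : j.-tuple TR => ((u : TR, y : Xm), (t, W))).
    apply: measurable_fun_pair; first exact: measurable_cst.
    by apply: measurable_fun_pair; [exact: measurable_id|exact: measurable_cst].
  have m1 := measurableT_comp (@measurable_path_val j) mp.
  by apply: eq_measurable_fun m1.
have inner j u y : measurable_fun setT (fun W : j.-tuple Xd =>
    \int[power_measure lebesgue_measure (k := j)]_t path_val u y (t : j.-tuple R) W).
  apply: (@measurable_power_integral _ _ _ leb _ lebE j _ _
    (fun p : j.-tuple Xd * j.-tuple TR => path_val u y p.2 p.1)).
    have mp : measurable_fun setT (fun p : j.-tuple Xd * j.-tuple TR => ((u : TR, y : Xm), (p.2, p.1))).
      apply: measurable_fun_pair; first exact: measurable_cst.
      by apply: measurable_fun_pair; [exact: measurable_snd|exact: measurable_fst].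
    have m1 := measurableT_comp (@measurable_path_val j) mp.
    by apply: eq_measurable_fun m1.
  by move=> p; exact: path_val_ge0.
have inner0 j u y W : 0 <= \int[power_measure lebesgue_measure (k := j)]_t path_val u y (t : j.-tuple R) W.
  have [p pE] := @power_measure_exists _ _ _ leb _ j lebE.
  by rewrite (@eq_raw_integral _ _ _ _ _ p)//; apply: integral_ge0 => t _; exact: path_val_ge0.
elim: k s x => [|k IH] s x.
  rewrite (@power_integral0 _ _ _ _ _ (inner 0%N s x)).
  by rewrite (power_integral0 _ (fixed 0%N s x [tuple])).
rewrite (power_integral_cons mu'E (inner k.+1 s x) (inner0 k.+1 s x)).
have [pl plE] := @power_measure_exists _ _ _ leb _ k lebE.
have [pm pmE] := @power_measure_exists _ _ _ mu _ k mu'E.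
pose G (w : Xd) (t1 : TR) := ((s < t1)%R%:R)%:E * iter_int step mu after h k (step (t1 - s) x w).
have mT : measurable_fun setT (fun t1 : TR => (t1 - s)%R : TR).
  by apply: measurable_funB; [exact: measurable_id|exact: measurable_cst].
have mstp : measurable_fun setT (fun p : TR * Xd => step (p.1 - s)%R x p.2 : Xm).
  apply: (@measurableT_comp _ _ _ _ _ _ _ _ (fun p : TR * Xd => ((p.1 - s)%R : TR, x : Xm, p.2)) mstep).
  apply: measurable_fun_pair; last exact: measurable_snd.
  apply: measurable_fun_pair; last exact: measurable_cst.
  exact: (measurableT_comp mT measurable_fst).
have -> : \int[mu]_w \int[power_measure mu' (k:=k)]_W
    \int[power_measure lebesgue_measure (k:=k.+1)]_t path_val s x (t : k.+1.-tuple R) [tuple of w :: W] =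
    \int[mu]_w \int[leb]_t1 G w t1.
  apply: eq_integral => w _.
  transitivity (\int[power_measure mu' (k:=k)]_W \int[leb]_t1
     \int[power_measure lebesgue_measure (k:=k)]_t path_val s x (t1 :: (t : k.-tuple R)) (w :: (W : k.-tuple Xd))).
    congr (integral _ _ _); apply/funext => W.
    by rewrite (power_integral_cons lebE (fixed k.+1 s x [tuple of w :: W]))// => t; exact: path_val_ge0.
  have mX : measurable_fun setT (fun p : TR * k.-tuple Xd =>
      \int[power_measure lebesgue_measure (k:=k)]_t path_val s x (p.1 :: (t : k.-tuple R)) (w :: p.2)).
    apply: (@measurable_power_integral _ _ _ leb _ lebE k _ _
      (fun q : (TR * k.-tuple Xd) * k.-tuple TR => path_val s x (q.1.1 :: q.2) (w :: q.1.2))).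
      have mp : measurable_fun setT (fun q : (TR * k.-tuple Xd) * k.-tuple TR =>
         ((s : TR, x : Xm), ([tuple of q.1.1 :: q.2], [tuple of w :: q.1.2]))).
        apply: measurable_fun_pair; first exact: measurable_cst.
        apply: measurable_fun_pair.
          apply: measurable_cons; last exact: measurable_snd.
          exact: (measurableT_comp measurable_fst measurable_fst).
        apply: measurable_cons; first exact: measurable_cst.
        exact: (measurableT_comp measurable_snd measurable_fst).
      have m1 := measurableT_comp (@measurable_path_val k.+1) mp.
      by apply: eq_measurable_fun m1.
    by move=> q; exact: path_val_ge0.
  rewrite (@power_integral_swap _ _ _ mu mu' mu'E k _ TR leb _ mX); last first.
    move=> p; rewrite (@eq_raw_integral _ _ _ _ _ pl)//.
    by apply: integral_ge0 => t _; exact: path_val_ge0.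
  apply: eq_integral => t1 _ /=.
  rewrite /G -(IH t1) [LHS](@eq_raw_integral _ _ _ _ _ pm)// [X in _ = _ * X](@eq_raw_integral _ _ _ _ _ pm)//.
  rewrite -ge0_integralZl//; last exact: inner.
  apply: eq_integral => W _.
  rewrite [LHS](@eq_raw_integral _ _ _ _ _ pl)// [X in _ = _ * X](@eq_raw_integral _ _ _ _ _ pl)//.
  rewrite -ge0_integralZl//; first exact: fixed.
  by move=> t _; exact: path_val_ge0.
have mG : measurable_fun setT (fun p : TR * Xd => G p.2 p.1).
  apply: emeasurable_funM.
    apply: measurable_lt_indic; [exact: measurable_cst|exact: measurable_fst].
  exact: (measurableT_comp (measurable_iter_int mstep mu cutoff_after k mh h0) mstp).
have G0 w t1 : 0 <= G w t1.
  by rewrite mule_ge0 ?lee_fin ?ler0n// (iter_int_ge0 _ _ cutoff_after).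
transitivity (\int[leb]_t1 \int[mu]_w G w t1).
  exact/esym/(fubini_tonelli (m1 := leb) (m2 := mu) (fun p : TR * Xd => G p.2 p.1) mG (fun p => G0 _ _)).
rewrite -[RHS](integral_translation s).
- apply: eq_integral => t1 _; apply: eq_integral => w _.
  by rewrite /G /after subr_gt0.
- exact: (measurable_iter_int_inner mstep _ cutoff_after).
- by move=> t; apply: integral_ge0 => w _; rewrite mule_ge0 ?lee_fin ?ler0n// (iter_int_ge0 _ _ cutoff_after).
Qed.

End path_integral.

Section flow_step.
Context {R : realType} {m d : nat}.
Variables (a : 'cV[R]_m -> 'cV[R]_m) (sigma : 'cV[R]_m -> 'M[R]_(m, d)) (D : R).
Hypothesis aD : forall x y, enorm (a x - a y) <= D * enorm (x - y).
Hypothesis sD : forall x y, opnorm (sigma x - sigma y) <= D * enorm (x - y).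
Hypothesis D0 : 0 <= D.
Variable y_ : R -> 'cV[R]_m -> 'cV[R]_m.
Hypothesis y_flow : forall x, ode_sol a x (y_ ^~ x).
Variable b : R.
Hypothesis b_gt0 : 0 < b.

Local Notation TR := (measurableTypeR R).
Local Notation Xm := (borel 'cV[R]_m).
Local Notation Xd := (borel 'cV[R]_d).

(* Flow for time s, then jump; negative times are frozen so that the map is jointly continuous on all of R. *)
Definition step (s : R) (x : 'cV[R]_m) (w : 'cV[R]_d) : 'cV[R]_m :=
  jump sigma b (y_ (Num.max 0 s) x) w.

Lemma stepE s x w : step s x w = jump sigma b (y_ (Num.max 0 s) x) w.
Proof. by []. Qed.

Lemma step_continuous : continuous (fun p : R * 'cV[R]_m * 'cV[R]_d => step p.1.1 p.1.2 p.2).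
Proof.
move=> p; apply: (@continuous_comp _ _ _
  (fun p : R * 'cV[R]_m * 'cV[R]_d => (y_ (Num.max 0 p.1.1) p.1.2, p.2))
  (fun q : 'cV[R]_m * 'cV[R]_d => jump sigma b q.1 q.2)); last exact: (jump_continuous sD D0 (ltW b_gt0)).
apply: (@cvg_pair _ _ _ (nbhs p) (nbhs (y_ (Num.max 0 p.1.1) p.1.2)) (nbhs p.2) _ _ _
  (fun p : R * 'cV[R]_m * 'cV[R]_d => y_ (Num.max 0 p.1.1) p.1.2) snd); last exact: cvg_snd.
apply: (@continuous_comp _ _ _ fst (fun q : R * 'cV[R]_m => y_ (Num.max 0 q.1) q.2)); first exact: cvg_fst.
exact: (flow_continuous aD D0 y_flow).
Qed.

Lemma measurable_step : measurable_fun setT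
  ((fun p => step p.1.1 p.1.2 p.2) : (TR * Xm * Xd)%type -> Xm).
Proof.
have mf : measurable_fun setT ((fun p => y_ (Num.max 0 p.1) p.2) : (TR * Xm)%type -> Xm).
  apply: (@measurable_continuous2 _ _ R 'cV[R]_m 'cV[R]_m (fun p => y_ (Num.max 0 p.1) p.2)).
  - exact: countable_base_R.
  - exact: countable_base_cV.
  - exact: (flow_continuous aD D0 y_flow).
  - exact: (measurableT_comp (@measurable_borelR R) measurable_fst).
  - exact: measurable_snd.
apply: (@measurable_continuous2 _ _ 'cV[R]_m 'cV[R]_d 'cV[R]_m (fun p => jump sigma b p.1 p.2)
   (fun p : (TR * Xm * Xd)%type => y_ (Num.max 0 p.1.1) p.1.2) snd).
- exact: countable_base_cV.
- exact: countable_base_cV.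
- exact: (jump_continuous sD D0 (ltW b_gt0)).
- exact: (measurableT_comp mf measurable_fst).
- exact: measurable_snd.
Qed.

Variable mu : {sigma_finite_measure set Xd -> \bar R}.
Variable mu' : set Xd -> \bar R.
Hypothesis mu'E : forall A, measurable A -> mu' A = mu A.

Local Notation r h k x := (iter_int step mu (@after R d) h k x).

Lemma path_val_path_end h k s x (t : k.-tuple R) (W : k.-tuple 'cV[R]_d) :
  path_val step h s x t W = if path <%R s t then
     h (path_end sigma y_ b s x (zip (zip t [tuple of nseq k 0]) W)) else 0%E.
Proof.
elim: k s x t W => [|k IH] s x t W; first by rewrite (tuple0 t) (tuple0 W).
case: (tupleP t) => t1 t'; case: (tupleP W) => w1 W' /=; rewrite IH.
have [st|] := boolP (s < t1); last by rewrite mul0e.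
by rewrite mul1e /step max_r ?subr_ge0 ?(ltW st)// addr0.
Qed.

(** The first jump happens at time 0 from the origin and contributes an integral over noise only.
    The restriction to increasing times is moved into [path_val], which vanishes for all others. *)
Lemma Ccheck_iter_int k (A : set 'cV[R]_m) : measurable (A : set Xm) ->
  Ccheck a sigma b mu' k.+1 A =
  (\int[mu]_w r (fun x => (\1_A x)%:E) k (jump sigma b 0 w))%E.
Proof.
move=> mA; pose h x : \bar R := (\1_A x)%:E.
have mh : measurable_fun setT (h : Xm -> \bar R) by apply/measurable_EFinP; exact: measurable_indic.
have h0 x : (0 <= h x)%E by rewrite lee_fin.
pose leb : {sigma_finite_measure set TR -> \bar R} := lebesgue_measure.
have lebE B : measurable B -> (lebesgue_measure : set TR -> \bar R) B = leb B by [].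
pose f (W : k.+1.-tuple Xd) := (\int[power_measure lebesgue_measure (k := k)]_t
   path_val step h 0 (jump sigma b 0 (thead W)) (t : k.-tuple R) (behead W))%E.
have mf : measurable_fun setT f.
  apply: (@measurable_power_integral _ _ _ leb _ lebE k _ _
    (fun q : k.+1.-tuple Xd * k.-tuple TR => path_val step h 0 (jump sigma b 0 (thead q.1)) q.2 (behead q.1))).
    have mj : measurable_fun setT (fun q : k.+1.-tuple Xd * k.-tuple TR => jump sigma b 0 (thead q.1) : Xm).
      apply: (@measurable_continuous2 _ _ 'cV[R]_m 'cV[R]_d 'cV[R]_m (fun p => jump sigma b p.1 p.2)
         (fun=> 0 : Xm) (fun q : k.+1.-tuple Xd * k.-tuple TR => thead q.1)).
      - exact: countable_base_cV.
      - exact: countable_base_cV.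
      - exact: (jump_continuous sD D0 (ltW b_gt0)).
      - exact: measurable_cst.
      - exact: (measurableT_comp (@measurable_thead _ Xd k) measurable_fst).
    have mp : measurable_fun setT (fun q : k.+1.-tuple Xd * k.-tuple TR =>
       ((0 : TR, jump sigma b 0 (thead q.1) : Xm), (q.2, [tuple of behead q.1] : k.-tuple Xd))).
      apply: measurable_fun_pair; first by apply: measurable_fun_pair => //; exact: measurable_cst.
      apply: measurable_fun_pair; first exact: measurable_snd.
      exact: (measurableT_comp (@measurable_behead _ Xd k) measurable_fst).
    have m1 := measurableT_comp (@measurable_path_val _ _ _ _ measurable_step _ mh k) mp.
    by apply: eq_measurable_fun m1.
  by move=> q; exact: path_val_ge0.
have f0 W : (0 <= f W)%E.
  have [p pE] := @power_measure_exists _ _ _ leb _ k lebE.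
  by rewrite /f (@eq_raw_integral _ _ _ _ _ p)//; apply: integral_ge0 => t _; exact: path_val_ge0.
transitivity (\int[power_measure mu' (k := k.+1)]_W f W)%E.
  rewrite /Ccheck /f; congr (integral _ _ _); apply/funext => W.
  rewrite raw_integral_mkcond; congr (integral _ _ _); apply/funext => t.
  rewrite patchE (path_val_path_end h 0 _ t [tuple of behead W]).
  case: ifPn => [|].
    rewrite inE => it; rewrite (introT idP ((increasing_path t).1 it)).
    by rewrite /h /gcheck (gbarE sigma aD y_flow b _ _ _ it) /jump add0r.
  rewrite notin_setE => it; case: ifPn => // pt.
  by case: it; apply/increasing_path.
rewrite (power_integral_cons mu'E mf f0); apply: eq_integral => w _.
rewrite -(path_integral measurable_step mu'E mh h0 k 0); congr (integral _ _ _); apply/funext => W.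
Qed.

End flow_step.

Lemma int_cst_indic dT (T : measurableType dT) (R : realType) (mu : {measure set T -> \bar R})
    (A : set T) (K : R) : measurable A -> 0 <= K ->
  (\int[mu]_x (K * \1_A x)%:E = K%:E * mu A)%E.
Proof.
move=> mA K0; under eq_integral do rewrite EFinM.
rewrite ge0_integralZl_EFin//; last by apply/measurable_EFinP; exact: measurable_indic.
by rewrite integral_indic// setIT.
Qed.

Lemma lebesgue_initial (R : realType) (T : R) : 0 < T ->
  lebesgue_measure (`]0, T]%classic : set (measurableTypeR R)) = T%:E.
Proof. by move=> T0; rewrite lebesgue_measure_itv/= lte_fin T0 -EFinB subr0. Qed.

Lemma ge0_dominated_cvg dT (T : measurableType dT) (R : realType) (mu : {measure set T -> \bar R})
    (f_ : nat -> T -> \bar R) (f : T -> \bar R) (g : T -> R) :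
  (forall n, measurable_fun setT (f_ n)) -> (forall x, f_ n x @[n --> \oo] --> f x) ->
  mu.-integrable setT (fun x => (g x)%:E) -> (forall n x, 0 <= f_ n x)%E ->
  (forall n x, f_ n x <= (g x)%:E)%E ->
  (\int[mu]_x f_ n x)%E @[n --> \oo] --> (\int[mu]_x f x)%E.
Proof.
move=> mf ff ig f0 fg.
apply: (@dominated_cvg _ _ _ mu setT measurableT f_ f (fun x => (g x)%:E)) => //.
by move=> n x _; rewrite gee0_abs.
Qed.

(** Dominated convergence speaks of sequences; choosing counterexamples at distances 1/(k+1)
    converts it into a statement on a neighbourhood. *)
Lemma seq_near (R : realType) n (A : set 'cV[R]_n) (x : 'cV[R]_n) (P : 'cV[R]_n -> Prop) :
  (forall z_ : nat -> 'cV[R]_n, (forall n, A (z_ n)) -> z_ n @[n --> \oo] --> x -> \forall n \near \oo, P (z_ n)) ->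
  exists2 dl, 0 < dl & forall z, A z -> enorm (z - x) < dl -> P z.
Proof.
move=> h; apply: contrapT => nd.
have bad k : exists z, [/\ A z, enorm (z - x) < k.+1%:R^-1 & ~ P z].
  apply: contrapT => nz; apply: nd; exists k.+1%:R^-1; first by rewrite invr_gt0.
  by move=> z Az zx; apply: contrapT => Pz; apply: nz; exists z.
have [z_ hz] := choice bad.
have zx : z_ n @[n --> \oo] --> x.
  apply/(@cvg_enormP _ _ _ _ eventually_filter) => eps eps0.
  have := near_infty_natSinv_lt (PosNum eps0).
  apply: filterS => k /= ke; have [_ zk _] := hz k; exact: lt_trans zk ke.
have [k [Pk _]] := near_ex2 _ (h z_ (fun n => let: And3 p _ _ := hz n in p) zx) (nbhs_infty_ge 0%N).
by have [_ _ /(_ Pk)] := hz k.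
Qed.

Lemma cvg_fin_near (R : realType) (u : nat -> \bar R) l kappa : 0 < kappa ->
  u n @[n --> \oo] --> l -> l \is a fin_num -> (forall n, u n \is a fin_num) ->
  \forall n \near \oo, (u n <= l + kappa%:E)%E /\ (l <= u n + kappa%:E)%E.
Proof.
move=> k0 ul lf uf; have : u n @[n --> \oo] --> (fine l)%:E by rewrite fineK.
move=> /fine_cvgP [_ /cvgrPdist_le /(_ _ k0)].
apply: filterS => n; rewrite /= -(fineK (uf n)) -(fineK lf) /= -!EFinD !lee_fin ler_distlC => /andP[h1 h2].
by split; lra.
Qed.

(** * Continuous approximations of indicators *)

Section bump.
Context {R : realType} {m : nat}.

(** A plateau of height 1 on the ball of radius 1/q, falling with slope q to 0 at radius 2/q. *)
Definition hat (q : R) (z x : 'cV[R]_m) : R := Num.max 0 (Num.min 1 (2 - q * enorm (x - z))).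

(* 0 is added so that the supremum is meaningful for the empty set. *)
Definition bump (q : R) (A : set 'cV[R]_m) (x : 'cV[R]_m) : R :=
  sup ([set 0] `|` [set hat q z x | z in A]).

Lemma hat_le1 q z x : hat q z x <= 1.
Proof. by rewrite ge_max ler01 ge_min lexx. Qed.

Lemma bump_has_sup q A x : has_sup ([set 0] `|` [set hat q z x | z in A]).
Proof.
split; first by exists 0; left.
by exists 1 => _ [->//|[z _ <-]]; exact: hat_le1.
Qed.

Lemma bump_ub q A x z : A z -> hat q z x <= bump q A x.
Proof. by move=> Az; apply: (ub_le_sup (bump_has_sup q A x).2); right; exists z. Qed.

Lemma bump_ge0 q A x : 0 <= bump q A x.
Proof. by apply: (ub_le_sup (bump_has_sup q A x).2); left. Qed.

Lemma bump_le q A x r : 0 <= r -> (forall z, A z -> hat q z x <= r) -> bump q A x <= r.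
Proof.
move=> r0 h; apply: ge_sup; first exact: (bump_has_sup q A x).1.
by move=> _ [->//|[z Az <-]]; exact: h.
Qed.

Lemma bump_le1 q A x : bump q A x <= 1.
Proof. by apply: bump_le => // z _; exact: hat_le1. Qed.

Lemma bump1 q A x z : A z -> q * enorm (x - z) <= 1 -> bump q A x = 1.
Proof.
move=> Az qx; apply/eqP; rewrite eq_le bump_le1/=; apply: le_trans (bump_ub q x Az).
by rewrite le_max le_min lexx/=; apply/orP; right; lra.
Qed.

Lemma bump0 q A x : (forall z, A z -> 2 <= q * enorm (x - z)) -> bump q A x = 0.
Proof.
move=> h; apply/eqP; rewrite eq_le bump_ge0 andbT; apply: bump_le => // z /h hz.
by rewrite ge_max lexx/= ge_min; apply/orP; right; lra.
Qed.

Lemma hat_lipschitz q z x y : 0 <= q -> hat q z x <= hat q z y + q * enorm (x - y).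
Proof.
move=> q0; have h : enorm (y - z) <= enorm (x - z) + enorm (x - y).
  by rewrite (enormB x y) [leRHS]addrC; exact: enorm_sub_triangle.
have e0 : 0 <= q * enorm (x - y) by rewrite mulr_ge0 ?enorm_ge0.
have hq : q * enorm (y - z) <= q * enorm (x - z) + q * enorm (x - y).
  by rewrite -mulrDr; apply: ler_wpM2l.
rewrite /hat ge_max; apply/andP; split.
  by apply: addr_ge0 => //; rewrite le_max lexx.
rewrite -lerBlDr le_max le_min; apply/orP.
set u := Num.min 1 _.
have u1 : u <= 1 by rewrite ge_min lexx.
have u2 : u <= 2 - q * enorm (x - z) by rewrite ge_min lexx orbT.
by right; apply/andP; split; lra.
Qed.

Lemma bump_lipschitz q A x y : 0 <= q -> bump q A x <= bump q A y + q * enorm (x - y).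
Proof.
move=> q0; apply: bump_le; first by rewrite addr_ge0 ?bump_ge0 ?mulr_ge0 ?enorm_ge0.
by move=> z Az; apply: le_trans (hat_lipschitz z x y q0) _; rewrite lerD2r; exact: bump_ub.
Qed.

Lemma bump_continuous q A : 0 <= q -> continuous (bump q A).
Proof.
move=> q0 x; apply/(@cvgrPdist_lt _ _ _ _ (nbhs_filter x)) => eps eps0.
have d0 : 0 < eps / (q + 1) by rewrite divr_gt0// ltr_wpDl.
have := near_enorm x d0; apply: (@filterS _ _ (nbhs_filter x)) => y yx.
have h1 := bump_lipschitz A x y q0; have h2 := bump_lipschitz A y x q0.
have e : enorm (x - y) = enorm (y - x) by rewrite enormB.
move: yx; rewrite ltr_pdivlMr ?ltr_wpDl// mulrDr mulr1 => yx.
have y0 := enorm_ge0 (y - x).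
by rewrite ltr_distl; apply/andP; split; rewrite e in h1; lra.
Qed.

Lemma bump_cvg (A : set 'cV[R]_m) x : bump n%:R A x @[n --> \oo] --> (\1_(closure A) x : R).
Proof.
have [xA|xA] := pselect (closure A x).
  rewrite indicE mem_set//; apply: cvg_near_cst; exists 1%N => // n /= n1.
  have n0 : 0 < n%:R :> R by rewrite ltr0n.
  have ni : 0 < n%:R^-1 :> R by rewrite invr_gt0.
  have [z [Az zx]] := xA _ (near_enorm x ni).
  by apply: (bump1 Az); rewrite -(enormB z) mulrC -ler_pdivlMr// mul1r ltW.
rewrite indicE memNset//.
have [r r0 hr] : exists2 r, 0 < r & forall z, A z -> r <= enorm (x - z).
  have : nbhs x (~` closure A) by apply: open_nbhs_nbhs; split => //; exact/closed_openC/closed_closure.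
  move=> /nbhs_enormP [r r0 hr]; exists r => // z Az; rewrite leNgt; apply/negP => zx.
  by apply: (hr z); [rewrite /= enormB|exact: subset_closure].
apply: cvg_near_cst; near=> n; apply: bump0 => z /hr hz.
apply: le_trans (_ : n%:R * r <= _); last by rewrite ler_wpM2l.
rewrite -ler_pdivrMr//; near: n; exact: nbhs_infty_ger.
Unshelve. all: by end_near. Qed.

Lemma bump_ball_out q (U A : set 'cV[R]_m) r x : A `<=` ~` U -> 0 <= q -> 2 <= q * r -> shrink U r x ->
  bump q A x = 0.
Proof.
move=> AU q0 qr xU; apply: bump0 => z /AU zU; apply: le_trans qr _; rewrite ler_wpM2l// leNgt.
by apply/negP => xz; apply: zU; apply: xU; rewrite enormB.
Qed.

(** The minimum is positive only near both U and its complement. Because of it the bump is 1 also at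
    the points of U within 1/q of the complement, and its limit is the indicator of the closure of A
    together with the boundary of U. *)
Definition upper_bump q (U A : set 'cV[R]_m) x :=
  Num.max (bump q A x) (Num.min (bump q (~` U) x) (bump q U x)).

(** The continuous minorant for lower bounds: it vanishes off G and tends to the indicator of G when
    G is open. *)
Definition lower_bump q (G : set 'cV[R]_m) x := 1 - bump q (~` G) x.

Lemma upper_bump_continuous q U A : 0 <= q -> continuous (upper_bump q U A).
Proof.
move=> q0 x; apply: continuous_max; first exact: bump_continuous.
by apply: continuous_min; exact: bump_continuous.
Qed.

Lemma lower_bump_continuous q G : 0 <= q -> continuous (lower_bump q G).
Proof. move=> q0 x; apply/(@cvgrPdist_lt _ _ _ _ (nbhs_filter x)) => eps eps0.
have /(@cvgrPdist_lt _ _ _ _ (nbhs_filter x)) /(_ eps eps0) := bump_continuous (A := ~` G) q0 (x := x).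
apply: (@filterS _ _ (nbhs_filter x)) => y; rewrite distrC /lower_bump.
by congr (_ < _); congr (`| _ |); ring. Qed.

Lemma upper_bump_itv q U A x : 0 <= upper_bump q U A x <= 1.
Proof.
rewrite /upper_bump le_max bump_ge0/= ge_max bump_le1/= ge_min bump_le1//.
Qed.

Lemma lower_bump_itv q G x : 0 <= lower_bump q G x <= 1.
Proof.
have h0 := bump_ge0 q (~` G) x; have h1 := bump_le1 q (~` G) x.
by rewrite /lower_bump; apply/andP; split; lra.
Qed.

Lemma upper_bump1 q U A x : 0 < q -> (A `|` (U `\` shrink U q^-1)) x -> upper_bump q U A x = 1.
Proof.
move=> q0 h; apply/eqP; rewrite eq_le (andP (upper_bump_itv q U A x)).2/= /upper_bump le_max.
apply/orP; case: h => [Ax|[Ux nx]]; [left|right].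
  by rewrite (bump1 Ax)// subrr enorm0 mulr0.
rewrite le_min (bump1 Ux) ?subrr ?enorm0 ?mulr0// lexx andbT.
have [z zx nU] : exists2 z, enorm (z - x) < q^-1 & ~ U z.
  by apply: contrapT => h; apply: nx => z zx; apply: contrapT => nU; apply: h; exists z.
by rewrite (bump1 (A := ~` U) nU)// -(enormB z) mulrC -ler_pdivlMr// mul1r ltW.
Qed.

Lemma upper_bump0 q U A r x : A `<=` ~` U -> 0 <= q -> 2 <= q * r -> shrink U r x -> upper_bump q U A x = 0.
Proof.
move=> AU q0 qr xU; rewrite /upper_bump (bump_ball_out AU q0 qr xU) (bump_ball_out (@subset_refl _ (~` U)) q0 qr xU).
by rewrite min_l ?bump_ge0// maxxx.
Qed.

Lemma lower_bump0 q G x : ~ G x -> lower_bump q G x = 0.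
Proof. by move=> Gx; rewrite /lower_bump (bump1 Gx) ?subrr// enorm0 mulr0. Qed.

Lemma cvg_maxr (p q : nat -> R) (u v : R) : p n @[n --> \oo] --> u -> q n @[n --> \oo] --> v ->
  Num.max (p n) (q n) @[n --> \oo] --> Num.max u v.
Proof.
move=> pu qv; rewrite maxr_absE.
have -> : (fun n => Num.max (p n) (q n)) = fun n => (p n + q n + `|p n - q n|) / 2.
  by apply/funext => n; rewrite maxr_absE.
apply: cvgM; last exact: cvg_cst.
by apply: cvgD; [exact: cvgD|apply: cvg_norm; exact: cvgB].
Qed.

Lemma cvg_minr (p q : nat -> R) (u v : R) : p n @[n --> \oo] --> u -> q n @[n --> \oo] --> v ->
  Num.min (p n) (q n) @[n --> \oo] --> Num.min u v.
Proof.
move=> pu qv; rewrite minr_absE.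
have -> : (fun n => Num.min (p n) (q n)) = fun n => (p n + q n - `|p n - q n|) / 2.
  by apply/funext => n; rewrite minr_absE.
apply: cvgM; last exact: cvg_cst.
by apply: cvgB; [exact: cvgD|apply: cvg_norm; exact: cvgB].
Qed.

Lemma upper_bump_cvg U A x : open U ->
  upper_bump n%:R U A x @[n --> \oo] --> (\1_(closure A `|` boundary U) x : R).
Proof.
move=> oU.
have -> : (\1_(closure A `|` boundary U) x : R) =
    Num.max (\1_(closure A) x) (Num.min (\1_(closure (~` U)) x) (\1_(closure U) x)).
  have cU : closure (~` U) = ~` U by apply/esym/closure_id; exact: open_closedC.
  rewrite cU !indicE in_setU.
  have -> : (x \in boundary U) = (x \in ~` U) && (x \in closure U).
    apply/idP/andP; rewrite /boundary !inE (interior_id U).1//.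
      by move=> [? ?].
    by move=> [? ?].
  by case: (x \in closure A); case: (x \in ~` U); case: (x \in closure U) => /=;
    rewrite ?(maxxx, minxx, min_l ler01, min_r ler01, max_l ler01, max_r ler01).
apply: cvg_maxr; first exact: bump_cvg.
by apply: cvg_minr; exact: bump_cvg.
Qed.

Lemma lower_bump_cvg G x : open G -> lower_bump n%:R G x @[n --> \oo] --> (\1_G x : R).
Proof.
move=> oG.
have -> : (\1_G x : R) = 1 - \1_(closure (~` G)) x.
  have <- : ~` G = closure (~` G) by apply/closure_id; exact: open_closedC.
  by rewrite !indicE in_setC; case: (x \in G); rewrite ?subr0 ?subrr.
by apply: cvgB; [exact: cvg_cst|exact: bump_cvg].
Qed.

End bump.

(** * Moments of the noise *)

Section dyadic.
Context {R : realType}.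
Implicit Types (H : R -> R) (p q x y : R).

Lemma exists_pow2_gt x : exists n, x < 2 ^+ n.+1.
Proof.
exists (Num.trunc `|x|).
have /andP[_ h] := Num.Theory.truncn_itv (normr_ge0 x).
apply: le_lt_trans (ler_norm x) _; apply: lt_le_trans h _.
by rewrite -natrX ler_nat; exact/ltnW/ltn_expl.
Qed.

(** A bound of Potter type: the ratio estimate is iterated while x is halved down to the scale x0,
    and n counts the halvings. *)
Lemma dyadic_upper H p x0 : 0 < x0 -> 0 < p -> (forall x, H x <= 1) ->
  (forall x, x0 <= x -> H (2 * x) <= 2 `^ (- p) * H x) ->
  forall x, x0 <= x -> H x <= (2 * x0) `^ p * x `^ (- p).
Proof.
move=> x00 p0 H1 h x xx0; have [n] := exists_pow2_gt (x / x0).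
rewrite ltr_pdivrMr//; elim: n x xx0 => [|n IH] x xx0 xn.
  apply: le_trans (H1 x) _; have xp : 0 < x by exact: lt_le_trans xx0.
  rewrite powRN ler_pdivlMr ?powR_gt0// mul1r.
  by apply: ge0_ler_powR; rewrite ?nnegrE ?(ltW p0) ?(ltW xp)//; [rewrite mulr_ge0// ltW|move: xn; rewrite expr1 => /ltW].
have [x2|x2] := ltP x (2 * x0).
  apply: le_trans (H1 x) _; have xp : 0 < x by exact: lt_le_trans xx0.
  rewrite powRN ler_pdivlMr ?powR_gt0// mul1r.
  by apply: ge0_ler_powR; rewrite ?nnegrE ?(ltW p0) ?(ltW xp) ?(ltW x2)// mulr_ge0// ltW.
have hx : x0 <= x / 2 by rewrite ler_pdivlMr// mulrC.
have {h} := h _ hx; rewrite mulrCA divff ?mulr1 ?pnatr_eq0// => /le_trans; apply.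
have {IH} := IH _ hx.
have xn2 : x / 2 < 2 ^+ n.+1 * x0 by rewrite ltr_pdivrMr// mulrAC -exprSr.
move=> /(_ xn2) h; apply: le_trans (ler_wpM2l (powR_ge0 _ _) h) _.
have x0' : 0 <= x by exact: le_trans (ltW x00) xx0.
by rewrite mulrCA -powRM// ?divr_ge0// mulrCA divff ?mulr1 ?pnatr_eq0.
Qed.

Lemma dyadic_lower H q x0 : 0 < x0 -> 0 < q -> 0 < H (2 * x0) -> (forall x y, x <= y -> H y <= H x) ->
  (forall x, x0 <= x -> 2 `^ (- q) * H x <= H (2 * x)) ->
  forall x, x0 <= x -> H (2 * x0) * x0 `^ q * x `^ (- q) <= H x.
Proof.
move=> x00 q0 Hp Hd h x xx0; have [n] := exists_pow2_gt (x / x0).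
have base z : x0 <= z -> z <= 2 * x0 -> H (2 * x0) * x0 `^ q * z `^ (- q) <= H z.
  move=> zx0 z2; apply: le_trans (Hd _ _ z2); rewrite -mulrA ler_piMr ?(ltW Hp)//.
  have zp : 0 < z by exact: lt_le_trans zx0.
  rewrite powRN ler_pdivrMr ?powR_gt0// mul1r.
  by apply: ge0_ler_powR; rewrite ?nnegrE ?(ltW q0) ?(ltW zp) ?(ltW x00).
rewrite ltr_pdivrMr//; elim: n x xx0 => [|n IH] x xx0 xn.
  by apply: base => //; move: xn; rewrite expr1 => /ltW.
have [x2|x2] := leP x (2 * x0); first exact: base.
have hx : x0 <= x / 2 by rewrite ler_pdivlMr// mulrC ltW.
have {h} := h _ hx; rewrite mulrCA divff ?mulr1 ?pnatr_eq0//; apply: le_trans.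
have xn2 : x / 2 < 2 ^+ n.+1 * x0 by rewrite ltr_pdivrMr// mulrAC -exprSr.
apply: le_trans (ler_wpM2l (powR_ge0 _ _) (IH _ hx xn2)).
have x0' : 0 <= x by exact: le_trans (ltW x00) xx0.
by rewrite mulrCA -powRM// ?divr_ge0// mulrCA divff ?mulr1 ?pnatr_eq0.
Qed.

(** Keeps the linear term, so that a centred argument contributes only at second order. Both signs
    follow from (1 - t) exp(t) <= 1. *)
Lemma expR_le_quadratic t : expR t <= 1 + t + t ^+ 2 * expR `|t| :> R.
Proof.
have h : 0 < expR t := expR_gt0 t.
have [t0|t0] := leP 0 t.
  rewrite ger0_norm//; have h1 := expR_ge1Dx (- t).
  have h2 : (1 - t) * expR t <= 1.
    by rewrite -ler_pdivlMr// mul1r -expRN.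
  have h3 : t * (expR t - 1 - t * expR t) <= 0 by apply: mulr_ge0_le0 => //; lra.
  by rewrite expr2; nra.
rewrite ltr0_norm//; have h1 := expR_ge1Dx (- t).
have h4 : expR t * expR (- t) = 1 by rewrite -expRD subrr expR0.
have h5 : expR t * (1 - t) <= 1 by rewrite -[leRHS]h4; exact: (ler_wpM2l (ltW h) h1).
have h6 : (1 + t + t ^+ 2) * (1 - t) >= 1.
  have -> : (1 + t + t ^+ 2) * (1 - t) = 1 - t ^+ 3 by ring.
  have : t ^+ 3 <= 0 by rewrite exprS mulr_le0_ge0 ?sqr_ge0// ltW.
  by lra.
have h7 : expR t <= 1 + t + t ^+ 2.
  by rewrite -(ler_pM2r (_ : 0 < 1 - t)); lra.
apply: le_trans h7 _; rewrite lerD2l ler_peMr ?sqr_ge0//.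
by apply: le_trans h1; lra.
Qed.

End dyadic.

Section moments.
Context {R : realType} {d : nat}.
Local Notation Xd := (borel 'cV[R]_d).
Variable lw : probability Xd R.

Definition tl (x : R) : R := fine (lw [set z | x < enorm z]).

Lemma measurable_gt_enorm x : measurable ([set z | x < enorm z] : set Xd).
Proof.
have := @measurable_enorm R d measurableT _ (measurable_itv `]x, +oo[).
by rewrite setTI; congr measurable; apply/seteqP; split=> z; rewrite /= in_itv/= andbT.
Qed.

Lemma tlE x : (tl x)%:E = lw [set z | x < enorm z].
Proof. by rewrite fineK// fin_num_measure//; exact: measurable_gt_enorm. Qed.

Lemma tl_ge0 x : 0 <= tl x.
Proof. by rewrite -lee_fin tlE. Qed.

Lemma tl_le1 x : tl x <= 1.
Proof. by rewrite -lee_fin tlE probability_le1//; exact: measurable_gt_enorm. Qed.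

Lemma tl_decr x y : x <= y -> tl y <= tl x.
Proof.
move=> xy; rewrite -lee_fin !tlE; apply: le_measure; rewrite ?inE; try exact: measurable_gt_enorm.
by move=> z /=; exact: le_lt_trans.
Qed.

Variable alpha : R.
Hypothesis alpha_gt1 : 1 < alpha.
Hypothesis tl_rv : forall t, 0 < t -> tl (t * x) / tl x @[x --> +oo] --> t `^ (- alpha).

Lemma near_pinfty_from (P : R -> Prop) : (\forall x \near +oo, P x) ->
  exists2 x0, 0 < x0 & forall x, x0 <= x -> P x.
Proof.
move=> [M [_ h]]; exists (Num.max M 0 + 1); first by rewrite ltr_wpDl// le_max lexx orbT.
move=> x Mx; apply: h; apply: lt_le_trans Mx; apply: (@le_lt_trans _ _ (Num.max M 0)).
  by rewrite le_max lexx.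
by rewrite ltrDl.
Qed.

(** At t = 1 the ratio of tails tends to 1, whereas it is 0, by the convention on division by 0,
    where the tail vanishes. *)
Lemma tl_pos : \forall x \near +oo, 0 < tl x.
Proof.
have h1 : (0 : R) < 1 `^ (- alpha) by rewrite powR_gt0.
move/(@cvgr_gt _ _ _ _ _ _): (tl_rv ltr01) => /(_ 0 h1) [M [Mr h]]; exists M; split => // x Mx.
have := h x Mx; rewrite mul1r => h'; rewrite lt_def tl_ge0 andbT.
by apply/eqP => t0; move: h'; rewrite t0 mul0r ltxx.
Qed.

Lemma ltr_powR_exp (x p q : R) : 1 < x -> p < q -> x `^ p < x `^ q.
Proof.
move=> x1 pq; have x0 : 0 < x by exact: lt_trans x1.
by rewrite /powR gt_eqF// ltr_expR ltr_pM2r// ln_gt0.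
Qed.

Lemma tl_upper p : 0 < p -> p < alpha -> exists C x0, [/\ 0 < C, 0 < x0 &
  forall x, x0 <= x -> tl x <= C * x `^ (- p)].
Proof.
move=> p0 pa; have h : (2 : R) `^ (- alpha) < 2 `^ (- p) by apply: ltr_powR_exp; [lra|rewrite ltrN2].
have h2 : 0 < 2 :> R by [].
have [x1 x10 hx1] := near_pinfty_from (cvgr_lt _ (tl_rv h2) _ h).
have [x2 x20 hx2] := near_pinfty_from tl_pos.
pose x0 := Num.max x1 x2.
have x00 : 0 < x0 by rewrite lt_max x10.
exists ((2 * x0) `^ p), x0; split=> //; first by rewrite powR_gt0// mulr_gt0.
apply: dyadic_upper => //; first exact: tl_le1.
move=> x; rewrite ge_max => /andP[xx1 xx2].
by have := hx1 x xx1; rewrite ltr_pdivrMr ?hx2// => /ltW.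
Qed.

Lemma tl_lower q : alpha < q -> exists c x0, [/\ 0 < c, 0 < x0 &
  forall x, x0 <= x -> c * x `^ (- q) <= tl x].
Proof.
move=> pa; have h : (2 : R) `^ (- q) < 2 `^ (- alpha) by apply: ltr_powR_exp; [lra|rewrite ltrN2].
have h2 : 0 < 2 :> R by [].
have [x1 x10 hx1] := near_pinfty_from (cvgr_gt _ (tl_rv h2) _ h).
have [x2 x20 hx2] := near_pinfty_from tl_pos.
pose x0 := Num.max x1 x2.
have x00 : 0 < x0 by rewrite lt_max x10.
have tp : 0 < tl (2 * x0) by apply: hx2; rewrite /x0 (@le_trans _ _ (Num.max x1 x2))// ?le_max ?lexx ?orbT// ler_peMl ?(ltW x00)//; lra.
have q0 : 0 < q by apply: lt_trans pa; apply: lt_trans alpha_gt1.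
exists (tl (2 * x0) * x0 `^ q), x0; split=> //; first by rewrite mulr_gt0// powR_gt0.
apply: dyadic_lower => //; first exact: tl_decr.
move=> x; rewrite ge_max => /andP[xx1 xx2].
by have := hx1 x xx1; rewrite ltr_pdivlMr ?hx2// => /ltW.
Qed.

(** Dyadic shells of radius 2^n x0: with an exponent p' strictly between p and alpha, their
    contributions decay like 2^(n (p - p')), a geometric series. *)
Lemma enorm_moment p : 0 < p -> p < alpha -> lw.-integrable setT (fun z => (enorm z `^ p)%:E).
Proof.
move=> p0 pa; pose p' := (p + alpha) / 2.
have [pp' p'a] : p < p' /\ p' < alpha by rewrite /p'; split; lra.
have p'0 : 0 < p' by exact: lt_trans pp'.
have [C [x0 [C0 x00 hC]]] := tl_upper p'0 p'a.
have mP : measurable_fun setT ((fun z => enorm z `^ p) : Xd -> measurableTypeR R).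
  exact: (measurableT_comp (measurable_powR p) (@measurable_enorm R d)).
apply/integrableP; split; first exact/measurable_EFinP.
under eq_integral do rewrite gee0_abs ?lee_fin ?powR_ge0//.
pose r : R := 2 `^ (p - p').
have r0 : 0 < r by rewrite powR_gt0.
have r1 : r < 1 by rewrite -(powRr0 2); apply: ltr_powR_exp; [lra|rewrite subr_lt0].
pose A := (2 * x0) `^ p * (C * x0 `^ (- p')).
have A0 : 0 <= A by rewrite mulr_ge0 ?powR_ge0// mulr_ge0 ?powR_ge0// ltW.
(* The largest value of |z|^p on the n-th shell, charged on the whole exterior of its inner radius,
   whose probability is a tail. *)
pose g (n : nat) (z : Xd) : \bar R := ((2 ^+ n.+1 * x0) `^ p * \1_[set z | 2 ^+ n * x0 < enorm z] z)%:E.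
have g0 n z : (0 <= g n z)%E by rewrite lee_fin mulr_ge0// powR_ge0.
have mg n : measurable_fun setT (g n).
  apply/measurable_EFinP; apply: measurable_funM => //.
  by apply: measurable_indic; exact: measurable_gt_enorm.
apply: (@le_lt_trans _ _ (\int[lw]_z ((x0 `^ p)%:E + \sum_(n <oo) g n z))%E).
  apply: ge0_le_integral => //.
  - by move=> z _; rewrite lee_fin powR_ge0.
  - exact/measurable_EFinP.
  - by apply: emeasurable_funD => //; apply: ge0_emeasurable_sum.
  - move=> z _; have [zx|xz] := leP (enorm z) x0.
      apply: (@le_trans _ _ (x0 `^ p)%:E).
        by rewrite lee_fin; apply: ge0_ler_powR; rewrite ?nnegrE ?(ltW p0) ?enorm_ge0 ?(ltW x00).
      by rewrite leeDl//; apply: nneseries_ge0.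
    have ex : exists n, enorm z <= 2 ^+ n.+1 * x0.
      have [n hn] := exists_pow2_gt (enorm z / x0).
      by exists n; move: hn; rewrite ltr_pdivrMr// => /ltW.
    case: (ex_minnP ex) => n zn nmin.
    have nz : 2 ^+ n * x0 < enorm z.
      rewrite ltNge; apply/negP; case: n zn nmin => [|n] _ nmin; first by rewrite expr0 mul1r leNgt xz.
      by move=> /nmin; rewrite ltnn.
    apply: (@le_trans _ _ (g n z)).
      rewrite /g indicE mem_set//= mulr1 lee_fin.
      apply: ge0_ler_powR; rewrite ?nnegrE ?(ltW p0) ?enorm_ge0//.
      by rewrite mulr_ge0 ?exprn_ge0// ltW.
    apply: (@le_trans _ _ (\sum_(k <oo) g k z)%E).
      apply: le_trans (nneseries_lim_ge n.+1 _) => //.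
      by rewrite big_nat_recr//= leeDr// sume_ge0.
    by rewrite leeDr// lee_fin powR_ge0.
rewrite ge0_integralD//; last 3 first.
- by move=> z _; rewrite lee_fin powR_ge0.
- by move=> z _; apply: nneseries_ge0.
- by apply: ge0_emeasurable_sum.
rewrite integral_cst//= probability_setT mule1 integral_nneseries//.
apply: lte_add_pinfty; first exact: ltry.
apply: (@le_lt_trans _ _ (A / (1 - r))%:E); last exact: ltry.
have ig n : (\int[lw]_z g n z <= (A * r ^+ n)%:E)%E.
  rewrite /g (int_cst_indic lw (measurable_gt_enorm _)) ?powR_ge0//.
  rewrite [X in (_ * X)%E](_ : _ = (tl (2 ^+ n * x0))%:E); last by rewrite tlE.
  rewrite -EFinM lee_fin.
  have x2 : x0 <= 2 ^+ n * x0 by rewrite ler_peMl ?(ltW x00)// exprn_ege1//; lra.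
  apply: le_trans (ler_wpM2l (powR_ge0 _ _) (hC _ x2)) _.
  rewrite /A exprS -mulrA (mulrCA 2) powRM ?exprn_ge0 ?mulr_ge0 ?(ltW x00)//.
  have e2 q : (2 ^+ n : R) `^ q = 2 `^ (n%:R * q) by rewrite -powR_mulrn// -powRrM.
  have e3 : (2 ^+ n * x0) `^ (- p') = 2 `^ (n%:R * - p') * x0 `^ (- p').
    by rewrite powRM ?e2 ?exprn_ge0 ?(ltW x00).
  have e4 : r ^+ n = 2 `^ (n%:R * p) * 2 `^ (n%:R * - p').
    rewrite -powR_mulrn ?(ltW r0)// /r -powRrM -powRD; last by rewrite pnatr_eq0 implybT.
    by congr (_ `^ _); ring.
  rewrite e2 e3 e4.
  by rewrite le_eqVlt; apply/orP; left; apply/eqP; ring.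
apply: lime_le; first by apply: is_cvg_nneseries => n _ _; apply: integral_ge0.
apply: nearW => n; apply: (@le_trans _ _ (\sum_(0 <= i < n) (A * r ^+ i)%:E)%E).
  by apply: lee_sum => i _; exact: ig.
rewrite sumEFin lee_fin ler_pdivlMr ?subr_gt0//.
have -> : \sum_(0 <= i < n) A * r ^+ i = A * \sum_(0 <= i < n) r ^+ i by rewrite mulr_sumr.
rewrite -mulrA ler_piMr//.
elim: n => [|n IH]; first by rewrite big_nil mul0r.
rewrite big_nat_recr//= mulrDl.
suff e k : (\sum_(0 <= i < k) r ^+ i) * (1 - r) = 1 - r ^+ k.
  by rewrite -mulrDl -(big_nat_recr n 0)//= e lerBlDr lerDl exprn_ge0// ltW.
elim: k => [|k IHk]; first by rewrite big_nil mul0r expr0 subrr.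
by rewrite big_nat_recr//= mulrDl IHk exprS; ring.
Qed.

End moments.

(** Validity for all small eta with an explicit threshold, combined by [ev_and2]; [ev_near] is the
    link to the filter 0^'+. *)
Definition ev {R : realType} (P : R -> Prop) : Prop :=
  exists2 e, 0 < e & forall eta, 0 < eta < e -> P eta.

Lemma powR_add {R : realType} (x r s : R) : 0 < x -> x `^ (r + s) = x `^ r * x `^ s.
Proof. by move=> x0; rewrite powRD//; apply/implyP => _; rewrite gt_eqF. Qed.

Section eventually_small.
Context {R : realType}.
Implicit Types (P Q : R -> Prop).

Lemma ev_and P Q : ev P -> ev Q -> ev (fun eta => P eta /\ Q eta).
Proof.
move=> [e e0 hP] [f f0 hQ]; exists (Num.min e f); first by rewrite lt_min e0.
by move=> eta /andP[h0]; rewrite lt_min => /andP[h1 h2]; split; [apply: hP|apply: hQ]; rewrite h0.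
Qed.

Lemma ev_imp P Q : (forall eta, 0 < eta -> P eta -> Q eta) -> ev P -> ev Q.
Proof. by move=> h [e e0 hP]; exists e => // eta /andP[h0 h1]; apply: h => //; apply: hP; rewrite h0. Qed.

Lemma ev_and2 P Q S : (forall eta, 0 < eta -> P eta -> Q eta -> S eta) -> ev P -> ev Q -> ev S.
Proof. by move=> h hP hQ; apply: ev_imp (ev_and hP hQ) => eta e0 [p q]; exact: h. Qed.

Lemma ev_all P : (forall eta, 0 < eta -> P eta) -> ev P.
Proof. by move=> h; exists 1 => // eta /andP[h0 _]; exact: h. Qed.

Lemma ev_lt (c : R) : 0 < c -> ev (fun eta => eta < c).
Proof. by move=> c0; exists c => // eta /andP[]. Qed.

Lemma ev_near P : (\forall eta \near (0 : R)^'+, P eta) <-> ev P.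
Proof.
split=> [|[e e0 h]].
  rewrite /at_right/= /within/= => /nbhs_ballP[e /= e0 h]; exists e => // eta /andP[h0 h1].
  by apply: h => //; rewrite /ball/= sub0r normrN gtr0_norm.
near=> eta; apply: h; apply/andP; split; first by near: eta; exact: nbhs_right_gt.
by near: eta; exact: nbhs_right_lt.
Unshelve. all: by end_near. Qed.

Lemma ev_pinfty P : (\forall x \near +oo, P x) -> ev (fun eta => P eta^-1).
Proof.
move=> /near_pinfty_from[x0 x00 h]; exists x0^-1; first by rewrite invr_gt0.
move=> eta /andP[h0 h1]; apply: h; rewrite -[leLHS]invrK lef_pV2 ?posrE ?invr_gt0//; exact: ltW.
Qed.

Lemma ev_powR p c : 0 < p -> 0 < c -> ev (fun eta : R => eta `^ p < c).
Proof. by move=> p0 c0; apply/ev_near; exact: (cvgr_lt _ (powR_cvg0 p0)). Qed.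

Lemma ev_ex P : ev P -> exists2 eta, 0 < eta & P eta.
Proof. by move=> [e e0 h]; exists (e / 2); rewrite ?divr_gt0//; apply: h; rewrite divr_gt0//= ltr_pdivrMr//; lra. Qed.

End eventually_small.

Section expectation.
Context {R : realType} {dT : measure_display} {T : measurableType dT}.
Variable P : probability T R.

Definition Ex (g : T -> R) : R := (\int[P]_x g x)%R.
Definition integ (g : T -> R) := P.-integrable setT (EFin \o g).

Lemma integ_measurable g : integ g -> measurable_fun setT g.
Proof. by case/integrableP => /measurable_EFinP. Qed.

Lemma integ_bounded (g : T -> R) M : measurable_fun setT g -> (forall x, `|g x| <= M) -> integ g.
Proof.
move=> mg gM; have fP : (P setT < +oo)%E by rewrite probability_setT ltry.
apply: (@measurable_bounded_integrable _ _ _ P _ _ measurableT fP mg).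
by exists M; split; [exact: num_real|move=> r Mr x _; exact: le_trans (gM x) (ltW Mr)].
Qed.

Lemma integ01 (g : T -> R) : measurable_fun setT g -> (forall x, 0 <= g x <= 1) -> integ g.
Proof.
by move=> mg g01; apply: (integ_bounded mg (M := 1)) => x; have /andP[h0 h1] := g01 x; rewrite ger0_norm.
Qed.

Lemma integ_dom (f g : T -> R) : measurable_fun setT f -> (forall x, `|f x| <= g x) -> integ g -> integ f.
Proof.
move=> mf fg ig; apply: (le_integrable measurableT _ _ ig); first exact/measurable_EFinP.
by move=> x _; rewrite /= lee_fin; apply: le_trans (fg x) (ler_norm _).
Qed.

Lemma integ_eq f g : f =1 g -> integ f -> integ g.
Proof. by move=> /funext ->. Qed.

Lemma integD f g : integ f -> integ g -> integ (fun x => f x + g x).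
Proof. by move=> hf hg; have := integrableD measurableT hf hg. Qed.

Lemma integZ c f : integ f -> integ (fun x => c * f x).
Proof. by move=> hf; have := integrableZl measurableT c hf. Qed.

Lemma integB f g : integ f -> integ g -> integ (fun x => f x - g x).
Proof. by move=> hf hg; have := integrableB measurableT hf hg. Qed.

Lemma integ_cst c : integ (fun=> c).
Proof. by apply: (integ_bounded (M := `|c|)). Qed.

Lemma ExD f g : integ f -> integ g -> Ex (fun x => f x + g x) = Ex f + Ex g.
Proof. by move=> hf hg; rewrite /Ex RintegralD. Qed.

Lemma ExB f g : integ f -> integ g -> Ex (fun x => f x - g x) = Ex f - Ex g.
Proof. by move=> hf hg; rewrite /Ex RintegralB. Qed.

Lemma ExZ c f : integ f -> Ex (fun x => c * f x) = c * Ex f.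
Proof. by move=> hf; rewrite /Ex RintegralZl. Qed.

Lemma Ex_cst c : Ex (fun=> c) = c.
Proof.
rewrite /Ex Rintegral_cst//; have -> : fine (P setT) = 1 by rewrite probability_setT.
by rewrite mulr1.
Qed.

Lemma Ex_le f g : integ f -> integ g -> (forall x, f x <= g x) -> Ex f <= Ex g.
Proof. by move=> hf hg fg; apply: le_Rintegral. Qed.

Lemma Ex_ge0 f : (forall x, 0 <= f x) -> 0 <= Ex f.
Proof. by move=> f0; apply: Rintegral_ge0. Qed.

Lemma Ex_le_cst f c : integ f -> (forall x, f x <= c) -> Ex f <= c.
Proof. by move=> hf fc; rewrite -[leRHS]Ex_cst; apply: Ex_le => //; exact: integ_cst. Qed.

Lemma Ex_eq f g : f =1 g -> Ex f = Ex g.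
Proof. by move=> /funext ->. Qed.

Lemma Ex_indic A : measurable A -> Ex (\1_A) = fine (P A).
Proof. by move=> mA; rewrite /Ex /Rintegral integral_indic// setIT. Qed.

Lemma ExE f : integ f -> (Ex f)%:E = (\int[P]_x (f x)%:E)%E.
Proof.
move=> hf; rewrite /Ex /Rintegral fineK//; exact: (integrable_fin_num measurableT hf).
Qed.

Lemma integ_sum n (f : 'I_n -> T -> R) : (forall i, integ (f i)) -> integ (fun x => \sum_i f i x).
Proof.
elim: n f => [|n IH] f hf.
  by apply: (integ_eq _ (integ_cst 0)) => x; rewrite big_ord0.
have h := integD (IH (fun i => f (widen_ord (leqnSn n) i)) (fun i => hf _)) (hf ord_max).
by apply: (integ_eq _ h) => x; rewrite big_ord_recr.
Qed.

Lemma Ex_sum n (f : 'I_n -> T -> R) : (forall i, integ (f i)) -> Ex (fun x => \sum_i f i x) = \sum_i Ex (f i).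
Proof.
elim: n f => [|n IH] f hf.
  by rewrite big_ord0 -[RHS](Ex_cst 0); apply: Ex_eq => x; rewrite big_ord0.
rewrite big_ord_recr/= -IH// -ExD//; last exact: integ_sum.
by apply: Ex_eq => x; rewrite big_ord_recr.
Qed.

End expectation.

(** * Exponential moments of the truncated noise *)

Section noise_moments.
Context {R : realType} {d : nat}.
Local Notation Xd := (borel 'cV[R]_d).
Variable lw : probability Xd R.
Variable alpha : R.
Hypothesis alpha_gt1 : 1 < alpha.
Hypothesis tl_rv : forall t, 0 < t -> tl lw (t * x) / tl lw x @[x --> +oo] --> t `^ (- alpha).
Local Notation tl := (tl lw).

Definition lam (eta : R) : R := eta^-1 * tl eta^-1.

Lemma ev_tl_pos : ev (fun eta => 0 < tl eta^-1).
Proof. exact: (@ev_pinfty _ (fun x => 0 < tl x) (tl_pos tl_rv)). Qed.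

Lemma lam_ge0 eta : 0 < eta -> 0 <= lam eta.
Proof. by move=> e0; rewrite mulr_ge0 ?invr_ge0 ?(ltW e0) ?tl_ge0. Qed.

Lemma ev_lam_pos : ev (fun eta => 0 < lam eta).
Proof. by apply: ev_imp ev_tl_pos => eta e0 h; rewrite mulr_gt0 ?invr_gt0. Qed.

Lemma lamE eta : 0 < eta -> tl eta^-1 = eta * lam eta.
Proof. by move=> e0; rewrite /lam mulrA divff ?mul1r// gt_eqF. Qed.

Lemma ev_tl_scale dl : 0 < dl -> ev (fun eta => tl (dl / eta) <= 2 * dl `^ (- alpha) * tl eta^-1).
Proof.
move=> d0; have h : dl `^ (- alpha) < 2 * dl `^ (- alpha).
  by have := powR_gt0 (- alpha) d0; move=> ?; lra.
apply: ev_and2 (ev_pinfty (cvgr_lt _ (tl_rv d0) _ h)) ev_tl_pos => eta e0 h1 h2.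
by move: h1; rewrite ltr_pdivrMr// => /ltW.
Qed.

(** This is where alpha > 1 enters: a tail exponent p strictly between 1 and alpha gives lam eta <=
    C eta^(p - 1). *)
Lemma ev_lam_small kappa : 0 < kappa -> ev (fun eta => lam eta <= kappa).
Proof.
move=> k0; pose p := (1 + alpha) / 2.
have [p1 pa] : 1 < p /\ p < alpha by move: alpha_gt1; rewrite /p => h; split; lra.
have [C [x0 [C0 x00 hC]]] := tl_upper tl_rv (lt_trans ltr01 p1) pa.
have p10 : 0 < p - 1 by rewrite subr_gt0.
have x0i : 0 < x0^-1 by rewrite invr_gt0.
apply: ev_and2 (ev_lt x0i) (ev_powR p10 (divr_gt0 k0 C0)) => eta e0 h1 h2.
have h3 : x0 <= eta^-1 by rewrite -[leLHS]invrK lef_pV2 ?posrE ?invr_gt0// ltW.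
rewrite /lam; apply: (@le_trans _ _ (eta^-1 * (C * eta^-1 `^ (- p)))).
  by rewrite ler_wpM2l ?hC// invr_ge0 ltW.
have -> : eta^-1 * (C * eta^-1 `^ (- p)) = C * eta `^ (p - 1).
  rewrite -[eta^-1]powR_inv1 ?(ltW e0)// -powRrM mulrCA -powR_add//.
  by congr (_ * _ `^ _); ring.
by move: h2; rewrite ltr_pdivlMr// mulrC => /ltW.
Qed.

(** The tail is at least a power of eta, so a sufficiently high power of eta is negligible against
    lam^J. The tail bound yields c eta^alpha, and the exponent alpha + 1 absorbs the constant c. *)
Lemma ev_lam_lower J : ev (fun eta => eta `^ ((alpha + 1) * J%:R) <= lam eta ^+ J).
Proof.
have a1 : alpha < alpha + 1 by rewrite ltrDl.
have [c [x0 [c0 x00 hc]]] := tl_lower alpha_gt1 tl_rv a1.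
have x0i : 0 < x0^-1 by rewrite invr_gt0.
apply: ev_and2 (ev_lt x0i) (ev_lt c0) => eta e0 h1 h2.
have h3 : x0 <= eta^-1 by rewrite -[leLHS]invrK lef_pV2 ?posrE ?invr_gt0// ltW.
rewrite powRrM powR_mulrn ?powR_ge0//; apply: lerXn2r; rewrite ?nnegrE ?powR_ge0 ?lam_ge0//.
apply: (@le_trans _ _ (eta^-1 * (c * eta^-1 `^ (- (alpha + 1))))); last first.
  by rewrite ler_wpM2l ?hc// invr_ge0 ltW.
have -> : eta^-1 * (c * eta^-1 `^ (- (alpha + 1))) = c * eta `^ alpha.
  rewrite -[eta^-1]powR_inv1 ?(ltW e0)// -powRrM mulrCA -powR_add//.
  by congr (_ * _ `^ _); ring.
rewrite powR_add//.
by rewrite powRr1 ?(ltW e0)// mulrC ler_wpM2r ?powR_ge0// ltW.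
Qed.

Definition logi (eta : R) : R := - ln eta.

(** The exponential equals eta^(K eps); the surplus 1 in the exponent supplies a factor eta that
    absorbs the constants. *)
Lemma ev_exp_small J C K eps kappa : 0 < kappa -> 0 <= C -> (alpha + 1) * J%:R + 1 <= K * eps ->
  ev (fun eta => C * expR (- (K * logi eta * eps)) <= kappa * lam eta ^+ J).
Proof.
move=> k0 C0 hK; have C1 : 0 < C + 1 by rewrite ltr_wpDl.
apply: ev_and2 (ev_lam_lower J) (ev_and (ev_lt ltr01) (ev_lt (divr_gt0 k0 C1))) => eta e0 h1 [e1 h2].
have -> : expR (- (K * logi eta * eps)) = eta `^ (K * eps).
  by rewrite /powR gt_eqF// /logi; congr expR; ring.
apply: (@le_trans _ _ (C * (eta * eta `^ ((alpha + 1) * J%:R)))).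
  apply: ler_wpM2l => //; rewrite -{2}[eta]powRr1 ?(ltW e0)// -powR_add//.
  by apply: ger_powR; [rewrite e0 ltW|rewrite addrC].
apply: (@le_trans _ _ (C * eta * lam eta ^+ J)).
  by rewrite -mulrA; apply: ler_wpM2l => //; apply: ler_wpM2l => //; exact: ltW.
apply: ler_wpM2r; first by rewrite exprn_ge0// lam_ge0.
move: h2; rewrite ltr_pdivlMr// mulrDr mulr1 mulrC => h2; lra.
Qed.

Hypothesis mean0 : forall i, Ex lw (fun z : Xd => (z : 'cV[R]_d) i ord0) = 0.

Lemma measurable_coord (i : 'I_d) : measurable_fun setT ((fun z => (z : 'cV[R]_d) i ord0) : Xd -> measurableTypeR R).
Proof.
apply: continuous_measurableR => z; apply/(@cvgrPdist_lt _ _ _ _ (nbhs_filter z)) => e e0.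
have := near_enorm z e0; apply: (@filterS _ _ (nbhs_filter z)) => w wz.
rewrite distrC; apply: le_lt_trans wz; have := coord_le_enorm (w - z) i.
by rewrite !mxE.
Qed.

Lemma integ_enorm : integ lw (@enorm R d).
Proof.
have h := enorm_moment tl_rv ltr01 alpha_gt1.
by apply: (integ_eq _ h) => z; rewrite powRr1// enorm_ge0.
Qed.

Lemma integ_coord i : integ lw (fun z : Xd => (z : 'cV[R]_d) i ord0).
Proof.
apply: (integ_dom (measurable_coord i) _ integ_enorm) => z; exact: coord_le_enorm.
Qed.

Lemma linform (v : 'rV[R]_d) : integ lw (fun z : Xd => (v *m (z : 'cV[R]_d)) ord0 ord0) /\
  Ex lw (fun z : Xd => (v *m (z : 'cV[R]_d)) ord0 ord0) = 0.
Proof.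
have h i : integ lw (fun z : Xd => v ord0 i * (z : 'cV[R]_d) i ord0) by apply: integZ; exact: integ_coord.
have e (z : Xd) : (v *m (z : 'cV[R]_d)) ord0 ord0 = \sum_i v ord0 i * (z : 'cV[R]_d) i ord0 by rewrite mxE.
split.
  by apply: (integ_eq _ (integ_sum h)) => z; rewrite e.
rewrite (Ex_eq _ e) Ex_sum// big1// => i _.
by rewrite ExZ ?mean0 ?mulr0//; exact: integ_coord.
Qed.

Definition small (dl eta : R) (z : 'cV[R]_d) : R := (eta * enorm z <= dl)%R%:R.

Lemma small01 dl eta z : 0 <= small dl eta z <= 1.
Proof. by rewrite /small; case: (eta * enorm z <= dl) => /=; rewrite ?ler01 ?lexx. Qed.

Lemma measurable_small dl eta : measurable_fun setT (small dl eta : Xd -> measurableTypeR R).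
Proof.
have mb : measurable_fun setT (fun b : bool => b%:R : measurableTypeR R) by exact: (@measurable_funTS).
apply: (measurableT_comp mb); apply: measurable_fun_ler => //.
by apply: measurable_funM => //; exact: measurable_enorm.
Qed.

(** On small noise the exponential is expanded to second order; the truncation also removes part of
    the centred linear term. Both errors are at most c |z|^p, whose moment is finite because p <
    alpha, and c is o(eta) because K Ks dl < p - 1. *)
Lemma exp_moment p K Ks dl : 1 < p -> p <= 2 -> p < alpha -> 0 < K -> 0 < Ks -> 0 < dl ->
  K * Ks * dl < p - 1 -> ev (fun eta => forall v : 'rV[R]_d,
    (forall z : 'cV[R]_d, `|(v *m z) ord0 ord0| <= Ks * enorm z) ->
    Ex lw (fun z => small dl eta z * expR (K * logi eta * (eta * (v *m (z : 'cV[R]_d)) ord0 ord0))) <= 1 + eta).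
Proof.
move=> p1 p2 pa K0 Ks0 d0 hg.
have p0 : 0 < p by exact: lt_trans p1.
(* The quadratic error carries eta^(1 + 3g): two units of g absorb the square of log(1/eta), the
   third makes the result smaller than eta. *)
pose g := (p - 1 - K * Ks * dl) / 3.
have gp : 0 < g by rewrite /g divr_gt0// subr_gt0.
have im := enorm_moment tl_rv p0 pa.
pose Mp := Ex lw (fun z : Xd => enorm z `^ p).
have Mp0 : 0 <= Mp by apply: Ex_ge0 => z; exact: powR_ge0.
pose A1 := K * Ks * dl `^ (1 - p) * g^-1.
pose A2 := (K * Ks) ^+ 2 * dl `^ (2 - p) * g^-1 ^+ 2.
have A10 : 0 <= A1 by rewrite !mulr_ge0 ?powR_ge0 ?invr_ge0 ?ltW.
have A20 : 0 <= A2.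
  by apply: mulr_ge0; [apply: mulr_ge0; [exact: sqr_ge0|exact: powR_ge0]|exact: sqr_ge0].
pose A := (A1 + A2) * Mp + 1.
have Ap : 0 < A by rewrite ltr_wpDl// mulr_ge0// addr_ge0.
have Ai : 0 < A^-1 by rewrite invr_gt0.
apply: ev_and2 (ev_lt ltr01) (ev_powR gp Ai) => eta e0 e1 h1 v hv.
pose L := logi eta.
have L0 : 0 < L by rewrite /L /logi oppr_gt0 ln_lt0// e0.
have eg0 : 0 < eta `^ g by rewrite powR_gt0.
have Lg : L <= g^-1 * (eta `^ g)^-1.
  have h : 0 < eta `^ (- g) by rewrite powR_gt0.
  have := ltW (ln_sublinear h); rewrite ln_powR mulNr -mulrN -/(logi eta) -/L powRN => h'.
  by rewrite -(ler_pM2l gp) mulrA divff ?mul1r// gt_eqF.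
pose t (z : 'cV[R]_d) := K * L * (eta * (v *m z) ord0 ord0).
have KL0 : 0 < K * L * eta by rewrite !mulr_gt0.
have tle z : `|t z| <= K * L * eta * Ks * enorm z.
  rewrite /t !normrM (gtr0_norm K0) (gtr0_norm L0) (gtr0_norm e0) !mulrA -mulrA.
  by rewrite -!mulrA; do 3 (apply: ler_wpM2l; first exact: ltW); exact: hv.
pose cE := expR (K * L * Ks * dl).
have cEE : cE = eta `^ (- (K * Ks * dl)).
  by rewrite /cE /powR gt_eqF// /L /logi; congr expR; ring.
pose c := K * L * eta * Ks * (dl / eta) `^ (1 - p) + cE * (K * L * eta * Ks) ^+ 2 * (dl / eta) `^ (2 - p).
have de0 : 0 < dl / eta by rewrite divr_gt0.
(* For small noise |z|^2 <= |z|^p (dl/eta)^(2-p). For large noise the left side is 0 and the linear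
   term is compensated by means of |z| <= |z|^p (dl/eta)^(1-p). *)
have pw z : small dl eta z * expR (t z) <= 1 + t z + c * enorm z `^ p.
  have KL1 : 0 <= K * L * eta * Ks by rewrite mulr_ge0 ?ltW.
  have zp : 0 <= enorm z `^ p by exact: powR_ge0.
  have c1 : 0 <= K * L * eta * Ks * (dl / eta) `^ (1 - p) by rewrite mulr_ge0 ?powR_ge0.
  have c2 : 0 <= cE * (K * L * eta * Ks) ^+ 2 * (dl / eta) `^ (2 - p).
    by apply: mulr_ge0; [apply: mulr_ge0; [exact: expR_ge0|exact: sqr_ge0]|exact: powR_ge0].
  rewrite /small; case: (leP (eta * enorm z) dl) => [sz|bz].
    rewrite mul1r; apply: le_trans (expR_le_quadratic (t z)) _; rewrite lerD2l.
    have zd : enorm z <= dl / eta by rewrite ler_pdivlMr// mulrC.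
    have eE : expR `|t z| <= cE.
      rewrite ler_expR; apply: le_trans (tle z) _.
      have -> : K * L * Ks * dl = K * L * eta * Ks * (dl / eta) by field; rewrite gt_eqF.
      by apply: ler_wpM2l.
    have t2 : t z ^+ 2 <= (K * L * eta * Ks) ^+ 2 * (enorm z `^ p * (dl / eta) `^ (2 - p)).
      rewrite -(real_normK (num_real (t z))); apply: (@le_trans _ _ ((K * L * eta * Ks * enorm z) ^+ 2)).
        by apply: lerXn2r (tle z); rewrite nnegrE// mulr_ge0 ?enorm_ge0.
      rewrite exprMn; apply: ler_wpM2l; first exact: sqr_ge0.
      have [->|zn] := eqVneq (enorm z) 0; first by rewrite expr0n mulr_ge0 ?powR_ge0.
      have zp0 : 0 < enorm z by rewrite lt_def zn enorm_ge0.
      rewrite -powR_mulrn ?enorm_ge0// -{1}[2%:R](subrK p) addrC powR_add//.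
      apply: ler_wpM2l => //; apply: ge0_ler_powR; rewrite ?nnegrE ?enorm_ge0 ?(ltW de0)//.
      by rewrite subr_ge0.
    apply: (@le_trans _ _ (cE * (K * L * eta * Ks) ^+ 2 * (dl / eta) `^ (2 - p) * enorm z `^ p)).
      have -> : cE * (K * L * eta * Ks) ^+ 2 * (dl / eta) `^ (2 - p) * enorm z `^ p =
        ((K * L * eta * Ks) ^+ 2 * (enorm z `^ p * (dl / eta) `^ (2 - p))) * cE by ring.
      by apply: ler_pM; rewrite ?expR_ge0 ?sqr_ge0.
    by rewrite /c mulrDl lerDr mulr_ge0.
  rewrite mul0r.
  have dz : dl / eta < enorm z by rewrite ltr_pdivrMr// mulrC.
  have zp0 : 0 < enorm z by exact: lt_trans dz.
  have : - t z <= c * enorm z `^ p.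
    apply: le_trans (ler_norm _) _; rewrite normrN; apply: le_trans (tle z) _.
    apply: (@le_trans _ _ (K * L * eta * Ks * (dl / eta) `^ (1 - p) * enorm z `^ p)).
      rewrite -[leRHS]mulrA; apply: ler_wpM2l => //.
      rewrite -{1}[enorm z]powRr1 ?enorm_ge0// -{1}[1](subrK p) powR_add//.
      apply: ler_wpM2r => //; rewrite -opprB !powRN lef_pV2 ?posrE ?powR_gt0//.
      by apply: ge0_ler_powR; rewrite ?nnegrE ?enorm_ge0 ?(ltW de0) ?(ltW dz)// subr_ge0 ltW.
    by rewrite /c mulrDl lerDl mulr_ge0.
  by lra.
have [il El] := linform v.
have it : integ lw (fun z : Xd => t z) by apply: integZ; exact: integZ.
have Et : Ex lw (fun z : Xd => t z) = 0 by rewrite ExZ ?ExZ ?El ?mulr0//; exact: integZ.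
have i1 : integ lw (fun z : Xd => 1 + t z + c * enorm z `^ p).
  by apply: integD; [apply: integD => //; exact: integ_cst|exact: integZ].
have ms : measurable_fun setT ((fun z => small dl eta z * expR (t z)) : Xd -> measurableTypeR R).
  apply: measurable_funM; first exact: measurable_small.
  by apply: (measurableT_comp (@measurable_expR R)); exact: integ_measurable it.
have is_ : integ lw (fun z : Xd => small dl eta z * expR (t z)).
  apply: integ_dom ms _ i1 => z; rewrite ger0_norm ?pw// mulr_ge0 ?expR_ge0//.
apply: le_trans (Ex_le is_ i1 pw) _.
rewrite ExD; [|by apply: integD => //; exact: integ_cst|exact: integZ].
rewrite ExD//; last exact: integ_cst.
rewrite Ex_cst Et addr0 ExZ// -/Mp lerD2l.
have en x : (dl / eta) `^ x = dl `^ x * eta `^ (- x).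
  rewrite powRM ?invr_ge0 ?(ltW e0) ?(ltW d0)//; congr (_ * _).
  by rewrite -[eta^-1]powR_inv1 ?(ltW e0)// -powRrM mulN1r.
have eD x y : eta `^ (x + y) = eta `^ x * eta `^ y by exact: powR_add.
have egv : (eta `^ g)^-1 * eta `^ g = 1 by rewrite mulVf// gt_eqF.
have g3 : K * Ks * dl = p - 1 - 3 * g by rewrite /g; field.
have geg x : g <= x -> eta `^ x <= eta `^ g by move=> gx; apply: ger_powR => //; rewrite e0 ltW.
have c1le : K * L * eta * Ks * (dl / eta) `^ (1 - p) <= eta * (A1 * eta `^ g).
  rewrite en opprB; have -> : eta `^ (p - 1) = eta `^ g * eta `^ (p - 1 - g) by rewrite -eD; congr (_ `^ _); ring.
  have h : L * eta `^ g <= g^-1.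
    by apply: le_trans (ler_wpM2r (ltW eg0) Lg) _; rewrite -mulrA egv mulr1.
  have h' : eta `^ (p - 1 - g) <= eta `^ g.
    apply: geg; have : 0 <= K * Ks * dl by rewrite !mulr_ge0 ?ltW.
    by rewrite g3; lra.
  have hh : L * eta `^ g * eta `^ (p - 1 - g) <= g^-1 * eta `^ g.
    by apply: ler_pM => //; rewrite ?powR_ge0// mulr_ge0 ?(ltW L0) ?(ltW eg0).
  have -> : K * L * eta * Ks * (dl `^ (1 - p) * (eta `^ g * eta `^ (p - 1 - g))) =
    eta * (K * Ks * dl `^ (1 - p) * (L * eta `^ g * eta `^ (p - 1 - g))) by ring.
  have -> : eta * (A1 * eta `^ g) = eta * (K * Ks * dl `^ (1 - p) * (g^-1 * eta `^ g)) by rewrite /A1; ring.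
  apply: ler_wpM2l; first exact: ltW.
  by apply: ler_wpM2l => //; rewrite !mulr_ge0 ?powR_ge0 ?ltW.
have c2le : cE * (K * L * eta * Ks) ^+ 2 * (dl / eta) `^ (2 - p) <= eta * (A2 * eta `^ g).
  rewrite cEE en opprB.
  have hL : (L * eta `^ g) ^+ 2 <= g^-1 ^+ 2.
    apply: lerXn2r; rewrite ?nnegrE ?invr_ge0 ?(ltW gp) ?mulr_ge0 ?(ltW L0) ?(ltW eg0)//.
    by apply: le_trans (ler_wpM2r (ltW eg0) Lg) _; rewrite -mulrA egv mulr1.
  have ep : eta `^ (- (K * Ks * dl)) * (eta ^+ 2 * eta `^ (p - 2)) = eta * (eta `^ g ^+ 2 * eta `^ g).
    have e2 : eta ^+ 2 = eta `^ 2%:R by rewrite powR_mulrn ?(ltW e0).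
    rewrite e2 expr2; transitivity (eta `^ (1 + 3 * g)).
      by rewrite -!eD; congr (_ `^ _); rewrite g3; ring.
    rewrite eD powRr1 ?(ltW e0)//; congr (_ * _); rewrite -!eD; congr (_ `^ _); ring.
  have -> : eta `^ (- (K * Ks * dl)) * (K * L * eta * Ks) ^+ 2 * (dl `^ (2 - p) * eta `^ (p - 2)) =
    (K * Ks) ^+ 2 * dl `^ (2 - p) * L ^+ 2 * (eta `^ (- (K * Ks * dl)) * (eta ^+ 2 * eta `^ (p - 2))) by ring.
  rewrite ep.
  have -> : (K * Ks) ^+ 2 * dl `^ (2 - p) * L ^+ 2 * (eta * (eta `^ g ^+ 2 * eta `^ g)) =
    eta * ((K * Ks) ^+ 2 * dl `^ (2 - p) * (L * eta `^ g) ^+ 2 * eta `^ g) by ring.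
  apply: ler_wpM2l; first exact: ltW.
  rewrite /A2; apply: ler_wpM2r; first exact: ltW.
  by apply: ler_wpM2l => //; rewrite mulr_ge0 ?sqr_ge0 ?powR_ge0.
apply: (@le_trans _ _ (eta * ((A1 + A2) * Mp * eta `^ g))).
  have -> : eta * ((A1 + A2) * Mp * eta `^ g) = (eta * (A1 * eta `^ g) + eta * (A2 * eta `^ g)) * Mp by ring.
  by apply: ler_wpM2r => //; exact: lerD.
rewrite -[leRHS]mulr1; apply: ler_wpM2l; first exact: ltW.
apply: (@le_trans _ _ (A * eta `^ g)); first by apply: ler_wpM2r; [exact: ltW|rewrite /A lerDl].
by rewrite mulrC -ler_pdivlMr// mul1r ltW.
Qed.

End noise_moments.

(** * The chain and its large jumps *)

Section chain.
Context {R : realType} {m d : nat}.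
Variables (a : 'cV[R]_m -> 'cV[R]_m) (sigma : 'cV[R]_m -> 'M[R]_(m, d)) (D : R).
Hypothesis aD : forall x y, enorm (a x - a y) <= D * enorm (x - y).
Hypothesis sD : forall x y, opnorm (sigma x - sigma y) <= D * enorm (x - y).
Hypothesis D0 : 0 <= D.
Variable b : R.
Hypothesis b_gt0 : 0 < b.
Local Notation Xm := (borel 'cV[R]_m).
Local Notation Xd := (borel 'cV[R]_d).
Variable lw : probability Xd R.
Local Notation TR := (measurableTypeR R).

Section kernel.
Variable eta : R.

Definition move (x : 'cV[R]_m) (z : 'cV[R]_d) : 'cV[R]_m :=
  x + clip b (eta *: a x + eta *: (sigma x *m z)).

Lemma moveE x z : move x z = x + clip b (eta *: a x + eta *: (sigma x *m z)).
Proof. by []. Qed.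

Lemma move_continuous : continuous (fun p : 'cV[R]_m * 'cV[R]_d => move p.1 p.2).
Proof.
move=> p; apply/(@cvg_enormP _ _ _ _ (nbhs_filter p)) => e e0.
pose k := 1 + 2 * `|eta| * D + 2 * `|eta|.
have k0 : 0 < k by rewrite /k -addrA ltr_wpDr// addr_ge0// !mulr_ge0.
have ek : 0 < e / k by rewrite divr_gt0.
have h1 : \forall q \near p, enorm (q.1 - p.1) < e / k.
  exact: (@cvg_fst _ _ (nbhs p.1) (nbhs p.2) _ _ (near_enorm p.1 ek)).
have h2 : \forall q \near p, enorm (sigma q.1 *m q.2 - sigma p.1 *m p.2) < e / k.
  exact: (sigma_mul_continuous sD D0 (near_enorm (sigma p.1 *m p.2) ek)).
apply: filterS2 h1 h2 => q q1 q2; rewrite /move opprD addrACA.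
apply: le_lt_trans (enorm_triangle _ _) _.
have h : enorm (clip b (eta *: a q.1 + eta *: (sigma q.1 *m q.2)) - clip b (eta *: a p.1 + eta *: (sigma p.1 *m p.2)))
   <= 2 * (`|eta| * (D * enorm (q.1 - p.1)) + `|eta| * enorm (sigma q.1 *m q.2 - sigma p.1 *m p.2)).
  apply: le_trans (clip_lipschitz _ _ (ltW b_gt0)) _; rewrite ler_pM2l// opprD addrACA -!scalerBr.
  apply: le_trans (enorm_triangle _ _) _; rewrite !enormZ lerD2r; apply: ler_wpM2l => //.
apply: le_lt_trans (lerD (lexx _) h) _.
have e1 : 2 * (`|eta| * (D * enorm (q.1 - p.1))) <= 2 * `|eta| * D * (e / k).
  rewrite (_ : 2 * (`|eta| * (D * enorm (q.1 - p.1))) = 2 * `|eta| * D * enorm (q.1 - p.1)); last by ring.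
  by apply: ler_wpM2l; [rewrite !mulr_ge0|exact: ltW].
have e2 : 2 * (`|eta| * enorm (sigma q.1 *m q.2 - sigma p.1 *m p.2)) <= 2 * `|eta| * (e / k).
  by rewrite mulrA; apply: ler_wpM2l; [rewrite mulr_ge0|exact: ltW].
have -> : e = e / k + 2 * `|eta| * D * (e / k) + 2 * `|eta| * (e / k).
  transitivity (k * (e / k)); first by rewrite mulrCA divff ?mulr1// gt_eqF.
  by rewrite {1}/k; ring.
by rewrite mulrDr; lra.
Qed.

Lemma measurable_move dX (X : measurableType dX) (f : X -> Xm) (g : X -> Xd) :
  measurable_fun setT f -> measurable_fun setT g -> measurable_fun setT (fun w => move (f w) (g w) : Xm).
Proof.
move=> mf mg; apply: (@measurable_continuous2 _ _ 'cV[R]_m 'cV[R]_d 'cV[R]_m (fun p => move p.1 p.2) f g) => //.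
- exact: countable_base_cV.
- exact: countable_base_cV.
- exact: move_continuous.
Qed.

Definition frac (g : 'cV[R]_m -> R) := measurable_fun setT (g : Xm -> TR) /\ forall x, 0 <= g x <= 1.

Definition Kop (g : 'cV[R]_m -> R) (x : 'cV[R]_m) : R := Ex lw (fun z => g (move x z)).

Lemma KopE g x : Kop g x = Ex lw (fun z => g (move x z)).
Proof. by []. Qed.

Lemma frac_integ g x : frac g -> integ lw (fun z : Xd => g (move x z)).
Proof.
move=> [mg g01]; apply: integ01 => // .
by apply: (measurableT_comp mg); apply: measurable_move; [exact: measurable_cst|exact: measurable_id].
Qed.

Lemma frac_Kop g : frac g -> frac (Kop g).
Proof.
move=> fg; have [mg g01] := fg; split; last first.
  move=> x; apply/andP; split.
    by apply: Ex_ge0 => z; have /andP[] := g01 (move x z).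
  by apply: Ex_le_cst; [exact: frac_integ|move=> z; have /andP[] := g01 (move x z)].
have mG : measurable_fun setT ((fun p => (g (move p.1 p.2))%:E) : (Xm * Xd)%type -> \bar R).
  apply/measurable_EFinP; apply: (measurableT_comp mg).
  by apply: measurable_move; [exact: measurable_fst|exact: measurable_snd].
have G0 p : (0 <= ((fun p => (g (move p.1 p.2))%:E) : (Xm * Xd)%type -> \bar R) p)%E.
  by rewrite lee_fin; have /andP[] := g01 (move p.1 p.2).
have := measurable_fun_fubini_tonelli_F (m2 := lw) _ mG G0.
by move=> h; exact: (measurableT_comp (fine_measurable measurableT) h).
Qed.

Lemma Kop_le g h x : frac g -> frac h -> (forall y, g y <= h y) -> Kop g x <= Kop h x.
Proof. by move=> fg fh gh; apply: Ex_le; [exact: frac_integ|exact: frac_integ|move=> z; exact: gh]. Qed.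

Definition killed (K : set 'cV[R]_m) (g h : 'cV[R]_m -> R) x := if `[< K x >] then g x else h x.

Lemma killed_in K g h x : K x -> killed K g h x = g x.
Proof. by rewrite /killed; case: asboolP. Qed.

Lemma killed_out K g h x : ~ K x -> killed K g h x = h x.
Proof. by rewrite /killed; case: asboolP. Qed.

Lemma frac_killed K g h : measurable (K : set Xm) -> frac g -> frac h -> frac (killed K g h).
Proof.
move=> mK [mg g01] [mh h01]; split; last by move=> x; rewrite /killed; case: ifP.
apply: (measurable_fun_if measurableT).
- apply: (@measurable_fun_bool _ _ _ _ true); rewrite setTI (_ : _ @^-1` _ = K)//.
  by apply/seteqP; split=> x /=; [move/asboolP|move=> ?; apply/asboolP].
- exact: measurable_funS mg.
- exact: measurable_funS mh.
Qed.

Lemma frac_indic A : measurable (A : set Xm) -> frac (\1_A).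
Proof.
move=> mA; split; first exact: measurable_indic.
by move=> x; rewrite indicE; case: (x \in A) => /=; rewrite ?ler01 ?lexx.
Qed.

Lemma frac_cst0 : frac (fun=> 0).
Proof. by split; [exact: measurable_cst|move=> x; rewrite lexx ler01]. Qed.

(** The value h is collected on leaving K, the value g if n steps pass inside K. *)
Fixpoint iterk (K : set 'cV[R]_m) (h g : 'cV[R]_m -> R) (n : nat) : 'cV[R]_m -> R :=
  if n is n'.+1 then killed K (Kop (iterk K h g n')) h else killed K g h.

(* Probability of leaving K within n steps, landing in A. *)
Definition exitp K A n := iterk K (\1_A) (fun=> 0) n.
(* Expectation of g after n steps on the event of no exit from K. *)
Definition survp K g n := iterk K (fun=> 0) g n.

Section iterk.
Variables (K : set 'cV[R]_m).
Hypothesis mK : measurable (K : set Xm).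

Lemma frac_iterk h g n : frac h -> frac g -> frac (iterk K h g n).
Proof. by move=> fh fg; elim: n => [|n IH] /=; apply: frac_killed => //; exact: frac_Kop. Qed.

Lemma frac_exitp A n : measurable (A : set Xm) -> frac (exitp K A n).
Proof. by move=> mA; apply: frac_iterk; [exact: frac_indic|exact: frac_cst0]. Qed.

Lemma frac_survp g n : frac g -> frac (survp K g n).
Proof. by move=> fg; apply: frac_iterk => //; exact: frac_cst0. Qed.

Lemma exitp_out A n x : ~ K x -> exitp K A n x = \1_A x.
Proof. by case: n => [|n] Kx; rewrite /exitp /= killed_out. Qed.

Lemma survp_out g n x : ~ K x -> survp K g n x = 0.
Proof. by case: n => [|n] Kx; rewrite /survp /= killed_out. Qed.

Lemma exitpS A n x : K x -> exitp K A n.+1 x = Kop (exitp K A n) x.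
Proof. by move=> Kx; rewrite /exitp /= killed_in. Qed.

Lemma survpS g n x : K x -> survp K g n.+1 x = Kop (survp K g n) x.
Proof. by move=> Kx; rewrite /survp /= killed_in. Qed.

Lemma exitp0 A x : K x -> exitp K A 0 x = 0.
Proof. by move=> Kx; rewrite /exitp /= killed_in. Qed.

Lemma survp0 g x : K x -> survp K g 0 x = g x.
Proof. by move=> Kx; rewrite /survp /= killed_in. Qed.

Lemma exitp_leS A n x : measurable (A : set Xm) -> exitp K A n x <= exitp K A n.+1 x.
Proof.
move=> mA; elim: n x => [|n IH] x.
  have [Kx|Kx] := pselect (K x); last by rewrite !exitp_out.
  by rewrite exitp0//; have [_ /(_ x)/andP[]] := frac_exitp 1 mA.
have [Kx|Kx] := pselect (K x); last by rewrite !exitp_out.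
rewrite exitpS// [leRHS]exitpS//; apply: Kop_le => //; exact: frac_exitp.
Qed.

Lemma exitp_le A n n' x : measurable (A : set Xm) -> (n <= n')%N -> exitp K A n x <= exitp K A n' x.
Proof.
move=> mA; elim: n' => [|n' IH]; first by rewrite leqn0 => /eqP ->.
rewrite leq_eqVlt => /orP[/eqP -> //|]; rewrite ltnS => /IH h.
by apply: le_trans h _; exact: exitp_leS.
Qed.

Lemma exitp_target_le A A' n x : measurable (A : set Xm) -> measurable (A' : set Xm) ->
  (forall x, ~ K x -> A x -> A' x) -> exitp K A n x <= exitp K A' n x.
Proof.
move=> mA mA' AA'.
have base y : ~ K y -> (\1_A y : R) <= \1_A' y.
  move=> Ky; rewrite !indicE; have [Ay|Ay] := pselect (A y); last by rewrite (memNset Ay).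
  by rewrite !mem_set//; exact: AA'.
elim: n x => [|n IH] x; have [Kx|Kx] := pselect (K x).
- by rewrite !exitp0.
- by rewrite !exitp_out// base.
- by rewrite !exitpS//; apply: Kop_le => //; exact: frac_exitp.
- by rewrite !exitp_out// base.
Qed.

Lemma survp_bound g n x c : frac g -> 0 <= c -> (forall y, K y -> g y <= c) -> survp K g n x <= c.
Proof.
move=> fg c0 gc; elim: n x => [|n IH] x; have [Kx|Kx] := pselect (K x).
- by rewrite survp0// gc.
- by rewrite survp_out.
- by rewrite survpS//; apply: Ex_le_cst; [apply: frac_integ; exact: frac_survp|].
- by rewrite survp_out.
Qed.

(** A bound over n steps that is uniform in the state multiplies along successive blocks: the Markov
    property in operator form. *)
Lemma survp_pow k n c x : 0 <= c <= 1 -> (forall y, survp K (\1_K) n y <= c) ->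
  survp K (\1_K) (k * n) x <= c ^+ k.
Proof.
move=> /andP[c0 c1] hc; have fK := frac_indic mK.
have f01 j y : 0 <= survp K (\1_K) j y <= 1 by exact: (frac_survp j fK).2.
have step j c' y : (forall y, survp K (\1_K) j y <= c') -> 0 <= c' ->
    forall i, survp K (\1_K) (i + j) y <= c' * survp K (\1_K) i y.
  move=> hj c'0 i; elim: i y => [|i IH] y; have [Ky|Ky] := pselect (K y).
  - by rewrite survp0// indicE mem_set//= mulr1 add0n.
  - by rewrite !survp_out// mulr0.
  - rewrite addSn !survpS// -ExZ; last by apply: frac_integ; exact: frac_survp.
    apply: Ex_le; [by apply: frac_integ; exact: frac_survp| |by move=> z; exact: IH].
    by apply: integZ; apply: frac_integ; exact: frac_survp.
  - by rewrite !survp_out// mulr0.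
elim: k x => [|k IH] x; first by rewrite mul0n expr0; have /andP[] := f01 0%N x.
rewrite mulSn addnC exprS; apply: le_trans (step n c x hc c0 (k * n)%N) _.
by apply: ler_wpM2l.
Qed.

End iterk.

(** * Tracking the flow up to the first large jump *)

Section first_jump.
Hypothesis eta_gt0 : 0 < eta.
Variables (dl theta eps : R) (N : nat).
Hypotheses (theta0 : 0 <= theta) (eps0 : 0 <= eps).
Variables (path : nat -> 'cV[R]_m) (q : nat -> R) (r Ce : R).

Definition noise_inc (x : 'cV[R]_m) (z : 'cV[R]_d) := eta *: (sigma x *m z).

(** The exponential potential of the accumulated noise: at least 1 as soon as a coordinate of S
    exceeds eps in absolute value, and exponentially small at S = 0. *)
Definition Psi (S : 'cV[R]_m) : R :=
  \sum_i (expR (theta * (S i ord0 - eps)) + expR (theta * (- S i ord0 - eps))).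

Definition tube l x := enorm (x - path l) <= r.

Hypothesis path_euler : forall l, (l < N)%N ->
  enorm (path l.+1 - path l - eta *: a (path l)) <= Ce * eta ^+ 2.
Hypothesis q_step : forall l, (l < N)%N ->
  (1 + eta * D) * q l + eta * D * (m%:R * eps) + Ce * eta ^+ 2 <= q l.+1.
Hypothesis q_r : forall l, (l <= N)%N -> q l + m%:R * eps <= r.
Hypothesis no_clip : forall l x z, (l < N)%N -> tube l x -> eta * enorm z <= dl ->
  enorm (eta *: a x + eta *: (sigma x *m z)) <= b.
Hypothesis exp_bound : forall l x, (l < N)%N -> tube l x -> forall i,
  Ex lw (fun z => small dl eta z * expR (theta * noise_inc x z i ord0)) <= 1 + eta /\
  Ex lw (fun z => small dl eta z * expR (theta * - noise_inc x z i ord0)) <= 1 + eta.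

Lemma Psi_ge0 S : 0 <= Psi S.
Proof. by apply: sumr_ge0 => i _; rewrite addr_ge0// expR_ge0. Qed.

Lemma Psi_ge1 (S : 'cV[R]_m) i : eps < `|S i ord0| -> 1 <= Psi S.
Proof.
move=> h; rewrite /Psi (bigD1 i)//=.
have e1 t : 0 <= t -> 1 <= expR (theta * t) by move=> t0; rewrite -expR0 ler_expR mulr_ge0.
have p0 : 0 <= \sum_(j | j != i) (expR (theta * (S j ord0 - eps)) + expR (theta * (- S j ord0 - eps))).
  by apply: sumr_ge0 => j _; rewrite addr_ge0// expR_ge0.
have h1 := expR_ge0 (theta * (S i ord0 - eps)); have h2 := expR_ge0 (theta * (- S i ord0 - eps)).
move: h; rewrite ltr_normr => /orP[h|h].
  have := e1 (S i ord0 - eps); rewrite subr_ge0 => /(_ (ltW h)); lra.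
have := e1 (- S i ord0 - eps); rewrite subr_ge0 => /(_ (ltW h)); lra.
Qed.

Lemma enorm_le_coord (S : 'cV[R]_m) : (forall i, `|S i ord0| <= eps) -> enorm S <= m%:R * eps.
Proof.
move=> h; apply: le_trans (enorm_le_norm S) _; apply: ler_wpM2l => //.
rewrite [leLHS]/Num.norm /= mx_normrE; apply/bigmax_leP; split => //.
by move=> [i j] _ /=; rewrite (ord1 j).
Qed.

(** Subtracting the accumulated noise from the displacement leaves a remainder driven only by the
    drift, the Euler error and |S| <= m eps, so it obeys the deterministic recursion [q_step]. Small
    noise inside the tube is never clipped. *)
Lemma track_step l x z (S : 'cV[R]_m) : (l < N)%N -> tube l x -> eta * enorm z <= dl ->
  (forall i, `|S i ord0| <= eps) -> enorm (x - path l - S) <= q l ->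
  enorm (move x z - path l.+1 - (S + noise_inc x z)) <= q l.+1.
Proof.
move=> lN tx zs hS hx; rewrite /move clip_id; last exact: (no_clip lN tx zs).
apply: le_trans (q_step lN).
have -> : x + (eta *: a x + eta *: (sigma x *m z)) - path l.+1 - (S + noise_inc x z) =
  (x - path l - S) + eta *: (a x - a (path l)) - (path l.+1 - path l - eta *: a (path l)).
  rewrite /noise_inc scalerBr; set u := eta *: a x; set v := eta *: a (path l).
  set n := eta *: (_ *m _).
  by rewrite !opprD !opprK; apply/matrixP => i j; rewrite !mxE; ring.
apply: le_trans (enorm_triangle _ _) _; rewrite enormN; apply: lerD (path_euler lN).
apply: le_trans (enorm_triangle _ _) _; rewrite enormZ gtr0_norm//.
have hxy : enorm (x - path l) <= q l + m%:R * eps.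
  have := enorm_triangle (x - path l - S) S; rewrite subrK => /le_trans; apply.
  by apply: lerD => //; exact: enorm_le_coord.
have h1 : eta * enorm (a x - a (path l)) <= eta * (D * (q l + m%:R * eps)).
  apply: ler_wpM2l; first exact: ltW.
  by apply: le_trans (aD _ _) _; apply: ler_wpM2l.
have -> : (1 + eta * D) * q l + eta * D * (m%:R * eps) = q l + eta * (D * (q l + m%:R * eps)) by ring.
exact: lerD.
Qed.

Lemma measurable_noise_coord x i : measurable_fun setT ((fun z => noise_inc x z i ord0) : Xd -> TR).
Proof.
rewrite (_ : (fun z => _) = fun z : Xd => \sum_j (eta * sigma x i j) * (z : 'cV[R]_d) j ord0); last first.
  by apply/funext => z; rewrite /noise_inc !mxE mulr_sumr; apply: eq_bigr => j _; rewrite mulrA.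
apply: measurable_sum => j; apply: measurable_funM => //; exact: measurable_coord.
Qed.

Variable Bn : R.
Hypothesis noise_bound : forall l x z i, (l < N)%N -> tube l x -> eta * enorm z <= dl -> `|noise_inc x z i ord0| <= Bn.

Lemma integ_exp l x (s : bool) i : (l < N)%N -> tube l x -> integ lw
  (fun z : Xd => small dl eta z * expR (theta * (if s then noise_inc x z i ord0 else - noise_inc x z i ord0))).
Proof.
move=> lN tx; have ms := measurable_noise_coord x i.
apply: (@integ_bounded _ _ _ _ _ (expR (theta * Bn))).
  apply: measurable_funM; first exact: measurable_small.
  apply: (measurableT_comp (@measurable_expR R)); apply: measurable_funM => //.
  by case: s => //; exact: measurable_funN.
move=> z; rewrite ger0_norm; last by rewrite mulr_ge0 ?expR_ge0//; have /andP[] := small01 dl eta z.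
rewrite /small; case: (leP (eta * enorm z) dl) => zs; last by rewrite mul0r expR_ge0.
rewrite mul1r ler_expR; apply: ler_wpM2l => //.
have h := noise_bound i lN tx zs.
by case: s; apply: le_trans h; rewrite ?ler_norm// -normrN ler_norm.
Qed.

(** S is known before the step, so each exponential factors, and its new factor has truncated mean
    at most 1 + eta: a supermartingale up to the factor 1 + eta. *)
Lemma Psi_integ l x (S : 'cV[R]_m) : (l < N)%N -> tube l x ->
  integ lw (fun z : Xd => small dl eta z * Psi (S + noise_inc x z)) /\
  Ex lw (fun z : Xd => small dl eta z * Psi (S + noise_inc x z)) <= (1 + eta) * Psi S.
Proof.
move=> lN tx.
pose f (i : 'I_m) (z : Xd) : R :=
  expR (theta * (S i ord0 - eps)) * (small dl eta z * expR (theta * noise_inc x z i ord0)) +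
  expR (theta * (- S i ord0 - eps)) * (small dl eta z * expR (theta * - noise_inc x z i ord0)).
have it i := integ_exp true i lN tx; have if_ i := integ_exp false i lN tx.
have fi i : integ lw (f i) by apply: integD; apply: integZ; [exact: it|exact: if_].
have fE z : \sum_i f i z = small dl eta z * Psi (S + noise_inc x z).
  rewrite /Psi mulr_sumr; apply: eq_bigr => i _.
  have nE : (S + noise_inc x z) i ord0 = S i ord0 + noise_inc x z i ord0 by rewrite mxE.
  rewrite /f nE [RHS]mulrDr; congr (_ + _).
    by rewrite mulrCA -expRD; congr (_ * expR _); ring.
  by rewrite mulrCA -expRD; congr (_ * expR _); ring.
split; first by apply: (integ_eq fE); exact: integ_sum.
rewrite -(Ex_eq _ fE) Ex_sum// /Psi mulr_sumr; apply: ler_sum => i _.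
have [h1 h2] := exp_bound lN tx i.
rewrite /f ExD; [|by apply: integZ; exact: it|by apply: integZ; exact: if_].
rewrite !ExZ; [|exact: if_|exact: it].
rewrite [leRHS]mulrDr; apply: lerD; rewrite [leRHS]mulrC; apply: ler_wpM2l => //; exact: expR_ge0.
Qed.

Lemma integ_small g x : frac g -> integ lw (fun z : Xd => small dl eta z * g (move x z)) /\
  integ lw (fun z : Xd => (1 - small dl eta z) * g (move x z)).
Proof.
move=> fg; have [mg g01] := fg.
have mgm : measurable_fun setT ((fun z => g (move x z)) : Xd -> TR).
  by apply: (measurableT_comp mg); apply: measurable_move; [exact: measurable_cst|exact: measurable_id].
have ms := @measurable_small R d dl eta.
have key (u v : R) : 0 <= u <= 1 -> 0 <= v <= 1 -> 0 <= u * v <= 1.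
  by move=> /andP[u0 u1] /andP[v0 v1]; rewrite mulr_ge0//= mulr_ile1.
split; apply: integ01.
- exact: measurable_funM.
- by move=> z; apply: key; [exact: small01|].
- by apply: measurable_funM => //; apply: measurable_funB.
- move=> z; apply: key => //; have /andP[h0 h1] := small01 dl eta z.
  by apply/andP; split; lra.
Qed.

Lemma Kop_split g x : frac g -> Kop g x =
  Ex lw (fun z : Xd => small dl eta z * g (move x z)) + Ex lw (fun z : Xd => (1 - small dl eta z) * g (move x z)).
Proof.
move=> fg; have [h1 h2] := integ_small x fg.
by rewrite -ExD//; apply: Ex_eq => z; ring.
Qed.

Lemma integ_smallZ c : integ lw (fun z : Xd => small dl eta z * c).
Proof.
apply: (integ_eq (f := fun z : Xd => c * small dl eta z)); first by move=> z; rewrite mulrC.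
by apply: integZ; apply: integ01; [exact: measurable_small|exact: small01].
Qed.

(** Induction on the remaining steps with S as an extra variable. Once S has left its box the
    potential exceeds 1 and dominates w; otherwise a step splits into small noise, which extends S,
    and large noise, which costs beta l. *)
Lemma first_jump_upper (w : nat -> 'cV[R]_m -> R) (beta : nat -> R) :
  (forall n, frac (w n)) -> (forall l, 0 <= beta l) ->
  (forall n l x, (l + n.+1 = N)%N -> tube l x -> w n.+1 x <= Kop (w n) x) ->
  (forall x, tube N x -> w 0%N x <= 0) ->
  (forall n l x, (l + n.+1 = N)%N -> tube l x ->
     Ex lw (fun z : Xd => (1 - small dl eta z) * w n (move x z)) <= beta l) ->
  forall n l x S, (l + n = N)%N -> enorm (x - path l - S) <= q l ->
  w n x <= (1 + eta) ^+ n * Psi S + \sum_(l <= j < N) beta j.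
Proof.
move=> fw b0 hw hw0 hb; have e1 : 1 <= 1 + eta by rewrite lerDl ltW.
have en n : 1 <= (1 + eta) ^+ n by rewrite exprn_ege1.
have sb l : 0 <= \sum_(l <= j < N) beta j by apply: sumr_ge0.
have Ps n (S : 'cV[R]_m) : Psi S <= (1 + eta) ^+ n * Psi S by rewrite ler_peMl// Psi_ge0.
have tubeP l x (S : 'cV[R]_m) : (l <= N)%N -> (forall i, `|S i ord0| <= eps) -> enorm (x - path l - S) <= q l -> tube l x.
  move=> lN hS hx; rewrite /tube; apply: le_trans (q_r lN).
  have := enorm_triangle (x - path l - S) S; rewrite subrK => /le_trans; apply.
  by apply: lerD => //; exact: enorm_le_coord.
elim=> [|n IH] l x S lnN hx.
  have [hS|/existsNP[i /negP]] := pselect (forall i, `|S i ord0| <= eps); last first.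
    rewrite -ltNge => /Psi_ge1 h; have /andP[_ w1] := (fw 0%N).2 x.
    by have := Ps 0%N S; have := sb l; lra.
  rewrite addn0 in lnN; rewrite lnN in hx *.
  apply: le_trans (hw0 _ (tubeP _ _ _ (leqnn N) hS hx)) _.
  by rewrite addr_ge0// mulr_ge0 ?Psi_ge0// (le_trans _ (en 0%N)).
have lN : (l < N)%N by rewrite -lnN addnS ltnS leq_addr.
have [hS|/existsNP[i /negP]] := pselect (forall i, `|S i ord0| <= eps); last first.
  rewrite -ltNge => /Psi_ge1 h; have /andP[_ w1] := (fw n.+1).2 x.
  by have := Ps n.+1 S; have := sb l; lra.
have tx := tubeP _ _ _ (ltnW lN) hS hx.
apply: le_trans (hw _ _ _ lnN tx) _; rewrite (Kop_split x (fw n)).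
rewrite (big_ltn lN) (addrC (beta l)) addrA; apply: lerD (hb _ _ _ lnN tx).
have [iP EP] := Psi_integ S lN tx.
set B := \sum_(l.+1 <= j < N) beta j; have B0 : 0 <= B by exact: sb.
have iPc : integ lw (fun z : Xd => (1 + eta) ^+ n * (small dl eta z * Psi (S + noise_inc x z)) + small dl eta z * B).
  by apply: integD; [exact: integZ|exact: integ_smallZ].
apply: le_trans (Ex_le (integ_small x (fw n)).1 iPc _) _.
  move=> z; rewrite /small; case: (leP (eta * enorm z) dl) => zs; last by rewrite !mul0r mulr0 addr0.
  rewrite !mul1r; apply: IH; first by rewrite addSnnS.
  exact: (track_step lN tx zs hS hx).
rewrite ExD; [|exact: integZ|exact: integ_smallZ].
apply: lerD; last first.
  apply: Ex_le_cst; first exact: integ_smallZ.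
  by move=> z; have /andP[_ s1] := small01 dl eta z; rewrite ler_piMl.
rewrite ExZ// exprS (mulrC (1 + eta)) -mulrA; apply: ler_wpM2l => //.
by rewrite exprn_ge0// (le_trans _ e1).
Qed.

(** The same induction from below: the potential pays for paths that leave the tube, and the powers
    of 1 - p for the absence of an earlier large jump. *)
Lemma first_jump_lower (v : nat -> 'cV[R]_m -> R) (beta : nat -> R) (p : R) :
  (forall n, frac (v n)) -> (forall l, 0 <= beta l) -> \sum_(0 <= j < N) beta j <= 1 ->
  0 <= p <= 1 -> Ex lw (fun z : Xd => 1 - small dl eta z) <= p ->
  (forall n l x, (l + n.+1 = N)%N -> tube l x -> Kop (v n) x <= v n.+1 x) ->
  (forall n l x, (l + n.+1 = N)%N -> tube l x ->
     beta l <= Ex lw (fun z : Xd => (1 - small dl eta z) * v n (move x z))) ->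
  forall n l x S, (l + n = N)%N -> enorm (x - path l - S) <= q l ->
  (1 - p) ^+ n * \sum_(l <= j < N) beta j <= v n x + (1 + eta) ^+ n * Psi S.
Proof.
move=> fv b0 b1 /andP[p0 p1] hp hv hb; have e1 : 1 <= 1 + eta by rewrite lerDl ltW.
have en n : 1 <= (1 + eta) ^+ n by rewrite exprn_ege1.
have sb l : 0 <= \sum_(l <= j < N) beta j by apply: sumr_ge0.
have sb1 l : (l <= N)%N -> \sum_(l <= j < N) beta j <= 1.
  move=> lN; apply: le_trans b1; rewrite [leRHS](@big_cat_nat _ _ _ l)//= lerDr; exact: sumr_ge0.
have pn n : 0 <= (1 - p) ^+ n <= 1.
  by rewrite exprn_ge0 ?subr_ge0//= exprn_ile1 ?subr_ge0// lerBlDr lerDl.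
have Ps n (S : 'cV[R]_m) : Psi S <= (1 + eta) ^+ n * Psi S by rewrite ler_peMl// Psi_ge0.
have tubeP l x (S : 'cV[R]_m) : (l <= N)%N -> (forall i, `|S i ord0| <= eps) -> enorm (x - path l - S) <= q l -> tube l x.
  move=> lN hS hx; rewrite /tube; apply: le_trans (q_r lN).
  have := enorm_triangle (x - path l - S) S; rewrite subrK => /le_trans; apply.
  by apply: lerD => //; exact: enorm_le_coord.
elim=> [|n IH] l x S lnN hx.
  rewrite addn0 in lnN; rewrite lnN big_geq// mulr0 addr_ge0//; first by have /andP[] := (fv 0%N).2 x.
  by rewrite mulr_ge0 ?Psi_ge0// (le_trans _ (en 0%N)).
have lN : (l < N)%N by rewrite -lnN addnS ltnS leq_addr.
have /andP[q0 q1] := pn n.+1.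
have /andP[v0 _] := (fv n.+1).2 x.
have [hS|/existsNP[i /negP]] := pselect (forall i, `|S i ord0| <= eps); last first.
  rewrite -ltNge => /Psi_ge1 h.
  have : (1 - p) ^+ n.+1 * \sum_(l <= j < N) beta j <= 1 by rewrite mulr_ile1// sb1// ltnW.
  by have := Ps n.+1 S; lra.
have tx := tubeP _ _ _ (ltnW lN) hS hx.
have hK := hv _ _ _ lnN tx; rewrite (Kop_split x (fv n)) in hK.
have hbl := hb _ _ _ lnN tx.
rewrite (big_ltn lN) mulrDr.
set B := \sum_(l.+1 <= j < N) beta j; have B0 : 0 <= B by exact: sb.
have [iP EP] := Psi_integ S lN tx.
have isv := (integ_small x (fv n)).1.
have i2 : integ lw (fun z : Xd => small dl eta z * v n (move x z) + (1 + eta) ^+ n * (small dl eta z * Psi (S + noise_inc x z))).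
  by apply: integD => //; exact: integZ.
have h3 : Ex lw (fun z : Xd => small dl eta z * ((1 - p) ^+ n * B)) <=
    Ex lw (fun z : Xd => small dl eta z * v n (move x z)) + (1 + eta) ^+ n * ((1 + eta) * Psi S).
  apply: le_trans (Ex_le (integ_smallZ _) i2 _) _.
    move=> z; rewrite /small; case: (leP (eta * enorm z) dl) => zs; last by rewrite !mul0r mulr0 addr0.
    rewrite !mul1r; apply: IH; first by rewrite addSnnS.
    exact: (track_step lN tx zs hS hx).
  rewrite ExD//; last exact: integZ.
  rewrite lerD2l ExZ//; apply: ler_wpM2l => //.
  by rewrite exprn_ge0// (le_trans _ e1).
have is1 : integ lw (small dl eta : Xd -> R) by apply: integ01; [exact: measurable_small|exact: small01].
have h4 : (1 - p) ^+ n.+1 * B <= Ex lw (fun z : Xd => small dl eta z * ((1 - p) ^+ n * B)).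
  have -> : Ex lw (fun z : Xd => small dl eta z * ((1 - p) ^+ n * B)) = (1 - p) ^+ n * B * Ex lw (small dl eta).
    by rewrite -ExZ//; apply: Ex_eq => z; rewrite mulrC.
  have h5 : 1 - p <= Ex lw (small dl eta).
    have : Ex lw (fun z : Xd => 1 - small dl eta z) = 1 - Ex lw (small dl eta).
      by rewrite ExB// ?Ex_cst//; exact: integ_cst.
    by move: hp => /[swap] ->; lra.
  rewrite exprSr -mulrA (mulrC (1 - p)) mulrA; apply: ler_wpM2l => //.
  by rewrite mulr_ge0//; have /andP[] := pn n.
have h6 : (1 - p) ^+ n.+1 * beta l <= beta l by rewrite ler_piMl.
have e3 : (1 + eta) ^+ n * ((1 + eta) * Psi S) = (1 + eta) ^+ n.+1 * Psi S by rewrite exprS; ring.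
rewrite e3 in h3; lra.
Qed.

End first_jump.

(** * Exit windows and returns to a core *)

Let ig g x : frac g -> integ lw (fun z : Xd => g (move x z)).
Proof. by move=> fg; exact: (frac_integ x fg). Qed.

Let f01 (g : 'cV[R]_m -> R) x : frac g -> 0 <= g x <= 1. Proof. by case=> _; apply. Qed.

(* Probability of leaving U at one of the steps n+1, ..., n+k, landing in B. *)
Definition gap U B n k := survp U (exitp U B k) n.

Section gap.
Variables (U B : set 'cV[R]_m).
Hypotheses (mU : measurable (U : set Xm)) (mB : measurable (B : set Xm)).

Let fe k : frac (exitp U B k). Proof. exact: (frac_exitp mU k mB). Qed.

Lemma frac_gap n k : frac (gap U B n k).
Proof. exact: (frac_survp mU n (fe k)). Qed.

Lemma gapS n k x : U x -> gap U B n.+1 k x = Kop (gap U B n k) x.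
Proof. by move=> Ux; rewrite /gap survpS. Qed.

Lemma gap_out n k x : ~ U x -> gap U B n k x = 0.
Proof. by move=> Ux; rewrite /gap survp_out. Qed.

Lemma gap0 k x : U x -> gap U B 0 k x = exitp U B k x.
Proof. by move=> Ux; rewrite /gap survp0. Qed.

Lemma gap_shift n k x : gap U B n.+1 k x <= gap U B n k.+1 x.
Proof.
elim: n x => [|n IH] x; (have [Ux|Ux] := pselect (U x); last by rewrite !gap_out).
- rewrite gapS// gap0// exitpS//; apply: (Kop_le x (frac_gap 0 k) (fe k)) => y.
  have [Uy|Uy] := pselect (U y); first by rewrite gap0.
  by rewrite gap_out//; have /andP[] := f01 y (fe k).
- by rewrite gapS// [leRHS]gapS//; apply: (Kop_le x (frac_gap _ _) (frac_gap _ _)).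
Qed.

(** The windows n+j+1, ..., n+j+k and n+1, ..., n+j+k end together and the first is contained in the
    second. This allows step counts to be rounded. *)
Lemma gap_le n j k x : gap U B (n + j) k x <= gap U B n (k + j) x.
Proof.
elim: j k => [|j IH] k; first by rewrite !addn0.
by rewrite addnS addnS -addSn; apply: le_trans (gap_shift _ _ _) _; exact: IH.
Qed.

Lemma gap_le0 n k x : U x -> gap U B n k x <= exitp U B (k + n) x.
Proof. by move=> Ux; rewrite -gap0// -[n in leLHS]add0n; exact: gap_le. Qed.

End gap.

(* The chain is compared with its successive returns to core, through K. *)
Section block.
Variables (U K core B : set 'cV[R]_m).
Hypotheses (mU : measurable (U : set Xm)) (mK : measurable (K : set Xm)) (mC : measurable (core : set Xm))
  (mB : measurable (B : set Xm)).
Variables (h : nat -> 'cV[R]_m -> R) (A : R).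
Hypothesis fh : forall j, frac (h j).
Hypothesis A0 : 0 <= A.

(** The event that a cycle fails to close: the chain stays in K for j steps without meeting the
    core. *)
Definition ret j := survp (K `\` core) (\1_(K `\` core)) j.

Let mKC : measurable (K `\` core : set Xm). Proof. exact: measurableD. Qed.
Lemma frac_ret j : frac (ret j).
Proof. by apply: frac_survp => //; exact: frac_indic. Qed.

Let fx k (T : set Xm) : measurable T -> frac (exitp K T k).
Proof. by move=> mT; exact: (frac_exitp mK k mT). Qed.
Let shell : set 'cV[R]_m := B `|` (U `\` K).
Let mshell : measurable (shell : set Xm). Proof. by apply: measurableU => //; exact: measurableD. Qed.
Let mCU : measurable (~` U : set Xm). Proof. exact: measurableC. Qed.
Let mCK : measurable (~` K : set Xm). Proof. exact: measurableC. Qed.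
Let fK : frac (\1_K). Proof. exact: frac_indic. Qed.
Let ge0 (g : 'cV[R]_m -> R) x : frac g -> 0 <= g x. Proof. by move=> hg; have /andP[] := f01 x hg. Qed.
Let le1 (g : 'cV[R]_m -> R) x : frac g -> g x <= 1. Proof. by move=> hg; have /andP[] := f01 x hg. Qed.

Let retS j x : K x -> ~ core x -> ret j.+1 x = Kop (ret j) x.
Proof. by move=> Kx Cx; rewrite /ret survpS. Qed.

Let ret0 x : K x -> ~ core x -> ret 0 x = 1.
Proof. by move=> Kx Cx; rewrite /ret survp0// indicE mem_set. Qed.

Section upper.
Hypothesis h_step : forall j x, K x -> h j.+1 x <= Kop (h j) x.
Hypothesis h_core : forall j x, core x -> h j x <= A.
Hypothesis h_out : forall j x, ~ U x -> h j x <= \1_B x.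

Let h_outK j x : ~ K x -> h j x <= \1_shell x.
Proof.
move=> Kx; have [Ux|Ux] := pselect (U x).
  by rewrite indicE mem_set; [exact: le1|right].
apply: le_trans (h_out j Ux) _; rewrite !indicE.
have [Bx|Bx] := pselect (B x); last by rewrite (memNset Bx).
by rewrite !mem_set//; left.
Qed.

(** Three fates: the core is reached, from where h is at most A; K is left first, where h is at most
    the indicator of the shell; or neither, which is [ret]. Induction on steps plays the part of the
    hitting time. *)
Lemma return_upper j x : h j x <= A * \1_K x + ret j x + exitp K shell j x.
Proof.
have out i y : ~ K y -> h i y <= A * \1_K y + ret i y + exitp K shell i y.
  move=> Ky; rewrite exitp_out// -[leLHS]add0r; apply: lerD (h_outK _ Ky).
  by rewrite addr_ge0 ?mulr_ge0 ?(ge0 _ fK) ?(ge0 _ (frac_ret _)).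
have inC i y : K y -> core y -> h i y <= A + ret i y + exitp K shell i y.
  move=> Ky Cy; apply: le_trans (h_core _ Cy) _; rewrite -addrA lerDl.
  by rewrite addr_ge0 ?(ge0 _ (frac_ret _)) ?(ge0 _ (fx _ mshell)).
elim: j x => [|j IH] x; (have [Kx|Kx] := pselect (K x); last exact: out);
  rewrite [\1_K x]indicE mem_set//= mulr1; (have [Cx|Cx] := pselect (core x); first exact: inC).
- by rewrite ret0// (le_trans (le1 _ (fh 0)))// addrAC lerDr addr_ge0// (ge0 _ (fx _ mshell)).
- apply: le_trans (h_step _ Kx) _; rewrite retS// exitpS//.
  have i1 := integZ A (ig x fK); have i2 := ig x (frac_ret j); have i3 := ig x (fx j mshell).
  apply: (@le_trans _ _ (Ex lw (fun z : Xd => A * \1_K (move x z) + ret j (move x z) + exitp K shell j (move x z)))).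
    by apply: Ex_le => [||z]; [exact: ig|apply: integD => //; exact: integD|exact: IH].
  rewrite ExD ?ExD//; last exact: integD.
  rewrite !lerD2r ExZ; last exact: ig.
  by apply: ler_piMr => //; apply: Ex_le_cst => [|z]; [exact: ig|exact: le1].
Qed.

(** A run of j steps inside K is followed by N steps for the return to the core; paths that leave U
    during the run are taken out of the factor A. *)
Lemma block_upper N j x : h (j + N)%N x <=
  A * (1 - exitp K (~` U) j x) + survp K (ret N) j x + exitp K shell (j + N) x.
Proof.
have fs i : frac (survp K (ret N) i) by exact: (frac_survp mK i (frac_ret N)).
have out i y : ~ K y -> h (i + N)%N y <= A * (1 - exitp K (~` U) i y) + survp K (ret N) i y + exitp K shell (i + N) y.
  move=> Ky; rewrite [exitp K shell _ y]exitp_out// -[leLHS]add0r; apply: lerD (h_outK _ Ky).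
  by rewrite addr_ge0 ?mulr_ge0 ?subr_ge0 ?(le1 _ (fx _ mCU)) ?(ge0 _ (fs _)).
elim: j x => [|j IH] x; (have [Kx|Kx] := pselect (K x); last exact: out).
- by have := return_upper N x; rewrite exitp0// subr0 survp0// [\1_K x]indicE mem_set// mulr1 add0n.
rewrite addSn; apply: le_trans (h_step _ Kx) _; rewrite survpS// !exitpS//.
have i0 : integ lw (fun z : Xd => 1 - exitp K (~` U) j (move x z)) by apply: integB; [exact: integ_cst|exact: ig (fx _ mCU)].
have i1 := integZ A i0; have i2 := ig x (fs j); have i3 := ig x (fx (j + N) mshell).
apply: (@le_trans _ _ (Ex lw (fun z : Xd => A * (1 - exitp K (~` U) j (move x z)) + survp K (ret N) j (move x z) +
    exitp K shell (j + N) (move x z)))).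
  by apply: Ex_le => [||z]; [exact: ig|apply: integD => //; exact: integD|exact: IH].
rewrite ExD ?ExD//; last exact: integD.
by rewrite ExZ// ExB ?Ex_cst//; [exact: integ_cst|exact: ig (fx _ mCU)].
Qed.
End upper.

Section lower.
Hypothesis h_step : forall j x, K x -> Kop (h j) x <= h j.+1 x.
Variable N : nat.
Hypothesis h_core : forall j x, (j <= N)%N -> core x -> A <= h j x.
Hypothesis h_out : forall j x, ~ K x -> \1_B x <= h j x.

(** Only paths that reach the core before leaving K are credited. The bound j <= N reflects that in
    the core the value A is guaranteed for at most N remaining steps. *)
Lemma return_lower j x : (j <= N)%N -> A * (1 - ret j x - exitp K (~` K) j x) <= h j x.
Proof.
have out i y : ~ K y -> A * (1 - ret i y - exitp K (~` K) i y) <= h i y.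
  move=> Ky; rewrite exitp_out// indicE mem_set// addrAC subrr sub0r mulrN.
  by apply: le_trans (ge0 _ (fh _)); rewrite oppr_le0 mulr_ge0 ?(ge0 _ (frac_ret _)).
have inC i y : (i <= N)%N -> core y -> A * (1 - ret i y - exitp K (~` K) i y) <= h i y.
  move=> iN Cy; apply: le_trans (h_core iN Cy); apply: ler_piMr => //; rewrite lerBlDr lerBlDr -addrA lerDl.
  by rewrite addr_ge0 ?(ge0 _ (frac_ret _)) ?(ge0 _ (fx _ mCK)).
elim: j x => [|j IH] x jN; (have [Kx|Kx] := pselect (K x); last exact: out);
  (have [Cx|Cx] := pselect (core x); first exact: inC).
- by rewrite ret0// subrr sub0r mulrN; apply: le_trans (ge0 _ (fh _)); rewrite oppr_le0 mulr_ge0// (ge0 _ (fx _ mCK)).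
apply: le_trans (h_step _ Kx); rewrite retS// exitpS//.
have i2 := ig x (frac_ret j); have i3 := ig x (fx j mCK).
have i1 : integ lw (fun z : Xd => 1 - ret j (move x z)) by apply: integB => //; exact: integ_cst.
apply: (@le_trans _ _ (Ex lw (fun z : Xd => A * (1 - ret j (move x z) - exitp K (~` K) j (move x z))))); last first.
  by apply: Ex_le => [||z]; [apply: integZ; exact: integB|exact: ig|exact: IH (ltnW jN)].
rewrite ExZ ?ExB ?Ex_cst//; [exact: integ_cst|exact: integB].
Qed.

Lemma block_lower j x : exitp K B j x + A * (1 - survp K (ret N) j x - exitp K (~` K) (j + N) x) <= h (j + N)%N x.
Proof.
have fs i : frac (survp K (ret N) i) by exact: (frac_survp mK i (frac_ret N)).
have out i y : ~ K y ->
    exitp K B i y + A * (1 - survp K (ret N) i y - exitp K (~` K) (i + N) y) <= h (i + N)%N y.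
  by move=> Ky; rewrite !exitp_out// survp_out// subr0 [\1_(~` K) y]indicE mem_set// subrr mulr0 addr0; exact: h_out.
elim: j x => [|j IH] x; (have [Kx|Kx] := pselect (K x); last exact: out).
- by rewrite exitp0// add0r survp0// add0n; exact: (return_lower _ (leqnn N)).
rewrite addSn; apply: le_trans (h_step _ Kx); rewrite survpS// !exitpS//.
have i0 := ig x (fx j mB); have i2 := ig x (fs j); have i3 := ig x (fx (j + N) mCK).
have i1 : integ lw (fun z : Xd => 1 - survp K (ret N) j (move x z)) by apply: integB => //; exact: integ_cst.
have i4 : integ lw (fun z : Xd => 1 - survp K (ret N) j (move x z) - exitp K (~` K) (j + N) (move x z)) by exact: integB.
apply: (@le_trans _ _ (Ex lw (fun z : Xd => exitp K B j (move x z) +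
    A * (1 - survp K (ret N) j (move x z) - exitp K (~` K) (j + N) (move x z))))); last first.
  by apply: Ex_le => [||z]; [apply: integD => //; exact: integZ|exact: ig|exact: IH].
rewrite ExD ?ExZ ?ExB ?Ex_cst//; [exact: integ_cst|exact: integZ].
Qed.
End lower.

End block.

(* One attempt at leaving lasts N steps, followed by at most N' steps to return to core. *)
Section cycles.
Variables (U K core B : set 'cV[R]_m).
Hypotheses (mU : measurable (U : set Xm)) (mK : measurable (K : set Xm)) (mC : measurable (core : set Xm))
  (mB : measurable (B : set Xm)).
Hypotheses (KU : K `<=` U) (CK : core `<=` K) (BU : B `<=` ~` U).
Variables (N N' : nat) (p q ep : R) (x0 : 'cV[R]_m).
Hypothesis core0 : core x0.
Hypothesis ret_ep : forall x, ret K core N' x <= ep.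

Local Notation L := (N + N')%N.

Let fe k : frac (exitp U B k). Proof. exact: (frac_exitp mU k mB). Qed.
Let fg n k : frac (gap U B n k). Proof. exact: frac_gap. Qed.
Let fr j : frac (ret K core j). Proof. exact: frac_ret. Qed.
Let ge0 (g : 'cV[R]_m -> R) x : frac g -> 0 <= g x. Proof. by move=> hg; have /andP[] := f01 x hg. Qed.
Let le1 (g : 'cV[R]_m -> R) x : frac g -> g x <= 1. Proof. by move=> hg; have /andP[] := f01 x hg. Qed.

Let ep0 : 0 <= ep. Proof. by apply: le_trans (ret_ep x0); exact: ge0 (fr N'). Qed.

Let survp_ep x : survp K (ret K core N') N x <= ep.
Proof. by apply: (survp_bound mK N x (fr N') ep0) => y _; exact: ret_ep. Qed.

Let set0shell : set0 `|` (U `\` K) = U `\` K. Proof. by rewrite set0U. Qed.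

Section upper.
Hypothesis p01 : 0 < p <= 1.
Hypothesis exit_p : forall x, core x -> p <= exitp K (~` U) N x.
Hypothesis exit_q : forall x, core x -> exitp K (B `|` (U `\` K)) L x <= q.
Hypothesis exit_ep : forall x, core x -> exitp K (U `\` K) L x <= ep.

Let p0 : 0 < p. Proof. by case/andP: p01. Qed.
Let p1 : p <= 1. Proof. by case/andP: p01. Qed.

(** The supremum over all horizons and core states is finite and, after one cycle, satisfies sup <=
    (1 - p) sup + ep + q; solving for it gives the bound. *)
Lemma cycle_exit k x : core x -> exitp U B k x <= (q + ep) / p.
Proof.
pose S := [set y | exists k x, core x /\ y = exitp U B k x].
have S0 : S !=set0 by exists (exitp U B 0 x0), 0%N, x0.
have Sb : ubound S 1 by move=> y [j [z [_ ->]]]; exact: le1.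
have hS j z : core z -> exitp U B j z <= sup S.
  by move=> Cz; apply: ub_le_sup; [exists 1|exists j, z].
have A0 : 0 <= sup S by apply: le_trans (hS 0%N x0 core0); exact: ge0.
have hub j z : core z -> exitp U B j z <= sup S * (1 - p) + ep + q.
  (* Lengthening the horizon by one cycle only increases the probability, so a full cycle may be run
     first. *)
  move=> Cz; apply: le_trans (exitp_le mU z mB (leq_addr L j)) _.
  have h1 i y : K y -> exitp U B (j + i.+1) y <= Kop (exitp U B (j + i)) y.
    by move=> /KU Uy; rewrite addnS exitpS.
  have := @block_upper U K core B mU mK mC mB (fun i => exitp U B (j + i)) (sup S) (fun i => fe (j + i)) A0 h1
    (fun i y Cy => hS (j + i)%N y Cy) _ N' N z.
  move=> /(_ _)/le_trans; apply; first by move=> i y Uy; rewrite exitp_out.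
  apply: lerD (exit_q Cz); apply: lerD (survp_ep z); apply: ler_wpM2l => //.
  by rewrite lerD2l lerN2 exit_p.
have : sup S <= sup S * (1 - p) + ep + q by apply: ge_sup => // y [j [z [Cz ->]]]; exact: hub.
move=> h Cx; apply: le_trans (hS k x Cx) _; rewrite ler_pdivlMr//.
by move: h; rewrite mulrBr mulr1; lra.
Qed.

(** Each cycle passes without exit with probability at most 1 - p and adds an error 2 ep; the errors
    accumulate to at most 2 ep / p, the fixed point of the recursion. *)
Lemma cycle_gap l k x : core x -> gap U B (l * L) k x <= (1 - p) ^+ l * ((q + ep) / p) + 2 * ep / p.
Proof.
have e2 : 0 <= 2 * ep / p by rewrite divr_ge0 ?mulr_ge0// ltW.
have q0 : 0 <= (q + ep) / p by apply: le_trans (cycle_exit 0 core0); exact: ge0.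
have A0 i : 0 <= (1 - p) ^+ i * ((q + ep) / p) + 2 * ep / p.
  by rewrite addr_ge0// mulr_ge0// exprn_ge0// subr_ge0.
elim: l k x => [|l IH] k x Cx.
  by rewrite mul0n gap0; [rewrite expr0 mul1r (le_trans (cycle_exit k Cx))// lerDl|exact/KU/CK].
have h1 j y : K y -> gap U B (l * L + j.+1) k y <= Kop (gap U B (l * L + j) k) y.
  by move=> /KU Uy; rewrite addnS gapS.
have h2 j y : core y -> gap U B (l * L + j) k y <= (1 - p) ^+ l * ((q + ep) / p) + 2 * ep / p.
  by move=> Cy; apply: le_trans (gap_le mU mB _ _ _ _) _; exact: IH.
have h3 j y : ~ U y -> gap U B (l * L + j) k y <= \1_set0 y.
  by move=> Uy; rewrite gap_out// indicE.
have := @block_upper U K core set0 mU mK mC measurable0 (fun j => gap U B (l * L + j) k) _ (fun j => fg (l * L + j) k) (A0 l) h1 h2 h3 N' N x.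
rewrite set0shell mulSn addnC => /le_trans; apply.
apply: (@le_trans _ _ (((1 - p) ^+ l * ((q + ep) / p) + 2 * ep / p) * (1 - p) + ep + ep)).
  apply: lerD (exit_ep Cx); apply: lerD (survp_ep x); apply: ler_wpM2l => //.
  by rewrite lerD2l lerN2 exit_p.
rewrite exprS le_eqVlt; apply/orP; left; apply/eqP; field; exact: lt0r_neq0.
Qed.

Lemma cycle_gap_from l k x : gap U B (l * L + N') k x <=
  (1 - p) ^+ l * ((q + ep) / p) + 2 * ep / p + ep + exitp K (U `\` K) N' x.
Proof.
have e2 : 0 <= 2 * ep / p by rewrite divr_ge0 ?mulr_ge0// ltW.
have q0 : 0 <= (q + ep) / p by apply: le_trans (cycle_exit 0 core0); exact: ge0.
have A0 : 0 <= (1 - p) ^+ l * ((q + ep) / p) + 2 * ep / p.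
  by rewrite addr_ge0// mulr_ge0// exprn_ge0// subr_ge0.
have h1 j y : K y -> gap U B (l * L + j.+1) k y <= Kop (gap U B (l * L + j) k) y.
  by move=> /KU Uy; rewrite addnS gapS.
have h2 j y : core y -> gap U B (l * L + j) k y <= (1 - p) ^+ l * ((q + ep) / p) + 2 * ep / p.
  by move=> Cy; apply: le_trans (gap_le mU mB _ _ _ _) _; exact: cycle_gap.
have h3 j y : ~ U y -> gap U B (l * L + j) k y <= \1_set0 y.
  by move=> Uy; rewrite gap_out// indicE.
have := @return_upper U K core set0 mU mK mC measurable0 (fun j => gap U B (l * L + j) k) _ (fun j => fg (l * L + j) k) A0 h1 h2 h3 N' x.
rewrite set0shell => /le_trans; apply; rewrite lerD2r; apply: lerD (ret_ep x).
by apply: ler_piMr => //; exact: le1 (frac_indic mK).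
Qed.
Lemma cycle_exit_from k x : exitp U B k x <= (q + ep) / p + ep + exitp K (B `|` (U `\` K)) N' x.
Proof.
have A0 : 0 <= (q + ep) / p by apply: le_trans (cycle_exit 0 core0); exact: ge0.
have h1 j y : K y -> exitp U B (k + j.+1) y <= Kop (exitp U B (k + j)) y.
  by move=> /KU Uy; rewrite addnS exitpS.
have h2 j y : core y -> exitp U B (k + j) y <= (q + ep) / p by exact: cycle_exit.
have h3 j y : ~ U y -> exitp U B (k + j) y <= \1_B y by move=> Uy; rewrite exitp_out.
apply: le_trans (exitp_le mU x mB (leq_addr N' k)) _.
have := @return_upper U K core B mU mK mC mB (fun j => exitp U B (k + j)) _ (fun j => fe (k + j)) A0 h1 h2 h3 N' x.
move=> /le_trans; apply; rewrite lerD2r; apply: lerD (ret_ep x).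
by apply: ler_piMr => //; exact: le1 (frac_indic mK).
Qed.

(** N' steps bring the chain into the core, the remaining n - N' are rounded down to whole cycles,
    and the errors of the approach are added. *)
Lemma cycle_gap_bound n k x : U x -> gap U B n k x <=
  (1 - p) ^+ ((n - N') %/ L) * ((q + ep) / p) + 2 * ep / p + ep + exitp K (B `|` (U `\` K)) N' x.
Proof.
move=> Ux; have e2 : 0 <= 2 * ep / p by rewrite divr_ge0 ?mulr_ge0// ltW.
have mS : measurable (U `\` K : set Xm) by exact: measurableD.
have mT : measurable (B `|` (U `\` K) : set Xm) by exact: measurableU.
have [nN|Nn] := leqP n N'.
  move: (nN); rewrite -subn_eq0 => /eqP ->; rewrite div0n expr0 mul1r.
  apply: le_trans (gap_le0 mU mB _ _ Ux) _; apply: le_trans (cycle_exit_from _ _) _.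
  by rewrite lerD2r lerD2r lerDl.
have ln : ((n - N') %/ L * L + N' <= n)%N by have := leq_trunc_div (n - N') L; rewrite -(leq_add2r N') subnK// ltnW.
rewrite -(subnKC ln); apply: le_trans (gap_le mU mB _ _ _ _) _.
rewrite subnKC//; apply: le_trans (cycle_gap_from _ _ _) _; rewrite lerD2l.
by apply: (exitp_target_le mK) => // y _ Ky; right.
Qed.
End upper.

Section lower.
Hypothesis p0 : 0 <= p.
Hypothesis pe0 : 0 < p + ep.
Hypothesis pe1 : p + ep <= 1.
Hypothesis q0 : 0 <= q.
Hypothesis exit_q : forall x, core x -> q <= exitp K B N x.
Hypothesis exit_p : forall x, core x -> exitp K (~` K) L x <= p.

Local Notation s := (1 - (p + ep)).
Let s0 : 0 <= s. Proof. by rewrite subr_ge0. Qed.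
Let s1 : s <= 1. Proof. by rewrite gerBl ltW. Qed.
Let mCK : measurable (~` K : set Xm). Proof. exact: measurableC. Qed.

(** The geometric sum of q s^j over j < i: exit into B in one of the first i cycles, each closing
    with probability at least s. *)
Let A i := q / (p + ep) * (1 - s ^+ i).
Let A0 i : 0 <= A i. Proof. by rewrite mulr_ge0 ?divr_ge0 ?(ltW pe0)// subr_ge0 exprn_ile1. Qed.

Let damp x w : core x -> 0 <= w -> w * s <= w * (1 - survp K (ret K core N') N x - exitp K (~` K) L x).
Proof.
move=> Cx w0; apply: ler_wpM2l => //; have := survp_ep x; have := exit_p Cx.
by move: (survp _ _ _ _) (exitp _ _ _ _) => u w'; lra.
Qed.

Lemma cycle_exit_lower i k x : core x -> (i * L <= k)%N -> A i <= exitp U B k x.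
Proof.
elim: i k x => [|i IH] k x Cx ik; first by rewrite /A expr0 subrr mulr0; exact: ge0.
have h1 j y : K y -> Kop (exitp U B (i * L + j)) y <= exitp U B (i * L + j.+1) y.
  by move=> /KU Uy; rewrite addnS exitpS.
have h2 j y : (j <= N')%N -> core y -> A i <= exitp U B (i * L + j) y.
  by move=> _ Cy; apply: IH => //; exact: leq_addr.
have h3 j y : ~ K y -> \1_B y <= exitp U B (i * L + j) y.
  move=> Ky; have [Uy|Uy] := pselect (U y); last by rewrite exitp_out.
  by rewrite indicE memNset ?ge0// => /BU; apply.
have := @block_lower K core B mK mC mB (fun j => exitp U B (i * L + j)) (A i) (fun j => fe (i * L + j)) (A0 i) h1 N' h2 h3 N x.
move=> hb; apply: le_trans (exitp_le mU x mB ik).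
rewrite mulSn addnC; apply: le_trans hb; apply: le_trans (lerD (exit_q Cx) (damp Cx (A0 i))).
by rewrite /A exprS le_eqVlt; apply/orP; left; apply/eqP; field; exact: lt0r_neq0.
Qed.

(** An exit within n + k steps is later than step n, unless K, which lies in U, has been left by
    then. *)
Lemma exit_le_gap n k x : exitp U B (n + k) x <= gap U B n k x + exitp K (~` K) n x.
Proof.
have fx j : frac (exitp K (~` K) j) by exact: (frac_exitp mK j mCK).
elim: n x => [|n IH] x; (have [Kx|Kx] := pselect (K x); last first);
  try by rewrite [exitp K _ _ x]exitp_out// indicE mem_set// (le_trans (le1 _ (fe _)))// lerDr ge0.
- by rewrite gap0 ?exitp0 ?addr0//; exact: KU.
have Ux := KU Kx; rewrite addSn exitpS// gapS// [exitp K _ _ _]exitpS//.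
rewrite !KopE -ExD; [|exact: ig|exact: ig].
by apply: Ex_le => [||z]; [exact: ig|apply: integD; exact: ig|exact: IH].
Qed.

(** Every cycle lasts at least N steps, so l closed cycles and N' further steps reach time l N + N'.
    The window must then be long enough, at least c0, for the i cycles in which the exit into B is
    collected; the subtracted p accounts for an exit during the N' steps. *)
Lemma cycle_gap_lower i l : p <= A i -> exists c0, forall n k x, core x -> (n <= l * N + N')%N -> (c0 <= k)%N ->
  (A i - p) * s ^+ l <= gap U B n k x.
Proof.
move=> pA; have w0 j : 0 <= (A i - p) * s ^+ j by rewrite mulr_ge0 ?subr_ge0 ?exprn_ge0.
elim: l => [|l [c0 IH]].
  exists (i * L)%N => n k x Cx; rewrite mul0n add0n expr0 mulr1 => nN ik.
  rewrite lerBlDr; apply: le_trans (cycle_exit_lower (k := (n + k)%N) Cx _) _.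
    by apply: leq_trans ik _; exact: leq_addl.
  apply: le_trans (exit_le_gap _ _ _) _; rewrite lerD2l; apply: le_trans (exit_p Cx).
  apply: (exitp_le mK x mCK); apply: leq_trans nN _; exact: leq_addl.
exists (c0 + (l.+1 * N + N'))%N => n k x Cx nl ck.
pose k' := (k - (l.+1 * N + N' - n))%N.
have ek : (k' + (l.+1 * N + N' - n))%N = k by rewrite subnK//; apply: leq_trans ck; apply: leq_trans (leq_subr _ _) _; exact: leq_addl.
have ck' : (c0 <= k')%N.
  rewrite leq_subRL; last by rewrite -ek leq_addl.
  by apply: leq_trans ck; rewrite addnC leq_add2l leq_subr.
have en : (n + (l.+1 * N + N' - n))%N = (l.+1 * N + N')%N by rewrite subnKC.
rewrite -ek; apply: le_trans (gap_le mU mB _ _ _ _); rewrite en.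
have h1 j y : K y -> Kop (gap U B (l * N + j) k') y <= gap U B (l * N + j.+1) k' y.
  by move=> /KU Uy; rewrite addnS gapS.
have h2 j y : (j <= N')%N -> core y -> (A i - p) * s ^+ l <= gap U B (l * N + j) k' y.
  by move=> jN Cy; apply: IH => //; rewrite leq_add2l.
have h3 j y : ~ K y -> \1_set0 y <= gap U B (l * N + j) k' y by move=> _; rewrite indicE in_set0 ge0.
have := @block_lower K core set0 mK mC measurable0 (fun j => gap U B (l * N + j) k') _ (fun j => fg (l * N + j) k') (w0 l) h1 N' h2 h3 N x.
have -> : (l * N + (N + N') = l.+1 * N + N')%N by rewrite mulSn addnA (addnC N).
apply: le_trans; rewrite -[leLHS]add0r; apply: lerD; first by apply: ge0; exact: (frac_exitp mK N measurable0).
by rewrite exprSr mulrA; exact: damp.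
Qed.

Lemma cycle_gap_lower_from i l : p <= A i -> exists c0, forall n k x, (n <= l * N + N')%N -> (c0 <= k)%N ->
  (A i - p) * s ^+ l * (1 - ep - exitp K (~` K) N' x) <= gap U B n k x.
Proof.
move=> pA; have w0 j : 0 <= (A i - p) * s ^+ j by rewrite mulr_ge0 ?subr_ge0 ?exprn_ge0.
have [c0 IH] := cycle_gap_lower l pA.
exists (c0 + (l * N + N'))%N => n k x nl ck.
pose k' := (k - (l * N + N' - n))%N.
have ek : (k' + (l * N + N' - n))%N = k by rewrite subnK//; apply: leq_trans ck; apply: leq_trans (leq_subr _ _) _; exact: leq_addl.
have ck' : (c0 <= k')%N.
  rewrite leq_subRL; last by rewrite -ek leq_addl.
  by apply: leq_trans ck; rewrite addnC leq_add2l leq_subr.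
have en : (n + (l * N + N' - n))%N = (l * N + N')%N by rewrite subnKC.
rewrite -ek; apply: le_trans (gap_le mU mB _ _ _ _); rewrite en.
have h1 j y : K y -> Kop (gap U B (l * N + j) k') y <= gap U B (l * N + j.+1) k' y.
  by move=> /KU Uy; rewrite addnS gapS.
have h2 j y : (j <= N')%N -> core y -> (A i - p) * s ^+ l <= gap U B (l * N + j) k' y.
  by move=> jN Cy; apply: IH => //; rewrite leq_add2l.
have := @return_lower K core mK mC (fun j => gap U B (l * N + j) k') _ (fun j => fg (l * N + j) k') (w0 l) h1 N' h2 N' x (leqnn _).
apply: le_trans; apply: ler_wpM2l => //; rewrite lerD2r lerD2l lerN2; exact: ret_ep.
Qed.

Lemma exit_within n x : exitp U (~` U) n x <= exitp K (~` K) n x.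
Proof.
have mCU : measurable (~` U : set Xm) by exact: measurableC.
have fx j : frac (exitp K (~` K) j) by exact: (frac_exitp mK j mCK).
have fu j : frac (exitp U (~` U) j) by exact: (frac_exitp mU j mCU).
elim: n x => [|n IH] x; (have [Kx|Kx] := pselect (K x); last first);
  try by rewrite [leRHS]exitp_out// indicE mem_set// (le1 _ (fu _)).
- by rewrite !exitp0//; exact: KU.
rewrite exitpS; last exact: KU.
by rewrite exitpS//; apply: (Kop_le x (fu n) (fx n)).
Qed.

(** The same scheme for the event of no exit at all. It serves the case of zero intensity, where
    there is no exit into a target to collect. *)
Lemma cycle_survival l n x : p <= 1 -> ep <= 1 -> (n <= l * N + N')%N ->
  (1 - p) * s ^+ l * (1 - ep - exitp K (~` K) N' x) <= 1 - exitp U (~` U) n x.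
Proof.
move=> p1 e1; have mCU : measurable (~` U : set Xm) by exact: measurableC.
have fu j : frac (exitp U (~` U) j) by exact: (frac_exitp mU j mCU).
pose h j y := 1 - exitp U (~` U) j y.
have fh j : frac (h j).
  split=> [|y]; first by apply: measurable_funB; [exact: measurable_cst|exact: (fu j).1].
  by have /andP[h0 h1] := (fu j).2 y; rewrite subr_ge0 h1 gerBl.
have hS j y : K y -> Kop (h j) y <= h j.+1 y.
  move=> /KU Uy; rewrite /h exitpS// KopE ExB ?Ex_cst//; [exact: integ_cst|exact: ig].
have hmono j j' y : (j <= j')%N -> h j' y <= h j y.
  by move=> jj; rewrite lerD2l lerN2; exact: (exitp_le mU y mCU jj).
have w0 j : 0 <= (1 - p) * s ^+ j by rewrite mulr_ge0 ?subr_ge0 ?exprn_ge0.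
have incore i j y : core y -> (j <= i * N + N')%N -> (1 - p) * s ^+ i <= h j y.
  elim: i j y => [|i IH] j y Cy ji.
    rewrite expr0 mulr1 /h lerD2l lerN2; apply: le_trans (exit_within _ _) _; apply: le_trans (exit_p Cy).
    apply: (exitp_le mK y mCK); apply: leq_trans ji _; rewrite mul0n; exact: leq_addl.
  apply: le_trans (hmono _ _ _ ji).
  have h1 j' z : K z -> Kop (h (i * N + j')%N) z <= h (i * N + j'.+1)%N z by move=> Kz; rewrite addnS; exact: hS.
  have h2 j' z : (j' <= N')%N -> core z -> (1 - p) * s ^+ i <= h (i * N + j')%N z.
    by move=> jN Cz; apply: IH => //; rewrite leq_add2l.
  have h3 j' z : ~ K z -> \1_set0 z <= h (i * N + j')%N z by move=> _; rewrite indicE in_set0 (ge0 _ (fh _)).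
  have := @block_lower K core set0 mK mC measurable0 (fun j' => h (i * N + j')%N) _ (fun j' => fh (i * N + j')%N) (w0 i) h1 N' h2 h3 N y.
  have -> : (i * N + (N + N') = i.+1 * N + N')%N by rewrite mulSn addnA (addnC N).
  apply: le_trans; rewrite -[leLHS]add0r; apply: lerD; first by apply: ge0; exact: (frac_exitp mK N measurable0).
  by rewrite exprSr mulrA; exact: damp.
move=> nl; apply: le_trans (hmono _ _ x nl).
have h1 j' z : K z -> Kop (h (l * N + j')%N) z <= h (l * N + j'.+1)%N z by move=> Kz; rewrite addnS; exact: hS.
have h2 j' z : (j' <= N')%N -> core z -> (1 - p) * s ^+ l <= h (l * N + j')%N z.
  by move=> jN Cz; apply: incore => //; rewrite leq_add2l.
have := @return_lower K core mK mC (fun j' => h (l * N + j')%N) _ (fun j' => fh (l * N + j')%N) (w0 l) h1 N' h2 N' x (leqnn _).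
by apply: le_trans; apply: ler_wpM2l => //; rewrite lerD2r lerD2l lerN2; exact: ret_ep.
Qed.
End lower.

End cycles.
End kernel.
End chain.

(** * Large noise, compactness and elementary bounds *)

Section big_noise.
Context {R : realType} {d : nat}.
Local Notation Xd := (borel 'cV[R]_d).
Variable lw : probability Xd R.

Definition big (dl eta : R) (z : 'cV[R]_d) : R := 1 - small dl eta z.

Lemma bigE dl eta z : 0 < eta -> big dl eta z = (dl < eta * enorm z)%R%:R.
Proof. by move=> e0; rewrite /big /small; case: leP => _; rewrite ?subrr ?subr0. Qed.

Lemma big01 dl eta z : 0 <= big dl eta z <= 1.
Proof. by have /andP[h1 h2] := small01 dl eta z; rewrite /big subr_ge0 h2 gerBl. Qed.

Lemma measurable_big dl eta : measurable_fun setT (big dl eta : Xd -> measurableTypeR R).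
Proof. by apply: measurable_funB => //; exact: measurable_small. Qed.

Lemma integ_big dl eta : integ lw (big dl eta).
Proof. by apply: integ01; [exact: measurable_big|exact: big01]. Qed.

Lemma Ex_big dl eta : 0 < eta -> Ex lw (big dl eta) = tl lw (dl / eta).
Proof.
move=> e0; rewrite /tl -Ex_indic; last exact: measurable_gt_enorm.
apply: Ex_eq => z; rewrite bigE// indicE; case: (ltP dl (eta * enorm z)) => zs.
  by rewrite mem_set//= ltr_pdivrMr// mulrC.
by rewrite memNset//=; apply/negP; rewrite -leNgt ler_pdivlMr// mulrC.
Qed.

End big_noise.

Section uniformity.
Context {R : realType} {m : nat}.

(** Compactness in covering form, with eta as the parameter, turns a threshold near each point into
    one threshold for the whole set. *)
Lemma ev_compact (C : set 'cV[R]_m) (P : R -> 'cV[R]_m -> Prop) : compact C ->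
  (forall x, C x -> exists2 r, 0 < r & ev (fun eta => forall z, C z -> enorm (z - x) < r -> P eta z)) ->
  ev (fun eta => forall z, C z -> P eta z).
Proof.
move=> /compact_near_coveringP/(_ R (0^'+)) /(_ (fun k x => C x -> P k x) (at_right_proper_filter 0)) h loc.
apply/ev_near; apply: filterS (h _) => [eta he z Cz|x Cx]; first exact: he.
have [r r0 /ev_near hr] := loc x Cx.
exists ([set z | enorm (z - x) < r], [set eta | forall z, C z -> enorm (z - x) < r -> P eta z]).
  by split => /=; [exact: near_enorm|exact: hr].
by move=> [z eta] /= [zx he] Cz; exact: he.
Qed.

Lemma uniform_on_compact (C : set 'cV[R]_m) (g : 'cV[R]_m -> R) : compact C ->
  (forall x kappa, C x -> 0 < kappa -> exists2 dl, 0 < dl & forall z, C z -> enorm (z - x) < dl -> `|g z - g x| <= kappa) ->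
  forall kappa, 0 < kappa -> exists2 dl, 0 < dl & forall x z, C x -> C z -> enorm (z - x) < dl -> `|g z - g x| <= kappa.
Proof.
move=> cC cg kappa k0.
have [|dl dl0 h] := ev_ex (@ev_compact C (fun eta x => forall z, C z -> enorm (z - x) < eta -> `|g z - g x| <= kappa) cC _).
  move=> x Cx; have k2 : 0 < kappa / 2 by rewrite divr_gt0.
  have [dl dl0 h] := cg x (kappa / 2) Cx k2.
  have dl2 : 0 < dl / 2 by rewrite divr_gt0.
  exists (dl / 2) => //; apply: ev_imp (ev_lt dl2) => eta e0 ed z Cz zx z' Cz' z'z.
  have h1 : `|g z - g x| <= kappa / 2 by apply: h => //; apply: lt_le_trans zx _; rewrite ler_pdivrMr// ler_pMr// ler1n.
  have h2 : `|g z' - g x| <= kappa / 2.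
    apply: h => //; apply: le_lt_trans (enorm_sub_triangle z _ _) _.
    by rewrite (splitr dl) ltrD// (lt_trans z'z).
  by apply: le_trans (ler_distD (g x) _ _) _; rewrite (splitr kappa) lerD// distrC.
by exists dl => // x z Cx Cz zx; apply: h.
Qed.

End uniformity.

Lemma powR_small {R : realType} (alpha c : R) : 0 < alpha -> 0 < c -> exists2 M, 0 < M & M `^ (- alpha) < c.
Proof.
move=> a0 c0; have [x x0 h] := ev_ex (ev_powR a0 c0).
by exists x^-1; [rewrite invr_gt0|rewrite -powR_inv1 ?ltW// -powRrM mulN1r opprK].
Qed.

Lemma dist_itv {R : realType} (B x y : R) : 0 <= x <= B -> 0 <= y <= B -> `|x - y| <= B.
Proof. by move=> /andP[x0 xB] /andP[y0 yB]; rewrite ler_norml; apply/andP; split; lra. Qed.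

Section step_functions.
Context {R : realType}.
Local Notation TR := (measurableTypeR R).

(** Intervals open on the left leave out time 0, at which no jump is allowed; a Riemann sum becomes
    an integral. *)
Definition stepf (eta : R) (g : nat -> R) N (s : R) : R :=
  \sum_(0 <= l < N) g l * \1_(`]l%:R * eta, l.+1%:R * eta]%classic : set R) s.

Lemma stepf_out eta g N s : 0 < eta -> s <= 0 \/ N%:R * eta < s -> stepf eta g N s = 0.
Proof.
move=> e0 hs; rewrite /stepf big_nat big1// => l /andP[_ lN].
rewrite indicE memNset ?mulr0//= in_itv/= => /andP[l1 l2]; case: hs => hs.
  by have := lt_le_trans l1 hs; rewrite ltNge mulr_ge0// ltW.
have := lt_le_trans hs l2; rewrite ltNge => /negP; apply.
by rewrite ler_pM2r// ler_nat.
Qed.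

Lemma stepf_in eta g N s : 0 < eta -> 0 < s <= N%:R * eta ->
  exists l, [/\ (l < N)%N, l%:R * eta < s <= l.+1%:R * eta & stepf eta g N s = g l].
Proof.
move=> e0; elim: N => [|N IH] /andP[s0 sN]; first by have := lt_le_trans s0 sN; rewrite mul0r ltxx.
have [sN'|Ns] := leP s (N%:R * eta).
  have [|l [lN ls E]] := IH; first by rewrite s0.
  exists l; split=> //; first exact: ltnW.
  rewrite /stepf big_nat_recr//= -/(stepf eta g N s) E indicE memNset ?mulr0 ?addr0//= in_itv/=.
  by rewrite ltNge sN'.
exists N; split=> //; first by rewrite Ns.
rewrite /stepf big_nat_recr//= -/(stepf eta g N s) stepf_out ?add0r//; last by right.
by rewrite indicE mem_set ?mulr1//= in_itv/= Ns.
Qed.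

Lemma measurable_stepf eta g N : measurable_fun setT (stepf eta g N : TR -> TR).
Proof. by apply: measurable_sum => l; apply: measurable_funM => //; apply: measurable_indic. Qed.

Lemma stepf_ge0 eta g N s : (forall l, 0 <= g l) -> 0 <= stepf eta g N s.
Proof. by move=> g0; apply: sumr_ge0 => l _; rewrite mulr_ge0// indicE. Qed.

Lemma int_stepf eta g N : 0 < eta -> (forall l, 0 <= g l) ->
  (\int[lebesgue_measure]_(s in [set: TR]) (stepf eta g N s)%:E = (\sum_(0 <= l < N) eta * g l)%:E)%E.
Proof.
move=> e0 g0; elim: N => [|N IH].
  by rewrite big_geq// integral0_eq// => s _; rewrite /stepf big_geq.
transitivity (\int[lebesgue_measure]_(s in [set: TR])
    ((stepf eta g N s)%:E + (g N * \1_(`]N%:R * eta, N.+1%:R * eta]%classic : set R) s)%:E))%E.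
  by apply: eq_integral => s _; rewrite /stepf big_nat_recr//= EFinD.
rewrite ge0_integralD//; last 4 first.
- by move=> s _; rewrite lee_fin stepf_ge0.
- by apply/measurable_EFinP; exact: measurable_stepf.
- by move=> s _; rewrite lee_fin mulr_ge0// indicE.
- by apply/measurable_EFinP; apply: measurable_funM => //; apply: measurable_indic.
rewrite IH big_nat_recr//= EFinD; congr (_ + _)%E.
rewrite (int_cst_indic lebesgue_measure)//.
rewrite [X in (_ * X)%E](_ : _ = eta%:E).
  by rewrite -EFinM mulrC.
transitivity (lebesgue_measure (`]N%:R * eta, N.+1%:R * eta]%classic : set TR)); first by [].
rewrite lebesgue_measure_itv/= lte_fin ltr_pM2r// ltr_nat leqnn -EFinB.
by congr EFin; rewrite -natr1; ring.
Qed.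

End step_functions.

Section real_bounds.
Context {R : realType}.
Implicit Types (C x t : R).

(** This and the two definitions after it are the bounds that the cycle estimates produce when all
    errors are measured by one slack x. Their values at x = 0 are the limits to be proved, so
    continuity at 0 finishes the passage to the limit. *)
Definition upper_limit C Cb t x :=
  expR (- ((C - x) / C / (1 + x) * (t - x))) * ((1 + x) * (Cb + 2 * x) / (C - x)) + 2 * ((1 + x) * x) / (C - x) + 2 * x.

Definition lower_limit C Ci t x :=
  ((Ci - x) / ((1 + x) * (C + x) + x) * (1 - x) - x) *
  expR (- ((t / C * ((1 + x) * (C + x) + x) + x) / (1 - x))) * (1 - 2 * x).

Definition survival_limit t x := 1 - (1 - x) * expR (- ((t * ((1 + x) * x + x) + x) / (1 - x))) * (1 - 2 * x).

(** A wrapper with its own constructor around convergence at 0, on which the limits of the explicit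
    bounds are assembled term by term. *)
Variant tends (f : R -> R) (l : R) : Prop := Tends of f x @[x --> (0 : R)] --> l.
Lemma small_arg (F : R -> R) c kappa : 0 < c -> 0 < kappa -> tends F (F 0) ->
  exists k, [/\ 0 < k, k < c & `|F k - F 0| <= kappa].
Proof.
move=> c0 k0 [] /cvgrPdist_le/(_ kappa k0)/nbhs_ballP[e /= e0 he].
have m0 : 0 < Num.min e c by rewrite lt_min e0.
exists (Num.min e c / 2); split; first by rewrite divr_gt0.
  by rewrite ltr_pdivrMr// (le_lt_trans (_ : _ <= c))// ?ge_min ?lexx ?orbT// ltr_pMr// ltr1n.
rewrite distrC; apply: he; rewrite /ball/= sub0r normrN gtr0_norm ?divr_gt0//.
by rewrite ltr_pdivrMr// (le_lt_trans (_ : _ <= e))// ?ge_min ?lexx// ltr_pMr// ltr1n.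
Qed.

Let id0 : tends (fun x => x) 0. Proof. by split; exact: cvg_id. Qed.
Let cst (k : R) : tends (fun=> k) k. Proof. by split; exact: cvg_cst. Qed.
Let ecvg (f : R -> R) (l : R) : tends f l -> tends (fun x => expR (f x)) (expR l).
Proof. by case=> h; split; apply: (continuous_cvg _ (@continuous_expR R l) h). Qed.
Let addc (f g : R -> R) (l k : R) : tends f l -> tends g k -> tends (fun x => f x + g x) (l + k).
Proof. by case=> hf [hg]; split; apply: cvgD. Qed.
Let subc (f g : R -> R) (l k : R) : tends f l -> tends g k -> tends (fun x => f x - g x) (l - k).
Proof. by case=> hf [hg]; split; apply: cvgB. Qed.
Let mulc (f g : R -> R) (l k : R) : tends f l -> tends g k -> tends (fun x => f x * g x) (l * k).
Proof. by case=> hf [hg]; split; apply: cvgM. Qed.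
Let oppc (f : R -> R) (l : R) : tends f l -> tends (fun x => - f x) (- l).
Proof. by case=> hf; split; apply: cvgN. Qed.
Let invc (f : R -> R) (l : R) : l != 0 -> tends f l -> tends (fun x => (f x)^-1) l^-1.
Proof. by move=> l0 [hf]; split; apply: cvgV. Qed.
Let one_plus : tends (fun x => 1 + x) (1 + 0). Proof. exact: addc (cst 1) id0. Qed.
Let one_minus : tends (fun x => 1 - x) (1 - 0). Proof. exact: subc (cst 1) id0. Qed.
Let twice : tends (fun x => 2 * x) (2 * 0). Proof. exact: mulc (cst 2) id0. Qed.
Let m0 : 1 - 0 != 0 :> R. Proof. by rewrite subr0 oner_eq0. Qed.

Lemma upper_limit_cvg C Cb t : 0 < C -> tends (upper_limit C Cb t) (upper_limit C Cb t 0).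
Proof.
move=> C0; have Cm : tends (fun x => C - x) (C - 0) by exact: subc (cst C) id0.
have Cm0 : C - 0 != 0 by rewrite subr0 gt_eqF.
have p0 : 1 + 0 != 0 :> R by rewrite addr0 oner_eq0.
have h1 := oppc (mulc (mulc (mulc Cm (cst C^-1)) (invc p0 one_plus)) (subc (cst t) id0)).
have h2 := mulc (mulc one_plus (addc (cst Cb) twice)) (invc Cm0 Cm).
have h3 := mulc (mulc (cst 2) (mulc one_plus id0)) (invc Cm0 Cm).
exact: addc (addc (mulc (ecvg h1) h2) h3) twice.
Qed.

Lemma lower_limit_cvg C Ci t : 0 < C -> tends (lower_limit C Ci t) (lower_limit C Ci t 0).
Proof.
move=> C0; have d1 := addc (mulc one_plus (addc (cst C) id0)) id0.
have d0 : (1 + 0) * (C + 0) + 0 != 0 by rewrite !addr0 mul1r gt_eqF.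
have h1 := oppc (mulc (addc (mulc (cst (t / C)) d1) id0) (invc m0 one_minus)).
have h2 := subc (mulc (mulc (subc (cst Ci) id0) (invc d0 d1)) one_minus) id0.
exact: mulc (mulc h2 (ecvg h1)) (subc (cst 1) twice).
Qed.

Lemma survival_limit_cvg t : tends (survival_limit t) (survival_limit t 0).
Proof.
have h1 := oppc (mulc (addc (mulc (cst t) (addc (mulc one_plus id0) id0)) id0) (invc m0 one_minus)).
exact: subc (cst 1) (mulc (mulc one_minus (ecvg h1)) (subc (cst 1) twice)).
Qed.

Lemma upper_limit0 C Cb t : 0 < C -> upper_limit C Cb t 0 = Cb / C * expR (- t).
Proof.
move=> C0; rewrite /upper_limit !(addr0, subr0, mulr0, mul0r, mul1r) divr1 divff ?gt_eqF// mul1r.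
by rewrite mulrC.
Qed.

Lemma lower_limit0 C Ci t : 0 < C -> lower_limit C Ci t 0 = Ci / C * expR (- t).
Proof.
by move=> C0; rewrite /lower_limit !(addr0, subr0, mulr0, mul0r, mul1r, mulr1) divr1 divfK// gt_eqF.
Qed.

Lemma survival_limit0 t : survival_limit t 0 = 0.
Proof. by rewrite /survival_limit !(addr0, subr0, mulr0, mul0r, mul1r, mulr1) oppr0 expR0 subrr. Qed.

Lemma pow_le_exp (p : R) n : p <= 1 -> (1 - p) ^+ n <= expR (- (p * n%:R)).
Proof.
move=> p1; rewrite -mulNr mulrC expRM_natl; apply: lerXn2r; rewrite ?nnegrE ?expR_ge0 ?subr_ge0//.
exact: expR_ge1Dx.
Qed.

(** exp(-x/(1-x)) <= 1 - x, from 1 + x/(1-x) = 1/(1-x); then x/(1-x) <= x/(1-k). *)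
Lemma exp_le_pow (x k : R) n : 0 <= x -> x <= k -> k < 1 -> expR (- (x * n%:R / (1 - k))) <= (1 - x) ^+ n.
Proof.
move=> x0 xk k1; have k10 : 0 < 1 - k by rewrite subr_gt0.
have x1 : 0 < 1 - x by rewrite subr_gt0 (le_lt_trans xk).
apply: (@le_trans _ _ (expR (- (x / (1 - x)) * n%:R))).
  rewrite ler_expR mulNr lerN2 [leRHS]mulrAC; apply: ler_wpM2r => //; apply: ler_wpM2l => //.
  by rewrite lef_pV2 ?posrE// lerD2l lerN2.
rewrite mulrC expRM_natl; apply: lerXn2r; rewrite ?nnegrE ?expR_ge0 ?(ltW x1)//.
rewrite expRN -[leRHS]invrK lef_pV2 ?posrE ?expR_gt0 ?invr_gt0//.
apply: le_trans (expR_ge1Dx _).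
by rewrite le_eqVlt; apply/orP; left; apply/eqP; field; exact: lt0r_neq0.
Qed.

End real_bounds.

(** * Exit intensities *)

Section model.
Context {R : realType} {m d : nat}.
Variables (a : 'cV[R]_m -> 'cV[R]_m) (sigma : 'cV[R]_m -> 'M[R]_(m, d)) (D : R).
Hypothesis aD : forall x y, enorm (a x - a y) <= D * enorm (x - y).
Hypothesis sD : forall x y, opnorm (sigma x - sigma y) <= D * enorm (x - y).
Hypothesis D0 : 0 <= D.
Variable y_ : R -> 'cV[R]_m -> 'cV[R]_m.
Hypothesis y_flow : forall x, ode_sol a x (y_ ^~ x).
Variable b : R.
Hypothesis b_gt0 : 0 < b.
Variables (U : set 'cV[R]_m) (c e M : R).
Hypotheses (c_gt0 : 0 < c) (e_gt0 : 0 < e) (UM : U `<=` eball M 0).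
Variable J : nat.
Hypothesis ball_safe0 : forall x s, enorm x <= e -> 0 <= s -> shrink U c (y_ s x).
Hypothesis ball_jump_safe : forall k v w, (k.+2 <= J)%N -> enorm v <= e ->
  safe sigma y_ b U c e k 1 (jump sigma b v w).
Hypothesis flow_uni : forall c r, 0 < c -> 0 < r -> exists c' T, [/\ 0 < c', 0 <= T &
  forall x, shrink U c x -> (forall t, 0 <= t -> shrink U c' (y_ t x)) /\
     (forall t, T <= t -> enorm (y_ t x) <= r)].

Local Notation TR := (measurableTypeR R).
Local Notation Xm := (borel 'cV[R]_m).
Local Notation Xd := (borel 'cV[R]_d).

Variable mu : {sigma_finite_measure set Xd -> \bar R}.
Variable alpha : R.
Hypothesis alpha_gt1 : 1 < alpha.
Hypothesis mu_tail : forall r, 0 < r -> mu [set w | r <= enorm w] = (r `^ (- alpha))%:E.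
Variable r0 : R.
Hypothesis r0_gt0 : 0 < r0.
Hypothesis U_open : open U.
Variable lw : probability Xd R.
Hypothesis tl_rv : forall t, 0 < t -> tl lw (t * x) / tl lw x @[x --> +oo] --> t `^ (- alpha).
Hypothesis mean0 : forall i, Ex lw (fun z : Xd => (z : 'cV[R]_d) i ord0) = 0.
Hypothesis law_cvg : forall (g : 'cV[R]_d -> R) r B kappa, 0 < r -> continuous g ->
  (forall w, 0 <= g w <= B) -> (forall w, enorm w <= r -> g w = 0) -> 0 < kappa ->
  ev (fun eta => `|Ex lw (fun z : Xd => g (eta *: (z : 'cV[R]_d))) - tl lw eta^-1 * fine (\int[mu]_w (g w)%:E)%E|
                   <= kappa * tl lw eta^-1).
Hypothesis J_gt0 : (0 < J)%N.
Hypothesis core_margin : r0 <= 1 / 2 / 2 ^+ J.-1.+2 * c.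
Hypothesis flow_core : forall rho x s, 0 <= rho <= e / 2 -> enorm x <= rho -> 0 <= s -> enorm (y_ s x) <= rho.

Local Notation exitp := (exitp a sigma b lw).
Local Notation ret := (ret a sigma b lw).
Local Notation move := (move a sigma b).
Local Notation Kop := (Kop a sigma b lw).
Local Notation lam := (lam lw).
Local Notation gap := (gap a sigma b lw).
Local Notation step := (step sigma y_ b).
Local Notation safe := (safe sigma y_ b U c e).
Local Notation jump := (jump sigma b).

Let half0 : 0 < 1 / 2 :> R. Proof. by rewrite divr_gt0. Qed.
Let half01 : 0 < (1 / 2 : R) <= 1. Proof. by apply/andP; split; lra. Qed.
Let quarter01 : 0 < (1 / 2 / 2 : R) <= 1. Proof. by apply/andP; split; lra. Qed.
Let Jlt : (J.-1 < J)%N. Proof. by rewrite prednK. Qed.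

Definition near_path eta x0 r l x := enorm (x - y_ (l%:R * eta) x0) <= r.

Definition bounded_flow x0 := forall s, 0 <= s -> enorm (y_ s x0) <= M.

Lemma Psi0 theta eps : Psi theta eps (0 : 'cV[R]_m) = 2 * m%:R * expR (- (theta * eps)).
Proof.
rewrite /Psi (eq_bigr (fun=> 2 * expR (- (theta * eps)))) => [|i _].
  by rewrite sumr_const card_ord -[LHS]mulr_natl; ring.
rewrite !mxE oppr0 !sub0r mulrN; ring.
Qed.

(** The constants come in a forced order: eps from the tube radius r, then K with K eps large enough
    to beat lam^pw, then dl so small that K Ks dl < p - 1 and no small step is clipped. All are
    uniform in the starting point. *)
Lemma first_jump_setup r T pw kappa dmax : 0 < r <= 1 -> 0 < T -> 0 < kappa -> 0 < dmax ->
  exists eps r1 dl, [/\ 0 < r1, 0 < dl <= dmax, 0 <= eps &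
   ev (fun eta => forall x0, bounded_flow x0 -> forall N, N%:R * eta <= T -> exists (theta : R) (q : nat -> R) (Ce Bn : R),
   [/\ [/\ 0 <= theta, (1 + eta) ^+ N * Psi theta eps (0 : 'cV[R]_m) <= kappa * lam eta ^+ pw, r1 <= q 0%N &
        forall l, (l <= N)%N -> q l + m%:R * eps <= r],
     forall l, (l < N)%N -> enorm (y_ (l.+1%:R * eta) x0 - y_ (l%:R * eta) x0 - eta *: a (y_ (l%:R * eta) x0)) <= Ce * eta ^+ 2,
     forall l, (l < N)%N -> (1 + eta * D) * q l + eta * D * (m%:R * eps) + Ce * eta ^+ 2 <= q l.+1,
     forall l (x : 'cV[R]_m) (z : 'cV[R]_d), (l < N)%N -> near_path eta x0 r l x -> eta * enorm z <= dl ->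
       enorm (eta *: a x + eta *: (sigma x *m z)) <= b &
     (forall l (x : 'cV[R]_m), (l < N)%N -> near_path eta x0 r l x -> forall i : 'I_m,
        Ex lw (fun z : Xd => small dl eta z * expR (theta * noise_inc sigma eta x z i ord0)) <= 1 + eta /\
        Ex lw (fun z : Xd => small dl eta z * expR (theta * - noise_inc sigma eta x z i ord0)) <= 1 + eta) /\
     (forall l (x : 'cV[R]_m) (z : 'cV[R]_d) (i : 'I_m), (l < N)%N -> near_path eta x0 r l x -> eta * enorm z <= dl ->
        `|noise_inc sigma eta x z i ord0| <= Bn)])].
Proof.
move=> /andP[ra0 r1] T0 k0 dm0.
pose E := expR ((D + 1) * T).
have E1 : 1 <= E by rewrite -expR0 ler_expR mulr_ge0 ?addr_ge0// ltW.
have E0 : 0 < E by exact: lt_le_trans E1.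
(* Dominates the dimension, the Lipschitz constant and the Gronwall growth together, so that each
   error term in eps is at most r/8. *)
pose Q := 8 * (m%:R + 1) * (D + 1) * E.
have m0 : 0 <= m%:R :> R by [].
have D10 : 0 < D + 1 by rewrite ltr_wpDl.
have m10 : 0 < m%:R + 1 :> R by rewrite ltr_wpDl.
have Q0 : 0 < Q by rewrite !mulr_gt0.
pose eps := r / Q.
have eps0 : 0 < eps by rewrite divr_gt0.
have epsQ : eps * Q = r by rewrite mulfVK// gt_eqF.
have h8 : 8 * (m%:R * eps) <= r.
  rewrite -epsQ /Q -subr_ge0; have -> : eps * (8 * (m%:R + 1) * (D + 1) * E) - 8 * (m%:R * eps) =
    8 * eps * (m%:R * ((D + 1) * E - 1) + (D + 1) * E) by ring.
  have h : 1 <= (D + 1) * E by apply: (@le_trans _ _ E) => //; rewrite ler_peMl ?(ltW E0)// lerDr.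
  have hd : 0 <= (D + 1) * E by exact: le_trans h.
  apply: mulr_ge0; first by rewrite mulr_ge0// ltW.
  by apply: addr_ge0 => //; apply: mulr_ge0 => //; rewrite subr_ge0.
have h9 : 8 * (D * (m%:R * eps) * E) <= r.
  rewrite -epsQ /Q -subr_ge0; have -> : eps * (8 * (m%:R + 1) * (D + 1) * E) - 8 * (D * (m%:R * eps) * E) =
    8 * eps * E * (m%:R + D + 1) by ring.
  by apply: mulr_ge0; [rewrite mulr_ge0 ?(ltW E0)// mulr_ge0// ltW|rewrite !addr_ge0].
pose Ma := enorm (a 0) + D * (`|M| + 1).
have Ma0 : 0 <= Ma by rewrite addr_ge0 ?enorm_ge0 ?mulr_ge0 ?addr_ge0.
pose Ks := opnorm (sigma 0) + D * (`|M| + 1) + 1.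
have Ks0 : 0 < Ks by rewrite ltr_wpDl// addr_ge0 ?opnorm_ge0 ?mulr_ge0 ?addr_ge0.
have aMa x : enorm x <= `|M| + 1 -> enorm (a x) <= Ma.
  move=> xM; apply: le_trans (enorm_le_add _ (a 0)) _; rewrite lerD2l.
  by apply: le_trans (aD _ _) _; apply: ler_wpM2l => //; rewrite subr0.
have sKs x : enorm x <= `|M| + 1 -> opnorm (sigma x) <= Ks.
  by move=> xM; apply: le_trans (sigma_bounded sD D0 xM) _; rewrite lerDl.
pose K := ((alpha + 1) * pw%:R + 1) / eps.
have al0 : 0 < alpha by apply: lt_trans alpha_gt1.
have K0 : 0 < K by rewrite divr_gt0// ltr_wpDl// mulr_ge0// addr_ge0// ltW.
pose p := 1 + Num.min 1 (alpha - 1) / 2.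
have mn0 : 0 < Num.min 1 (alpha - 1) by rewrite lt_min ltr01 subr_gt0.
have mn1 : Num.min 1 (alpha - 1) <= 1 by rewrite ge_min lexx.
have mna : Num.min 1 (alpha - 1) <= alpha - 1 by rewrite ge_min lexx orbT.
have [p1 p2 pa] : [/\ 1 < p, p <= 2 & p < alpha] by rewrite /p; split; lra.
have KK : 0 < 2 * K * Ks by rewrite mulr_gt0// mulr_gt0.
have K2 : 0 < 2 * Ks by rewrite mulr_gt0.
pose dl := Num.min dmax (Num.min ((p - 1) / (2 * K * Ks)) (b / (2 * Ks))).
have dl0 : 0 < dl.
  by rewrite !lt_min dm0/=; apply/andP; split; apply: divr_gt0; rewrite ?subr_gt0.
have dlm : dl <= dmax by rewrite ge_min lexx.
have dlp : K * Ks * dl < p - 1.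
  have : dl <= (p - 1) / (2 * K * Ks) by rewrite !ge_min lexx orbT.
  rewrite ler_pdivlMr// => h; have : 0 < p - 1 by rewrite subr_gt0.
  by move=> h'; lra.
have dlb : Ks * dl <= b / 2.
  have : dl <= b / (2 * Ks) by rewrite !ge_min lexx !orbT.
  by rewrite ler_pdivlMr// => h; lra.
exists eps, (r / (4 * E)), dl; split.
- by rewrite divr_gt0// mulr_gt0.
- by rewrite dl0.
- exact: ltW.
pose Ce := D * Ma.
have Ce0 : 0 <= Ce by rewrite mulr_ge0.
have c1 : 0 < r / (8 * (Ce + 1) * E).
  by rewrite divr_gt0// !mulr_gt0// ltr_wpDl.
have c2 : 0 < b / (2 * (Ma + 1)) by rewrite divr_gt0// mulr_gt0// ltr_wpDl.
have C0 : 0 <= expR T * (2 * m%:R) by rewrite mulr_ge0 ?expR_ge0 ?mulr_ge0.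
have hK : (alpha + 1) * pw%:R + 1 <= K * eps by rewrite /K mulfVK// gt_eqF.
have H1 := ev_and (ev_lt ltr01) (ev_and (ev_lt c1) (ev_lt c2)).
have H2 := exp_moment alpha_gt1 tl_rv mean0 p1 p2 pa K0 Ks0 dl0 dlp.
have H3 := ev_exp_small alpha_gt1 tl_rv k0 C0 hK.
apply: (ev_and2 _ H1 (ev_and H2 H3)).
move=> eta e0 [e1 [ec1 ec2]] [hexp hsmall] x0 bx0 N NT.
have bfl l : enorm (y_ (l%:R * eta) x0) <= M by apply: bx0; rewrite mulr_ge0// ltW.
have xM l x : near_path eta x0 r l x -> enorm x <= `|M| + 1.
  rewrite /near_path => h; apply: le_trans (enorm_le_add _ (y_ (l%:R * eta) x0)) _.
  by apply: lerD; [apply: le_trans (bfl l) _; exact: ler_norm|exact: le_trans h r1].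
have et3 : Ce * eta * E <= r / 8.
  move: ec1; rewrite ltr_pdivlMr; last by rewrite !mulr_gt0// ltr_wpDl.
  have : 0 <= eta * E by rewrite mulr_ge0 ?ltW.
  move=> h; have -> : eta * (8 * (Ce + 1) * E) = 8 * (Ce * eta * E) + 8 * (eta * E) by ring.
  by move=> h'; lra.
pose e3 := D * (m%:R * eps) + Ce * eta.
have e30 : 0 <= e3 by apply: addr_ge0; apply: mulr_ge0 => //; [exact/mulr_ge0/ltW|exact: ltW].
pose q0 := r / (4 * E) + e3.
have q00 : 0 <= q0 by rewrite addr_ge0// divr_ge0 ?(ltW ra0)// mulr_ge0 ?(ltW E0).
(* The rate D + 1 exceeds the Lipschitz rate by 1: the surplus eta q absorbs the additive error eta
   e3 of each step, because q stays above e3. *)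
pose g := 1 + eta * (D + 1).
have g1 : 1 <= g by rewrite lerDl mulr_ge0 ?(ltW e0) ?(ltW D10).
have L0 : 0 <= logi eta by rewrite /logi oppr_ge0 ln_le0// ltW.
have gE l : (l <= N)%N -> g ^+ l <= E.
  move=> lN; apply: (@le_trans _ _ (g ^+ N)); first exact: ler_weXn2l.
  apply: (@le_trans _ _ (expR (eta * (D + 1)) ^+ N)).
    by apply: lerXn2r; rewrite ?nnegrE ?expR_ge0 ?(le_trans _ g1)//; exact: expR_ge1Dx.
  rewrite -expRM_natl ler_expR.
  by rewrite mulrA [leRHS]mulrC; apply: ler_wpM2r => //; exact: ltW.
have E41 : r / (4 * E) * E = r / 4 by field; rewrite gt_eqF.
exists (K * logi eta), (fun l => q0 * g ^+ l), Ce, (Ks * dl).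
split.
- split.
  + by rewrite mulr_ge0// ltW.
  + apply: le_trans hsmall; rewrite -[leRHS]mulrA; apply: ler_pM.
    * by rewrite exprn_ge0// addr_ge0// ltW.
    * exact: Psi_ge0.
    * apply: (@le_trans _ _ (expR eta ^+ N)).
        by apply: lerXn2r; rewrite ?nnegrE ?expR_ge0 ?addr_ge0 ?(ltW e0)//; exact: expR_ge1Dx.
      by rewrite -expRM_natl ler_expR.
    * by rewrite Psi0.
  + by rewrite expr0 mulr1 /q0 lerDl.
  + move=> l lN; apply: (@le_trans _ _ (q0 * E + m%:R * eps)).
      by rewrite lerD2r; apply: ler_wpM2l => //; exact: gE.
    have -> : q0 * E = r / (4 * E) * E + (D * (m%:R * eps) * E + Ce * eta * E) by rewrite /q0 /e3; ring.
    by rewrite E41; lra.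
- move=> l lN; have -> : l.+1%:R * eta = l%:R * eta + eta by rewrite -natr1; ring.
  apply: (flow_euler aD D0 y_flow) => //; [|by rewrite mulr_ge0// ltW|exact: ltW].
  move=> t t0; apply: aMa; apply: le_trans (bx0 t t0) _.
  by apply: le_trans (ler_norm _) _; rewrite lerDl.
- move=> l lN; rewrite [g ^+ l.+1]exprS.
  have q1 : e3 <= q0 * g ^+ l.
    apply: (@le_trans _ _ q0); first by rewrite /q0 lerDr divr_ge0 ?(ltW ra0)// mulr_ge0 ?(ltW E0).
    by rewrite ler_peMr// exprn_ege1.
  have -> : q0 * (g * g ^+ l) = (1 + eta * D) * (q0 * g ^+ l) + eta * (q0 * g ^+ l) by rewrite /g; ring.
  rewrite -addrA lerD2l; apply: le_trans (ler_wpM2l (ltW e0) q1).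
  by rewrite /e3 le_eqVlt; apply/orP; left; apply/eqP; ring.
- move=> l x z lN tx zd; apply: le_trans (enorm_triangle _ _) _; rewrite !enormZ gtr0_norm//.
  have h1 : eta * enorm (a x) <= b / 2.
    apply: (@le_trans _ _ (eta * (Ma + 1))).
      apply: ler_wpM2l; first exact: ltW.
      by apply: le_trans (aMa _ (xM _ _ tx)) _; rewrite lerDl.
    by move: ec2; rewrite ltr_pdivlMr ?mulr_gt0 ?ltr_wpDl// => h; lra.
  have h2 : eta * enorm (sigma x *m z) <= Ks * dl.
    apply: (@le_trans _ _ (eta * (Ks * enorm z))).
      apply: ler_wpM2l; first exact: ltW.
      by apply: le_trans (enorm_mulmx _ _) _; apply: ler_wpM2r; [exact: enorm_ge0|exact: sKs (xM _ _ tx)].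
    by rewrite mulrCA; apply: ler_wpM2l => //; exact: ltW.
  lra.
- have nE x z i : noise_inc sigma eta x z i ord0 = eta * (row i (sigma x) *m z) ord0 ord0.
    by rewrite /noise_inc -row_mul !mxE.
  have rb x i z : enorm x <= `|M| + 1 -> `|(row i (sigma x) *m z) ord0 ord0| <= Ks * enorm z.
    move=> xx; rewrite -row_mul mxE; apply: le_trans (coord_le_enorm _ i) _.
    by apply: le_trans (enorm_mulmx _ _) _; apply: ler_wpM2r; [exact: enorm_ge0|exact: sKs].
  split.
    move=> l x lN tx i; split.
      rewrite (Ex_eq _ (g := fun z : Xd => small dl eta z * expR (K * logi eta * (eta * (row i (sigma x) *m (z : 'cV[R]_d)) ord0 ord0)))).
        by apply: hexp => z; apply: rb; exact: xM tx.
      by move=> z; rewrite nE.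
    rewrite (Ex_eq _ (g := fun z : Xd => small dl eta z * expR (K * logi eta * (eta * ((- row i (sigma x)) *m (z : 'cV[R]_d)) ord0 ord0)))).
      by apply: hexp => z; rewrite mulNmx mxE normrN; apply: rb; exact: xM tx.
    move=> z; rewrite nE; congr (_ * expR (_ * _)); rewrite mulNmx.
    by move: (row _ _ *m _) => A; rewrite mxE mulrN.
  move=> l x z i lN tx zd; rewrite nE normrM gtr0_norm//.
  apply: (@le_trans _ _ (eta * (Ks * enorm z))).
    by apply: ler_wpM2l; [exact: ltW|apply: rb; exact: xM tx].
  by rewrite mulrCA; apply: ler_wpM2l => //; exact: ltW.
Qed.

Lemma first_jump_upper_ev r T pw kappa dmax : 0 < r <= 1 -> 0 < T -> 0 < kappa -> 0 < dmax ->
  exists r1 dl, [/\ 0 < r1, 0 < dl <= dmax &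
  ev (fun eta => forall x0, bounded_flow x0 -> forall N, N%:R * eta <= T ->
    forall (w : nat -> 'cV[R]_m -> R) (beta : nat -> R),
    (forall n, frac (w n)) -> (forall l, 0 <= beta l) ->
    (forall n l x, (l + n.+1 = N)%N -> near_path eta x0 r l x -> w n.+1 x <= Kop eta (w n) x) ->
    (forall x, near_path eta x0 r N x -> w 0%N x <= 0) ->
    (forall n l x, (l + n.+1 = N)%N -> near_path eta x0 r l x ->
       Ex lw (fun z : Xd => big dl eta z * w n (move eta x z)) <= beta l) ->
    forall x, enorm (x - x0) <= r1 -> w N x <= kappa * lam eta ^+ pw + \sum_(0 <= j < N) beta j)].
Proof.
move=> rr T0 k0 dm0; have [eps [r1 [dl [r10 dl0 eps0 h]]]] := first_jump_setup pw rr T0 k0 dm0.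
exists r1, dl; split=> //; apply: ev_imp h => eta e0 h x0 bx0 N NT w beta fw b0 hw hw0 hb x xx0.
have [theta [q [Ce [Bn [[t0 hP q0 qr] hE hq hc [he hn]]]]]] := h x0 bx0 N NT.
have y0 : y_ 0 x0 = x0 := flow0 y_flow x0.
apply: (@le_trans _ _ ((1 + eta) ^+ N * Psi theta eps (0 : 'cV[R]_m) + \sum_(0 <= j < N) beta j)).
  apply: (first_jump_upper aD sD D0 b_gt0 e0 t0 eps0 hE hq qr hc he hn fw b0 hw hw0 hb) => //.
  by rewrite mul0r y0 subr0; exact: le_trans q0.
by rewrite lerD2r.
Qed.

Lemma first_jump_lower_ev r T pw kappa dmax : 0 < r <= 1 -> 0 < T -> 0 < kappa -> 0 < dmax ->
  exists r1 dl, [/\ 0 < r1, 0 < dl <= dmax &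
  ev (fun eta => forall x0, bounded_flow x0 -> forall N, N%:R * eta <= T ->
    forall (v : nat -> 'cV[R]_m -> R) (beta : nat -> R),
    (forall n, frac (v n)) -> (forall l, 0 <= beta l) -> \sum_(0 <= j < N) beta j <= 1 ->
    (forall n l x, (l + n.+1 = N)%N -> near_path eta x0 r l x -> Kop eta (v n) x <= v n.+1 x) ->
    (forall n l x, (l + n.+1 = N)%N -> near_path eta x0 r l x ->
       beta l <= Ex lw (fun z : Xd => big dl eta z * v n (move eta x z))) ->
    forall x, enorm (x - x0) <= r1 ->
      (1 - tl lw (dl / eta)) ^+ N * \sum_(0 <= j < N) beta j <= v N x + kappa * lam eta ^+ pw)].
Proof.
move=> rr T0 k0 dm0; have [eps [r1 [dl [r10 dl0 eps0 h]]]] := first_jump_setup pw rr T0 k0 dm0.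
exists r1, dl; split=> //; apply: ev_imp h => eta e0 h x0 bx0 N NT v beta fv b0 b1 hv hb x xx0.
have [theta [q [Ce [Bn [[t0 hP q0 qr] hE hq hc [he hn]]]]]] := h x0 bx0 N NT.
have y0 : y_ 0 x0 = x0 := flow0 y_flow x0.
have p01 : 0 <= tl lw (dl / eta) <= 1 by rewrite tl_ge0 tl_le1.
have hp : Ex lw (fun z : Xd => 1 - small dl eta z) <= tl lw (dl / eta) by rewrite -Ex_big.
apply: (@le_trans _ _ (v N x + (1 + eta) ^+ N * Psi theta eps (0 : 'cV[R]_m))); last by rewrite lerD2l.
apply: (first_jump_lower aD sD D0 b_gt0 e0 t0 eps0 hE hq qr hc he hn fv b0 b1 p01 hp hv hb) => //.
by rewrite mul0r y0 subr0; exact: le_trans q0.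
Qed.

(** * Finiteness and continuity of the intensities *)

Lemma safe_bound k th x : 0 < th -> safe k th x -> enorm x <= M.
Proof.
move=> th0 /(safe_in y_flow) xU; have /UM : U x by apply: xU; rewrite subrr enorm0 mulr_gt0.
by rewrite /eball/= subr0.
Qed.

Lemma safe_step k th x s w : 0 <= th -> safe k.+1 th x -> 0 <= s -> safe k th (step s x w).
Proof.
move=> th0 xs s0; apply: (safe_jump w xs s0).
by rewrite max_r// subrr enorm0 mulr_ge0// ltW.
Qed.

(** By time T0 the flow is within e of the origin, and a jump from there has full margin by
    [ball_jump_safe], whatever th was. *)
Lemma safe_late_jump th : 0 < th -> exists2 T0, 0 < T0 & forall k x s w,
  (k.+2 <= J)%N -> safe k th x -> T0 < s -> safe k 1 (step s x w).
Proof.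
move=> th0; have [c' [T [c'0 T0 h]]] := flow_uni (mulr_gt0 th0 c_gt0) e_gt0.
exists (T + 1); first by rewrite ltr_wpDl.
move=> k x s w kJ xs Ts; apply: ball_jump_safe => //.
have Ts' : T <= s by apply: ltW; apply: le_lt_trans Ts; rewrite lerDl.
rewrite max_r; last exact: le_trans Ts'.
by have [_] := h x (safe_in y_flow xs); apply.
Qed.

(** A small jump is treated as a deviation from the flow: it does not use up one of the k jumps, it
    only halves the margin. *)
Lemma safe_small_jump th : 0 < th <= 1 -> exists2 d0, 0 < d0 & forall k x s w,
  (k < J)%N -> safe k th x -> 0 <= s -> enorm w <= d0 -> safe k (th / 2) (step s x w).
Proof.
move=> th01; have th0 : 0 < th by case/andP: th01.
have [e1 e10 h] := safe_nbhd aD D0 y_flow c_gt0 e_gt0 ball_safe0 ball_jump_safe flow_uni th01.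
have K0 : 0 <= opnorm (sigma 0) + D * `|M| by rewrite addr_ge0 ?opnorm_ge0 ?mulr_ge0.
pose K := opnorm (sigma 0) + D * `|M| + 1.
have Kp : 0 < K by rewrite ltr_wpDl.
exists (e1 / K); first by rewrite divr_gt0.
move=> k x s w kJ xs s0 wd; apply: (h k x s) => //.
have ys : enorm (y_ s x) <= `|M|.
  by apply: le_trans (ler_norm M); apply: (safe_bound th0 (safe_flow aD y_flow s0 xs)).
rewrite /step max_r//; apply: le_trans (enorm_jump_sub _ _ _ (ltW b_gt0)) _.
apply: (@le_trans _ _ (K * enorm w)).
  by apply: ler_wpM2r; [exact: enorm_ge0|apply: le_trans (sigma_bounded sD D0 ys) _; rewrite lerDl].
by rewrite mulrC -ler_pdivlMr.
Qed.

(** The condition on a state just reached by a jump, with k jumps still to come: all but the last of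
    them are safe, and with none to come the state may lie outside U. *)
Definition adm k th x : Prop := if k is k'.+1 then safe k' th x else True.

Lemma adm_step k th x s w : 0 <= th -> adm k.+1 th x -> 0 <= s -> adm k th (step s x w).
Proof. by case: k => //= k th0; exact: safe_step. Qed.

Let mstep := measurable_step aD sD D0 y_flow b_gt0.

(** Test functions of the exit position. Their vanishing at depth r0 inside U is what keeps the
    intensities finite. *)
Definition exit_obs (h : 'cV[R]_m -> R) :=
  [/\ measurable_fun setT (h : Xm -> TR), forall x, 0 <= h x <= 1 &
      forall x, shrink U r0 x -> h x = 0].

(* The intensity of the k-jump paths from x that end in h, over all jump times. *)
Definition r_ (h : 'cV[R]_m -> R) k x := iter_int step mu (@after R d) (fun x => (h x)%:E) k x.

Lemma exit_obs_ge0 h x : exit_obs h -> (0 <= (h x)%:E)%E.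
Proof. by case=> _ h01 _; rewrite lee_fin; have /andP[] := h01 x. Qed.

Lemma r_ge0 h k x : exit_obs h -> (0 <= r_ h k x)%E.
Proof. by move=> oh; apply: (iter_int_ge0 _ _ (@cutoff_after R d)) => z; exact: exit_obs_ge0. Qed.

Lemma exit_obs_measurable h : exit_obs h -> measurable_fun setT ((fun x => (h x)%:E) : Xm -> \bar R).
Proof. by case=> mh _ _; exact/measurable_EFinP. Qed.

Lemma measurable_r h k : exit_obs h -> measurable_fun setT (r_ h k : Xm -> \bar R).
Proof.
move=> oh; apply: (measurable_iter_int mstep mu (@cutoff_after R d) k (exit_obs_measurable oh)).
by move=> z; exact: exit_obs_ge0.
Qed.

Lemma measurable_r_inner h k x : exit_obs h -> measurable_fun setT
  ((fun s => \int[mu]_w ((after s w)%:E * r_ h k (step s x w)))%E : TR -> \bar R).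
Proof.
move=> oh; apply: (measurable_iter_int_inner mstep mu (@cutoff_after R d) k x (exit_obs_measurable oh)).
by move=> z; exact: exit_obs_ge0.
Qed.

Lemma measurable_r_integrand h k s x : exit_obs h -> measurable_fun setT
  ((fun w => (after s w)%:E * r_ h k (step s x w))%E : Xd -> \bar R).
Proof.
move=> oh; apply: (measurable_iter_int_integrand mstep mu (@cutoff_after R d) k s x (exit_obs_measurable oh)).
by move=> z; exact: exit_obs_ge0.
Qed.

(** Safe jumps keep the path at depth at least th c >= r0, where h vanishes. *)
Lemma r_zero h k th x : exit_obs h -> 0 < th -> r0 <= th * c -> safe k th x -> r_ h k x = 0%E.
Proof.
move=> oh th0 rt; elim: k x => [|k IH] x xs.
  rewrite /r_ /=; case: oh => _ _ -> // z zx; apply: (safe_in y_flow xs).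
  exact: lt_le_trans zx rt.
rewrite /r_ /=; apply: integral0_eq => s _; apply: integral0_eq => w _.
rewrite /after; case: ltP => [s0|_]; last by rewrite mul0e.
by rewrite -/(r_ h k _) IH ?mule0//; apply: safe_step (ltW s0) => //; exact: ltW.
Qed.

(** A jump after T0 starts near the origin, and one of size at most d0 is a mere deviation; in both
    cases the k jumps that remain cannot reach the support of h. Only a bounded range of times and
    noise of finite measure contribute. *)
Lemma r_support th : 0 < th <= 1 -> r0 <= th / 2 * c ->
  exists T0 d0, [/\ 0 < T0, 0 < d0 & forall h k x s w, exit_obs h -> (k.+2 <= J)%N ->
    safe k th x -> 0 <= s -> (T0 < s \/ enorm w <= d0) -> r_ h k (step s x w) = 0%E].
Proof.
move=> th01 rt; have [th0 th1] : 0 < th /\ th <= 1 by case/andP: th01.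
have [T0 T00 hT] := safe_late_jump th0; have [d0 d00 hd] := safe_small_jump th01.
exists T0, d0; split=> // h k x s w oh kJ xs s0 [Ts|wd].
  apply: (r_zero oh _ _ (hT k x s w kJ xs Ts)) => //.
  by apply: le_trans rt _; rewrite ler_wpM2r ?(ltW c_gt0)//; lra.
by apply: (r_zero oh _ _ (hd k x s w (ltnW kJ) xs s0 wd)) => //; rewrite divr_gt0.
Qed.

Lemma mu_ge_measurable q : measurable ([set w | q <= enorm w] : set Xd).
Proof.
have := @measurable_enorm R d measurableT _ (measurable_itv `[q, +oo[).
by rewrite setTI; congr measurable; apply/seteqP; split=> x; rewrite /= in_itv/= andbT.
Qed.

(** Each jump contributes at most T0 in time and d0^-alpha in noise mass; adding 1 makes the powers
    of K increasing. *)
Lemma r_bound th : 0 < th <= 1 -> r0 <= th / 2 * c -> exists2 B : R, 0 < B &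
  forall h k x, exit_obs h -> (k < J)%N -> adm k th x -> (r_ h k x <= B%:E)%E.
Proof.
move=> th01 rt; have th0 : 0 < th by case/andP: th01.
have [T0 [d0 [T00 d00 hs]]] := r_support th01 rt.
have dp : 0 < d0 `^ (- alpha) by rewrite powR_gt0.
pose K := 1 + T0 * d0 `^ (- alpha).
have K1 : 1 <= K by rewrite /K lerDl mulr_ge0 // ltW.
have K0 : 0 <= K by exact: le_trans K1.
exists (K ^+ J); first by rewrite exprn_gt0// (lt_le_trans _ K1).
move=> h k x oh kJ ax; apply: (@le_trans _ _ (K ^+ k)%:E); last first.
  by rewrite lee_fin ler_weXn2l// ltnW.
elim: k x kJ ax => [|k IH] x kJ ax.
  by rewrite expr0 /r_ /= lee_fin; case: oh => _ h01 _; have /andP[] := h01 x.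
have Kk : 0 <= K ^+ k by rewrite exprn_ge0.
have inner s : (\int[mu]_w ((after s w)%:E * r_ h k (step s x w)) <=
    ((K ^+ k * d0 `^ (- alpha)) * \1_(`]0, T0]%classic : set TR) s)%:E)%E.
  have [s0|s0] := ltP 0 s; last first.
    rewrite integral0_eq; last by move=> w _; rewrite /after ltNge s0 mul0e.
    by rewrite lee_fin mulr_ge0// mulr_ge0// ltW.
  have [sT|Ts] := leP s T0; last first.
    rewrite integral0_eq; last by move=> w _; rewrite (hs _ _ x) ?mule0//; [exact: ltW|left].
    by rewrite lee_fin mulr_ge0// mulr_ge0// ltW.
  rewrite indicE mem_set/= ?in_itv/= ?s0// mulr1 EFinM -mu_tail//.
  rewrite -(int_cst_indic mu (mu_ge_measurable d0) Kk).
  apply: ge0_le_integral => //.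
  - by move=> w _; rewrite mule_ge0 ?r_ge0// lee_fin ler0n.
  - exact: measurable_r_integrand.
  - apply/measurable_EFinP; apply: measurable_funM => //.
    by apply: measurable_indic; exact: mu_ge_measurable.
  - move=> w _; rewrite /after s0 mul1e indicE.
    have [dw|wd] := leP d0 (enorm w); last first.
      by rewrite (hs _ _ x) ?lee_fin ?mulr_ge0//; [exact: ltW|right; exact: ltW].
    rewrite mem_set//= mulr1; apply: IH; first exact: ltnW.
    by apply: (adm_step w (ltW th0) ax); exact: ltW.
rewrite /r_ /=; apply: (@le_trans _ _ (\int[lebesgue_measure]_(s in [set: TR])
  (((K ^+ k * d0 `^ (- alpha)) * \1_(`]0, T0]%classic : set TR) s)%:E))%E).
  apply: ge0_le_integral => //.
  - by move=> s _; apply: integral_ge0 => w _; rewrite mule_ge0 ?r_ge0// lee_fin ler0n.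
  - exact: measurable_r_inner.
  - by apply/measurable_EFinP; apply: measurable_funM.
rewrite (int_cst_indic (@lebesgue_measure R))//; last by rewrite mulr_ge0// ltW.
rewrite [X in (_ * X)%E](_ : _ = T0%:E); last exact: lebesgue_initial.
rewrite -EFinM lee_fin exprSr -mulrA.
by rewrite ler_wpM2l// mulrC /K lerDr.
Qed.

Section dominated.
Variable Q : (nat -> 'cV[R]_m) -> 'cV[R]_m -> Prop.
Hypothesis Q_step : forall x_ x s w, Q x_ x -> Q (fun n => step s (x_ n) w) (step s x w).
Variables (f_ : nat -> 'cV[R]_m -> R) (f : 'cV[R]_m -> R).
Hypothesis of_ : forall n, exit_obs (f_ n).
Hypothesis Q_cvg : forall x_ x, Q x_ x -> f_ n (x_ n) @[n --> \oo] --> f x.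

(** One induction for two applications: Q is taken to be constancy of the sequence, with varying
    [f_], or convergence of the sequence, with a fixed continuous f. The dominating functions come
    from [r_support] and [r_bound]. *)
Lemma r_dominated th k (x_ : nat -> 'cV[R]_m) x : 0 < th <= 1 -> r0 <= th / 2 * c -> (k < J)%N ->
  (forall n, adm k th (x_ n)) -> adm k th x -> Q x_ x ->
  r_ (f_ n) k (x_ n) @[n --> \oo] --> r_ f k x.
Proof.
move=> th01 rt; have th0 : 0 < th by case/andP: th01.
have [T0 [d0 [T00 d00 hs]]] := r_support th01 rt.
have [B B0 hB] := r_bound th01 rt.
have B0' := ltW B0.
have dp : 0 < d0 `^ (- alpha) by rewrite powR_gt0.
elim: k x_ x => [|k IH] x_ x kJ ax_ ax Qx.
  by apply: cvg_EFin; [exact: nearW|exact: Q_cvg].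
have dom h z s w : exit_obs h -> adm k.+1 th z ->
    ((after s w)%:E * r_ h k (step s z w) <= (B * \1_[set w | d0 <= enorm w] w)%:E)%E.
  move=> oh az; rewrite /after; case: ltP => [s0|_]; last by rewrite mul0e lee_fin mulr_ge0.
  rewrite mul1e indicE; have [dw|wd] := leP d0 (enorm w); last first.
    by rewrite (hs _ _ z) ?lee_fin ?mulr_ge0//; [exact: ltW|right; exact: ltW].
  rewrite mem_set//= mulr1; apply: hB => //; first exact: ltnW.
  by apply: (adm_step w (ltW th0) az); exact: ltW.
have nonneg h z s w : exit_obs h -> (0 <= (after s w)%:E * r_ h k (step s z w))%E.
  by move=> oh; rewrite mule_ge0 ?r_ge0// lee_fin ler0n.
have intB : mu.-integrable setT (fun w => (B * \1_[set w | d0 <= enorm w] w)%:E).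
  have mB : measurable_fun setT ((fun w => (B * \1_[set w | d0 <= enorm w] w)%:E) : Xd -> \bar R).
    apply/measurable_EFinP; apply: measurable_funM => //.
    by apply: measurable_indic; exact: mu_ge_measurable.
  apply/integrableP; split=> //.
  under eq_integral do rewrite gee0_abs ?lee_fin ?mulr_ge0//.
  rewrite (int_cst_indic mu (mu_ge_measurable d0) B0').
  rewrite [X in (_ * X)%E](_ : _ = (d0 `^ (- alpha))%:E); last exact: mu_tail.
  by rewrite -EFinM ltry.
pose G h z s := (\int[mu]_w ((after s w)%:E * r_ h k (step s z w)))%E.
have Gle h z s : exit_obs h -> adm k.+1 th z ->
    (G h z s <= ((B * d0 `^ (- alpha)) * \1_(`]0, T0]%classic : set TR) s)%:E)%E.
  move=> oh az; have [s0|s0] := ltP 0 s; last first.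
    rewrite /G integral0_eq; last by move=> w _; rewrite /after ltNge s0 mul0e.
    by rewrite lee_fin mulr_ge0// mulr_ge0// ltW.
  have [sT|Ts] := leP s T0; last first.
    rewrite /G integral0_eq; last by move=> w _; rewrite (hs _ _ z) ?mule0//; [exact: ltW|left].
    by rewrite lee_fin mulr_ge0// mulr_ge0// ltW.
  rewrite indicE mem_set/= ?in_itv/= ?s0// mulr1 EFinM -mu_tail//.
  rewrite -(int_cst_indic mu (mu_ge_measurable d0) B0').
  apply: ge0_le_integral => //.
  - by move=> w _; exact: nonneg.
  - exact: measurable_r_integrand.
  - by case/integrableP: intB.
  - by move=> w _; exact: dom.
have cvgG s : G (f_ n) (x_ n) s @[n --> \oo] --> G f x s.
  apply: (@ge0_dominated_cvg _ Xd R mu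
    (fun n w => (after s w)%:E * r_ (f_ n) k (step s (x_ n) w))%E
    (fun w => (after s w)%:E * r_ f k (step s x w))%E (fun w => B * \1_[set w | d0 <= enorm w] w)
    (fun n => measurable_r_integrand k s (x_ n) (of_ n)) _ intB).
  - move=> w; rewrite /after; case: ltP => [s0|_].
      under eq_cvg do rewrite mul1e.
      rewrite mul1e; apply: IH; first exact: ltnW.
      + by move=> n; exact: (adm_step w (ltW th0) (ax_ n) (ltW s0)).
      + exact: (adm_step w (ltW th0) ax (ltW s0)).
      + exact: Q_step.
    by rewrite mul0e; apply: cvg_near_cst; apply: nearW => n; rewrite mul0e.
  - by move=> n w; exact: nonneg.
  - by move=> n w; exact: dom.
apply: (@ge0_dominated_cvg _ TR R lebesgue_measure (fun n => G (f_ n) (x_ n)) (G f x)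
    (fun s => (B * d0 `^ (- alpha)) * \1_(`]0, T0]%classic : set TR) s)
    (fun n => measurable_r_inner k (x_ n) (of_ n))).
- exact: cvgG.
- apply/integrableP; split; first by apply/measurable_EFinP; apply: measurable_funM.
  under eq_integral do rewrite gee0_abs ?lee_fin ?mulr_ge0 ?powR_ge0//.
  rewrite (int_cst_indic (@lebesgue_measure R))//; last by rewrite mulr_ge0// ltW.
  rewrite [X in (_ * X)%E](_ : _ = T0%:E); last exact: lebesgue_initial.
  by rewrite -EFinM ltry.
- by move=> n s; apply: integral_ge0 => w _; exact: nonneg.
- by move=> n s; exact: Gle.
Qed.

End dominated.

(** Intensity of a jump at the present instant followed by k others; at the origin with k = J.-1 it
    is the integral of h against the limit measure. *)
Definition exit_rate (h : 'cV[R]_m -> R) k x := (\int[mu]_w r_ h k (jump x w))%E.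

Lemma exit_rateE h k x : exit_rate h k x = (\int[mu]_w r_ h k (jump x w))%E.
Proof. by []. Qed.

Lemma step0 x w : step 0 x w = jump x w.
Proof. by rewrite /step maxxx (flow0 y_flow). Qed.

Lemma adm_jump th k x w : 0 < th -> safe k th x -> adm k th (jump x w).
Proof.
by move=> th0; case: k => //= k xs; rewrite -step0; apply: safe_step => //; exact: ltW.
Qed.

Lemma measurable_exit_rate_integrand h k x : exit_obs h ->
  measurable_fun setT ((fun w => r_ h k (jump x w)) : Xd -> \bar R).
Proof.
move=> oh; apply: (measurableT_comp (measurable_r k oh)).
apply: (@measurable_continuous2 _ _ 'cV[R]_m 'cV[R]_d 'cV[R]_m (fun p => jump p.1 p.2)
   (fun=> x : Xm) id).
- exact: countable_base_cV.
- exact: countable_base_cV.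
- exact: (jump_continuous sD D0 (ltW b_gt0)).
- exact: measurable_cst.
- exact: measurable_id.
Qed.

Lemma exit_rate_support th : 0 < th <= 1 -> r0 <= th / 2 * c -> exists d0 B : R, [/\ 0 < d0, 0 < B &
  forall h k x w, exit_obs h -> (k < J)%N -> safe k th x ->
    (r_ h k (jump x w) <= (B * \1_[set w | d0 <= enorm w] w)%:E)%E].
Proof.
move=> th01 rt; have [th0 th1] : 0 < th /\ th <= 1 by case/andP: th01.
have [d0 d00 hd] := safe_small_jump th01.
have [B B0 hB] := r_bound th01 rt.
exists d0, B; split=> // h k x w oh kJ xs.
rewrite indicE; have [dw|wd] := leP d0 (enorm w).
  by rewrite mem_set//= mulr1; apply: hB => //; exact: adm_jump.
rewrite -step0 (r_zero oh _ _ (hd k x 0 w kJ xs (lexx 0) (ltW wd))) ?divr_gt0//.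
by rewrite lee_fin mulr_ge0// ltW.
Qed.

Lemma exit_rate_bounded th : 0 < th <= 1 -> r0 <= th / 2 * c -> exists B : R,
  forall h k x, exit_obs h -> (k < J)%N -> safe k th x -> (exit_rate h k x <= B%:E)%E.
Proof.
move=> th01 rt; have [d0 [B [d00 B0 hs]]] := exit_rate_support th01 rt.
exists (B * d0 `^ (- alpha)) => h k x oh kJ xs.
apply: (@le_trans _ _ (\int[mu]_w (B * \1_[set w | d0 <= enorm w] w)%:E)%E).
  apply: ge0_le_integral => //.
  - by move=> w _; exact: r_ge0.
  - exact: measurable_exit_rate_integrand.
  - apply/measurable_EFinP; apply: measurable_funM => //.
    by apply: measurable_indic; exact: mu_ge_measurable.
  - by move=> w _; exact: hs.
rewrite (int_cst_indic mu (mu_ge_measurable d0) (ltW B0)).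
by rewrite [X in (_ * X)%E](_ : _ = (d0 `^ (- alpha))%:E); last exact: mu_tail.
Qed.

Lemma exit_rate_dominated (Q : (nat -> 'cV[R]_m) -> 'cV[R]_m -> Prop) th
    (f_ : nat -> 'cV[R]_m -> R) (f : 'cV[R]_m -> R) k (x_ : nat -> 'cV[R]_m) x :
  (forall x_ x s w, Q x_ x -> Q (fun n => step s (x_ n) w) (step s x w)) ->
  (forall x_ x w, Q x_ x -> Q (fun n => jump (x_ n) w) (jump x w)) ->
  (forall n, exit_obs (f_ n)) ->
  (forall x_ x, Q x_ x -> f_ n (x_ n) @[n --> \oo] --> f x) ->
  0 < th <= 1 -> r0 <= th / 2 * c ->
  (k < J)%N -> (forall n, safe k th (x_ n)) -> safe k th x -> Q x_ x ->
  exit_rate (f_ n) k (x_ n) @[n --> \oo] --> exit_rate f k x.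
Proof.
move=> Qs Qj of_ Qc th01 rt kJ xn xs Qx.
have [d0 [B [d00 B0 hs]]] := exit_rate_support th01 rt.
apply: (@ge0_dominated_cvg _ Xd R mu (fun n w => r_ (f_ n) k (jump (x_ n) w))
  (fun w => r_ f k (jump x w)) (fun w => B * \1_[set w | d0 <= enorm w] w)).
- by move=> n; exact: measurable_exit_rate_integrand.
- move=> w; apply: (@r_dominated Q Qs f_ f of_ Qc th) => //.
  + by move=> n; apply: adm_jump => //; case/andP: th01.
  + by apply: adm_jump => //; case/andP: th01.
  + exact: Qj.
- have mB : measurable_fun setT ((fun w => (B * \1_[set w | d0 <= enorm w] w)%:E) : Xd -> \bar R).
    apply/measurable_EFinP; apply: measurable_funM => //.
    by apply: measurable_indic; exact: mu_ge_measurable.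
  apply/integrableP; split=> //.
  under eq_integral do rewrite gee0_abs ?lee_fin ?mulr_ge0// ?(ltW B0)//.
  rewrite (int_cst_indic mu (mu_ge_measurable d0) (ltW B0)).
  rewrite [X in (_ * X)%E](_ : _ = (d0 `^ (- alpha))%:E); last exact: mu_tail.
  by rewrite -EFinM ltry.
- by move=> n w; exact: r_ge0.
- by move=> n w; exact: hs.
Qed.

Lemma exit_rate_cvg th (f_ : nat -> 'cV[R]_m -> R) (f : 'cV[R]_m -> R) k x :
  (forall n, exit_obs (f_ n)) -> (forall x, f_ n x @[n --> \oo] --> f x) ->
  0 < th <= 1 -> r0 <= th / 2 * c -> (k < J)%N -> safe k th x ->
  exit_rate (f_ n) k x @[n --> \oo] --> exit_rate f k x.
Proof.
move=> of_ fc th01 rt kJ xs.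
apply: (@exit_rate_dominated (fun x_ x => forall n, x_ n = x) th f_ f k (fun=> x)) => //.
- by move=> x_ z s w xz n; rewrite xz.
- by move=> x_ z w xz n; rewrite xz.
- by move=> x_ z xz; under eq_cvg do rewrite xz; exact: fc.
Qed.

Lemma step_cvg (x_ : nat -> 'cV[R]_m) x s w : x_ n @[n --> \oo] --> x ->
  step s (x_ n) w @[n --> \oo] --> step s x w.
Proof.
move=> xx; apply: (cvg_comp (fun n => (s, x_ n, w)) (fun p => step p.1.1 p.1.2 p.2) _
  (step_continuous aD sD D0 y_flow b_gt0 (x := (s, x, w)))).
apply: (@cvg_pair _ _ _ \oo (nbhs (s, x)) (nbhs w) _ _ _ (fun n => (s, x_ n)) (fun=> w)); last exact: cvg_cst.
by apply: (@cvg_pair _ _ _ \oo (nbhs s) (nbhs x) _ _ _ (fun=> s) x_) => //; exact: cvg_cst.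
Qed.

Lemma jump_cvg (x_ : nat -> 'cV[R]_m) x w : x_ n @[n --> \oo] --> x ->
  jump (x_ n) w @[n --> \oo] --> jump x w.
Proof.
move=> xx; apply: (cvg_comp (fun n => (x_ n, w)) (fun p => jump p.1 p.2) _
  (jump_continuous sD D0 (ltW b_gt0) (x := (x, w)))).
by apply: (@cvg_pair _ _ _ \oo (nbhs x) (nbhs w) _ _ _ x_ (fun=> w)) => //; exact: cvg_cst.
Qed.

Lemma exit_rate_continuous th f k x kappa : continuous f -> exit_obs f -> 0 < kappa ->
  0 < th <= 1 -> r0 <= th / 2 * c -> (k < J)%N -> safe k th x ->
  exists2 dl, 0 < dl & forall z, safe k th z -> enorm (z - x) < dl ->
    (exit_rate f k z <= exit_rate f k x + kappa%:E)%E /\ (exit_rate f k x <= exit_rate f k z + kappa%:E)%E.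
Proof.
move=> cf off k0 th01 rt kJ xs.
have [B hB] := exit_rate_bounded th01 rt.
have fin z : safe k th z -> exit_rate f k z \is a fin_num.
  move=> zs; rewrite ge0_fin_numE; first exact: le_lt_trans (hB f k z off kJ zs) (ltry _).
  by apply: integral_ge0 => w _; exact: r_ge0.
have [|dl dl0 h] := @seq_near _ _ [set z | safe k th z] x
  (fun z => (exit_rate f k z <= exit_rate f k x + kappa%:E)%E /\ (exit_rate f k x <= exit_rate f k z + kappa%:E)%E).
  move=> z_ zA zx.
  have := @exit_rate_dominated (fun x_ x => x_ n @[n --> \oo] --> x) th (fun=> f) f k z_ x
    _ _ (fun=> off) _ th01 rt kJ zA xs zx.
  move=> /(_ (fun x_ x s w => @step_cvg x_ x s w) (fun x_ x w => @jump_cvg x_ x w)).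
  move=> /(_ (fun x_ x xx => cvg_comp x_ f xx (cf x))) h.
  apply: (cvg_fin_near k0 h (fin _ xs)) => n.
  exact: (fin _ (zA n)).
by exists dl => // z zs zx; apply: h.
Qed.

Lemma r_continuous th f k x kappa : continuous f -> exit_obs f -> 0 < kappa -> (k < J)%N ->
  0 < th <= 1 -> r0 <= th / 2 * c -> adm k th x ->
  exists2 dl, 0 < dl & forall z, adm k th z -> enorm (z - x) < dl ->
    (r_ f k z <= r_ f k x + kappa%:E)%E /\ (r_ f k x <= r_ f k z + kappa%:E)%E.
Proof.
move=> cf off k0 kJ th01 rt xs.
have [B B0 hB] := r_bound th01 rt.
have fin z : adm k th z -> r_ f k z \is a fin_num.
  by move=> zs; rewrite ge0_fin_numE ?r_ge0//; exact: le_lt_trans (hB f k z off kJ zs) (ltry _).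
have [|dl dl0 h] := @seq_near _ _ [set z | adm k th z] x
  (fun z => (r_ f k z <= r_ f k x + kappa%:E)%E /\ (r_ f k x <= r_ f k z + kappa%:E)%E).
  move=> z_ zA zx.
  have := @r_dominated (fun x_ x => x_ n @[n --> \oo] --> x) (fun x_ x s w => @step_cvg x_ x s w)
    (fun=> f) f (fun=> off) (fun x_ x xx => cvg_comp x_ f xx (cf x)) th k z_ x th01 rt kJ zA xs zx.
  by move=> h; apply: (cvg_fin_near k0 h (fin _ xs)) => n; exact: (fin _ (zA n)).
by exists dl => // z zs zx; apply: h.
Qed.

(** * Uniform continuity of the intensities and Riemann sums *)

Section rates.
Variable f : 'cV[R]_m -> R.
Hypothesis f_obs : exit_obs f.
Hypothesis f_cont : continuous f.

Local Notation r_ := (r_ f).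
Local Notation exit_rate := (exit_rate f).

Definition rr k x := fine (r_ k x).
Definition Gam k x := fine (exit_rate k x).

Section fixed_margin.
Variable th : R.
Hypothesis th01 : 0 < th <= 1.
Hypothesis rt : r0 <= th / 2 * c.

Let th0 : 0 < th. Proof. by case/andP: th01. Qed.

Lemma rrE : exists2 B, 0 < B & forall k x, (k < J)%N -> adm k th x -> r_ k x = (rr k x)%:E /\ 0 <= rr k x <= B.
Proof.
have [B B0 hB] := r_bound th01 rt.
exists B => // k x kJ ax; have h1 := hB f k x f_obs kJ ax.
have h0 := r_ge0 k x f_obs.
have E : r_ k x = (rr k x)%:E by rewrite /rr fineK// ge0_fin_numE//; exact: le_lt_trans h1 (ltry _).
by split=> //; move: h0 h1; rewrite E !lee_fin => -> ->.
Qed.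

Lemma GamE : exists2 B, 0 < B & forall k x, (k < J)%N -> safe k th x -> exit_rate k x = (Gam k x)%:E /\ 0 <= Gam k x <= B.
Proof.
have [B hB] := exit_rate_bounded th01 rt.
exists (`|B| + 1); first by rewrite ltr_wpDl.
move=> k x kJ ax; have h1 := hB f k x f_obs kJ ax.
have h0 : (0 <= exit_rate k x)%E by apply: integral_ge0 => w _; exact: r_ge0 f_obs.
have E : exit_rate k x = (Gam k x)%:E by rewrite /Gam fineK// ge0_fin_numE//; exact: le_lt_trans h1 (ltry _).
split=> //; move: h0 h1; rewrite E !lee_fin => -> /le_trans; apply.
by apply: le_trans (ler_norm B) _; rewrite lerDl.
Qed.

Let admJ k x w : safe k th x -> adm k th (jump x w).
Proof. by move=> xs; exact: (adm_jump w th0 xs). Qed.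

Lemma jump_bound k x w : safe k th x -> enorm (jump x w) <= M + b.
Proof.
move=> xs; apply: le_trans (enorm_triangle _ _) _; apply: lerD.
  exact: (safe_bound th0 xs).
by apply: enorm_clip_leb; exact: ltW.
Qed.

(** Clipping bounds a jump by b, so a state reached by a jump stays within M + b of the origin even
    if it is outside U. *)
Lemma adm_compact k : compact (eball (M + b) 0 `&` [set x | adm k th x]).
Proof.
apply: (@cV_bounded_closed_compact _ _ _ (M + b)); first exact: subIsetl.
apply: closedI; first exact: eball_closed.
case: k => [|k] /=; last exact: (safe_closed aD sD D0 y_flow b_gt0).
by rewrite (_ : [set _ | True] = setT)//; exact: closedT.
Qed.

Lemma dist_fin (u v : \bar R) x y kappa : u = x%:E -> v = y%:E ->
  (u <= v + kappa%:E)%E /\ (v <= u + kappa%:E)%E -> `|x - y| <= kappa.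
Proof.
by move=> -> -> []; rewrite -!EFinD !lee_fin ler_norml => h1 h2; apply/andP; split; lra.
Qed.

Lemma rr_local k x kappa : (k < J)%N -> adm k th x -> 0 < kappa ->
  exists2 dl, 0 < dl & forall z, adm k th z -> enorm (z - x) < dl -> `|rr k z - rr k x| <= kappa.
Proof.
move=> kJ ax k0; have [B B0 hB] := rrE.
have [dl dl0 h] := r_continuous
  f_cont f_obs k0 kJ th01 rt ax.
exists dl => // z az zx; apply: dist_fin (h z az zx); exact: (hB k _ kJ _).1.
Qed.

Lemma rr_uniform k kappa : (k < J)%N -> 0 < kappa ->
  exists2 dl, 0 < dl & forall x z, adm k th x -> adm k th z -> enorm x <= M + b -> enorm z <= M + b ->
    enorm (z - x) < dl -> `|rr k z - rr k x| <= kappa.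
Proof.
move=> kJ k0; have [|dl dl0 h] := @uniform_on_compact R m _ (rr k) (@adm_compact k) _ kappa k0.
  move=> x kap [_ ax] kap0; have [dl dl0 h] := rr_local kJ ax kap0.
  by exists dl => // z [_ az]; exact: h.
by exists dl => // x z ax az xb zb; apply: h; split=> //; rewrite /eball/= subr0.
Qed.

Lemma Gam_uniform k kappa : (k < J)%N -> 0 < kappa ->
  exists2 dl, 0 < dl & forall x z, safe k th x -> safe k th z -> enorm (z - x) < dl -> `|Gam k z - Gam k x| <= kappa.
Proof.
move=> kJ k0.
have := uniform_on_compact (safe_compact aD sD D0 y_flow b_gt0 c_gt0 th0 UM (k := k)).
apply=> // x kap xs kap0; have [B B0 hB] := GamE.
have [dl dl0 h] := exit_rate_continuous
  f_cont f_obs kap0 th01 rt kJ xs.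
exists dl => // z zs zx; apply: dist_fin (h z zs zx); exact: (hB k _ kJ _).1.
Qed.

Lemma rr_jump_support : exists2 d0, 0 < d0 & forall k x w, (k < J)%N -> safe k th x -> enorm w <= d0 ->
  rr k (jump x w) = 0.
Proof.
have [d0 [B [d00 B0 hs]]] := exit_rate_support th01 rt.
exists (d0 / 2); first by rewrite divr_gt0.
move=> k x w kJ xs wd; have := hs f k x w f_obs kJ xs.
rewrite indicE memNset/= ?mulr0; last by apply/negP; rewrite -ltNge; lra.
by move=> h; rewrite /rr (_ : r_ k _ = 0%E)//; apply/eqP; rewrite eq_le h (r_ge0 _ _ f_obs).
Qed.

Lemma jump_dist x x' w : enorm (jump x w - jump x' w) <= (1 + 2 * D * enorm w) * enorm (x - x').
Proof.
rewrite !jumpE opprD addrACA; apply: le_trans (enorm_triangle _ _) _; rewrite mulrDl mul1r lerD2l.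
apply: le_trans (clip_lipschitz _ _ (ltW b_gt0)) _; rewrite -!mulrA ler_pM2l//.
apply: le_trans (enorm_sigma_sub sD _ _ _ _) _.
by rewrite subrr enorm0 mulr0 addr0 -!mulrA (mulrC (enorm w)).
Qed.

Lemma rr_jump_continuous k x : (k < J)%N -> safe k th x -> continuous (fun w => rr k (jump x w)).
Proof.
move=> kJ xs w; apply: (@cvgrPdist_le _ _ _ _ (nbhs_filter w) _ _).2 => kappa k0.
have [dl dl0 h] := rr_local kJ (admJ w xs) k0.
have jc : jump x w' @[w' --> w] --> jump x w.
  apply: (cvg_comp (fun w' => (x, w')) (fun p => jump p.1 p.2) _ (jump_continuous sD D0 (ltW b_gt0) (x := (x, w)))).
  by apply: (@cvg_pair _ _ _ (nbhs w) (nbhs x) (nbhs w) _ _ _ (fun=> x) id) => //; exact: cvg_cst.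
have := (@cvg_enormP _ _ _ _ (nbhs_filter w) _ _).1 jc dl dl0.
apply: (@filterS _ _ (nbhs_filter w)) => w' hw.
by rewrite distrC; apply: h => //; exact: (admJ w' xs).
Qed.

Lemma measurable_dilation eta : measurable_fun setT ((fun z => eta *: (z : 'cV[R]_d)) : Xd -> Xd).
Proof. by apply: continuous_borel; exact: scaler_continuous. Qed.

Lemma integ_scaled (g : 'cV[R]_d -> R) B eta : continuous g -> (forall w, `|g w| <= B) ->
  integ lw (fun z : Xd => g (eta *: (z : 'cV[R]_d))).
Proof.
move=> cg gB; apply: (@integ_bounded _ _ _ _ _ B); last by move=> z; exact: gB.
apply: (measurableT_comp _ (measurable_dilation eta)); exact: continuous_measurableR.
Qed.

(** Regular variation gives the limit at a fixed p. Neighbouring states are compared on three ranges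
    of noise: no contribution up to d0, uniform continuity up to Mw, small probability beyond.
    Compactness of the safe states concludes. *)
Lemma rate_law k kappa : (k < J)%N -> 0 < kappa -> ev (fun eta => forall p, safe k th p ->
  `|Ex lw (fun z : Xd => rr k (jump p (eta *: (z : 'cV[R]_d)))) - tl lw eta^-1 * Gam k p| <= kappa * tl lw eta^-1).
Proof.
move=> kJ k0; have [B B0 hB] := rrE; have [d0 d00 hd] := rr_jump_support.
have al0 : 0 < alpha := lt_trans ltr01 alpha_gt1.
have [BG BG0 hG] := GamE.
pose Kd := (d0 / 2) `^ (- alpha).
have Kd0 : 0 < Kd by rewrite powR_gt0// divr_gt0.
(* Beyond Mw the noise, weighted by the bound B, costs at most a quarter of kappa. *)
have [Mw Mw0 hMw] := powR_small al0 (divr_gt0 k0 (mulr_gt0 (ltr0n R 8) B0)).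
pose k1 := kappa / (8 * Kd).
have k10 : 0 < k1 by rewrite divr_gt0// mulr_gt0.
have [d1 d10 hd1] := rr_uniform kJ k10.
have k4 : 0 < kappa / 4 by rewrite divr_gt0.
have [d2 d20 hd2] := Gam_uniform kJ k4.
pose L := 1 + 2 * D * Mw.
have L0 : 0 < L by rewrite ltr_wpDr// mulr_ge0 ?mulr_ge0// ltW.
have d02 : 0 < d0 / 2 by rewrite divr_gt0.
have gB p w : safe k th p -> 0 <= rr k (jump p w) <= B by move=> ps; apply: (hB k _ kJ (admJ w ps)).2.
have gn p w : safe k th p -> `|rr k (jump p w)| <= B by move=> ps; have /andP[h1 h2] := gB p w ps; rewrite ger0_norm.
apply: (@ev_compact R m [set p | safe k th p] (fun eta p => `|Ex lw (fun z : Xd => rr k (jump p (eta *: (z : 'cV[R]_d)))) -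
    tl lw eta^-1 * Gam k p| <= kappa * tl lw eta^-1)) => [|p0 ps0].
  exact: (safe_compact aD sD D0 y_flow b_gt0 c_gt0 th0 UM (k := k)).
exists (Num.min (d1 / L) d2); first by rewrite lt_min d20 divr_gt0.
have H1 := law_cvg d00 (rr_jump_continuous kJ ps0) (fun w => gB p0 w ps0) (fun w wd => hd k p0 w kJ ps0 wd) k4.
apply: (ev_and2 _ H1 (ev_and (ev_tl_scale tl_rv d02) (ev_tl_scale tl_rv Mw0))) => eta e0 h1 [h2 h3] p ps.
rewrite lt_min => /andP[]; rewrite ltr_pdivlMr// => pp1 pp2.
have t0 := tl_ge0 lw eta^-1.
have hG2 := hd2 p0 p ps0 ps pp2.
have GE : fine (\int[mu]_w (rr k (jump p0 w))%:E)%E = Gam k p0.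
  rewrite /Gam exit_rateE; congr fine; apply: eq_integral => w _.
  by rewrite (hB k _ kJ (admJ w ps0)).1.
rewrite GE in h1.
have ig q : safe k th q -> integ lw (fun z : Xd => rr k (jump q (eta *: (z : 'cV[R]_d)))).
  by move=> qs; apply: integ_scaled (rr_jump_continuous kJ qs) (fun w => gn q w qs).
have pw (z : Xd) : `|rr k (jump p (eta *: (z : 'cV[R]_d))) - rr k (jump p0 (eta *: (z : 'cV[R]_d)))| <=
    k1 * big (d0 / 2) eta z + B * big Mw eta z.
  set w := eta *: (z : 'cV[R]_d).
  have wE : enorm w = eta * enorm z by rewrite enormZ gtr0_norm.
  have [wM|Mw'] := leP (enorm w) Mw; last first.
    rewrite (bigE Mw)// -wE Mw' mulr1; apply: (@le_trans _ _ B); last first.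
      by rewrite lerDr mulr_ge0// ?(ltW k10)//; have /andP[] := big01 (d0 / 2) eta z.
    by apply: dist_itv; exact: gB.
  rewrite (bigE (d0 / 2))// -wE; have [wd|dw] := leP (enorm w) d0.
    rewrite !hd// subrr normr0 addr_ge0// mulr_ge0 ?(ltW k10) ?(ltW B0)//.
    by have /andP[] := big01 Mw eta z.
  have -> : d0 / 2 < enorm w by apply: le_lt_trans dw; rewrite ler_pdivrMr// ler_pMr// ler1n.
  rewrite mulr1; apply: (@le_trans _ _ k1); last by rewrite lerDl mulr_ge0 ?(ltW B0)//; have /andP[] := big01 Mw eta z.
  apply: hd1; [exact: admJ|exact: admJ|exact: jump_bound ps0|exact: jump_bound ps|].
  apply: le_lt_trans (jump_dist _ _ _) _; apply: le_lt_trans pp1; rewrite mulrC.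
  apply: ler_wpM2l; first exact: enorm_ge0.
  by rewrite lerD2l; apply: ler_wpM2l => //; exact: mulr_ge0.
have ib1 := integ_big lw (d0 / 2) eta; have ib2 := integ_big lw Mw eta.
have hEx : `|Ex lw (fun z : Xd => rr k (jump p (eta *: (z : 'cV[R]_d)))) - Ex lw (fun z : Xd => rr k (jump p0 (eta *: (z : 'cV[R]_d))))|
    <= k1 * tl lw (d0 / 2 / eta) + B * tl lw (Mw / eta).
  rewrite -ExB ?ig//.
  have ipb : integ lw (fun z : Xd => k1 * big (d0 / 2) eta z + B * big Mw eta z) by apply: integD; exact: integZ.
  have EE : Ex lw (fun z : Xd => k1 * big (d0 / 2) eta z + B * big Mw eta z) = k1 * tl lw (d0 / 2 / eta) + B * tl lw (Mw / eta).
    by rewrite ExD ?ExZ ?Ex_big//; exact: integZ.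
  rewrite -EE ler_norml; apply/andP; split.
    rewrite -mulN1r -ExZ//; apply: Ex_le => [||z]; [exact: integZ|by apply: integB; exact: ig|].
    by have := pw z; rewrite ler_norml mulN1r => /andP[].
  apply: Ex_le => [||z]; [by apply: integB; exact: ig|by []|].
  by have := pw z; rewrite ler_norml => /andP[].
have b1 : k1 * tl lw (d0 / 2 / eta) <= kappa / 4 * tl lw eta^-1.
  apply: le_trans (ler_wpM2l (ltW k10) h2) _.
  by rewrite le_eqVlt; apply/orP; left; apply/eqP; rewrite /k1 -/Kd; field; rewrite gt_eqF.
have b2 : B * tl lw (Mw / eta) <= kappa / 4 * tl lw eta^-1.
  apply: le_trans (ler_wpM2l (ltW B0) h3) _; rewrite !mulrA; apply: ler_wpM2r => //.
  move: hMw; rewrite ltr_pdivlMr ?mulr_gt0// => hMw; lra.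
have b3 : `|tl lw eta^-1 * Gam k p0 - tl lw eta^-1 * Gam k p| <= kappa / 4 * tl lw eta^-1.
  rewrite -[X in `|X|]mulrBr normrM (ger0_norm t0) [leLHS]mulrC distrC.
  exact: ler_wpM2r t0 _ _ hG2.
apply: le_trans (ler_distD (Ex lw (fun z : Xd => rr k (jump p0 (eta *: (z : 'cV[R]_d))))) _ _) _.
apply: le_trans (lerD hEx (le_trans (ler_distD (tl lw eta^-1 * Gam k p0) _ _) (lerD h1 b3))) _.
apply: le_trans (lerD (lerD b1 b2) (lexx _)) _.
by rewrite le_eqVlt; apply/orP; left; apply/eqP; move: (tl lw eta^-1) => t; field.
Qed.

Lemma safe_flow_lip : exists2 L, 0 < L & forall k x s h, safe k th x -> 0 <= s -> 0 <= h -> h <= 1 ->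
  enorm (y_ (s + h) x - y_ s x) <= L * h.
Proof.
pose Ma := enorm (a 0) + D * `|M|.
have Ma0 : 0 <= Ma by rewrite addr_ge0 ?enorm_ge0 ?mulr_ge0.
have Lp : 0 < Ma + D * Ma + 1 by rewrite ltr_wpDl// addr_ge0 ?mulr_ge0.
exists (Ma + D * Ma + 1) => // k x s h xs s0 h0 h1.
have aM t : 0 <= t -> enorm (a (y_ t x)) <= Ma.
  move=> t0; apply: le_trans (enorm_le_add _ (a 0)) _; rewrite lerD2l; apply: le_trans (aD _ _) _.
  apply: ler_wpM2l => //; rewrite subr0; apply: le_trans (ler_norm M).
  exact: (safe_bound th0 (safe_flow aD y_flow t0 xs)).
have := flow_euler aD D0 y_flow aM s0 h0 => hE.
apply: le_trans (enorm_le_add _ (h *: a (y_ s x))) _; rewrite enormZ ger0_norm// mulrC.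
apply: (@le_trans _ _ (Ma * h + D * Ma * h ^+ 2)).
  by apply: lerD; [apply: ler_wpM2r => //; exact: aM|exact: hE].
have : D * Ma * h ^+ 2 <= D * Ma * h.
  by apply: ler_wpM2l; [exact: mulr_ge0|rewrite expr2; exact: ler_piMl].
by rewrite !mulrDl mul1r; lra.
Qed.

Let H k x s := (\int[mu]_w ((after s w)%:E * r_ k (step s x w)))%E.

Lemma rate_at_time k x s : (k < J)%N -> safe k th x -> H k x s = (if 0 < s then Gam k (y_ s x) else 0)%:E.
Proof.
move=> kJ xs; have [B B0 hG] := GamE; rewrite /H; case: ltP => s0; last first.
  by rewrite integral0_eq// => w _; rewrite /after ltNge s0 mul0e.
rewrite -(hG k (y_ s x) kJ (safe_flow aD y_flow (ltW s0) xs)).1.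
by apply: eq_integral => w _; rewrite /after s0 mul1e stepE max_r// ltW.
Qed.

Lemma safe_pred_adm k x : safe k th x -> adm k.+1 th x. Proof. by []. Qed.

(** The flow has bounded speed on safe states, so the intensity hardly changes within one step of
    length eta, uniformly in x and l. *)
Lemma rate_step_close k kappa : (k < J)%N -> 0 < kappa -> ev (fun eta => forall x l s, safe k th x ->
  l%:R * eta < s <= l.+1%:R * eta -> `|Gam k (y_ (l%:R * eta) x) - Gam k (y_ s x)| <= kappa).
Proof.
move=> kJ k0; have [dl dl0 hd] := Gam_uniform kJ k0; have [L L0 hL] := safe_flow_lip.
apply: ev_and2 (ev_lt ltr01) (ev_lt (divr_gt0 dl0 L0)) => eta e0 e1 ed x l s xs /andP[ls sl].
have l0 : 0 <= l%:R * eta by rewrite mulr_ge0// ltW.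
have h0 : 0 <= s - l%:R * eta by rewrite subr_ge0 ltW.
have h1 : s - l%:R * eta <= eta by rewrite lerBlDr; move: sl; rewrite -natr1 mulrDl mul1r addrC.
rewrite distrC; apply: hd; [exact: safe_flow|apply: safe_flow => //; exact: le_trans (ltW ls)|].
have -> : s = l%:R * eta + (s - l%:R * eta) by rewrite addrC subrK.
apply: le_lt_trans (hL k x _ _ xs l0 h0 _) _; first by apply: le_trans h1 (ltW e1).
by apply: (@le_lt_trans _ _ (L * eta)); [exact: ler_wpM2l (ltW L0) _ _ h1|rewrite mulrC -ltr_pdivlMr].
Qed.

Let mH k x : measurable_fun setT (H k x : TR -> \bar R).
Proof. exact: (measurable_r_inner k x f_obs). Qed.

Let H0 k x s : (0 <= H k x s)%E.
Proof. by apply: integral_ge0 => w _; rewrite mule_ge0 ?lee_fin ?ler0n// (r_ge0 _ _ f_obs). Qed.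

Let int_margin kappa T : 0 < T -> 0 <= kappa ->
  (\int[lebesgue_measure]_(s in [set: TR]) (kappa / T * \1_(`]0, T]%classic : set R) s)%:E = kappa%:E)%E.
Proof.
move=> T0 k0; rewrite (int_cst_indic lebesgue_measure)//; last by rewrite divr_ge0// ltW.
rewrite [X in (_ * X)%E](_ : _ = T%:E); last exact: lebesgue_initial.
by rewrite -EFinM divfK// gt_eqF.
Qed.

(** The Riemann sum is the integral of a step function that stays within kappa/T of the intensity at
    each time; kappa spread over ]0, T] pays for the error. *)
Lemma riemann_upper k kappa T : (k.+1 < J)%N -> 0 < kappa -> 0 < T -> ev (fun eta => forall x N, safe k th x ->
  N%:R * eta <= T -> \sum_(0 <= l < N) eta * Gam k (y_ (l%:R * eta) x) <= rr k.+1 x + kappa).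
Proof.
move=> kJ k0 T0; have kT : 0 < kappa / T by rewrite divr_gt0.
have [BG BG0 hG] := GamE; have [B B0 hB] := rrE.
apply: ev_imp (rate_step_close (ltnW kJ) kT) => eta e0 he x N xs NT.
have g0 l : 0 <= Gam k (y_ (l%:R * eta) x).
  have l0 : 0 <= l%:R * eta by rewrite mulr_ge0// ltW.
  by have [_ /andP[]] := hG k (y_ (l%:R * eta) x) (ltnW kJ) (safe_flow aD y_flow l0 xs).
rewrite -lee_fin -(int_stepf _ e0 g0) EFinD -(hB _ _ kJ (safe_pred_adm xs)).1.
rewrite -[X in (_ <= _ + X)%E](int_margin T0 (ltW k0)).
rewrite [r_ k.+1 x](_ : _ = (\int[lebesgue_measure]_(s in [set: TR]) H k x s)%E)//.
rewrite -ge0_integralD//; last 2 first.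
- by move=> s _; rewrite lee_fin mulr_ge0 ?(ltW kT)// indicE.
- by apply/measurable_EFinP; apply: measurable_funM => //; apply: measurable_indic.
apply: ge0_le_integral => //.
- by move=> s _; rewrite lee_fin stepf_ge0.
- by apply/measurable_EFinP; exact: measurable_stepf.
- apply: emeasurable_funD => //.
  by apply/measurable_EFinP; apply: measurable_funM => //; apply: measurable_indic.
move=> s _; rewrite (rate_at_time s (ltnW kJ) xs) -EFinD lee_fin.
have i0 : 0 <= kappa / T * \1_(`]0, T]%classic : set R) s by rewrite mulr_ge0 ?(ltW kT)// indicE.
have h0 : 0 <= (if 0 < s then Gam k (y_ s x) else 0).
  by rewrite -lee_fin -(rate_at_time s (ltnW kJ) xs).
have [s0|s0] := leP s 0; first by rewrite stepf_out ?addr_ge0//; left.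
have [sN|Ns] := leP s (N%:R * eta); last by rewrite stepf_out ?addr_ge0//; [move: h0; rewrite s0|right].
have sN' : 0 < s <= N%:R * eta by rewrite s0.
have [l [lN ls ->]] := stepf_in (fun l => Gam k (y_ (l%:R * eta) x)) e0 sN'.
rewrite indicE mem_set/= ?in_itv/= ?s0 ?(le_trans sN)// mulr1.
by have := he x l s xs ls; rewrite ler_norml => /andP[_]; rewrite lerBlDl.
Qed.

(** The sum must reach T0, after which the intensity vanishes by [r_support]. *)
Lemma riemann_lower k : (k.+1 < J)%N -> exists2 T0, 0 < T0 & forall kappa T, 0 < kappa -> 0 < T ->
  ev (fun eta => forall x N, safe k th x -> T0 <= N%:R * eta <= T ->
    rr k.+1 x <= \sum_(0 <= l < N) eta * Gam k (y_ (l%:R * eta) x) + kappa).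
Proof.
move=> kJ; have [T0 [d0 [T00 d00 hs]]] := r_support th01 rt.
exists T0 => // kappa T k0 Tp; have kT : 0 < kappa / T by rewrite divr_gt0.
have [BG BG0 hG] := GamE; have [B B0 hB] := rrE.
apply: ev_imp (rate_step_close (ltnW kJ) kT) => eta e0 he x N xs /andP[TN NT].
have g0 l : 0 <= Gam k (y_ (l%:R * eta) x).
  have l0 : 0 <= l%:R * eta by rewrite mulr_ge0// ltW.
  by have [_ /andP[]] := hG k (y_ (l%:R * eta) x) (ltnW kJ) (safe_flow aD y_flow l0 xs).
rewrite -lee_fin EFinD -(int_stepf _ e0 g0) -(hB _ _ kJ (safe_pred_adm xs)).1.
rewrite -[X in (_ <= _ + X)%E](int_margin Tp (ltW k0)).
rewrite [r_ k.+1 x](_ : _ = (\int[lebesgue_measure]_(s in [set: TR]) H k x s)%E)//.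
rewrite -ge0_integralD//; last 4 first.
- by move=> s _; rewrite lee_fin stepf_ge0.
- by apply/measurable_EFinP; exact: measurable_stepf.
- by move=> s _; rewrite lee_fin mulr_ge0 ?(ltW kT)// indicE.
- by apply/measurable_EFinP; apply: measurable_funM => //; apply: measurable_indic.
apply: ge0_le_integral => //.
- apply: emeasurable_funD; first by apply/measurable_EFinP; exact: measurable_stepf.
  by apply/measurable_EFinP; apply: measurable_funM => //; apply: measurable_indic.
move=> s _; have i0 : 0 <= kappa / T * \1_(`]0, T]%classic : set R) s by rewrite mulr_ge0 ?(ltW kT)// indicE.
have z0 : (0 <= (stepf eta (fun l => Gam k (y_ (l%:R * eta) x)) N s)%:E + (kappa / T * \1_(`]0, T]%classic : set R) s)%:E)%E.
  by rewrite -EFinD lee_fin addr_ge0// stepf_ge0.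
have [s0|s0] := leP s 0; first by rewrite (rate_at_time s (ltnW kJ) xs) ltNge s0.
have [sN|Ns] := leP s (N%:R * eta); last first.
  rewrite /H integral0_eq// => w _; rewrite (hs _ _ x) ?mule0//; [exact: ltW|left].
  exact: le_lt_trans Ns.
have sN' : 0 < s <= N%:R * eta by rewrite s0.
rewrite (rate_at_time s (ltnW kJ) xs) -EFinD lee_fin s0.
have [l [lN ls ->]] := stepf_in (fun l => Gam k (y_ (l%:R * eta) x)) e0 sN'.
rewrite indicE mem_set/= ?in_itv/= ?s0 ?(le_trans sN)// mulr1.
by have := he x l s xs ls; rewrite distrC ler_norml => /andP[_]; rewrite lerBlDl.
Qed.

End fixed_margin.
End rates.

(** * Induction on the number of jumps *)

Section levels.
Variable f : 'cV[R]_m -> R.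
Hypothesis f_obs : exit_obs f.
Hypothesis f_cont : continuous f.

Local Notation rr := (rr f).
Local Notation Gam := (Gam f).

(** A family obeying the one-step equation inside [K0]; it stands for exit probabilities with
    different targets in the upper and in the lower bound. *)
Variable v : R -> nat -> 'cV[R]_m -> R.
Variable K0 : set 'cV[R]_m.
Hypothesis shrink_K0 : shrink U r0 `<=` K0.
Hypothesis v_frac : forall eta n, frac (v eta n).
Hypothesis v_step : forall eta n x, K0 x -> v eta n.+1 x = Kop eta (v eta n) x.

Lemma f_uniform kappa : 0 < kappa -> exists2 dl, 0 < dl & forall x x0,
  enorm x0 <= M + b -> enorm (x - x0) < dl -> `|f x - f x0| <= kappa.
Proof.
move=> k0; have [|dl dl0 h] := @uniform_on_compact R m _ f (@eball_compact R m (M + b + 1) 0) _ kappa k0.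
  move=> x kap _ kap0; have := (@cvgrPdist_le _ _ _ _ (nbhs_filter x) _ _).1 (@f_cont x) kap kap0.
  by move=> /nbhs_enormP[dl dl0 h]; exists dl => // z _ zx; rewrite distrC; apply: h.
exists (Num.min dl 1); first by rewrite lt_min dl0 ltr01.
move=> x x0 xb; rewrite lt_min => /andP[xd x1]; apply: h => //; rewrite /eball/= subr0.
  by apply: le_trans xb _; rewrite lerDl.
by apply: le_trans (enorm_le_add _ x0) _; apply: lerD => //; exact: ltW.
Qed.

(** A step of the chain and the limiting jump with noise eta z differ by the drift eta a(x) under
    the clipping. *)
Lemma move_jump eta x (z : 'cV[R]_d) : 0 < eta -> enorm (move eta x z - jump x (eta *: z)) <= 2 * eta * enorm (a x).
Proof.
move=> e0; rewrite moveE jumpE opprD addrACA subrr add0r.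
apply: le_trans (clip_lipschitz _ _ (ltW b_gt0)) _.
by rewrite -scalemxAr addrK enormZ gtr0_norm// mulrA.
Qed.

Section margin.
Variable th : R.
Hypothesis th01 : 0 < th <= 1.
Hypothesis rt : r0 <= th / 2 / 2 * c.

Let th0 : 0 < th. Proof. by case/andP: th01. Qed.
Let th2 : 0 < th / 2 <= 1.
Proof. by have /andP[h0 h1] := th01; apply/andP; split; lra. Qed.
Let rt2 : r0 <= th / 2 * c.
Proof. by apply: le_trans rt _; apply: ler_wpM2r; [exact: ltW|rewrite ler_pdivrMr// ler_peMr ?ler1n// ltW ?divr_gt0]. Qed.

(* A state near a safe one stays safe with half the margin, so that all jumps from it can be compared with the limit. *)
Lemma near_safe k : (k < J)%N -> exists2 e1, 0 < e1 & forall p x, safe k th p -> enorm (x - p) <= e1 ->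
  [/\ safe k (th / 2) x, forall w, adm k (th / 2) (jump x w) & forall w, enorm (jump x w) <= M + b].
Proof.
move=> kJ; have [e1 e10 h] := safe_nbhd aD D0 y_flow c_gt0 e_gt0 ball_safe0 ball_jump_safe flow_uni th01.
exists e1 => // p x ps xp; have xs : safe k (th / 2) x.
  by apply: (h k p 0 x kJ ps (lexx 0)); rewrite (flow0 y_flow).
have t20 : 0 < th / 2 by case/andP: th2.
split=> // w; first exact: (adm_jump w t20 xs).
exact: (jump_bound th2 w xs).
Qed.

Lemma drift_bound : exists2 A, 0 < A & forall k x, safe k (th / 2) x -> enorm (a x) <= A.
Proof.
exists (enorm (a 0) + D * `|M| + 1); first by rewrite ltr_wpDl// addr_ge0 ?enorm_ge0 ?mulr_ge0.
move=> k x xs; apply: le_trans (enorm_le_add _ (a 0)) _; rewrite -addrA lerD2l.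
apply: le_trans (aD _ _) _; apply: (@le_trans _ _ (D * `|M|)); last by rewrite lerDl.
apply: ler_wpM2l => //; rewrite subr0; apply: le_trans (ler_norm M).
have t20 : 0 < th / 2 by case/andP: th2.
exact: (safe_bound t20 xs).
Qed.

Lemma tube_K0 k x0 eta r l x : safe k th x0 -> 0 < eta -> r <= th / 2 * c ->
  near_path eta x0 r l x -> K0 x.
Proof.
move=> xs e0 rc xl; apply: shrink_K0.
have l0 : 0 <= l%:R * eta by rewrite mulr_ge0// ltW.
apply: (le_shrink _ (shrinkD (safe_flow_in xs l0) xl)).
have : r0 <= th / 2 * c := rt2; have -> : th * c = th / 2 * c + th / 2 * c by field.
by rewrite lerBrDr => h; apply: lerD.
Qed.

Let bounded_safe k x0 : safe k th x0 -> bounded_flow x0.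
Proof. by move=> xs s s0; exact: (safe_bound th0 (safe_flow aD y_flow s0 xs)). Qed.

Let gam0 k x0 eta l : (k < J)%N -> safe k th x0 -> 0 < eta -> 0 <= Gam k (y_ (l%:R * eta) x0).
Proof.
move=> kJ xs e0; have l0 : 0 <= l%:R * eta by rewrite mulr_ge0// ltW.
have [BG BG0 hG] := GamE f_obs th01 rt2.
by have [_ /andP[]] := hG k _ kJ (safe_flow aD y_flow l0 xs).
Qed.

(** Each of the k further jumps costs a factor lam. The claim concerns states reached by a jump,
    possibly outside U, as they occur after the first large jump. *)
Definition level_upper k th' := forall kappa T, 0 < kappa -> 0 < T ->
  exists2 r, 0 < r & ev (fun eta => forall x0 x, adm k th' x0 -> enorm x0 <= M + b -> enorm (x - x0) < r ->
    forall N, N%:R * eta <= T -> v eta N x <= lam eta ^+ k * (rr k x0 + kappa)).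

(** After a large step the chain is near the limiting jump, where the level k bound is lam^k times
    [rr], and [rate_law] integrates [rr] over the noise. The radius r precedes dl because dl will be
    chosen in terms of the tube radius. *)
Lemma big_jump_upper k : (k < J)%N -> level_upper k (th / 2) -> forall kappa T, 0 < kappa -> 0 < T ->
  exists2 r, 0 < r & forall dl, 0 < dl -> ev (fun eta => forall p x, safe k th p -> enorm (x - p) <= r ->
    forall N, N%:R * eta <= T ->
      Ex lw (fun z : Xd => big dl eta z * v eta N (move eta x z)) <= lam eta ^+ k * tl lw eta^-1 * (Gam k p + kappa)).
Proof.
move=> kJ CU kappa T k0 T0.
have [e1 e10 he1] := near_safe kJ; have [A A0 hA] := drift_bound.
have k4 : 0 < kappa / 4 by rewrite divr_gt0.
have [d2 d20 hd2] := Gam_uniform f_obs f_cont th2 rt kJ k4.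
have [B B0 hB] := rrE f_obs th2 rt.
exists (Num.min e1 (d2 / 2)); first by rewrite lt_min e10 divr_gt0.
move=> dl dl0; pose Kd := dl `^ (- alpha).
have Kd0 : 0 < Kd by rewrite powR_gt0.
pose k1 := kappa / (8 * Kd).
have k10 : 0 < k1 by rewrite divr_gt0// mulr_gt0.
have [r' r'0 hCU] := CU k1 T k10 T0.
have c1 : 0 < r' / (2 * (A + 1)) by rewrite divr_gt0// mulr_gt0// addr_gt0.
have hL := rate_law
  f_obs f_cont th2 rt kJ k4.
apply: (ev_and2 _ (ev_and hCU (ev_lt c1)) (ev_and hL (ev_tl_scale tl_rv dl0))) => eta e0 [h1 h2] [h3 h4] p x ps.
rewrite le_min => /andP[xp1 xp2] N NT.
have [xs xa xb] := he1 p x ps xp1.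
have l0 : 0 <= lam eta ^+ k by rewrite exprn_ge0// lam_ge0.
have t0 := tl_ge0 lw eta^-1.
have rr0 w : 0 <= rr k (jump x w) <= B := (hB k _ kJ (xa w)).2.
have irr : integ lw (fun z : Xd => rr k (jump x (eta *: (z : 'cV[R]_d)))).
  have rc := rr_jump_continuous f_obs f_cont th2 rt kJ xs.
  apply: (integ_scaled eta rc (B := B)).
  by move=> w; have /andP[w1 w2] := rr0 w; rewrite ger0_norm.
have ibig := integ_big lw dl eta.
have pw (z : Xd) : big dl eta z * v eta N (move eta x z) <=
    lam eta ^+ k * (rr k (jump x (eta *: (z : 'cV[R]_d))) + k1 * big dl eta z).
  have /andP[b0 b1] := big01 dl eta z; have /andP[q0 q1] := rr0 (eta *: (z : 'cV[R]_d)).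
  have hv : v eta N (move eta x z) <= lam eta ^+ k * (rr k (jump x (eta *: (z : 'cV[R]_d))) + k1).
    apply: h1 => //; apply: le_lt_trans (move_jump _ _ e0) _.
    apply: (@le_lt_trans _ _ (2 * eta * A)); first by apply: ler_wpM2l; [rewrite mulr_ge0// ltW|exact: hA xs].
    move: h2; rewrite ltr_pdivlMr ?mulr_gt0 ?addr_gt0// => h2; apply: le_lt_trans h2.
    by rewrite -mulrA mulrCA; apply: ler_wpM2l; [exact: ltW|rewrite ler_pM2l// lerDl].
  apply: le_trans (ler_wpM2l b0 hv) _; rewrite mulrCA; apply: ler_wpM2l => //; rewrite mulrDr (mulrC _ k1).
  by rewrite lerD2r; exact: ler_piMl.
have iv : integ lw (fun z : Xd => big dl eta z * v eta N (move eta x z)).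
  by have [_] := @integ_small _ _ _ a sigma D aD sD D0 b b_gt0 lw eta dl (v eta N) x (v_frac eta N).
have ir : integ lw (fun z : Xd => rr k (jump x (eta *: (z : 'cV[R]_d))) + k1 * big dl eta z).
  by apply: integD => //; exact: integZ.
apply: le_trans (Ex_le iv (integZ _ ir) pw) _; rewrite ExZ// ExD//; last exact: integZ.
rewrite ExZ// Ex_big// -[leRHS]mulrA; apply: ler_wpM2l => //.
have hG : Gam k x <= Gam k p + kappa / 4.
  have ps2 : safe k (th / 2) p by apply: (safe_le_th c_gt0 e_gt0) ps; rewrite ler_pdivrMr// ler_peMr ?ler1n// ltW.
  have := hd2 p x ps2 xs _; rewrite ler_norml => /(_ _)/andP[|_]; last by rewrite lerBlDl.
  by apply: le_lt_trans xp2 _; rewrite ltr_pdivrMr// ltr_pMr// ltr1n.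
have h5 : Ex lw (fun z : Xd => rr k (jump x (eta *: (z : 'cV[R]_d)))) <= tl lw eta^-1 * (Gam k x + kappa / 4).
  by have := h3 x xs; rewrite ler_norml => /andP[_]; rewrite lerBlDl mulrDr (mulrC _ (kappa / 4)).
have h6 : k1 * tl lw (dl / eta) <= tl lw eta^-1 * (kappa / 4).
  apply: le_trans (ler_wpM2l (ltW k10) h4) _; rewrite le_eqVlt; apply/orP; left; apply/eqP.
  by rewrite /k1 -/Kd; field; rewrite gt_eqF.
apply: le_trans (lerD h5 h6) _; rewrite -mulrDr; apply: ler_wpM2l => //.
apply: le_trans (lerD (lerD hG (lexx _)) (lexx _)) _; rewrite -!addrA lerD2l.
by move: k0; lra.
Qed.

(** A large jump at step l costs lam^k tl (Gam + k1) with tl = eta lam, so the sum over l is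
    lam^(k+1) times a Riemann sum of Gam along the flow. *)
Lemma first_jump_level_upper k : (k < J)%N -> level_upper k (th / 2) -> forall kappa T, 0 < kappa -> 0 < T ->
  (forall eta x, K0 x -> v eta 0%N x <= 0) ->
  exists2 r1, 0 < r1 & ev (fun eta => forall x0 x, safe k th x0 -> enorm (x - x0) <= r1 -> forall N, N%:R * eta <= T ->
    v eta N x <= lam eta ^+ k.+1 * (\sum_(0 <= l < N) eta * Gam k (y_ (l%:R * eta) x0) + kappa)).
Proof.
move=> kJ CU kappa T k0 T0 v0.
have T1 : 0 < 2 * (T + 1) by rewrite mulr_gt0// addr_gt0.
pose k1 := kappa / (2 * (T + 1)).
have k10 : 0 < k1 by rewrite divr_gt0.
have [r r_gt0 hB] := big_jump_upper kJ CU k10 T0.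
pose rm := Num.min r (Num.min 1 (th / 2 * c)).
have rm0 : 0 < rm <= 1 by rewrite !lt_min r_gt0 ltr01 !ge_min lexx orbT andbT/= mulr_gt0// divr_gt0.
have rmr : rm <= r by rewrite ge_min lexx.
have rmc : rm <= th / 2 * c by rewrite !ge_min lexx !orbT.
have k2 : 0 < kappa / 2 by rewrite divr_gt0.
have [r1 [dl [r10 /andP[dl0 _] h]]] := first_jump_upper_ev k.+1 rm0 T0 k2 ltr01.
exists r1 => //; apply: ev_and2 h (hB dl dl0) => eta e0 h1 h2 x0 x xs xx0 N NT.
have g0 l := gam0 l kJ xs e0.
have lt0 : 0 <= lam eta ^+ k * tl lw eta^-1 by rewrite mulr_ge0 ?tl_ge0// exprn_ge0// lam_ge0.
pose beta l := lam eta ^+ k * tl lw eta^-1 * (Gam k (y_ (l%:R * eta) x0) + k1).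
have b0 l : 0 <= beta l by rewrite mulr_ge0// addr_ge0// ltW.
have nT n l : (l + n.+1 = N)%N -> n%:R * eta <= T.
  move=> ln; apply: le_trans NT; rewrite ler_pM2r// ler_nat -ln; apply: leq_trans (leqnSn n) _; exact: leq_addl.
have := h1 x0 (bounded_safe xs) N NT (v eta) beta (v_frac eta) b0 _ _ _ x xx0.
have w1 n l x' : (l + n.+1 = N)%N -> near_path eta x0 rm l x' -> v eta n.+1 x' <= Kop eta (v eta n) x'.
  by move=> _ xl; rewrite v_step//; exact: (tube_K0 xs e0 rmc xl).
have w2 x' : near_path eta x0 rm N x' -> v eta 0%N x' <= 0.
  by move=> xl; apply: v0; exact: (tube_K0 xs e0 rmc xl).
have w3 n l x' : (l + n.+1 = N)%N -> near_path eta x0 rm l x' ->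
    Ex lw (fun z : Xd => big dl eta z * v eta n (move eta x' z)) <= beta l.
  move=> ln xl; have l0 : 0 <= l%:R * eta by rewrite mulr_ge0// ltW.
  by apply: h2 (safe_flow aD y_flow l0 xs) _ _ (nT n l ln); exact: le_trans rmr.
move=> /(_ w1 w2 w3) /le_trans; apply.
have -> : \sum_(0 <= j < N) beta j = lam eta ^+ k.+1 * (\sum_(0 <= l < N) eta * Gam k (y_ (l%:R * eta) x0) + N%:R * eta * k1).
  rewrite /beta lamE// exprS; have -> : N%:R * eta * k1 = \sum_(0 <= l < N) eta * k1.
    by rewrite sumr_const_nat subn0 -[RHS]mulr_natl mulrA.
  rewrite -big_split/= mulr_sumr; apply: eq_bigr => l _; ring.
rewrite mulrC -mulrDr; apply: ler_wpM2l; first by rewrite exprn_ge0// lam_ge0.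
rewrite addrCA lerD2l; apply: (@le_trans _ _ (kappa / 2 + T * k1)); first by rewrite lerD2l; apply: ler_wpM2r => //; exact: ltW.
have : k1 * (2 * (T + 1)) = kappa by rewrite /k1 divfK// gt_eqF.
by move=> hk; lra.
Qed.

(** There is a minimal duration T0, since the k jumps need time to happen, and no maximal one. *)
Definition level_lower k th' := exists2 T0, 0 <= T0 & forall kappa, 0 < kappa ->
  exists2 r, 0 < r & ev (fun eta => forall x0 x, adm k th' x0 -> enorm x0 <= M + b -> enorm (x - x0) < r ->
    forall N, T0 <= N%:R * eta -> lam eta ^+ k * (rr k x0 - kappa) <= v eta N x).

(** Dropping noise below dl loses nothing when dl <= d0, because the intensity after a jump with
    noise at most d0 is 0. *)
Lemma big_jump_lower k : (k < J)%N -> level_lower k (th / 2) -> exists2 T0, 0 <= T0 & forall kappa, 0 < kappa ->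
  exists r d0, [/\ 0 < r, 0 < d0 & forall dl, 0 < dl <= d0 -> ev (fun eta => forall p x, safe k th p -> enorm (x - p) <= r ->
    forall N, T0 <= N%:R * eta ->
      lam eta ^+ k * tl lw eta^-1 * (Gam k p - kappa) <= Ex lw (fun z : Xd => big dl eta z * v eta N (move eta x z)))].
Proof.
move=> kJ [T0 T00 CL]; exists T0 => // kappa k0.
have [e1 e10 he1] := near_safe kJ; have [A A0 hA] := drift_bound.
have k4 : 0 < kappa / 4 by rewrite divr_gt0.
have [d2 d20 hd2] := Gam_uniform f_obs f_cont th2 rt kJ k4.
have [B B0 hB] := rrE f_obs th2 rt.
have [d0 d00 hd0] := rr_jump_support f_obs th2 rt.
exists (Num.min e1 (d2 / 2)), d0; split=> //; first by rewrite lt_min e10 divr_gt0.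
move=> dl /andP[dl0 dld]; pose Kd := dl `^ (- alpha).
have Kd0 : 0 < Kd by rewrite powR_gt0.
pose k1 := kappa / (8 * Kd).
have k10 : 0 < k1 by rewrite divr_gt0// mulr_gt0.
have [r' r'0 hCL] := CL k1 k10.
have c1 : 0 < r' / (2 * (A + 1)) by rewrite divr_gt0// mulr_gt0// addr_gt0.
have hL := rate_law
  f_obs f_cont th2 rt kJ k4.
apply: (ev_and2 _ (ev_and hCL (ev_lt c1)) (ev_and hL (ev_tl_scale tl_rv dl0))) => eta e0 [h1 h2] [h3 h4] p x ps.
rewrite le_min => /andP[xp1 xp2] N NT.
have [xs xa xb] := he1 p x ps xp1.
have l0 : 0 <= lam eta ^+ k by rewrite exprn_ge0// lam_ge0.
have t0 := tl_ge0 lw eta^-1.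
have rr0 w : 0 <= rr k (jump x w) <= B := (hB k _ kJ (xa w)).2.
have irr : integ lw (fun z : Xd => rr k (jump x (eta *: (z : 'cV[R]_d)))).
  have rc := rr_jump_continuous f_obs f_cont th2 rt kJ xs.
  apply: (integ_scaled eta rc (B := B)).
  by move=> w; have /andP[w1 w2] := rr0 w; rewrite ger0_norm.
have ibig := integ_big lw dl eta.
have pw (z : Xd) : lam eta ^+ k * (rr k (jump x (eta *: (z : 'cV[R]_d))) - k1 * big dl eta z) <=
    big dl eta z * v eta N (move eta x z).
  rewrite (bigE dl)//; case: ltP => zd; last first.
    rewrite hd0 ?mulr0 ?mul0r ?subrr ?mulr0//; last by rewrite enormZ gtr0_norm// (le_trans zd).
  rewrite mul1r mulr1.
  apply: h1 => //; apply: le_lt_trans (move_jump _ _ e0) _.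
  apply: (@le_lt_trans _ _ (2 * eta * A)); first by apply: ler_wpM2l; [rewrite mulr_ge0// ltW|exact: hA xs].
  move: h2; rewrite ltr_pdivlMr ?mulr_gt0 ?addr_gt0// => h2; apply: le_lt_trans h2.
  by rewrite -mulrA mulrCA; apply: ler_wpM2l; [exact: ltW|rewrite ler_pM2l// lerDl].
have iv : integ lw (fun z : Xd => big dl eta z * v eta N (move eta x z)).
  by have [_] := @integ_small _ _ _ a sigma D aD sD D0 b b_gt0 lw eta dl (v eta N) x (v_frac eta N).
have ir : integ lw (fun z : Xd => rr k (jump x (eta *: (z : 'cV[R]_d))) - k1 * big dl eta z).
  by apply: integB => //; exact: integZ.
apply: le_trans (Ex_le (integZ _ ir) iv pw); rewrite ExZ// ExB//; last exact: integZ.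
rewrite ExZ// Ex_big// -[leLHS]mulrA; apply: ler_wpM2l => //.
have hG : Gam k p - kappa / 4 <= Gam k x.
  have ps2 : safe k (th / 2) p by apply: (safe_le_th c_gt0 e_gt0) ps; rewrite ler_pdivrMr// ler_peMr ?ler1n// ltW.
  have := hd2 p x ps2 xs _; rewrite ler_norml => /(_ _)/andP[|h _]; last by move: h; rewrite lerBrDr addrC.
  by apply: le_lt_trans xp2 _; rewrite ltr_pdivrMr// ltr_pMr// ltr1n.
have h5 : tl lw eta^-1 * (Gam k x - kappa / 4) <= Ex lw (fun z : Xd => rr k (jump x (eta *: (z : 'cV[R]_d)))).
  have := h3 x xs; rewrite ler_norml => /andP[h _]; move: h.
  by rewrite lerBrDl mulrBr (mulrC _ (kappa / 4)).
have h6 : k1 * tl lw (dl / eta) <= tl lw eta^-1 * (kappa / 4).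
  apply: le_trans (ler_wpM2l (ltW k10) h4) _; rewrite le_eqVlt; apply/orP; left; apply/eqP.
  by rewrite /k1 -/Kd; field; rewrite gt_eqF.
apply: le_trans (lerB h5 h6); rewrite -mulrBr; apply: ler_wpM2l => //.
apply: le_trans (lerD (lerD hG (lexx _)) (lexx _)); rewrite -!addrA lerD2l.
by move: k0; lra.
Qed.

(** The first large jump is placed in the first N steps, and the last N2 steps are reserved for the
    k jumps that follow. *)
Lemma first_jump_level_lower k : (k < J)%N -> level_lower k (th / 2) -> exists2 T0, 0 <= T0 & forall kappa T,
  0 < kappa -> 0 < T ->
  exists2 r1, 0 < r1 & ev (fun eta => forall x0 x, safe k th x0 -> enorm (x - x0) <= r1 ->
    forall N N2, N%:R * eta <= T -> T0 <= N2%:R * eta ->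
    lam eta ^+ k.+1 * (\sum_(0 <= l < N) eta * Gam k (y_ (l%:R * eta) x0) - kappa) <= v eta (N + N2)%N x).
Proof.
move=> kJ CL; have [T0 T00 hB] := big_jump_lower kJ CL; exists T0 => // kappa T k0 Tp.
have T1 : 0 < 4 * (T + 1) by rewrite mulr_gt0// addr_gt0.
pose k1 := kappa / (4 * (T + 1)).
have k10 : 0 < k1 by rewrite divr_gt0.
have [r [d0 [r_gt0 d00 hd]]] := hB k1 k10.
have [BG BG0 hG] := GamE f_obs th01 rt2.
pose rm := Num.min r (Num.min 1 (th / 2 * c)).
have rm0 : 0 < rm <= 1 by rewrite !lt_min r_gt0 ltr01 !ge_min lexx orbT andbT/= mulr_gt0// divr_gt0.
have rmr : rm <= r by rewrite ge_min lexx.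
have rmc : rm <= th / 2 * c by rewrite !ge_min lexx !orbT.
have k2 : 0 < kappa / 2 by rewrite divr_gt0.
have [r1 [dl [r10 dl0 h]]] := first_jump_lower_ev k.+1 rm0 Tp k2 d00.
have dlp : 0 < dl by case/andP: dl0.
pose Kd := dl `^ (- alpha).
have Kd0 : 0 < Kd by rewrite powR_gt0.
(* q will bound N times the probability of a large step; its product with the largest possible
   Riemann sum is at most kappa/4. *)
pose q := kappa / (4 * (T * BG + 1)).
have TB : 0 < T * BG + 1 by rewrite addr_gt0// mulr_gt0.
have q0 : 0 < q by rewrite divr_gt0// mulr_gt0.
have s1 : 0 < q / (2 * Kd * T) by rewrite divr_gt0// !mulr_gt0.
have s2 : 0 < Num.min 1 (T * BG + 1)^-1 by rewrite lt_min ltr01 invr_gt0.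
exists r1 => //; apply: (ev_and2 _ (ev_and h (hd dl dl0)) (ev_and (ev_tl_scale tl_rv dlp)
  (ev_and (ev_lam_small alpha_gt1 tl_rv s1) (ev_lam_small alpha_gt1 tl_rv s2)))).
move=> eta e0 [h1 h2] [h3 [h4]]; rewrite le_min => /andP[h5 h6] x0 x xs xx0 N N2 NT N2T.
have g0 l := gam0 l kJ xs e0.
have gB l : Gam k (y_ (l%:R * eta) x0) <= BG.
  have l0 : 0 <= l%:R * eta by rewrite mulr_ge0// ltW.
  by have [_ /andP[]] := hG k _ kJ (safe_flow aD y_flow l0 xs).
have L0 : 0 <= lam eta := lam_ge0 lw e0.
have lk0 : 0 <= lam eta ^+ k by rewrite exprn_ge0.
have lt0 : 0 <= lam eta ^+ k * tl lw eta^-1 by rewrite mulr_ge0 ?tl_ge0.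
(* Truncation at 0 keeps beta nonnegative where Gam is below k1. *)
pose beta l := lam eta ^+ k * tl lw eta^-1 * Num.max 0 (Gam k (y_ (l%:R * eta) x0) - k1).
have b0 l : 0 <= beta l by rewrite mulr_ge0// le_max lexx.
have N0 : 0 <= N%:R * eta by rewrite mulr_ge0// ltW.
have E1 C : \sum_(0 <= l < N) eta * C = N%:R * eta * C :> R.
  by rewrite sumr_const_nat subn0 -[LHS]mulr_natl mulrA.
have sumb : \sum_(0 <= j < N) beta j = lam eta ^+ k.+1 * \sum_(0 <= l < N) eta * Num.max 0 (Gam k (y_ (l%:R * eta) x0) - k1).
  by rewrite mulr_sumr; apply: eq_bigr => l _; rewrite /beta lamE// exprS; ring.
have sumB : \sum_(0 <= l < N) eta * Num.max 0 (Gam k (y_ (l%:R * eta) x0) - k1) <= T * BG.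
  apply: (@le_trans _ _ (N%:R * eta * BG)); last by apply: ler_wpM2r => //; exact: ltW.
  rewrite -E1; apply: ler_sum => l _; apply: ler_wpM2l; first exact: ltW.
  by rewrite ge_max (ltW BG0)/=; apply: le_trans (gB l); rewrite gerBl ltW.
have sum0 : 0 <= \sum_(0 <= l < N) eta * Num.max 0 (Gam k (y_ (l%:R * eta) x0) - k1).
  by apply: sumr_ge0 => l _; rewrite mulr_ge0 ?(ltW e0)// le_max lexx.
have lk1 : lam eta ^+ k <= 1 by rewrite exprn_ile1.
have b1 : \sum_(0 <= j < N) beta j <= 1.
  rewrite sumb exprS; apply: (@le_trans _ _ (lam eta * (T * BG + 1))).
    apply: ler_pM => //; [by rewrite mulr_ge0|by rewrite ler_piMr|].
    by apply: le_trans sumB _; rewrite lerDl.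
  by rewrite -ler_pdivlMr// mul1r.
have := h1 x0 (bounded_safe xs) N NT (fun n => v eta (n + N2)%N) beta (fun n => v_frac eta _) b0 b1 _ _ x xx0.
have w1 n l x' : (l + n.+1 = N)%N -> near_path eta x0 rm l x' -> Kop eta (v eta (n + N2)%N) x' <= v eta (n.+1 + N2)%N x'.
  by move=> _ xl; rewrite addSn v_step//; exact: (tube_K0 xs e0 rmc xl).
have w3 n l x' : (l + n.+1 = N)%N -> near_path eta x0 rm l x' ->
    beta l <= Ex lw (fun z : Xd => big dl eta z * v eta (n + N2)%N (move eta x' z)).
  move=> ln xl; have l0 : 0 <= l%:R * eta by rewrite mulr_ge0// ltW.
  rewrite /beta; case: (leP 0 (Gam k (y_ (l%:R * eta) x0) - k1)) => hg.
    apply: h2 (safe_flow aD y_flow l0 xs) _ _ _; first exact: le_trans rmr.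
    by apply: le_trans N2T _; rewrite ler_pM2r// ler_nat leq_addl.
  rewrite mulr0; apply: Ex_ge0 => z; have /andP[z0 _] := big01 dl eta z.
  by rewrite mulr_ge0//; have /andP[] := (v_frac eta (n + N2)%N).2 (move eta x' z).
move=> /(_ w1 w3); rewrite -lerBlDr; apply: le_trans.
have hp : N%:R * tl lw (dl / eta) <= q.
  apply: (@le_trans _ _ (N%:R * (2 * Kd * tl lw eta^-1))); first by apply: ler_wpM2l.
  rewrite lamE//; have -> : N%:R * (2 * Kd * (eta * lam eta)) = N%:R * eta * (2 * Kd * lam eta) by ring.
  apply: (@le_trans _ _ (T * (2 * Kd * lam eta))).
    by apply: ler_wpM2r => //; rewrite mulr_ge0// mulr_ge0// ltW.
  by move: h4; rewrite ler_pdivlMr ?mulr_gt0// => h4; apply: le_trans h4; rewrite le_eqVlt; apply/orP; left; apply/eqP; ring.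
(* Bernoulli's inequality bounds from below the probability of no large step among N. *)
have hpow : 1 - q <= (1 - tl lw (dl / eta)) ^+ N.
  have t1 := tl_le1 lw (dl / eta).
  have : 1 - N%:R * tl lw (dl / eta) <= (1 - tl lw (dl / eta)) ^+ N.
    elim: (N) => [|n IH]; first by rewrite expr0 mul0r subr0.
    rewrite exprS; apply: le_trans (ler_wpM2l _ IH); last by rewrite subr_ge0.
    rewrite -natr1; have := tl_ge0 lw (dl / eta) => t0.
    have : 0 <= n%:R * tl lw (dl / eta) * tl lw (dl / eta) by rewrite !mulr_ge0.
    by move: (tl lw (dl / eta)) => t ht; rewrite -subr_ge0; have -> : (1 - t) * (1 - n%:R * t) - (1 - (n%:R + 1) * t) = n%:R * t * t by ring.
  by apply: le_trans; rewrite lerD2l lerN2.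
set S := \sum_(0 <= l < N) eta * Num.max 0 _ in sumb sumB sum0.
apply: (@le_trans _ _ ((1 - q) * (lam eta ^+ k.+1 * S) - kappa / 2 * lam eta ^+ k.+1)); last first.
  by rewrite lerD2r sumb; apply: ler_wpM2r hpow; rewrite mulr_ge0// exprn_ge0.
have -> : (1 - q) * (lam eta ^+ k.+1 * S) - kappa / 2 * lam eta ^+ k.+1 = lam eta ^+ k.+1 * ((1 - q) * S - kappa / 2) by ring.
apply: ler_wpM2l; first by rewrite exprn_ge0.
have qS : q * S <= kappa / 4.
  apply: (@le_trans _ _ (q * (T * BG + 1))); first by apply: ler_wpM2l; [exact: ltW|apply: le_trans sumB _; rewrite lerDl].
  by rewrite le_eqVlt; apply/orP; left; apply/eqP; rewrite /q; field; rewrite gt_eqF.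
have hS : \sum_(0 <= l < N) eta * Gam k (y_ (l%:R * eta) x0) - T * k1 <= S.
  rewrite lerBlDr; apply: (@le_trans _ _ (S + N%:R * eta * k1)); last first.
    by rewrite lerD2l; apply: ler_wpM2r => //; exact: ltW.
  rewrite -E1 /S -big_split/=; apply: ler_sum => l _; rewrite -mulrDr; apply: ler_wpM2l; first exact: ltW.
  by rewrite -lerBlDr le_max lexx orbT.
have Tk : T * k1 <= kappa / 4.
  apply: (@le_trans _ _ (k1 * (T + 1))); first by rewrite mulrC; apply: ler_wpM2l; [exact: ltW|rewrite lerDl].
  by rewrite le_eqVlt; apply/orP; left; apply/eqP; rewrite /k1; field; rewrite gt_eqF// addr_gt0.
have -> : (1 - q) * S - kappa / 2 = S - q * S - kappa / 2 by ring.
clearbody S; move: hS Tk qS; move: (\sum_(0 <= l < N) eta * Gam _ _) (q * S) (T * k1) => X1 X2 X3 hS h7 h8.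
have := le_trans (lerB hS h8) (lexx _); move: h7; move: k0; lra.
Qed.

End margin.
Lemma half_margins th k : 0 < th -> r0 <= th / 2 ^+ k.+2 * c ->
  [/\ r0 <= th / 2 / 2 ^+ k.+1 * c, r0 <= th / 2 / 2 * c & r0 <= th / 2 * c].
Proof.
move=> th0 rt; have rt1 : r0 <= th / 2 / 2 ^+ k.+1 * c.
  by have -> : th / 2 / 2 ^+ k.+1 = th / 2 ^+ k.+2 by rewrite [2 ^+ k.+2]exprS invfM mulrA.
have rt2 : r0 <= th / 2 / 2 * c.
  apply: le_trans rt1 _; apply: ler_wpM2r; first exact: ltW.
  apply: ler_wpM2l; first by rewrite ltW// divr_gt0.
  by rewrite lef_pV2 ?posrE ?exprn_gt0// ler_eXnr// ler1n.
split=> //; apply: le_trans rt2 _; apply: ler_wpM2r; first exact: ltW.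
by rewrite ler_pdivrMr// ler_peMr ?ler1n// ltW// divr_gt0.
Qed.

Section core.
Lemma core_safe x : enorm x <= e / 2 -> safe J.-1 (1 / 2) x.
Proof.
move=> xe; apply: (ball_safe y_flow c_gt0 e_gt0 ball_safe0 ball_jump_safe) => // s s0.
by apply: flow_core => //; rewrite lexx andbT divr_ge0// ltW.
Qed.

Lemma Gam_core0 : 0 <= Gam J.-1 0.
Proof.
have [_ _ rt3] := half_margins half0 core_margin.
have [BG BG0 hG] := GamE f_obs half01 rt3.
have s0 : safe J.-1 (1 / 2) 0 by apply: core_safe; rewrite enorm0 divr_ge0// ltW.
by have [_ /andP[]] := hG J.-1 0 Jlt s0.
Qed.

(** The flow does not leave a small ball around 0, so along it the intensity is frozen at its value
    at the origin, up to kappa. *)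
Lemma Gam_core kappa : 0 < kappa -> exists2 rho, 0 < rho <= e / 2 & forall x, enorm x <= rho ->
  safe J.-1 (1 / 2) x /\ forall s, 0 <= s -> `|Gam J.-1 (y_ s x) - Gam J.-1 0| <= kappa.
Proof.
move=> k0; have [_ _ rt3] := half_margins half0 core_margin.
have [dl dl0 hd] := Gam_uniform f_obs f_cont half01 rt3 Jlt k0.
have e2 : 0 < e / 2 by rewrite divr_gt0.
exists (Num.min (dl / 2) (e / 2)); first by rewrite lt_min e2 divr_gt0//= ge_min lexx orbT.
move=> x xr; have xe : enorm x <= e / 2 by apply: le_trans xr _; rewrite ge_min lexx orbT.
split; first exact: core_safe.
have s0 : safe J.-1 (1 / 2) 0 by apply: core_safe; rewrite enorm0 ltW.
move=> s ss; have yr : enorm (y_ s x) <= Num.min (dl / 2) (e / 2).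
  by apply: flow_core => //; rewrite le_min !divr_ge0 ?(ltW dl0) ?(ltW e_gt0)//= ge_min lexx orbT.
apply: hd => //.
  by apply: core_safe; apply: le_trans yr _; rewrite ge_min lexx orbT.
rewrite subr0; apply: le_lt_trans yr _; apply: (@le_lt_trans _ _ (dl / 2)); first by rewrite ge_min lexx.
by rewrite ltr_pdivrMr// ltr_pMr// ltr1n.
Qed.

Section upper_induction.
Hypothesis v_start : forall eta x, K0 x -> v eta 0%N x <= 0.
Hypothesis v_base : forall kappa T, 0 < kappa -> 0 < T ->
  ev (fun eta => forall x N, N%:R * eta <= T -> v eta N x <= f x + kappa).

(** Each level calls the previous one at half the margin, whence the power of 2 in the condition on
    r0. *)
Lemma level_upperP k th : (k < J)%N -> 0 < th <= 1 -> r0 <= th / 2 ^+ k.+1 * c -> level_upper k th.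
Proof.
elim: k th => [|k IH] th kJ th01 rt kappa T k0 T0.
  have k2 : 0 < kappa / 2 by rewrite divr_gt0.
  have [dl dl0 hd] := f_uniform k2; exists dl => //; apply: ev_imp (v_base k2 T0) => eta e0 h x0 x _ xb xx0 N NT.
  rewrite expr0 mul1r; apply: le_trans (h x N NT) _; have -> : rr 0 x0 = f x0 by [].
  by have := hd x x0 xb xx0; rewrite ler_norml => /andP[_]; lra.
have /andP[th0 th1] := th01.
have th2 : 0 < th / 2 <= 1 by apply/andP; split; lra.
have [rt1 rt2 rt3] := half_margins th0 rt.
have k2 : 0 < kappa / 2 by rewrite divr_gt0.
have [r1 r10 h] := first_jump_level_upper th01 rt2 (ltnW kJ) (IH (th / 2) (ltnW kJ) th2 rt1) k2 T0 v_start.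
exists r1 => //; apply: ev_and2 h (riemann_upper f_obs f_cont th01 rt3 kJ k2 T0) => eta e0 h1 h2 x0 x xs _ xx0 N NT.
apply: le_trans (h1 x0 x xs (ltW xx0) N NT) _; apply: ler_wpM2l; first by rewrite exprn_ge0// lam_ge0.
by have := h2 x0 N xs NT; lra.
Qed.

(** With the intensity frozen at the origin, the Riemann sum over time T is at most T times a
    constant; T >= 1 lets the additive error be moved inside the product. *)
Lemma core_upper kappa : 0 < kappa -> exists2 rho, 0 < rho <= e / 2 & forall T, 1 <= T ->
  ev (fun eta => forall x N, enorm x <= rho -> N%:R * eta <= T ->
    v eta N x <= lam eta ^+ J * (T * (Gam J.-1 0 + kappa))).
Proof.
move=> k0; have [rt1 rt2 rt3] := half_margins half0 core_margin.
have k2 : 0 < kappa / 2 by rewrite divr_gt0.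
have [rho /andP[rho0 rhoe] hG] := Gam_core k2.
exists rho; first by rewrite rho0.
move=> T T1; have T0 : 0 < T by exact: lt_le_trans T1.
have [r1 r10 h] := first_jump_level_upper half01 rt2 Jlt (level_upperP Jlt quarter01 rt1) k2 T0 v_start.
apply: ev_imp h => eta e0 h x N xr NT.
have [xs gG] := hG x xr.
apply: le_trans (h x x xs _ N NT) _; first by rewrite subrr enorm0 ltW.
rewrite (prednK J_gt0); apply: ler_wpM2l; first by rewrite exprn_ge0// lam_ge0.
apply: (@le_trans _ _ (\sum_(0 <= l < N) eta * (Gam J.-1 0 + kappa / 2) + kappa / 2)).
  rewrite lerD2r; apply: ler_sum => l _; apply: ler_wpM2l; first exact: ltW.
  have l0 : 0 <= l%:R * eta by rewrite mulr_ge0// ltW.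
  by have := gG _ l0; rewrite ler_norml => /andP[_]; rewrite lerBlDl.
rewrite sumr_const_nat subn0 -[X in X + _]mulr_natl mulrA.
have g0 : 0 <= Gam J.-1 0 + kappa / 2 by rewrite addr_ge0 ?(ltW k2)//; exact: Gam_core0.
apply: (@le_trans _ _ (T * (Gam J.-1 0 + kappa / 2) + T * (kappa / 2))).
  by apply: lerD; [exact: ler_wpM2r|rewrite ler_peMl// ltW].
by rewrite -mulrDr -addrA -splitr.
Qed.

End upper_induction.

Section lower_induction.
Hypothesis v_above : forall eta n x, f x <= v eta n x.

Lemma level_lowerP k th : (k < J)%N -> 0 < th <= 1 -> r0 <= th / 2 ^+ k.+1 * c -> level_lower k th.
Proof.
elim: k th => [|k IH] th kJ th01 rt.
  exists 0 => // kappa k0; have [dl dl0 hd] := f_uniform k0; exists dl => //; apply: ev_all => eta e0 x0 x _ xb xx0 N _.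
  rewrite expr0 mul1r; apply: le_trans (v_above eta N x); have -> : rr 0 x0 = f x0 by [].
  by have := hd x x0 xb xx0; rewrite ler_norml => /andP[+ _]; lra.
have /andP[th0 th1] := th01.
have th2 : 0 < th / 2 <= 1 by apply/andP; split; lra.
have [rt1 rt2 rt3] := half_margins th0 rt.
have [T1 T10 hF] := first_jump_level_lower th01 rt2 (ltnW kJ) (IH (th / 2) (ltnW kJ) th2 rt1).
have [T0 T00 hR] := riemann_lower f_obs f_cont th01 rt3 kJ.
(* T0 for the next jump, 1 for rounding to whole steps, T1 for the jumps after it. *)
exists (T0 + 1 + T1); first by rewrite !addr_ge0// ltW.
move=> kappa k0; have k2 : 0 < kappa / 2 by rewrite divr_gt0.
have Tp : 0 < T0 + 1 by rewrite addr_gt0.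
have [r1 r10 h] := hF _ _ k2 Tp.
exists r1 => //; apply: (ev_and2 _ (ev_and h (hR _ _ k2 Tp)) (ev_lt ltr01)) => eta e0 [h1 h2] e1 x0 x xs _ xx0 N NT.
pose N1 := (Num.truncn (T0 / eta)).+1.
have /andP[t1 t2] := Num.Theory.truncn_itv (ltW (divr_gt0 T00 e0)).
have N1a : T0 <= N1%:R * eta by rewrite -ler_pdivrMr// ltW.
have N1b : N1%:R * eta <= T0 + 1.
  rewrite /N1 -natr1 mulrDl mul1r; apply: lerD; last exact: ltW.
  by rewrite -ler_pdivlMr.
have N1N : (N1 <= N)%N.
  rewrite -(ler_nat R) -(ler_pM2r e0); apply: le_trans N1b _; apply: le_trans NT; by rewrite lerDl.
rewrite -(subnKC N1N); apply: le_trans (h1 x0 x xs (ltW xx0) N1 (N - N1)%N N1b _); last first.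
  by rewrite natrB// mulrBl lerBrDl; apply: le_trans NT; rewrite lerD2r.
apply: ler_wpM2l; first by rewrite exprn_ge0// lam_ge0.
by have := h2 x0 N1 xs; rewrite N1a N1b => /(_ isT); lra.
Qed.

(** The idle time T0 is fixed before kappa and T, hence negligible in long cycles. *)
Lemma core_lower : exists2 T0, 0 <= T0 & forall kappa, 0 < kappa -> exists2 rho, 0 < rho <= e / 2 & forall T, 1 <= T ->
  ev (fun eta => forall x N, enorm x <= rho -> T + 1 + T0 <= N%:R * eta ->
    lam eta ^+ J * (T * (Gam J.-1 0 - kappa)) <= v eta N x).
Proof.
have [rt1 rt2 rt3] := half_margins half0 core_margin.
have [T0 T00 hF] := first_jump_level_lower half01 rt2 Jlt (level_lowerP Jlt quarter01 rt1).
exists T0 => // kappa k0; have k2 : 0 < kappa / 2 by rewrite divr_gt0.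
have [rho /andP[rho0 rhoe] hG] := Gam_core k2.
exists rho; first by rewrite rho0.
move=> T T1; have Tp : 0 < T by exact: lt_le_trans T1.
have Tp1 : 0 < T + 1 by rewrite addr_gt0.
have [r1 r10 h] := hF _ _ k2 Tp1.
apply: (ev_and2 _ h (ev_lt ltr01)) => eta e0 h1 e1 x N xr NT.
have [xs gG] := hG x xr.
have lJ : 0 <= lam eta ^+ J by rewrite exprn_ge0// lam_ge0.
have [gk|gk] := leP 0 (Gam J.-1 0 - kappa); last first.
  have [_ /(_ x)/andP[v0 _]] := v_frac eta N.
  by apply: le_trans v0; rewrite mulr_ge0_le0// mulr_ge0_le0// ltW.
pose N1 := (Num.truncn (T / eta)).+1.
have /andP[t1 t2] := Num.Theory.truncn_itv (ltW (divr_gt0 Tp e0)).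
have N1a : T <= N1%:R * eta by rewrite -ler_pdivrMr// ltW.
have N1b : N1%:R * eta <= T + 1.
  rewrite /N1 -natr1 mulrDl mul1r; apply: lerD; last exact: ltW.
  by rewrite -ler_pdivlMr.
have N1N : (N1 <= N)%N.
  by rewrite -(ler_nat R) -(ler_pM2r e0); apply: le_trans N1b _; apply: le_trans NT; rewrite lerDl.
rewrite -(subnKC N1N); apply: le_trans (h1 x x xs _ N1 (N - N1)%N N1b _); last 2 first.
- by rewrite subrr enorm0 ltW.
- by rewrite natrB// mulrBl lerBrDl; apply: le_trans NT; rewrite lerD2r.
rewrite (prednK J_gt0); apply: ler_wpM2l => //.
apply: (@le_trans _ _ (\sum_(0 <= l < N1) eta * (Gam J.-1 0 - kappa / 2) - kappa / 2)); last first.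
  rewrite lerD2r; apply: ler_sum => l _; apply: ler_wpM2l; first exact: ltW.
  have l0 : 0 <= l%:R * eta by rewrite mulr_ge0// ltW.
  by have := gG _ l0; rewrite ler_norml => /andP[+ _]; rewrite lerBrDl addrC.
rewrite sumr_const_nat subn0 -[X in _ <= X - _]mulr_natl mulrA.
have g2 : 0 <= Gam J.-1 0 - kappa / 2 by move: gk k0; lra.
apply: (@le_trans _ _ (T * (Gam J.-1 0 - kappa / 2) - T * (kappa / 2))).
  by rewrite -mulrBr -addrA -opprD -splitr.
by apply: lerB; [exact: ler_wpM2r|rewrite ler_peMl// ltW].
Qed.

End lower_induction.
End core.

End levels.

(** * Exits from a smaller set and returns to the core *)

Lemma measurable_shrink q : measurable (shrink U q : set Xm).
Proof. by apply: closed_borel; exact: shrink_closed. Qed.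

Lemma measurable_eball r (x : 'cV[R]_m) : measurable (eball r x : set Xm).
Proof. by apply: closed_borel; exact: eball_closed. Qed.

Let bounded_in c0 x : 0 < c0 -> (forall t, 0 <= t -> shrink U c0 (y_ t x)) -> bounded_flow x.
Proof. by move=> c00 h s s0; have := UM (shrink_sub c00 (h s s0)); rewrite /eball/= subr0. Qed.

Let big_le dl eta (g : 'cV[R]_m -> R) x : 0 < eta -> frac g ->
  Ex lw (fun z : Xd => big dl eta z * g (move eta x z)) <= tl lw (dl / eta).
Proof.
move=> e0 fg; rewrite -Ex_big//; apply: Ex_le => [||z]; last first.
- by have /andP[b0 _] := big01 dl eta z; apply: ler_piMr => //; have /andP[] := fg.2 (move eta x z).
- exact: integ_big.
- by have [_] := @integ_small _ _ _ a sigma D aD sD D0 b b_gt0 lw eta dl g x fg.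
Qed.

(** Without a large jump the chain follows the flow, which keeps away from the complement of U.
    Leaving therefore takes a large jump, whose probability within T/eta steps is O(lam). *)
Lemma exit_small c1 : 0 < c1 -> exists2 c', 0 < c' & forall c2, 0 < c2 <= c' -> forall kappa T, 0 < kappa -> 0 < T ->
  ev (fun eta => forall A x N, measurable (A : set Xm) -> shrink U c1 x -> N%:R * eta <= T ->
    exitp eta (shrink U c2) A N x <= kappa).
Proof.
move=> c10; have [c' [T' [c'0 _ hc]]] := flow_uni c10 ltr01.
exists (c' / 2); first by rewrite divr_gt0.
move=> c2 /andP[c20 c2c] kappa T k0 T0.
pose r := Num.min 1 (c' / 2).
have r01 : 0 < r <= 1 by rewrite lt_min ltr01 divr_gt0//= ge_min lexx.
have k2 : 0 < kappa / 2 by rewrite divr_gt0.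
have [r1 [dl [r10 /andP[dl0 _] h]]] := first_jump_upper_ev 0 r01 T0 k2 ltr01.
pose Kd := dl `^ (- alpha).
have Kd0 : 0 < Kd by rewrite powR_gt0.
have s1 : 0 < kappa / 2 / (2 * Kd * T) by rewrite divr_gt0// !mulr_gt0.
apply: (ev_and2 _ h (ev_and (ev_tl_scale tl_rv dl0) (ev_lam_small alpha_gt1 tl_rv s1))) => eta e0 h1 [h2 h3] A x N mA xU NT.
have [hin _] := hc x xU.
have mK := measurable_shrink c2.
have fe n : frac (exitp eta (shrink U c2) A n) by exact: (frac_exitp aD sD D0 b_gt0 lw eta mK n mA).
have inK l x' : near_path eta x r l x' -> shrink U c2 x'.
  move=> xl; have l0 : 0 <= l%:R * eta by rewrite mulr_ge0// ltW.
  apply: (le_shrink _ (shrinkD (hin _ l0) xl)).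
  have : r <= c' / 2 by rewrite ge_min lexx orbT.
  by move: c2c; lra.
have t0 := tl_ge0 lw (dl / eta).
have := h1 x (bounded_in c'0 hin) N NT (fun n => exitp eta (shrink U c2) A n) (fun=> tl lw (dl / eta)) fe (fun=> t0) _ _ _ x.
move=> /(_ _ _ _ _)/le_trans; apply.
- by move=> n l x' _ xl; rewrite exitpS//; exact: inK xl.
- by move=> x' xl; rewrite exitp0//; exact: inK xl.
- by move=> n l x' _ _; exact: big_le.
- by rewrite subrr enorm0 ltW.
rewrite expr0 mulr1 sumr_const_nat subn0 -[X in _ + X]mulr_natl [leRHS](splitr kappa) lerD2l.
apply: (@le_trans _ _ (N%:R * (2 * Kd * tl lw eta^-1))); first by apply: ler_wpM2l.
rewrite lamE//; have -> : N%:R * (2 * Kd * (eta * lam eta)) = N%:R * eta * (2 * Kd * lam eta) by ring.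
apply: (@le_trans _ _ (T * (2 * Kd * lam eta))).
  by apply: ler_wpM2r => //; rewrite mulr_ge0 ?lam_ge0// mulr_ge0// ltW.
move: h3; rewrite ler_pdivlMr ?mulr_gt0// => h3; apply: le_trans h3.
by rewrite le_eqVlt; apply/orP; left; apply/eqP; ring.
Qed.

(** One stretch of bounded duration fails to reach the core with probability at most C lam,
    uniformly in the state; pw + 1 successive stretches give (C lam)^(pw + 1), negligible against
    lam^pw. *)
Lemma return_small c2 rho pw kappa : 0 < c2 -> 0 < rho -> 0 < kappa -> exists2 T, 0 < T &
  ev (fun eta => exists2 N, N%:R * eta <= T & forall x, ret eta (shrink U c2) (eball rho 0) N x <= kappa * lam eta ^+ pw).
Proof.
move=> c20 rho0 k0; have rho2 : 0 < rho / 2 by rewrite divr_gt0.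
have [c' [T1 [c'0 T10 hc]]] := flow_uni c20 rho2.
have Tp : 0 < T1 + 1 by rewrite ltr_wpDl.
exists (pw.+1%:R * (T1 + 1)); first by rewrite mulr_gt0// ltr0n.
pose r := Num.min 1 (rho / 2).
have r01 : 0 < r <= 1 by rewrite lt_min ltr01 rho2/= ge_min lexx.
have [r1 [dl [r10 /andP[dl0 _] h]]] := first_jump_upper_ev 1 r01 Tp ltr01 ltr01.
pose C := 1 + 2 * dl `^ (- alpha) * (T1 + 1).
have C1 : 1 <= C by rewrite lerDl mulr_ge0 ?(ltW Tp)// mulr_ge0// powR_ge0.
have C0 : 0 < C by exact: lt_le_trans C1.
have s1 : 0 < C^-1 by rewrite invr_gt0.
have s2 : 0 < kappa / C ^+ pw.+1 by rewrite divr_gt0// exprn_gt0.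
apply: (ev_and2 _ (ev_and h (ev_lt ltr01)) (ev_and (ev_tl_scale tl_rv dl0)
  (ev_and (ev_lam_small alpha_gt1 tl_rv s1) (ev_lam_small alpha_gt1 tl_rv s2)))) => eta e0 [h1 e1] [h2 [h3 h4]].
pose N1 := (Num.truncn (T1 / eta)).+1.
have /andP[t1 t2] := Num.Theory.truncn_itv (divr_ge0 T10 (ltW e0)).
have N1a : T1 <= N1%:R * eta by rewrite -ler_pdivrMr// ltW.
have N1b : N1%:R * eta <= T1 + 1.
  rewrite /N1 -natr1 mulrDl mul1r; apply: lerD; last exact: ltW.
  by rewrite -ler_pdivlMr.
exists (pw.+1 * N1)%N; first by rewrite natrM -mulrA ler_pM2l ?ltr0n.
have mK := measurable_shrink c2; have mC := measurable_eball rho (0 : 'cV[R]_m).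
have mKC : measurable (shrink U c2 `\` eball rho 0 : set Xm) by exact: measurableD.
have fr n : frac (ret eta (shrink U c2) (eball rho 0) n) by exact: (frac_ret aD sD D0 b_gt0 lw eta mK mC n).
have L0 : 0 <= lam eta := lam_ge0 lw e0.
have t0 := tl_ge0 lw (dl / eta).
have one x : ret eta (shrink U c2) (eball rho 0) N1 x <= C * lam eta.
  have [xK|xK] := pselect (shrink U c2 x); last first.
    by rewrite /ret survp_out; [rewrite mulr_ge0// ltW|move=> []].
  have [hin hto] := hc x xK.
  have := h1 x (bounded_in c'0 hin) N1 N1b (fun n => ret eta (shrink U c2) (eball rho 0) n) (fun=> tl lw (dl / eta)) fr (fun=> t0) _ _ _ x.
  move=> /(_ _ _ _ _)/le_trans; apply.
  - move=> n l x' _ xl; have [Kx|Kx] := pselect ((shrink U c2 `\` eball rho 0) x').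
      by rewrite /ret survpS.
    by rewrite {1}/ret survp_out//; apply: Ex_ge0 => z; have /andP[] := (fr n).2 (move eta x' z).
  - move=> x' xl; rewrite /ret survp_out// => -[_]; apply; rewrite /eball/= subr0.
    apply: le_trans (enorm_le_add _ (y_ (N1%:R * eta) x)) _; rewrite [leRHS]splitr; apply: lerD; first exact: hto.
    by apply: le_trans xl _; rewrite ge_min lexx orbT.
  - by move=> n l x' _ _; exact: big_le.
  - by rewrite subrr enorm0 ltW.
  rewrite expr1 mul1r sumr_const_nat subn0 -[X in _ + X]mulr_natl /C [leRHS]mulrDl mul1r lerD2l.
  apply: (@le_trans _ _ (N1%:R * (2 * dl `^ (- alpha) * tl lw eta^-1))); first by apply: ler_wpM2l.
  rewrite lamE//; have -> : N1%:R * (2 * dl `^ (- alpha) * (eta * lam eta)) = 2 * dl `^ (- alpha) * (N1%:R * eta) * lam eta by ring.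
  by apply: ler_wpM2r => //; apply: ler_wpM2l => //; rewrite mulr_ge0// powR_ge0.
move=> x; have CL : 0 <= C * lam eta <= 1.
  by rewrite mulr_ge0 ?(ltW C0)//=; move: h3; rewrite -[C^-1]mul1r ler_pdivlMr// mulrC.
apply: (@le_trans _ _ ((C * lam eta) ^+ pw.+1)).
  exact: (survp_pow aD sD D0 b_gt0 mKC pw.+1 x CL one).
rewrite exprMn [lam eta ^+ pw.+1]exprS mulrA; apply: ler_wpM2r; first by rewrite exprn_ge0.
by move: h4; rewrite ler_pdivlMr ?exprn_gt0// mulrC.
Qed.

(** * The limit measure and its approximation *)

Lemma r_subadditive h h1 h2 k x : exit_obs h -> exit_obs h1 -> exit_obs h2 ->
  (forall y, h y <= h1 y + h2 y) -> (r_ h k x <= r_ h1 k x + r_ h2 k x)%E.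
Proof.
move=> oh o1 o2 hh; elim: k x => [|k IH] x; first by rewrite -EFinD lee_fin.
pose g h s := (\int[mu]_w ((after s w)%:E * r_ h k (step s x w)))%E.
have mg h' : exit_obs h' -> measurable_fun setT (g h' : TR -> \bar R).
  by move=> oh'; exact: (measurable_r_inner k x oh').
have i0 h' s w : exit_obs h' -> (0 <= (after s w)%:E * r_ h' k (step s x w))%E.
  by move=> oh'; rewrite mule_ge0 ?lee_fin ?ler0n// (r_ge0 _ _ oh').
have g0 h' s : exit_obs h' -> (0 <= g h' s)%E by move=> oh'; apply: integral_ge0 => w _; exact: i0.
have mi h' s : exit_obs h' -> measurable_fun setT ((fun w => (after s w)%:E * r_ h' k (step s x w))%E : Xd -> \bar R).
  by move=> oh'; exact: (measurable_r_integrand k s x oh').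
rewrite [r_ h k.+1 x](_ : _ = (\int[lebesgue_measure]_(s in [set: TR]) g h s)%E)//.
rewrite [r_ h1 k.+1 x](_ : _ = (\int[lebesgue_measure]_(s in [set: TR]) g h1 s)%E)//.
rewrite [r_ h2 k.+1 x](_ : _ = (\int[lebesgue_measure]_(s in [set: TR]) g h2 s)%E)//.
rewrite -ge0_integralD//; [|by move=> s _; exact: g0|exact: mg|by move=> s _; exact: g0|exact: mg].
apply: ge0_le_integral => //; [by move=> s _; exact: g0|exact: mg|by apply: emeasurable_funD; exact: mg|].
move=> s _; rewrite /g -ge0_integralD//; [|by move=> w _; exact: i0|exact: mi|by move=> w _; exact: i0|exact: mi].
apply: ge0_le_integral => //; [by move=> w _; exact: i0|exact: mi|by apply: emeasurable_funD; exact: mi|].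
move=> w _; have p2 := r_ge0 k (step s x w) o2; have p1 := r_ge0 k (step s x w) o1.
by rewrite -ge0_muleDr//; apply: lee_wpmul2l (IH _); rewrite lee_fin ler0n.
Qed.

Lemma exit_rate_subadditive h h1 h2 k x : exit_obs h -> exit_obs h1 -> exit_obs h2 ->
  (forall y, h y <= h1 y + h2 y) -> (exit_rate h k x <= exit_rate h1 k x + exit_rate h2 k x)%E.
Proof.
move=> oh o1 o2 hh; have i0 h' w : exit_obs h' -> (0 <= r_ h' k (jump x w))%E by move=> oh'; exact: (r_ge0 _ _ oh').
have mi h' : exit_obs h' -> measurable_fun setT ((fun w => r_ h' k (jump x w)) : Xd -> \bar R).
  by move=> oh'; exact: (measurable_exit_rate_integrand k x oh').
rewrite !exit_rateE -ge0_integralD//; [|by move=> w _; exact: i0|exact: mi|by move=> w _; exact: i0|exact: mi].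
apply: ge0_le_integral => //; [by move=> w _; exact: i0|exact: mi|by apply: emeasurable_funD; exact: mi|].
by move=> w _; exact: r_subadditive.
Qed.

Let margin : r0 <= 1 / 2 / 2 * c.
Proof. by have [_ _] := half_margins half0 core_margin. Qed.

Let safe_origin : safe J.-1 (1 / 2) 0.
Proof. by apply: core_safe; rewrite enorm0 divr_ge0// ltW. Qed.

Lemma indic_obs (A : set 'cV[R]_m) : measurable (A : set Xm) -> A `<=` ~` U -> exit_obs (\1_A).
Proof.
move=> mA AU; split=> [|x|x xU]; first exact: measurable_indic.
  by rewrite indicE; case: (x \in A); rewrite /= ?lexx ?ler01.
by rewrite indicE memNset// => /AU; apply; exact: shrink_sub xU.
Qed.

Lemma upper_bump_obs q (A : set 'cV[R]_m) : A `<=` ~` U -> 0 <= q -> 2 <= q * r0 -> exit_obs (upper_bump q U A).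
Proof.
move=> AU q0 q2; split=> [|x|x]; [|exact: upper_bump_itv|exact: upper_bump0].
by apply: continuous_measurableR; exact: upper_bump_continuous.
Qed.

Lemma lower_bump_obs q (G : set 'cV[R]_m) : G `<=` ~` U -> 0 <= q -> exit_obs (lower_bump q G).
Proof.
move=> GU q0; split=> [|x|x xU]; [|exact: lower_bump_itv|].
  by apply: continuous_measurableR; exact: lower_bump_continuous.
by apply: lower_bump0 => /GU; apply; exact: shrink_sub xU.
Qed.

Definition Cm (A : set 'cV[R]_m) : R := Gam (\1_A) J.-1 0.

Lemma GamEfin h : exit_obs h -> exit_rate h J.-1 0 = (Gam h J.-1 0)%:E /\ 0 <= Gam h J.-1 0.
Proof.
move=> oh; have [B B0 hB] := GamE oh half01 margin.
by have [-> /andP[]] := hB _ _ Jlt safe_origin.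
Qed.

Lemma CmE A : measurable (A : set Xm) -> A `<=` ~` U -> exit_rate (\1_A) J.-1 0 = (Cm A)%:E /\ 0 <= Cm A.
Proof. by move=> mA AU; exact: GamEfin (indic_obs mA AU). Qed.

(** Serves in place of additivity of the limit measure: a null boundary is added to a target, or
    removed from it, in this way. *)
Lemma Cm_subadditive A A1 A2 : measurable (A : set Xm) -> measurable (A1 : set Xm) -> measurable (A2 : set Xm) ->
  A `<=` ~` U -> A1 `<=` ~` U -> A2 `<=` ~` U -> A `<=` A1 `|` A2 -> Cm A <= Cm A1 + Cm A2.
Proof.
move=> mA m1 m2 AU U1 U2 sub.
have := @exit_rate_subadditive (\1_A) (\1_A1) (\1_A2) J.-1 0 (indic_obs mA AU) (indic_obs m1 U1) (indic_obs m2 U2).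
rewrite (CmE mA AU).1 (CmE m1 U1).1 (CmE m2 U2).1 -EFinD lee_fin; apply=> y; rewrite !indicE.
have [Ay|Ay] := pselect (A y); last by rewrite memNset// addr_ge0.
rewrite (mem_set Ay); case: (sub y Ay) => h; rewrite (mem_set h)/= ?lerDl ?lerDr//.
Qed.

Lemma Gam_cvg (f_ : nat -> 'cV[R]_m -> R) A : measurable (A : set Xm) -> A `<=` ~` U ->
  (forall n, exit_obs (f_ n)) -> (forall x, f_ n x @[n --> \oo] --> (\1_A x : R)) ->
  forall kappa, 0 < kappa -> \forall n \near \oo, Gam (f_ n) J.-1 0 <= Cm A + kappa /\
    Cm A <= Gam (f_ n) J.-1 0 + kappa.
Proof.
move=> mA AU of_ fc kappa k0.
have := exit_rate_cvg of_ fc half01 margin Jlt safe_origin.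
move=> h; have := @cvg_fin_near R _ _ kappa k0 h; rewrite (CmE mA AU).1 => /(_ isT).
have fin n : exit_rate (f_ n) J.-1 0 \is a fin_num by rewrite (GamEfin (of_ n)).1.
move=> /(_ fin); apply: filterS => n; rewrite (GamEfin (of_ n)).1 -!EFinD !lee_fin; exact.
Qed.

Lemma boundary_sub : boundary U `<=` ~` U.
Proof. by move=> x [_ xU] Ux; apply: xU; rewrite (interior_id U).1. Qed.

Lemma closure_sub A : A `<=` ~` U -> closure A `<=` ~` U.
Proof.
move=> AU; have -> : ~` U = closure (~` U) by apply/closure_id; exact: open_closedC.
exact: closure_subset.
Qed.

Lemma measurable_boundary : measurable (boundary U : set Xm).
Proof.
apply: measurableD; first by apply: closed_borel; exact: closed_closure.
by apply: open_borel; exact: open_interior.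
Qed.

Lemma measurable_closure A : measurable (closure A : set Xm).
Proof. by apply: closed_borel; exact: closed_closure. Qed.

Hypothesis C_boundary : Cm (boundary U) = 0.

(** The bumps tend to the indicator of the closure of A together with the boundary of U, which is
    null. The index is taken so large that the bump vanishes at depth r0. *)
Lemma upper_rate A kappa : A `<=` ~` U -> 0 < kappa -> exists q0 : nat, forall n : nat, (q0 <= n)%N ->
  exit_obs (upper_bump n%:R U A) /\ Gam (upper_bump n%:R U A) J.-1 0 <= Cm (closure A) + kappa.
Proof.
move=> AU k0; have cA := closure_sub AU; have mc := measurable_closure A.
pose n0 := (Num.truncn (2 / r0)).+1.
have n0r n : (n0 <= n)%N -> 2 <= n%:R * r0.
  move=> h; rewrite -ler_pdivrMr//; apply: (@le_trans _ _ n0%:R); last by rewrite ler_nat.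
  by have /andP[_ /ltW] := Num.Theory.truncn_itv (ltW (divr_gt0 (ltr0n R 2) r0_gt0)).
have ofn n : exit_obs (upper_bump (n + n0)%:R U A) by apply: upper_bump_obs => //; apply: n0r; exact: leq_addl.
have CU : closure A `|` boundary U `<=` ~` U by move=> x [/cA|/boundary_sub].
have mCU : measurable (closure A `|` boundary U : set Xm) by apply: measurableU => //; exact: measurable_boundary.
have fc x : upper_bump (n + n0)%:R U A x @[n --> \oo] --> (\1_(closure A `|` boundary U) x : R).
  have h := @upper_bump_cvg R m U A x U_open; exact: (cvg_comp (addn^~ n0) _ (cvg_addnr n0) h).
have [N _ hN] := Gam_cvg mCU CU ofn fc k0.
exists (N + n0)%N => n Nn; have n0n : (n0 <= n)%N by apply: leq_trans Nn; exact: leq_addl.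
have := ofn (n - n0)%N; rewrite subnK// => on; split=> //.
have Nn' : (N <= n - n0)%N by rewrite -(leq_add2r n0) subnK.
have [] := hN (n - n0)%N Nn'.
rewrite subnK// => h _; apply: le_trans h _; rewrite lerD2r.
have := Cm_subadditive mCU mc measurable_boundary CU cA boundary_sub (fun _ => id).
by rewrite C_boundary addr0.
Qed.

Lemma lower_rate G kappa : open G -> G `<=` ~` U -> 0 < kappa -> exists n : nat,
  exit_obs (lower_bump n%:R G) /\ Cm G - kappa <= Gam (lower_bump n%:R G) J.-1 0.
Proof.
move=> oG GU k0; have mG : measurable (G : set Xm) by exact: open_borel.
have ofn n : exit_obs (lower_bump n%:R G) by apply: lower_bump_obs.
have [N _ hN] := Gam_cvg mG GU ofn (fun x => @lower_bump_cvg R m G x oG) k0.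
by exists N; split=> //; rewrite lerBlDr; have [] := hN N (leqnn N).
Qed.

Lemma Cm_interior : Cm (~` U) <= Cm (interior (~` U)).
Proof.
have mCU : measurable (~` U : set Xm) by apply: closed_borel; exact: open_closedC.
have mI : measurable (interior (~` U) : set Xm) by apply: open_borel; exact: open_interior.
have iU : interior (~` U) `<=` ~` U by exact: interior_subset.
have := Cm_subadditive mCU mI measurable_boundary (fun _ => id) iU boundary_sub.
rewrite C_boundary addr0; apply=> x xU.
have [xI|xI] := pselect (interior (~` U) x); [by left|right; split].
  by rewrite -[closure U]setCK -interiorC.
by move=> /interior_subset.
Qed.

(** Entering the shell counts as hitting the target. The bump dominates the exit probability up to a
    small error: at depth c1 any exit within time T is unlikely by [exit_small], on A and in the
    outer layer of U the bump is 1, and elsewhere nothing is collected. *)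
Lemma upper_input A kappa : measurable (A : set Xm) -> A `<=` ~` U -> 0 < kappa ->
  exists2 c', 0 < c' & forall c2, 0 < c2 <= c' -> exists2 rho, 0 < rho <= e / 2 & forall T, 1 <= T ->
  ev (fun eta => forall x N, enorm x <= rho -> N%:R * eta <= T ->
    exitp eta (shrink U c2) (A `|` (U `\` shrink U c2)) N x <= lam eta ^+ J * (T * (Cm (closure A) + kappa))).
Proof.
move=> mA AU k0; have k2 : 0 < kappa / 2 by rewrite divr_gt0.
have [q0 hq] := upper_rate AU k2.
have [of_ hG] := hq q0.+1 (leqnSn q0).
pose f := upper_bump q0.+1%:R U A.
have qp : 0 < q0.+1%:R :> R by rewrite ltr0n.
have fc : continuous f by apply: upper_bump_continuous; exact: ltW.
pose c1 : R := q0.+1%:R^-1.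
have c10 : 0 < c1 by rewrite invr_gt0.
have [c' c'0 hc] := exit_small c10.
exists (Num.min c' (Num.min c1 r0)); first by rewrite !lt_min c'0 c10.
move=> c2 /andP[c20]; rewrite !le_min => /andP[c2c' /andP[c2c1 c2r]].
have mK := measurable_shrink c2.
have mU : measurable (U : set Xm) by exact: open_borel.
have mT : measurable (A `|` (U `\` shrink U c2) : set Xm) by apply: measurableU => //; exact: measurableD.
pose v eta n := exitp eta (shrink U c2) (A `|` (U `\` shrink U c2)) n.
have vf eta n : frac (v eta n) by exact: (frac_exitp aD sD D0 b_gt0 lw eta mK n mT).
have vs eta n x : shrink U c2 x -> v eta n.+1 x = Kop eta (v eta n) x by move=> Kx; rewrite /v exitpS.
have v0 eta x : shrink U c2 x -> v eta 0%N x <= 0 by move=> Kx; rewrite /v exitp0.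
have f01 x : 0 <= f x <= 1 := upper_bump_itv _ _ _ x.
have vb kap T : 0 < kap -> 0 < T -> ev (fun eta => forall x N, N%:R * eta <= T -> v eta N x <= f x + kap).
  move=> kap0 T0; have c2b : 0 < c2 <= c' by rewrite c20.
  apply: ev_imp (hc c2 c2b kap T kap0 T0) => eta e0 h x N NT; have /andP[f0 f1] := f01 x.
  have [xc|xc] := pselect ((A `|` (U `\` shrink U c1)) x).
    have -> : f x = 1 by exact: upper_bump1 qp xc.
    rewrite -[leLHS]addr0; apply: lerD (ltW kap0).
    by have /andP[] := (vf eta N).2 x.
  have [Kx|Kx] := pselect (shrink U c1 x).
    by apply: le_trans (h _ x N mT Kx NT) _; rewrite lerDr.
  rewrite /v exitp_out; last by move=> /(le_shrink _) h'; apply: xc; right; split=> //;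
    apply: (shrink_sub c20); exact: h'.
  rewrite indicE memNset ?addr_ge0 ?(ltW kap0)// => -[xA|[xU _]]; apply: xc; by [left|right].
have sub : shrink U r0 `<=` shrink U c2 by exact: le_shrink.
have [rho rho0 h] := core_upper
  of_ fc sub vf vs v0 vb k2.
exists rho => // T T1; apply: ev_imp (h T T1) => eta e0 h' x N xr NT.
apply: le_trans (h' x N xr NT) _; apply: ler_wpM2l; first by rewrite exprn_ge0// lam_ge0.
apply: ler_wpM2l; first exact: le_trans T1.
by rewrite [kappa in leRHS]splitr addrA lerD2r.
Qed.

(** A state in A has already left, so the exit probability lies above [lower_bump] of the interior
    from step 0 on. *)
Lemma lower_input A kappa c2 : measurable (A : set Xm) -> A `<=` ~` U -> 0 < kappa -> 0 < c2 <= r0 ->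
  exists2 T0, 0 <= T0 & exists2 rho, 0 < rho <= e / 2 & forall T, 1 <= T ->
  ev (fun eta => forall x N, enorm x <= rho -> T + 1 + T0 <= N%:R * eta ->
    lam eta ^+ J * (T * (Cm (interior A) - kappa)) <= exitp eta (shrink U c2) A N x).
Proof.
move=> mA AU k0 /andP[c20 c2r]; have k2 : 0 < kappa / 2 by rewrite divr_gt0.
have oG := open_interior A; have GU : interior A `<=` ~` U by move=> x /interior_subset/AU.
have [q [of_ hG]] := lower_rate oG GU k2.
pose f := lower_bump q%:R (interior A).
have fc : continuous f by exact: lower_bump_continuous.
have mK := measurable_shrink c2.
pose v eta n := exitp eta (shrink U c2) A n.
have vf eta n : frac (v eta n) by exact: (frac_exitp aD sD D0 b_gt0 lw eta mK n mA).
have vs eta n x : shrink U c2 x -> v eta n.+1 x = Kop eta (v eta n) x by move=> Kx; rewrite /v exitpS.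
have va eta n x : f x <= v eta n x.
  have /andP[f0 f1] := lower_bump_itv q%:R (interior A) x.
  have [xA|xA] := pselect (interior A x); last by rewrite /f lower_bump0//; have /andP[] := (vf eta n).2 x.
  rewrite /v exitp_out; first by rewrite indicE mem_set//; exact: interior_subset.
  by move=> /(shrink_sub c20); exact: GU.
have sub : shrink U r0 `<=` shrink U c2 by exact: le_shrink.
have [T0 T00 h] := core_lower
  of_ fc sub vf vs va.
exists T0 => //; have [rho rho0 hr] := h _ k2.
exists rho => // T T1; apply: ev_imp (hr T T1) => eta e0 h' x N xr NT.
apply: le_trans (h' x N xr NT); apply: ler_wpM2l; first by rewrite exprn_ge0// lam_ge0.
apply: ler_wpM2l; first exact: le_trans T1.
by rewrite [kappa in leLHS]splitr opprD addrA lerD2r.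
Qed.

(** All estimates on common sets and scales: a cycle lasts between T and Tb <= (1 + kappa) T, so
    upper and lower bounds run on nearly the same clock. *)
Lemma cycle_inputs B e0 kappa : measurable (B : set Xm) -> B `<=` ~` U -> 0 < e0 -> 0 < kappa ->
  exists K : set 'cV[R]_m, exists core : set 'cV[R]_m, exists T Tb T' : R,
  [/\ [/\ measurable (K : set Xm), measurable (core : set Xm), K `<=` U, core `<=` K & core 0],
      shrink U e0 `<=` K,
      [/\ 1 <= T, T <= Tb, Tb <= (1 + kappa) * T & 0 <= T'] &
      ev (fun eta => exists N N',
       [/\ [/\ T <= N%:R * eta, (N + N')%:R * eta <= Tb & N'%:R * eta <= T'],
           forall x, ret eta K core N' x <= kappa * lam eta ^+ J,
           [/\ forall x, core x -> lam eta ^+ J * (T * (Cm (~` U) - kappa)) <= exitp eta K (~` U) N x,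
               forall x, core x -> lam eta ^+ J * (T * (Cm (interior B) - kappa)) <= exitp eta K B N x,
               forall x, core x -> exitp eta K (B `|` (U `\` K)) (N + N') x <= lam eta ^+ J * (Tb * (Cm (closure B) + kappa)),
               forall x, core x -> exitp eta K (U `\` K) (N + N') x <= lam eta ^+ J * (Tb * kappa) &
               forall x, core x -> exitp eta K (~` K) (N + N') x <= lam eta ^+ J * (Tb * (Cm (~` U) + kappa))] &
           forall x A, shrink U e0 x -> measurable (A : set Xm) -> exitp eta K A N' x <= kappa])].
Proof.
move=> mB BU e00 k0.
have mU : measurable (U : set Xm) by exact: open_borel.
have mCU : measurable (~` U : set Xm) by exact: measurableC.
have [c1 c10 h1] := upper_input mB BU k0.
have [c2 c20 h2] := upper_input measurable0 (@sub0set _ _) k0.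
have [c3 c30 h3] := upper_input mCU (fun _ => id) k0.
have [c4 c40 h4] := exit_small e00.
(* One depth for the smaller set: below the threshold of each estimate, below r0 and c, and at most
   e0 so that the set contains the starting region. *)
pose cK := Num.min c1 (Num.min c2 (Num.min c3 (Num.min c4 (Num.min e0 (Num.min r0 c))))).
have cK0 : 0 < cK by rewrite !lt_min c10 c20 c30 c40 e00 r0_gt0.
have [[cK1 cK2 cK3 cK4] cK5 cK6 cK7] : [/\ [/\ cK <= c1, cK <= c2, cK <= c3 & cK <= c4], cK <= e0, cK <= r0 & cK <= c].
  by rewrite /cK; split; [split|..]; rewrite !ge_min lexx ?orbT.
have [rho1 /andP[r10 r1e] H1] := h1 cK (introT andP (conj cK0 cK1)).
have [rho2 /andP[r20 r2e] H2] := h2 cK (introT andP (conj cK0 cK2)).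
have [rho3 /andP[r30 r3e] H3] := h3 cK (introT andP (conj cK0 cK3)).
have H4 := h4 cK (introT andP (conj cK0 cK4)).
have k2 : 0 < kappa / 2 by rewrite divr_gt0.
have [S5 S50 [rho5 /andP[r50 r5e] H5]] := lower_input mB BU k0 (introT andP (conj cK0 cK6)).
have [S6 S60 [rho6 /andP[r60 r6e] H6]] := lower_input mCU (fun _ => id) k0 (introT andP (conj cK0 cK6)).
pose rho := Num.min rho1 (Num.min rho2 (Num.min rho3 (Num.min rho5 rho6))).
have rho0 : 0 < rho by rewrite !lt_min r10 r20 r30 r50.
have [[q1 q2 q3] q5 q6] : [/\ [/\ rho <= rho1, rho <= rho2 & rho <= rho3], rho <= rho5 & rho <= rho6].
  by rewrite /rho; split; [split|..]; rewrite !ge_min lexx ?orbT.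
have [T' T'0 H7] := return_small J cK0 rho0 k0.
pose S := Num.max S5 S6.
have S0 : 0 <= S by rewrite le_max S50.
(* Large enough that the overhead 2 + S + T' of rounding, delayed jumps and return is at most kappa
   T. *)
pose T := (2 + S + T') / kappa + 1.
have T1 : 1 <= T by rewrite lerDr divr_ge0 ?(ltW k0)// !addr_ge0// ltW.
pose Tb := T + 2 + S + T'.
have ST0 : 0 <= 2 + S + T' by rewrite !addr_ge0// ltW.
have TbE : Tb = T + (2 + S + T') by rewrite /Tb !addrA.
have TTb : T <= Tb by rewrite TbE lerDl.
have Tb1 : 1 <= Tb by exact: le_trans TTb.
have TbT : Tb <= (1 + kappa) * T.
  rewrite TbE mulrDl mul1r lerD2l /T mulrDr mulr1 mulrC divfK ?gt_eqF// lerDl.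
  exact: ltW.
have T0 : 0 <= T by exact: le_trans ler01 T1.
clearbody T.
exists (shrink U cK), (eball rho 0), T, Tb, T'; split.
- split; [exact: measurable_shrink|exact: measurable_eball|exact: shrink_sub| |by rewrite /eball/= subrr enorm0 ltW].
  move=> x; rewrite /eball/= subr0 => xr; apply: (le_shrink cK7).
  rewrite -(flow0 y_flow x); apply: ball_safe0 => //; apply: le_trans xr _; apply: le_trans q1 _; apply: le_trans r1e _.
  by rewrite ler_pdivrMr// ler_peMr ?ler1n// ltW.
- exact: le_shrink.
- by split=> //; exact: ltW.
apply: (ev_and2 _ (ev_and (ev_and (H1 Tb Tb1) (H2 Tb Tb1)) (ev_and (H3 Tb Tb1) (H4 kappa T' k0 T'0)))
  (ev_and (ev_and (H5 T T1) (H6 T T1)) (ev_and H7 (ev_lt ltr01)))).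
move=> eta e0' [[g1 g2] [g3 g4]] [[g5 g6] [[N' N'T g7] e1]].
pose N := (Num.truncn ((T + 1 + S) / eta)).+1.
have TS0 : 0 <= T + 1 + S by rewrite !addr_ge0.
have /andP[t1 t2] := Num.Theory.truncn_itv (divr_ge0 TS0 (ltW e0')).
have N1a : T + 1 + S <= N%:R * eta by rewrite -ler_pdivrMr// ltW.
have N1b : N%:R * eta <= T + 2 + S.
  have -> : T + 2 + S = T + 1 + S + 1 by ring.
  by rewrite /N -natr1 mulrDl mul1r; apply: lerD; [rewrite -ler_pdivlMr|exact: ltW].
have NTb : (N + N')%:R * eta <= Tb by rewrite natrD mulrDl /Tb; exact: lerD.
have rb q x : rho <= q -> eball rho 0 x -> enorm x <= q by rewrite /eball/= subr0 => /[swap]; exact: le_trans.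
have SN S' : S' <= S -> T + 1 + S' <= N%:R * eta by move=> h; apply: le_trans N1a; rewrite lerD2l.
have s5 : S5 <= S by rewrite le_max lexx.
have s6 : S6 <= S by rewrite le_max lexx orbT.
exists N, N'; split=> //.
- by split=> //; apply: le_trans N1a; rewrite -addrA lerDl addr_ge0.
- split.
  + move=> x Cx; apply: le_trans (g6 x N (rb _ _ _ q6 Cx) (SN _ s6)).
    apply: ler_wpM2l; first by rewrite exprn_ge0// lam_ge0.
    apply: ler_wpM2l; first exact: le_trans T1.
    rewrite lerD2r; exact: (Cm_interior).
  + by move=> x Cx; exact: (g5 x N (rb _ _ _ q5 Cx) (SN _ s5)).
  + by move=> x Cx; exact: (g1 x _ (rb _ _ _ q1 Cx) NTb).
  (* With the empty target only the shell is counted; its intensity vanishes with that of the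
     boundary. *)
  + move=> x Cx; have := g2 x _ (rb _ _ _ q2 Cx) NTb; rewrite set0U closure0.
    have -> : Cm set0 = 0; last by rewrite add0r.
    have := Cm_subadditive measurable0 measurable_boundary measurable_boundary (@sub0set _ _)
      (boundary_sub) (boundary_sub) (@sub0set _ _).
    have [_ c0] := CmE measurable0 (@sub0set _ _).
    by rewrite C_boundary addr0 => c1'; apply/eqP; rewrite eq_le c1' c0.
  + move=> x Cx; have := g3 x _ (rb _ _ _ q3 Cx) NTb.
    have -> : closure (~` U) = ~` U by rewrite -((closure_id _).1 (open_closedC U_open)).
    apply: le_trans; apply: (exitp_target_le aD sD D0 b_gt0 lw eta (measurable_shrink cK)).
    * by apply: measurableC; exact: measurable_shrink.
    * by apply: measurableU => //; apply: measurableD => //; exact: measurable_shrink.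
    * by move=> y Ky _; have [Uy|Uy] := pselect (U y); [right|left].
- by move=> x A xe mA; exact: (g4 A x N' mA xe N'T).
Qed.

(** * Asymptotics of exit time and exit position *)

Section exit_asymptotics.
Variables (B : set 'cV[R]_m) (e0 : R).
Hypotheses (mB : measurable (B : set Xm)) (BU : B `<=` ~` U) (e00 : 0 < e0).
Local Notation C := (Cm (~` U)).
Local Notation Cb := (Cm (closure B)).
Local Notation Ci := (Cm (interior B)).

Let mU : measurable (U : set Xm). Proof. exact: open_borel. Qed.
Let Cb0 : 0 <= Cb. Proof. by case: (CmE (measurable_closure B) (closure_sub BU)). Qed.
Let cycles kappa (k0 : 0 < kappa) := cycle_inputs mB BU e00 k0.

Let ev_u k : 0 < k -> ev (fun eta => 0 < lam eta ^+ J /\ lam eta ^+ J <= k).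
Proof.
move=> k0; have m0 : 0 < Num.min 1 k by rewrite lt_min ltr01.
apply: ev_and2 (ev_lam_pos tl_rv) (ev_lam_small alpha_gt1 tl_rv m0) => eta _ l0.
rewrite le_min => /andP[l1 lk]; split; first by rewrite exprn_gt0.
by apply: le_trans lk; rewrite -(prednK J_gt0) exprS ler_piMr ?exprn_ile1// ltW.
Qed.

(** A single slack q controls all errors: p, qq and ep bound the probabilities, within one cycle, of
    exit, of hitting the target or the shell, and of failure. The factor (1 - p)^l over the
    completed cycles becomes the exponential. *)
Lemma gap_upper t kappa : 0 < C -> 0 < kappa -> ev (fun eta => forall x n k, shrink U e0 x ->
  t < n.+1%:R * (C * (eta * lam eta ^+ J)) -> gap eta U B n k x <= Cb / C * expR (- t) + kappa).
Proof.
move=> C0 k0; have [q [q0 qC hq]] := small_arg C0 k0 (upper_limit_cvg Cb t C0).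
rewrite (upper_limit0 _ _ C0) in hq.
have [K [core [T [Tb [T' [[mK mC KU CK C00] _ [T1 TTb TbT T'0] hev]]]]]] := cycles q0.
have T0 : 0 < T by exact: lt_le_trans T1.
have Tb0 : 0 < Tb by exact: lt_le_trans TTb.
have Cq : 0 < C - q by rewrite subr_gt0.
have k1 : 0 < Num.min (T * C)^-1 (Num.min Tb^-1 (q / (C * (Tb + T')))).
  by rewrite !lt_min !invr_gt0 mulr_gt0// Tb0 divr_gt0// mulr_gt0// ltr_wpDr.
apply: ev_and2 hev (ev_u k1) => eta eta0 [N [N' [[NT LTb N'T] hret [hp _ hqB hsh _] hx]]] [u0].
rewrite !le_min => /andP[u1 /andP[u2 u3]] x n k xe tn.
have Ux : U x by exact: shrink_sub e00 _ xe.
set u := lam eta ^+ J in u0 u1 u2 u3 hret hp hqB hsh tn *.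
pose p := u * (T * (C - q)); pose qq := u * (Tb * (Cb + q)); pose ep := u * (Tb * q).
have p0 : 0 < p by rewrite !mulr_gt0.
have p1 : p <= 1.
  apply: (@le_trans _ _ (u * (T * C))); last by rewrite -ler_pdivlMr ?mulr_gt0// mul1r.
  by rewrite /p ler_pM2l// ler_pM2l// gerBl ltW.
have p01 : 0 < p <= 1 by rewrite p0.
have ep_q : ep <= q.
  by rewrite /ep mulrA ler_piMl ?(ltW q0)// -ler_pdivlMr// mul1r.
have hret' y : ret eta K core N' y <= ep.
  apply: le_trans (hret y) _; rewrite /ep mulrC ler_pM2l// ler_peMl ?(ltW q0)//; exact: le_trans TTb.
have hb := cycle_gap_bound aD sD D0 b_gt0 mU mK mC mB KU CK C00 hret' p01 hp hqB hsh n k Ux.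
apply: le_trans hb _; set l := ((n - N') %/ (N + N'))%N.
have mT : measurable (B `|` (U `\` K) : set Xm) by apply: measurableU => //; exact: measurableD.
have hx' := hx x _ xe mT.
have Q1 : (qq + ep) / p <= (1 + q) * (Cb + 2 * q) / (C - q).
  have -> : (qq + ep) / p = Tb * (Cb + 2 * q) / (T * (C - q)).
    by rewrite /qq /ep /p; field; rewrite !gt_eqF.
  rewrite ler_pdivrMr ?mulr_gt0//.
  have -> : (1 + q) * (Cb + 2 * q) / (C - q) * (T * (C - q)) = (1 + q) * T * (Cb + 2 * q) by field; rewrite gt_eqF.
  by apply: ler_wpM2r => //; rewrite addr_ge0// mulr_ge0// ltW.
have Q2 : 2 * ep / p <= 2 * ((1 + q) * q) / (C - q).
  have -> : 2 * ep / p = 2 * (Tb * q) / (T * (C - q)) by rewrite /ep /p; field; rewrite !gt_eqF.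
  rewrite ler_pdivrMr ?mulr_gt0//.
  have -> : 2 * ((1 + q) * q) / (C - q) * (T * (C - q)) = 2 * ((1 + q) * T * q) by field; rewrite gt_eqF.
  by rewrite ler_pM2l//; apply: ler_wpM2r => //; exact: ltW.
have L0 : (0 < N + N')%N.
  rewrite lt0n; apply/eqP => L0; move: NT; rewrite leNgt => /negP; apply.
  by move: L0 => /eqP; rewrite addn_eq0 => /andP[/eqP -> _]; rewrite mul0r.
have nl : (n.+1 <= l.+1 * (N + N') + N')%N.
  have := ltn_ceil (n - N') L0; rewrite -/l => h.
  have [nN|Nn] := leqP N' n; first by move: h; rewrite -(ltn_add2r N') subnK.
  by apply: leq_trans Nn _; exact: leq_addl.
(* The n + 1 steps fit into l + 1 cycles of duration at most Tb and an approach of duration at most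
   T'; the excess is charged to q. *)
have hl : t - q <= C * u * Tb * l%:R.
  have : n.+1%:R * eta <= l.+1%:R * Tb + T'.
    apply: (@le_trans _ _ ((l.+1 * (N + N') + N')%:R * eta)); first by rewrite ler_pM2r// ler_nat.
    by rewrite natrD mulrDl natrM -mulrA; apply: lerD => //; rewrite ler_pM2l ?ltr0n.
  move=> h; have : n.+1%:R * (C * (eta * u)) <= C * u * (l.+1%:R * Tb + T').
    have -> : n.+1%:R * (C * (eta * u)) = C * u * (n.+1%:R * eta) by ring.
    by apply: ler_wpM2l => //; rewrite mulr_ge0// ltW.
  move=> h2; have := lt_le_trans tn h2.
  have -> : C * u * (l.+1%:R * Tb + T') = C * u * Tb * l%:R + u * (C * (Tb + T')) by rewrite -natr1; ring.
  have : u * (C * (Tb + T')) <= q by rewrite -ler_pdivlMr// mulr_gt0// ltr_wpDr.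
  by move=> h3 h4; rewrite lerBlDr; apply: le_trans (ltW h4) _; rewrite lerD2l.
have hpow : (1 - p) ^+ l <= expR (- ((C - q) / C / (1 + q) * (t - q))).
  apply: le_trans (pow_le_exp l p1) _; rewrite ler_expR lerN2.
  have q1 : 0 < 1 + q by rewrite addr_gt0.
  have ra0 : 0 <= (C - q) / C / (1 + q) by rewrite !divr_ge0// ltW.
  apply: le_trans (ler_wpM2l ra0 hl) _.
  have -> : (C - q) / C / (1 + q) * (C * u * Tb * l%:R) = u * ((C - q) * (Tb / (1 + q))) * l%:R.
    by field; rewrite !gt_eqF.
  apply: ler_wpM2r => //; rewrite /p ler_pM2l// mulrC ler_pM2r// ler_pdivrMr// mulrC.
  exact: TbT.
have Q0 : 0 <= (qq + ep) / p by rewrite divr_ge0// ?(ltW p0)// addr_ge0// !mulr_ge0// ?addr_ge0// ltW.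
have F : (1 - p) ^+ l * ((qq + ep) / p) + 2 * ep / p + ep + exitp eta K (B `|` U `\` K) N' x <= upper_limit C Cb t q.
  rewrite /upper_limit; have -> : 2 * q = q + q by ring.
  rewrite [_ + (q + q)]addrA; apply: lerD hx'; apply: lerD ep_q; apply: lerD Q2.
  apply: ler_pM => //; first by rewrite exprn_ge0// subr_ge0.
  by move: Q1; have -> : Cb + (q + q) = Cb + 2 * q by ring.
by apply: le_trans F _; move: hq; rewrite ler_norml => /andP[_]; rewrite lerBlDl.
Qed.

Let succ_div n N : (0 < N)%N -> (n <= (n %/ N).+1 * N)%N.
Proof. by move=> N0; rewrite ltnW// ltn_ceil. Qed.

(** Each of the n / N + 1 cycles takes at least time T, so their number times x = u T A is at most t
    A + k. *)
Let survive_le u T eta n N (x A k t : R) : 0 < T -> 0 < eta -> 0 < u -> (0 < N)%N -> T <= N%:R * eta -> 0 <= A ->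
  x = u * (T * A) -> x <= k -> k < 1 -> n%:R * (eta * u) <= t ->
  expR (- ((t * A + k) / (1 - k))) <= (1 - x) ^+ (n %/ N).+1.
Proof.
move=> T0 eta0 u0 N0 TN A0 xE xk k1 nt; have x0 : 0 <= x by rewrite xE mulr_ge0 ?mulr_ge0// ltW.
apply: le_trans (exp_le_pow (n %/ N).+1 x0 xk k1).
rewrite ler_expR lerN2; apply: ler_wpM2r; first by rewrite invr_ge0 subr_ge0 ltW.
rewrite -natr1 mulrDr mulr1; apply: lerD xk.
apply: (@le_trans _ _ (n%:R * (eta * u) * A)); last exact: ler_wpM2r.
have -> : n%:R * (eta * u) * A = u * A * (n%:R * eta) by ring.
have -> : x * (n %/ N)%:R = u * A * ((n %/ N)%:R * T) by rewrite xE; ring.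
apply: ler_wpM2l; first by rewrite mulr_ge0// ltW.
apply: (@le_trans _ _ ((n %/ N)%:R * (N%:R * eta))); first exact: ler_wpM2l.
by rewrite mulrA ler_pM2r// -natrM ler_nat leq_trunc_div.
Qed.

(** The number i of cycles in which the exit is collected depends on eta, hence the threshold c0 for
    the window inside the eventuality. *)
Lemma gap_lower t kappa : 0 < C -> 0 <= t -> 0 < kappa -> ev (fun eta => forall x n, shrink U e0 x ->
  n%:R * (C * (eta * lam eta ^+ J)) <= t -> exists c0, forall k, (c0 <= k)%N ->
  Ci / C * expR (- t) <= gap eta U B n k x + kappa).
Proof.
move=> C0 t0 k0; have m0 : 0 < Num.min C 2^-1 by rewrite lt_min C0/= invr_gt0 ltr0n.
have [q [q0 qm hq]] := small_arg m0 k0 (lower_limit_cvg Ci t C0).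
have [qC q2] : q < C /\ q < 2^-1 by move: qm; rewrite lt_min => /andP.
rewrite (lower_limit0 _ _ C0) in hq.
have [K [core [T [Tb [T' [[mK mC KU CK C00] _ [T1 TTb TbT T'0] hev]]]]]] := cycles q0.
have T0 : 0 < T by exact: lt_le_trans T1.
have Tb0 : 0 < Tb by exact: lt_le_trans TTb.
have q1 : q < 1 by apply: lt_trans q2 _; rewrite invf_lt1// ltr1n.
pose W := (1 + q) * (C + q) + q.
have W0 : 0 < W by rewrite addr_gt0// mulr_gt0// addr_gt0.
have k1 : 0 < q / (T * W) by rewrite divr_gt0// mulr_gt0.
apply: ev_and2 hev (ev_u k1) => eta eta0 [N [N' [[NT LTb N'T] hret [_ hqB _ _ hp] hx]]] [u0 uk] x n xe tn.
have mCK : measurable (~` K : set Xm) by exact: measurableC.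
set u := lam eta ^+ J in u0 uk hret hqB hp tn *.
have g0 k : 0 <= gap eta U B n k x.
  by have /andP[] := (frac_gap aD sD D0 b_gt0 lw eta mU mB n k).2 x.
suff [c0 hc] : exists c0, forall k, (c0 <= k)%N -> lower_limit C Ci t q <= gap eta U B n k x.
  exists c0 => k ck; move: hq; rewrite ler_norml => /andP[h _].
  move: h; rewrite lerBrDr addrC lerBlDr => h; apply: le_trans h _; rewrite lerD2r; exact: hc.
have e2 : 0 <= 1 - 2 * q by rewrite subr_ge0 -ler_pdivlMl// mulr1 ltW.
rewrite /lower_limit -/W.
(* A negative prefactor makes the bound trivial; otherwise Ci >= q follows and the cycle estimate
   applies. *)
have [Z0|Z0] := ltP ((Ci - q) / W * (1 - q) - q) 0.
  exists 0%N => k _; apply: le_trans (g0 k); rewrite mulr_le0_ge0// mulr_le0_ge0 ?expR_ge0//; exact: ltW.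
have CiQ : 0 <= Ci - q.
  rewrite leNgt; apply/negP => h; move: Z0; rewrite leNgt => /negP; apply.
  have : (Ci - q) / W * (1 - q) <= 0 by rewrite mulr_le0_ge0 ?subr_ge0 ?(ltW q1)// mulr_le0_ge0 ?invr_ge0 ?(ltW W0)// ltW.
  by move=> h'; apply: le_lt_trans (lerB h' (lexx q)) _; rewrite sub0r oppr_lt0.
pose ep := q * u; pose p := u * (Tb * (C + q)); pose qq := u * (T * (Ci - q)).
have p0 : 0 <= p by rewrite !mulr_ge0// ?addr_ge0// ltW.
have ep0 : 0 < ep by rewrite mulr_gt0.
have pepW : p + ep <= u * (T * W).
  rewrite /p /ep (mulrC q) -mulrDr ler_pM2l// /W; apply: (@le_trans _ _ ((1 + q) * T * (C + q) + T * q)).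
    by apply: lerD; [apply: ler_wpM2r => //; rewrite addr_ge0// ltW|rewrite ler_peMl// ltW].
  by rewrite le_eqVlt; apply/orP; left; apply/eqP; ring.
have uq : u * (T * W) <= q by rewrite -ler_pdivlMr// mulr_gt0.
have peq : p + ep <= q by exact: le_trans uq.
have pe0 : 0 < p + ep by rewrite ltr_wpDl.
have pe1 : p + ep <= 1 by apply: le_trans peq (ltW q1).
have epq : ep <= q by apply: le_trans peq; rewrite lerDr.
have pq : p <= q by apply: le_trans peq; rewrite lerDl ltW.
have qq0 : 0 <= qq by rewrite !mulr_ge0// ltW.
have N0 : (0 < N)%N.
  rewrite lt0n; apply/eqP => N0; move: NT; rewrite N0 mul0r leNgt => /negP; apply; exact: T0.
pose s := 1 - (p + ep).
have s0 : 0 <= s by rewrite subr_ge0.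
have s1 : s < 1 by rewrite gtrBl.
(* Enough later cycles for the geometric sum to be within the factor 1 - q of its limit. *)
have [i si] : exists i, s ^+ i <= q.
  have := cvg_expr (_ : `|s| < 1); rewrite ger0_norm// => /(_ s1)/cvgrPdist_le/(_ q q0)[i _ hi].
  by exists i; have := hi i (leqnn i); rewrite /= sub0r normrN ger0_norm// exprn_ge0.
pose Ai := qq / (p + ep) * (1 - s ^+ i).
have AiQ : (Ci - q) / W * (1 - q) <= Ai.
  have qCi : q <= Ci by rewrite -subr_ge0.
  apply: ler_pM; rewrite ?divr_ge0 ?subr_ge0 ?(ltW q1) ?(ltW W0)//; last by rewrite lerD2l lerN2.
  rewrite ler_pdivrMr// mulrAC ler_pdivlMr// /qq.
  have -> : u * (T * (Ci - q)) * W = (Ci - q) * (u * (T * W)) by ring.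
  exact: ler_wpM2l.
have pA : p <= Ai.
  by apply: le_trans pq _; apply: le_trans AiQ; rewrite -subr_ge0.
pose l := (n %/ N).+1.
have [c0 hc0] := cycle_gap_lower_from aD sD D0 b_gt0 mU mK mC mB KU BU 0 hret pe0 pe1 qq0 hqB hp l pA.
exists c0 => k ck; have nl : (n <= l * N + N')%N by apply: leq_trans (succ_div n N0) _; exact: leq_addr.
apply: le_trans (hc0 n k x nl ck).
have hx' := hx x _ xe mCK.
have hpow : expR (- ((t / C * W + q) / (1 - q))) <= s ^+ l.
  apply: le_trans (survive_le (x := u * (T * W)) (n := n) T0 eta0 u0 N0 NT (ltW W0) erefl uq q1 (t := t / C) _) _.
    by rewrite ler_pdivlMr//; apply: le_trans tn; rewrite le_eqVlt; apply/orP; left; apply/eqP; ring.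
  apply: lerXn2r; rewrite ?nnegrE// ?subr_ge0 ?(le_trans uq) ?(ltW q1)//.
  by rewrite /s lerD2l lerN2.
apply: ler_pM => //; first by rewrite mulr_ge0 ?expR_ge0.
  apply: ler_pM => //; exact: lerB.
have -> : 1 - 2 * q = 1 - q - q by ring.
by apply: lerB => //; rewrite lerD2l lerN2.
Qed.

(** With C = 0 a cycle leaves with probability of order q lam^J only, for a slack q of free choice,
    while the number of cycles is of order lam^-J; survival tends to 1 with q. *)
Lemma exit_slow t kappa : C = 0 -> 0 <= t -> 0 < kappa -> ev (fun eta => forall x n, shrink U e0 x ->
  n%:R * (eta * lam eta ^+ J) <= t -> exitp eta U (~` U) n x <= kappa).
Proof.
move=> C0 t0 k0; have m0 : 0 < 2^-1 :> R by rewrite invr_gt0.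
have [q [q0 q2 hq]] := small_arg m0 k0 (survival_limit_cvg t).
rewrite survival_limit0 subr0 in hq.
have [K [core [T [Tb [T' [[mK mC KU CK C00] _ [T1 TTb TbT T'0] hev]]]]]] := cycles q0.
have T0 : 0 < T by exact: lt_le_trans T1.
have Tb0 : 0 < Tb by exact: lt_le_trans TTb.
have q1 : q < 1 by apply: lt_trans q2 _; rewrite invf_lt1// ltr1n.
pose W := (1 + q) * q + q.
have W0 : 0 < W by rewrite addr_gt0// mulr_gt0// addr_gt0.
have k1 : 0 < q / (T * W) by rewrite divr_gt0// mulr_gt0.
apply: ev_and2 hev (ev_u k1) => eta eta0 [N [N' [[NT LTb N'T] hret [_ _ _ _ hp] hx]]] [u0 uk] x n xe tn.
have mCK : measurable (~` K : set Xm) by exact: measurableC.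
set u := lam eta ^+ J in u0 uk hret hp tn *.
rewrite C0 add0r in hp.
pose ep := q * u; pose p := u * (Tb * q).
have e2 : 0 <= 1 - 2 * q by rewrite subr_ge0 -ler_pdivlMl// mulr1 ltW.
have p0 : 0 <= p by rewrite !mulr_ge0// ltW.
have ep0 : 0 < ep by rewrite mulr_gt0.
have pepW : p + ep <= u * (T * W).
  rewrite /p /ep (mulrC q) -mulrDr ler_pM2l// /W; apply: (@le_trans _ _ ((1 + q) * T * q + T * q)).
    by apply: lerD; [apply: ler_wpM2r => //; exact: ltW|rewrite ler_peMl// ltW].
  by rewrite le_eqVlt; apply/orP; left; apply/eqP; ring.
have uq : u * (T * W) <= q by rewrite -ler_pdivlMr// mulr_gt0.
have peq : p + ep <= q by exact: le_trans uq.
have pe0 : 0 < p + ep by rewrite ltr_wpDl.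
have pe1 : p + ep <= 1 by apply: le_trans peq (ltW q1).
have epq : ep <= q by apply: le_trans peq; rewrite lerDr.
have pq : p <= q by apply: le_trans peq; rewrite lerDl ltW.
have N0 : (0 < N)%N.
  rewrite lt0n; apply/eqP => N0; move: NT; rewrite N0 mul0r leNgt => /negP; apply; exact: T0.
pose s := 1 - (p + ep).
have s0 : 0 <= s by rewrite subr_ge0.
pose l := (n %/ N).+1.
have nl : (n <= l * N + N')%N by apply: leq_trans (succ_div n N0) _; exact: leq_addr.
have := cycle_survival aD sD D0 b_gt0 mU mK mC KU 0 hret pe1 hp x (le_trans pq (ltW q1)) (le_trans epq (ltW q1)) nl.
rewrite lerBrDr addrC -lerBrDr => h; apply: le_trans h _.
have hx' := hx x _ xe mCK.
have hpow : expR (- ((t * W + q) / (1 - q))) <= s ^+ l.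
  apply: le_trans (survive_le (x := u * (T * W)) (n := n) T0 eta0 u0 N0 NT (ltW W0) erefl uq q1 tn) _.
  apply: lerXn2r; rewrite ?nnegrE// ?subr_ge0 ?(le_trans uq) ?(ltW q1)//.
  by rewrite /s lerD2l lerN2.
apply: le_trans (le_trans (ler_norm _) hq); rewrite /survival_limit -/W lerD2l lerN2.
apply: ler_pM => //; first by rewrite mulr_ge0 ?expR_ge0// subr_ge0 ltW.
  apply: ler_pM => //; [by rewrite subr_ge0 ltW|by rewrite lerD2l lerN2].
have -> : 1 - 2 * q = 1 - q - q by ring.
by apply: lerB => //; rewrite lerD2l lerN2.
Qed.

End exit_asymptotics.

End model.

(** * From iterated integrals to exit times *)

Section noise_law.
Local Open Scope ereal_scope.
Context {R : realType} {disp : measure_display} {Omega : measurableType disp} {d : nat}.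
Local Notation Xd := (borel 'cV[R]_d).
Variable P : probability Omega R.
Variable Z : nat -> Omega -> 'cV[R]_d.
Hypothesis Z_iid : iid P Z.
Variable lw : probability Xd R.
Hypothesis lwE : forall A : set Xd, measurable A -> lw A = P (Z 0%N @^-1` A).

Lemma measurable_noise j : measurable_fun setT (Z j : Omega -> Xd).
Proof. by have [] := Z_iid. Qed.

Lemma law_noise j (A : set Xd) : measurable A -> P (Z j @^-1` A) = lw A.
Proof. by move=> mA; rewrite lwE//; have [_ -> ] := Z_iid. Qed.

(** Cylinder events in finitely many noise vectors, the information about the past carried through
    the induction. *)
Definition past (s : seq nat) (A : nat -> set Xd) : set Omega := \bigcap_(i in [set` s]) (Z i @^-1` A i).

Lemma measurable_past s A : (forall i, measurable (A i)) -> measurable (past s A).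
Proof.
move=> mA; rewrite /past bigcap_seq; apply: bigsetI_measurable => i _.
by rewrite -[_ @^-1` _]setTI; exact: measurable_noise.
Qed.

Lemma past_cons j (s : seq nat) (A : nat -> set Xd) (B : set Xd) : uniq s -> {in s, forall i, (i <= j)%N} ->
  (forall i, measurable (A i)) -> measurable B ->
  exists A', [/\ forall i, measurable (A' i), past (j.+1 :: s) A' = past s A `&` (Z j.+1 @^-1` B) &
    P (past (j.+1 :: s) A') = P (past s A) * lw B].
Proof.
move=> us sj mA mB; pose A' i := if i == j.+1 then B else A i.
have mA' i : measurable (A' i) by rewrite /A'; case: eqP.
have As i : i \in s -> A' i = A i.
  by move=> /sj; rewrite /A'; case: eqP => // ->; rewrite ltnn.
have js : j.+1 \notin s by apply/negP => /sj; rewrite ltnn.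
have E : past (j.+1 :: s) A' = past s A `&` (Z j.+1 @^-1` B).
  apply/seteqP; split=> w h.
    split=> [i /= si|]; last by have := h j.+1; rewrite /= mem_head /A' eqxx; exact.
    by rewrite -As//; apply: (h i); rewrite /= inE si orbT.
  move=> i /=; rewrite inE => /orP[/eqP ->|si]; first by rewrite /A' eqxx; exact: h.2.
  by rewrite As//; exact: h.1.
exists A'; split=> //.
have pf (X : set Omega) : measurable X -> P X = (fine (P X))%:E by move=> mX; rewrite fineK// fin_num_measure.
have [_ _ ind] := Z_iid.
have u' : uniq (j.+1 :: s) by rewrite /= js.
rewrite pf; last exact: measurable_past.
rewrite (ind _ _ u' mA') big_cons (pf (past s A)); last exact: measurable_past.
rewrite (ind _ _ us mA) -(law_noise j.+1 mB) (pf (Z j.+1 @^-1` B)); last by rewrite -[_ @^-1` _]setTI; exact: measurable_noise.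
rewrite -EFinM mulrC; congr (_ * _)%:E; last by rewrite /A' eqxx.
by apply: eq_big_seq => i si; rewrite As.
Qed.

(** The noise vectors with indices j + 1, ..., j + n: [Z 0] is the generic copy and does not drive
    the chain. *)
Fixpoint noise_tuple n j (w : Omega) : n.-tuple Xd :=
  if n is n'.+1 then [tuple of (Z j.+1 w : Xd) :: noise_tuple n' j.+1 w] else [tuple].

Lemma measurable_noise_tuple n j : measurable_fun setT (noise_tuple n j).
Proof.
elim: n j => [|n IH] j; first exact: measurable_cst.
have h := measurable_fun_pair (measurable_noise j.+1) (IH j.+1).
have h2 := measurableT_comp (measurable_consX (k := n)) h.
by apply: eq_measurable_fun h2 => w _.
Qed.

(** Independence is given for finite families of events, so the induction carries a cylinder event.
    Given that event, two measures on pairs agree on rectangles, and uniqueness of the product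
    measure extends this to all measurable sets. *)
Lemma law_noise_tuple n j s A (X : set (n.-tuple Xd)) : uniq s -> {in s, forall i, (i <= j)%N} ->
  (forall i, measurable (A i)) -> measurable X ->
  P (past s A `&` (noise_tuple n j @^-1` X)) = P (past s A) * power_measure lw X.
Proof.
elim: n j s A X => [|n IH] j s A X us sj mA mX.
  rewrite /=; have [Xt|Xt] := pselect (X [tuple]).
    by rewrite diracE mem_set// mule1; congr (P _); apply/seteqP; split=> w //= [].
  rewrite diracE memNset// mule0 -(measure0 P); congr (P _); apply/seteqP; split=> w //= [_].
  by rewrite /preimage /=.
have mE := measurable_past s mA.
have [pn pnE] := @power_measure_exists R _ Xd lw lw n (fun _ _ => erefl).
pose F w := (Z j.+1 w : Xd, noise_tuple n j.+1 w).
have mF : measurable_fun setT F by apply: measurable_fun_pair; [exact: measurable_noise|exact: measurable_noise_tuple].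
have [q qE] := pushforward_exists (mrestr P mE) mF.
pose X' : set (Xd * n.-tuple Xd) := (fun p : Xd * n.-tuple Xd => [tuple of p.1 :: p.2]) @^-1` X.
have mX' : measurable X' by rewrite -[X']setTI; exact: measurable_consX.
have E1 : P (past s A `&` (noise_tuple n.+1 j @^-1` X)) = q X'.
  by rewrite qE /mrestr setIC.
have rect (A1 : set Xd) (A2 : set (n.-tuple Xd)) : measurable A1 -> measurable A2 ->
    q (A1 `*` A2) = P (past s A) * (lw A1 * pn A2).
  move=> m1 m2; rewrite qE /mrestr.
  have [A' [mA' EA' PA']] := past_cons us sj mA m1.
  transitivity (P (F @^-1` (A1 `*` A2) `&` past s A)); first by [].
  have -> : F @^-1` (A1 `*` A2) `&` past s A = past (j.+1 :: s) A' `&` (noise_tuple n j.+1 @^-1` A2).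
    rewrite EA'; apply/seteqP; split=> w; rewrite /F /=; first by move=> [[? ?] ?]; split=> //; split.
    by move=> [[? ?] ?]; split=> //; split.
  rewrite (IH j.+1 (j.+1 :: s) A' A2) ?PA' ?pnE ?muleA//.
    by rewrite /= us andbT; apply/negP => /sj; rewrite ltnn.
  by move=> i; rewrite inE => /orP[/eqP ->//|/sj/leqW].
have E2 : power_measure lw X = (lw \x pn) X'.
  rewrite /= /product_measure1; apply: eq_integral => x _; rewrite /= pnE.
    by congr (pn _); apply/seteqP; split=> t; rewrite /xsection/= inE.
  by rewrite -[Y in measurable Y]setTI; exact: (@measurable_cons1 _ Xd n x).
(* A null past makes both sides 0; otherwise its probability is divided out. *)
rewrite E1 E2; have [P0|P0] := eqVneq (P (past s A)) 0.
  rewrite P0 mul0e; apply/eqP; rewrite eq_le measure_ge0 andbT qE /mrestr -P0.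
  by apply: le_measure; rewrite ?inE//; [apply: measurableI => //; rewrite -[Y in measurable Y]setTI; exact: mF].
have fP : P (past s A) \is a fin_num by rewrite fin_num_measure.
pose r := (fine (P (past s A)))^-1%R.
have fp0 : (0 < fine (P (past s A)))%R.
  by rewrite lt_neqAle fine_ge0// andbT eq_sym; apply: contra_neq P0 => h; rewrite -(fineK fP) h.
have r0 : (0 <= r)%R by rewrite invr_ge0 ltW.
have := @product_measure_unique _ _ Xd (n.-tuple Xd) R lw pn (mscale (NngNum r0) q) _ X' mX'.
move=> ->; last first.
  move=> A1 A2 m1 m2; transitivity (r%:E * q (A1 `*` A2)); first by [].
  by rewrite (rect _ _ m1 m2) muleA -[in X in X * _](fineK fP) -EFinM /r mulVf ?gt_eqF// mul1e.
transitivity (P (past s A) * (r%:E * q X')); last by [].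
by rewrite muleA -[in X in X * _](fineK fP) -EFinM /r divff ?gt_eqF// mul1e.
Qed.

Lemma integral_noise n (f : n.-tuple Xd -> \bar R) : measurable_fun setT f -> (forall t, 0 <= f t) ->
  \int[P]_w f (noise_tuple n 0 w) = \int[power_measure lw (k := n)]_t f t.
Proof.
move=> mf f0; symmetry.
apply: (@integral_image_measure _ _ Omega (n.-tuple Xd) R P (power_measure lw (k := n)) _ f (@measurable_noise_tuple n 0%N) _ mf f0).
move=> A mA; have nil : {in [::], forall i, (i <= 0)%N} by [].
have := @law_noise_tuple n 0 [::] (fun=> setT) A isT nil (fun _ => measurableT) mA.
have -> : past [::] (fun=> setT) = setT by apply/seteqP; split=> // w _ i.
by rewrite setTI probability_setT mul1e => <-.
Qed.

End noise_law.

(** * Operator iterates as probabilities of the chain *)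

Section path_functional.
Context {R : realType} {disp : measure_display} {Omega : measurableType disp} {m d : nat}.
Local Notation Xm := (borel 'cV[R]_m).
Local Notation Xd := (borel 'cV[R]_d).
Local Notation TR := (measurableTypeR R).
Variables (a : 'cV[R]_m -> 'cV[R]_m) (sigma : 'cV[R]_m -> 'M[R]_(m, d)) (D : R).
Hypothesis aD : forall x y, enorm (a x - a y) <= D * enorm (x - y).
Hypothesis sD : forall x y, opnorm (sigma x - sigma y) <= D * enorm (x - y).
Hypothesis D0 : 0 <= D.
Variable b : R.
Hypothesis b_gt0 : 0 < b.
Variable P : probability Omega R.
Variable Z : nat -> Omega -> 'cV[R]_d.
Hypothesis Z_iid : iid P Z.
Variable lw : probability Xd R.
Hypothesis lwE : forall A : set Xd, measurable A -> lw A = P (Z 0%N @^-1` A).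
Variable eta : R.
Local Notation move := (move a sigma b eta).
Variables (U B : set 'cV[R]_m).
Hypotheses (mU : measurable (U : set Xm)) (mB : measurable (B : set Xm)).

(** The exit indicator as a function of finitely many noise vectors: its integral is [exitp], and
    inserting the noise gives the indicator of [exit_by]. *)
Fixpoint chain_val n (x : 'cV[R]_m) : n.-tuple Xd -> R :=
  if n is n'.+1 then fun W =>
    if `[< U x >] then chain_val (move x (thead W)) [tuple of behead W] else \1_B x
  else fun _ => if `[< U x >] then 0 else \1_B x.

Lemma chain_val01 n x W : 0 <= @chain_val n x W <= 1.
Proof.
have h x' : 0 <= (\1_B x' : R) <= 1 by rewrite indicE; case: (_ \in _); rewrite /= ?ler01 ?lexx.
by elim: n x W => [|n IH] x W /=; case: ifP => _ //; rewrite lexx ler01.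
Qed.

Lemma measurable_chain_val n :
  measurable_fun setT ((fun p => chain_val p.1 p.2) : (Xm * n.-tuple Xd)%type -> TR).
Proof.
have mb n' : measurable_fun setT ((fun p => `[< U p.1 >]) : (Xm * n'.-tuple Xd)%type -> bool).
  apply: (@measurable_fun_bool _ _ _ _ true); rewrite setTI.
  rewrite (_ : _ @^-1` _ = (fun p : (Xm * n'.-tuple Xd)%type => p.1) @^-1` (U : set Xm)).
    by rewrite -[Y in measurable Y]setTI; exact: measurable_fst.
  by apply/seteqP; split=> x /=; [move/asboolP|move=> ?; apply/asboolP].
have mi n' : measurable_fun setT ((fun p => \1_B p.1) : (Xm * n'.-tuple Xd)%type -> TR).
  by apply: (measurableT_comp (f := \1_B : Xm -> TR)); [exact: measurable_indic|exact: measurable_fst].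
elim: n => [|n IH].
  apply: (measurable_fun_if measurableT) => //; first exact: mb.
  by apply: measurable_funS (mi 0%N).
apply: (measurable_fun_if measurableT) => //; first exact: mb.
  have h : measurable_fun setT ((fun p => (move p.1 (thead p.2), [tuple of behead p.2])) :
      (Xm * n.+1.-tuple Xd)%type -> (Xm * n.-tuple Xd)%type).
    apply: measurable_fun_pair.
      apply: (measurable_move aD sD D0 b_gt0); first exact: measurable_fst.
      exact: (measurableT_comp (@measurable_thead _ Xd n) measurable_snd).
    exact: (measurableT_comp (@measurable_behead _ Xd n) measurable_snd).
  by have := measurableT_comp IH h; apply: measurable_funS.
by apply: measurable_funS (mi n.+1).
Qed.

Lemma measurable_chain_val1 n x : measurable_fun setT (@chain_val n x : n.-tuple Xd -> TR).
Proof.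
have h : measurable_fun setT ((fun W => (x, W)) : n.-tuple Xd -> (Xm * n.-tuple Xd)%type).
  by apply: measurable_fun_pair; [exact: measurable_cst|exact: measurable_id].
exact: (measurableT_comp (@measurable_chain_val n) h).
Qed.

Lemma chain_val_exitp n x :
  (\int[power_measure lw (k := n)]_W (chain_val x W)%:E)%E = (exitp a sigma b lw eta U B n x)%:E.
Proof.
have mE k x' : measurable_fun setT (fun W : k.-tuple Xd => (chain_val x' W)%:E).
  by apply/measurable_EFinP; exact: measurable_chain_val1.
have p0 k x' (W : k.-tuple Xd) : (0 <= (chain_val x' W)%:E)%E.
  by rewrite lee_fin; have /andP[] := chain_val01 x' W.
have mI y : (\int[lw]_z (\1_B y)%:E = (\1_B y)%:E)%E.
  by rewrite -[in RHS](Ex_cst lw (\1_B y)) (ExE (integ_cst lw _)).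
have mI' y k : (\int[power_measure lw (k := k)]_z (\1_B y)%:E = (\1_B y)%:E)%E.
  elim: k => [|k IH]; first by rewrite power_integral0//; exact: measurable_cst.
  rewrite (@power_integral_cons _ _ _ lw lw (fun _ _ => erefl))//; first by rewrite -[RHS]mI; apply: eq_integral => z _; exact: IH.
elim: n x => [|n IH] x.
  by rewrite power_integral0//; exact: (mE 0%N x).
rewrite (@power_integral_cons _ _ _ lw lw (fun _ _ => erefl) n _ (mE n.+1 x) (p0 _ _)).
have fe := frac_exitp aD sD D0 b_gt0 lw eta mU n mB.
have [Ux|Ux] := pselect (U x).
  rewrite exitpS// /Kop (ExE (frac_integ aD sD D0 b_gt0 lw eta x fe)).
  apply: eq_integral => z _; rewrite -IH; congr (integral _ _ _); apply/funext => W /=.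
  by rewrite asboolT// theadE; congr (chain_val _ _)%:E; apply: val_inj.
rewrite exitp_out// -[RHS]mI; apply: eq_integral => z _; rewrite -(mI' x n).
by congr (integral _ _ _); apply/funext => W /=; rewrite asboolF.
Qed.

(** The chain restarted after j steps sees the noise from index j + 1 on, since X reads its driving
    sequence from index 1. *)
Definition shifted j i w := Z (j + i)%N w.

Local Notation chain j := (X a sigma b (shifted j) eta).

Lemma chain_shift j x i w : chain j x i.+1 w = chain j.+1 (move x (Z j.+1 w)) i w.
Proof.
elim: i => [|i IH]; first by rewrite /= /shifted addn1.
rewrite [LHS]/= [RHS]/=; rewrite /= in IH; rewrite IH.
by rewrite /shifted addnS -addSn.
Qed.

Definition first_exit j x w i := (forall l, (l < i)%N -> U (chain j x l w)) /\ ~ U (chain j x i w).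

Definition exit_by j n x : set Omega :=
  [set w | exists i, [/\ (i <= n)%N, first_exit j x w i & B (chain j x i w)]].

Lemma chain_val_noise n j x w : chain_val x (noise_tuple Z n j w) = \1_(exit_by j n x) w.
Proof.
have out i : ~ U x -> (\1_B x : R) = \1_(exit_by j i x) w.
  move=> Ux; rewrite !indicE; congr (_%:R); congr nat_of_bool; apply/idP/idP; rewrite !inE.
    by move=> Bx; exists 0%N; split.
  by move=> [[|l] [_ [h _]]] //; have := h 0%N isT.
elim: n j x out => [|n IH] j x out /=; (case: asboolP => Ux; last exact: out).
  rewrite indicE memNset// => -[i [/[!leqn0]/eqP -> [_ +] _]]; exact.
rewrite theadE (_ : chain_val _ _ = chain_val (move x (Z j.+1 w)) (noise_tuple Z n j.+1 w)); last first.
  by congr chain_val; exact: val_inj.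
rewrite IH.
  rewrite !indicE; congr (_%:R); congr nat_of_bool; apply/idP/idP; rewrite !inE.
    move=> [i [ij [h1 h2] h3]]; exists i.+1; rewrite chain_shift; split=> //.
    by split; [move=> [|l] li //; rewrite chain_shift; exact: h1|rewrite chain_shift].
  move=> [[|i] [ij [h1 h2] h3]]; first by [].
  rewrite !chain_shift in h2 h3; exists i; split=> //; split=> // l li.
  by rewrite -chain_shift; exact: h1.
move=> i Uy; rewrite !indicE; congr (_%:R); congr nat_of_bool; apply/idP/idP; rewrite !inE.
  by move=> By; exists 0%N; split.
by move=> [[|l] [_ [h _]]] //; have := h 0%N isT.
Qed.

Lemma measurable_exit_by j n x : measurable (exit_by j n x).
Proof.
rewrite (_ : exit_by j n x = (fun w => chain_val x (noise_tuple Z n j w)) @^-1` [set 1]).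
  rewrite -[Y in measurable Y]setTI.
  have := measurableT_comp (@measurable_chain_val1 n x) (@measurable_noise_tuple _ _ _ _ P Z Z_iid n j).
  by move=> h; apply: (h measurableT); exact: measurable_set1.
apply/seteqP; split=> w /=; rewrite chain_val_noise indicE.
  by move=> h; rewrite mem_set.
by have [//|h] := pselect (exit_by j n x w); rewrite memNset//= => /eqP; rewrite eq_sym oner_eq0.
Qed.

Lemma prob_exit_by n x : P (exit_by 0 n x) = (exitp a sigma b lw eta U B n x)%:E.
Proof.
rewrite -chain_val_exitp -(@integral_noise _ _ _ _ P Z Z_iid lw lwE n).
- transitivity (P (exit_by 0 n x `&` setT)); first by rewrite setIT.
  rewrite -(integral_indic P measurableT)//; last exact: measurable_exit_by.
  by apply: eq_integral => w _; rewrite chain_val_noise.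
- by apply/measurable_EFinP; exact: measurable_chain_val1.
- by move=> t; rewrite lee_fin; have /andP[] := chain_val01 x t.
Qed.

Lemma gap_exitp n k x : U x -> gap a sigma b lw eta U B n k x =
  exitp a sigma b lw eta U B (n + k) x - exitp a sigma b lw eta U B n x.
Proof.
have fe i := frac_exitp aD sD D0 b_gt0 lw eta mU i mB.
elim: n x => [|n IH] x Ux; first by rewrite gap0// exitp0// subr0.
rewrite gapS// addSn !exitpS// /Kop -ExB; last 2 first.
  exact: (frac_integ aD sD D0 b_gt0).
  exact: (frac_integ aD sD D0 b_gt0).
apply: Ex_eq => z; have [Uy|Uy] := pselect (U (move x z)); first exact: IH.
by rewrite gap_out// !exitp_out// subrr.
Qed.

Lemma prob_exit_between n k x : U x ->
  P (exit_by 0 (n + k) x `\` exit_by 0 n x) = (gap a sigma b lw eta U B n k x)%:E.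
Proof.
move=> Ux; rewrite measureD; first last.
- by rewrite -ge0_fin_numE// fin_num_measure//; exact: measurable_exit_by.
- exact: measurable_exit_by.
- exact: measurable_exit_by.
rewrite (_ : exit_by 0 (n + k) x `&` _ = exit_by 0 n x); last first.
  apply/seteqP; split=> w; first by case.
  move=> h; split=> //; case: h => i [i1 i2 i3]; exists i; split=> //.
  by rewrite (leq_trans i1)// leq_addr.
transitivity (P (exit_by 0 (n + k) x) - P (exit_by 0 n x))%E; first by [].
by rewrite !prob_exit_by gap_exitp// EFinB.
Qed.

(** Windows of growing length increase to the event of an exit after step n, so continuity from
    below passes a bound uniform in k to the limit. *)
Lemma exit_between_lim (p : \bar R) n x : U x ->
  (forall k, ((gap a sigma b lw eta U B n k x)%:E <= p)%E) ->
  (P (\bigcup_k (exit_by 0 (n + k) x `\` exit_by 0 n x)) <= p)%E.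
Proof.
move=> Ux hp.
have mF k : measurable (exit_by 0 (n + k) x `\` exit_by 0 n x).
  by apply: measurableD; exact: measurable_exit_by.
have := @nondecreasing_cvg_mu _ _ _ P (fun k => exit_by 0 (n + k) x `\` exit_by 0 n x) mF.
move=> /(_ (bigcup_measurable (fun k _ => mF k))) h.
have nd : nondecreasing_seq (fun k => exit_by 0 (n + k) x `\` exit_by 0 n x).
  move=> k k' kk; apply/subsetPset => w [[i [i1 i2 i3]] h2]; split=> //; exists i; split=> //.
  by rewrite (leq_trans i1)// leq_add2l.
have {}h := h nd.
rewrite -(cvg_lim _ h)//; apply: lime_le; first by apply/cvg_ex; eexists; exact: h.
by apply: nearW => k; rewrite /= prob_exit_between.
Qed.

Lemma exit_between_ge k n x : U x ->
  ((gap a sigma b lw eta U B n k x)%:E <= P (\bigcup_k (exit_by 0 (n + k) x `\` exit_by 0 n x)))%E.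
Proof.
move=> Ux; rewrite -prob_exit_between//.
have mF k' : measurable (exit_by 0 (n + k') x `\` exit_by 0 n x).
  by apply: measurableD; exact: measurable_exit_by.
apply: le_measure; rewrite ?inE//; first exact: bigcup_measurable.
by move=> w h; exists k.
Qed.

End path_functional.

(** * Limits in eta and exit events *)

Section limits_at_zero.
Context {R : realType}.
Local Open Scope ereal_scope.

Lemma limf_esup_le (f : R -> \bar R) c : (forall kappa, (0 < kappa)%R -> ev (fun eta => f eta <= (c + kappa)%:E)) ->
  limf_esup f (0%R : R)^'+ <= c%:E.
Proof.
move=> h; apply/lee_addgt0Pr => kappa k0; have /ev_near hk := h _ k0.
rewrite /limf_esup; apply: (@le_trans _ _ (ereal_sup (f @` [set eta | f eta <= (c + kappa)%:E]))).
  by apply: ereal_inf_lbound; eexists; first exact: hk.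
by apply: ge_ereal_sup => _ [eta /= he <-]; rewrite -EFinD.
Qed.

Lemma limf_einf_ge (f : R -> \bar R) c : (forall kappa, (0 < kappa)%R -> ev (fun eta => (c - kappa)%:E <= f eta)) ->
  c%:E <= limf_einf f (0%R : R)^'+.
Proof.
move=> h; rewrite /limf_einf leeNr -EFinN; apply: limf_esup_le => kappa /h.
by apply: ev_imp => eta _; rewrite leeNl -EFinN opprD opprK.
Qed.

Lemma prob_sup_le T (A : set T) (p : T -> \bar R) c : 0 <= c -> (forall x, A x -> p x <= c) -> prob_sup A p <= c.
Proof. by move=> c0 h; rewrite /prob_sup ge_max c0; apply: ge_ereal_sup => _ [x Ax <-]; exact: h. Qed.

Lemma prob_inf_ge T (A : set T) (p : T -> \bar R) c : c <= 1 -> (forall x, A x -> c <= p x) -> c <= prob_inf A p.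
Proof. by move=> c1 h; rewrite /prob_inf le_min c1; apply: le_ereal_inf_tmp => _ [x Ax <-]; exact: h. Qed.

Lemma prob_sup_ge0 T (A : set T) (p : T -> \bar R) : 0 <= prob_sup A p.
Proof. by rewrite /prob_sup le_max lexx. Qed.

Lemma limf_esup_ge0 (f : R -> \bar R) : (forall eta, 0 <= f eta) -> 0 <= limf_esup f (0%R : R)^'+.
Proof.
move=> f0; apply: le_ereal_inf_tmp => _ [V /= hV <-].
have [eta eV] : V !=set0 by apply: (@filter_ex _ ((0%R : R)^'+)); exact: hV.
by apply: le_trans (f0 eta) _; apply: ereal_sup_ubound; exists eta.
Qed.

End limits_at_zero.

Section exit_events.
Context {R : realType} {disp : measure_display} {Omega : measurableType disp} {m d : nat}.
Variables (a : 'cV[R]_m -> 'cV[R]_m) (sigma : 'cV[R]_m -> 'M[R]_(m, d)) (b : R).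
Variable Z : nat -> Omega -> 'cV[R]_d.
Variable eta : R.
Variables (U B : set 'cV[R]_m).

Local Notation first_exit := (first_exit a sigma b Z eta U).
Local Notation exit_by := (exit_by a sigma b Z eta U).
Local Notation tau := (tau a sigma b Z U eta).

Lemma first_exit_tau x w i : first_exit 0 x w i -> tau x w = (i%:R)%:E.
Proof.
move=> [h1 h2]; apply/eqP; rewrite eq_le; apply/andP; split.
  by apply: ereal_inf_lbound; exists i => //; exact: h2.
apply: le_ereal_inf_tmp => _ [j /= hj <-]; rewrite lee_fin ler_nat leqNgt; apply/negP => ji.
exact: hj (h1 j ji).
Qed.

Lemma first_exit_exists x w : (exists i, first_exit 0 x w i) \/ tau x w = +oo%E.
Proof.
have [[j hj]|h] := pselect (exists j, ~ U (X a sigma b Z eta x j w)).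
  left; have ex : exists j, `[< ~ U (X a sigma b Z eta x j w) >] by exists j; exact/asboolP.
  exists (ex_minn ex); case: ex_minnP => i /asboolP hi min; split=> // l li.
  apply: contrapT => hl; have := min l (introT (asboolP _) hl); by rewrite leqNgt li.
right; rewrite /Defs.tau (_ : [set j | _] = set0) ?image_set0 ?ereal_inf0//.
by apply/seteqP; split=> // j /= hj; apply: h; exists j.
Qed.

(** Since n r <= t < (n + 1) r, the rescaled exit time exceeds t exactly when exit comes after step
    n; prescribing the exit position excludes infinite times. *)
Lemma late_exitE (t r : R) n x : 0 < r -> n%:R * r <= t -> t < n.+1%:R * r ->
  [set w | (t%:E < r%:E * tau x w)%E] `&` exit_location_in a sigma b Z U eta x B =
  \bigcup_k (exit_by B 0 (n + k) x `\` exit_by B 0 n x).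
Proof.
move=> r0 nt tn; apply/seteqP; split=> w.
  move=> [/= tw [j [tj Bj]]]; have [[i fi]|] := first_exit_exists x w; last by rewrite tj.
  have /eqP := first_exit_tau fi; rewrite tj eqe eqr_nat => /eqP ji; subst j.
  have ni : (n < i)%N.
    rewrite ltnNge; apply/negP => hin; move: tw; rewrite tj -EFinM lte_fin ltNge => /negP; apply.
    by apply: le_trans nt; rewrite mulrC ler_pM2r// ler_nat.
  exists (i - n)%N => //; split; first by exists i; split=> //; rewrite subnKC// ltnW.
  move=> [l [ln [l1 l2] _]]; have := leq_ltn_trans ln ni => /fi.1; exact: l2.
move=> [k _ [[i [ik fi Bi]] nn]]; have ti := first_exit_tau fi.
split; last by exists i; split.
rewrite /= ti -EFinM lte_fin; apply: lt_le_trans tn _; rewrite mulrC ler_pM2l// ler_nat.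
by rewrite ltnNge; apply/negP => hin; apply: nn; exists i.
Qed.

Lemma early_exitE (t r : R) n x : 0 < r -> n%:R * r <= t -> t < n.+1%:R * r ->
  [set w | (r%:E * tau x w <= t%:E)%E] = exit_by (~` U) 0 n x.
Proof.
move=> r0 nt tn; apply/seteqP; split=> w /=.
  move=> tw; have [[i fi]|ty] := first_exit_exists x w; last first.
    by move: tw; rewrite ty gt0_muley ?lte_fin// leye_eq.
  exists i; split=> //; last exact: fi.2.
  move: tw; rewrite (first_exit_tau fi) -EFinM lee_fin => /le_lt_trans/(_ tn).
  by rewrite mulrC ltr_pM2r// ltr_nat ltnS.
move=> [i [ik fi _]]; rewrite (first_exit_tau fi) -EFinM lee_fin; apply: le_trans nt.
by rewrite mulrC ler_pM2r// ler_nat.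
Qed.

Lemma truncn_rate (t r : R) : 0 <= t -> 0 < r -> exists n, n%:R * r <= t /\ t < n.+1%:R * r.
Proof.
move=> t0 r0; exists (Num.truncn (t / r)).
have /andP[h1 h2] := Num.Theory.truncn_itv (divr_ge0 t0 (ltW r0)).
by rewrite -ler_pdivlMr// -ltr_pdivrMr.
Qed.

End exit_events.

(** * The law of the noise *)

Section noise_limits.
Context {R : realType} {disp : measure_display} {Omega : measurableType disp} {d : nat}.
Local Notation Xd := (borel 'cV[R]_d).
Local Notation TR := (measurableTypeR R).
Variable P : probability Omega R.
Variable Y : Omega -> 'cV[R]_d.
Hypothesis mY : measurable_fun setT (Y : Omega -> Xd).

Lemma law_exists : exists lw : probability Xd R, forall A : set Xd, measurable A -> lw A = P (Y @^-1` A).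
Proof.
pose Y' : {mfun Omega >-> Xd} := HB.pack (Y : Omega -> Xd) (isMeasurableFun.Build _ _ _ _ _ mY).
by exists (distribution P Y').
Qed.

Variable lw : probability Xd R.
Hypothesis lwE : forall A : set Xd, measurable A -> lw A = P (Y @^-1` A).

Lemma tail_law x : tail P Y x = tl lw x.
Proof. by rewrite /tail /tl lwE//; exact: measurable_gt_enorm. Qed.

Lemma law_mean i : ('E_P[fun w => Y w i ord0] = 0)%E -> Ex lw (fun z : Xd => (z : 'cV[R]_d) i ord0) = 0.
Proof.
rewrite unlock => h; rewrite /Ex /Rintegral; apply/eqP; rewrite (_ : (\int[lw]_z _)%E = 0%E)//.
have mi : measurable_fun setT ((fun z => (z i ord0)%:E) : Xd -> \bar R).
  by apply/measurable_EFinP; apply: continuous_measurableR; exact: coord_continuous.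
rewrite -[RHS]h [LHS]integralE [RHS]integralE; congr (_ - _)%E.
  by apply: etrans (integral_image_measure mY lwE (measurable_funepos mi) (fun z => funepos_ge0 _ z)) _; apply: eq_integral => w _; rewrite !funeposE.
by apply: etrans (integral_image_measure mY lwE (measurable_funeneg mi) (fun z => funeneg_ge0 _ z)) _; apply: eq_integral => w _; rewrite !funenegE.
Qed.

Variables (nu : {measure set TR -> \bar R}) (alpha : R) (S : probability Xd R).
Hypothesis Y_rv : regularly_varying P Y alpha nu S.
Variable mu : {sigma_finite_measure set Xd -> \bar R}.
Hypothesis mu_tail : forall r, 0 < r -> mu [set w | r <= enorm w] = (r `^ (- alpha))%:E.
Hypothesis muE : forall f : Xd -> \bar R, measurable_fun setT f -> (forall x, 0 <= f x)%E ->
  (\int[mu]_x f x = \int[nu \x S]_(p in polar_dom) f (p.1 *: p.2))%E.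

Lemma tl_regular t : 0 < t -> tl lw (t * x) / tl lw x @[x --> +oo] --> t `^ (- alpha).
Proof.
move=> /(Y_rv.1 t); rewrite (_ : (fun x => _) = fun x => tl lw (t * x) / tl lw x)//.
by apply/funext => x; rewrite !tail_law.
Qed.

(** [law_scaled_cvg] multiplied by the tail, which is eventually positive. The limit integral is
    finite because g is bounded and vanishes near 0. *)
Lemma law_cvg (g : 'cV[R]_d -> R) r B kappa : 0 < r -> continuous g ->
  (forall w, 0 <= g w <= B) -> (forall w, enorm w <= r -> g w = 0) -> 0 < kappa ->
  ev (fun eta => `|Ex lw (fun z : Xd => g (eta *: (z : 'cV[R]_d))) - tl lw eta^-1 * fine (\int[mu]_w (g w)%:E)%E|
                   <= kappa * tl lw eta^-1).
Proof.
move=> r0 cg gB gr k0; have h := law_scaled_cvg mY Y_rv muE r0 cg gB gr.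
have mg : measurable_fun setT (g : Xd -> TR) by exact: continuous_measurableR.
have mge eta : measurable_fun setT ((fun z => (g (eta *: (z : 'cV[R]_d)))%:E) : Xd -> \bar R).
  apply/measurable_EFinP; apply: (@continuous_measurableR _ _ (fun z : 'cV[R]_d => g (eta *: z))) => z.
  by apply: continuous_comp; [exact: scaler_continuous|exact: cg].
have fin : (\int[mu]_w (g w)%:E)%E \is a fin_num.
  rewrite ge0_fin_numE; last by apply: integral_ge0 => w _; rewrite lee_fin; have /andP[] := gB w.
  have B0 : 0 <= B by have /andP[h1 h2] := gB 0; exact: le_trans h1 h2.
  have mS : measurable ([set w | r <= enorm w] : set Xd).
    apply: closed_borel; rewrite (_ : mkset _ = (@enorm R d) @^-1` [set x | r <= x])//.
    by apply: closed_comp; [move=> x _; exact: enorm_continuous|exact: closed_ge].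
  apply: (@le_lt_trans _ _ (\int[mu]_w (B * \1_([set w | r <= enorm w] : set Xd) w)%:E)%E).
    apply: ge0_le_integral => //.
    - by move=> w _; rewrite lee_fin; have /andP[] := gB w.
    - exact/measurable_EFinP.
    - by apply/measurable_EFinP; apply: measurable_funM => //; exact: measurable_indic.
    move=> w _; rewrite lee_fin indicE; have [wr|wr] := leP (enorm w) r.
      by rewrite gr// mulr_ge0.
    by rewrite mem_set/= ?mulr1; [have /andP[] := gB w|exact: ltW].
  under eq_integral do rewrite EFinM.
  rewrite ge0_integralZl//; last by apply/measurable_EFinP; exact: measurable_indic.
  have -> : (\int[mu]_x (\1_([set w | r <= enorm w] : set Xd) x)%:E = (r `^ (- alpha))%:E)%E.
    by rewrite integral_indic// setIT; exact: mu_tail.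
  by rewrite -EFinM ltry.
have k2 : 0 < kappa by [].
have Eeta eta : (\int[P]_w (g (eta *: Y w))%:E)%E = (Ex lw (fun z : Xd => g (eta *: (z : 'cV[R]_d))))%:E.
  rewrite ExE; last first.
    apply: (@integ_bounded _ _ _ _ _ B); first by apply/measurable_EFinP; exact: mge.
    by move=> z; have /andP[h1 h2] := gB (eta *: (z : 'cV[R]_d)); rewrite ger0_norm.
  symmetry; apply: (@integral_image_measure _ _ _ _ _ P lw Y _ mY lwE (mge eta)).
  by move=> z; rewrite lee_fin; have /andP[] := gB (eta *: (z : 'cV[R]_d)).
rewrite -(fineK fin) in h.
have h2 : \forall x \near +oo, `|(tl lw x)^-1 * Ex lw (fun z : Xd => g (x^-1 *: (z : 'cV[R]_d))) - fine (\int[mu]_w (g w)%:E)%E| <= kappa.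
  move/fine_cvgP : h => [_ /cvgrPdist_le/(_ kappa k0)].
  apply: filterS => x; rewrite /= Eeta tail_law -EFinM/= distrC; exact.
apply: (ev_and2 _ (ev_pinfty h2) (ev_tl_pos tl_regular)) => eta e0; rewrite invrK => h3 t0.
rewrite (_ : Ex lw _ - _ = tl lw eta^-1 * ((tl lw eta^-1)^-1 * Ex lw (fun z : Xd => g (eta *: (z : 'cV[R]_d))) - fine (\int[mu]_w (g w)%:E)%E)); last first.
  by rewrite mulrBr mulrA divff ?mul1r// gt_eqF.
by rewrite normrM gtr0_norm// mulrC ler_pM2r.
Qed.

End noise_limits.

(** * From exit bounds to limits superior and inferior *)

Section exit_time_limits.
Context {R : realType} {disp : measure_display} {Omega : measurableType disp} {m d : nat}.
Local Notation Xm := (borel 'cV[R]_m).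
Local Notation Xd := (borel 'cV[R]_d).
Variables (a : 'cV[R]_m -> 'cV[R]_m) (sigma : 'cV[R]_m -> 'M[R]_(m, d)) (D : R).
Hypothesis aD : forall x y, enorm (a x - a y) <= D * enorm (x - y).
Hypothesis sD : forall x y, opnorm (sigma x - sigma y) <= D * enorm (x - y).
Hypothesis D0 : 0 <= D.
Variable b : R.
Hypothesis b_gt0 : 0 < b.
Variable P : probability Omega R.
Variable Z : nat -> Omega -> 'cV[R]_d.
Hypothesis Z_iid : iid P Z.
Variable lw : probability Xd R.
Hypothesis lwE : forall A : set Xd, measurable A -> lw A = P (Z 0%N @^-1` A).
Variables (U : set 'cV[R]_m) (J : nat) (e0 : R).
Hypotheses (mU : measurable (U : set Xm)) (e00 : 0 < e0).
Hypothesis lam_pos : ev (fun eta => 0 < lam lw eta).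

Local Notation rate eta := (eta * lambda P (Z 0%N) eta ^+ J).
Local Notation tau := (tau a sigma b Z U).

Lemma rateE eta : rate eta = eta * lam lw eta ^+ J.
Proof. by rewrite /lambda (tail_law lwE). Qed.

Lemma late_exit_limsup (B : set 'cV[R]_m) C L t : measurable (B : set Xm) -> 0 < C -> 0 <= t -> 0 <= L ->
  (forall kappa, 0 < kappa -> ev (fun eta => forall x n k, shrink U e0 x ->
     t < n.+1%:R * (C * (eta * lam lw eta ^+ J)) -> gap a sigma b lw eta U B n k x <= L + kappa)) ->
  (limf_esup (fun eta : R => prob_sup (shrink U e0) (fun x =>
     P ([set w | (t%:E < (C * rate eta)%:E * tau eta x w)%E] `&` exit_location_in a sigma b Z U eta x B)))
     (0 : R)^'+ <= L%:E)%E.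
Proof.
move=> mB C0 t0 L0 h; apply: limf_esup_le => kappa k0.
apply: (ev_and2 _ (h kappa k0) lam_pos) => eta eta0 hg l0.
have r0 : 0 < C * (eta * lam lw eta ^+ J) by rewrite !mulr_gt0// exprn_gt0.
have [n [n1 n2]] := truncn_rate t0 r0.
apply: prob_sup_le => [|x xU]; first by rewrite lee_fin addr_ge0// ltW.
rewrite rateE (late_exitE a sigma b Z _ U B x r0 n1 n2).
apply: (exit_between_lim aD sD D0 b_gt0 Z_iid lwE mU mB) => [|k]; first exact: shrink_sub e00 _ xU.
by rewrite lee_fin; exact: hg.
Qed.

Lemma late_exit_liminf (B : set 'cV[R]_m) C L t : measurable (B : set Xm) -> 0 < C -> 0 <= t -> L <= 1 ->
  (forall kappa, 0 < kappa -> ev (fun eta => forall x n, shrink U e0 x ->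
     n%:R * (C * (eta * lam lw eta ^+ J)) <= t -> exists c0, forall k, (c0 <= k)%N ->
     L <= gap a sigma b lw eta U B n k x + kappa)) ->
  (L%:E <= limf_einf (fun eta : R => prob_inf (shrink U e0) (fun x =>
     P ([set w | (t%:E < (C * rate eta)%:E * tau eta x w)%E] `&` exit_location_in a sigma b Z U eta x B)))
     (0 : R)^'+)%E.
Proof.
move=> mB C0 t0 L1 h; apply: limf_einf_ge => kappa k0.
apply: (ev_and2 _ (h kappa k0) lam_pos) => eta eta0 hg l0.
have r0 : 0 < C * (eta * lam lw eta ^+ J) by rewrite !mulr_gt0// exprn_gt0.
have [n [n1 n2]] := truncn_rate t0 r0.
apply: prob_inf_ge => [|x xU]; first by rewrite lee_fin lerBlDr (le_trans L1)// lerDl ltW.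
rewrite rateE (late_exitE a sigma b Z _ U B x r0 n1 n2).
have [c0 hc] := hg x n xU n1.
have hge := @exit_between_ge _ _ _ _ _ a sigma D aD sD D0 b b_gt0 P Z Z_iid lw lwE eta U B mU mB c0 n x (shrink_sub e00 xU).
apply: le_trans hge.
by rewrite lee_fin lerBlDr; exact: hc.
Qed.

Lemma early_exit_lim0 t : 0 <= t ->
  (forall kappa, 0 < kappa -> ev (fun eta => forall x n, shrink U e0 x ->
     n%:R * (eta * lam lw eta ^+ J) <= t -> exitp a sigma b lw eta U (~` U) n x <= kappa)) ->
  limf_esup (fun eta : R => prob_sup (shrink U e0) (fun x =>
     P [set w | ((rate eta)%:E * tau eta x w <= t%:E)%E])) (0 : R)^'+ = 0%E.
Proof.
move=> t0 h; have mU' : measurable (~` U : set Xm) by exact: measurableC.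
apply/eqP; rewrite eq_le; apply/andP; split; last first.
  by apply: limf_esup_ge0 => eta; exact: prob_sup_ge0.
apply: limf_esup_le => kappa k0; apply: (ev_and2 _ (h kappa k0) lam_pos) => eta eta0 hg l0.
have r0 : 0 < eta * lam lw eta ^+ J by rewrite mulr_gt0// exprn_gt0.
have [n [n1 n2]] := truncn_rate t0 r0.
apply: prob_sup_le => [|x xU]; first by rewrite lee_fin add0r ltW.
rewrite rateE.
rewrite (early_exitE a sigma b Z _ U x r0 n1 n2).
by rewrite (prob_exit_by aD sD D0 b_gt0 Z_iid lwE eta mU mU') lee_fin add0r; exact: hg.
Qed.

End exit_time_limits.

Theorem theorem2p8 (R : realType) (m d : nat) (m_gt0 : (0 < m)%N) (d_gt0 : (0 < d)%N)
  (disp : measure_display) (Omega : measurableType disp) (P : probability Omega R)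
  (* the noise: Z 0 is the generic copy, Z 1, Z 2, etc. drive the process *)
  (Z : nat -> Omega -> 'cV[R]_d)
  (Z_iid : iid P Z)
  (Z_mean0 : forall i, ('E_P[fun w => Z 0%N w i ord0] = 0)%E)
  (alpha : R) (alpha_gt1 : 1 < alpha)
  (nu : {measure set (measurableTypeR R) -> \bar R}) (nu_alpha : is_nu_alpha alpha nu)
  (S : probability (borel 'cV[R]_d) R) (S_sphere : S (@esphere R d) = 1%E)
  (Z_rv : regularly_varying P (Z 0%N) alpha nu S)
  (a : 'cV[R]_m -> 'cV[R]_m) (sigma : 'cV[R]_m -> 'M[R]_(m, d))
  (lipschitz : exists2 D : R, 1 <= D & forall x y : 'cV[R]_m,
     Num.max (opnorm (sigma x - sigma y)) (enorm (a x - a y)) <= D * enorm (x - y))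
  (y_ : R -> 'cV[R]_m -> 'cV[R]_m) (y_flow : forall x, ode_sol a x (y_ ^~ x))
  (I : set 'cV[R]_m) (I_open : open I) (I_bounded : exists M : R, I `<=` eball M 0)
  (I0 : I 0)
  (a0 : a 0 = 0)
  (I_attracted : forall x, I x -> x <> 0 ->
     (forall t, 0 <= t -> I (y_ t x)) /\ y_ t x @[t --> +oo] --> (0 : 'cV[R]_m))
  (a_inward : \forall e \near (0 : R)^'+, forall x : 'cV[R]_m,
     eball e 0 x -> x <> 0 -> dot (a x) x < 0)
  (b : R) (b_gt0 : 0 < b)
  (J : nat) (J_def : is_jump_number a sigma b I J)
  (I_away : exists2 e : R, 0 < e & bounded_away (~` I) (coverage a sigma b J.-1 e))
  (C_boundary : Ccheck a sigma b (polar_measure nu S) J (boundary I) = 0%E) :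
  let Cmeas := Ccheck a sigma b (polar_measure nu S) J in
  let CI := Cmeas (~` I) in
  let C := fine CI in
  let rate eta := eta * lambda P (Z 0%N) eta ^+ J in
  let T := tau a sigma b Z I in
  let late t eta x := [set w | (t%:E < (C * rate eta)%:E * T eta x w)%E] in
  let exit_in B eta x := exit_location_in a sigma b Z I eta x B in
  [/\ (CI < +oo)%E,
      (0 < CI < +oo)%E ->
      forall (e t : R) (B : set (borel 'cV[R]_m)),
        0 < e -> 0 <= t -> measurable B -> B `<=` ~` I ->
        (limf_esup (fun eta => prob_sup (shrink I e)
             (fun x => P (late t eta x `&` exit_in B eta x))) (0 : R)^'+
           <= Cmeas (closure (B : set 'cV[R]_m)) * (C^-1 * expR (- t))%:E)%E /\
        (Cmeas (interior (B : set 'cV[R]_m)) * (C^-1 * expR (- t))%:E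
           <= limf_einf (fun eta => prob_inf (shrink I e)
             (fun x => P (late t eta x `&` exit_in B eta x))) (0 : R)^'+)%E &
      ~ (0 < CI < +oo)%E ->
      CI = 0%E /\
      forall e t : R, 0 < e -> 0 <= t ->
        limf_esup (fun eta => prob_sup (shrink I e)
          (fun x => P [set w | ((rate eta)%:E * T eta x w <= t%:E)%E])) (0 : R)^'+
          = 0%E].
Proof.
move=> Cmeas CI C rate T late exit_in.
have [D D1 hD] := lipschitz; have D0 : 0 <= D by exact: le_trans ler01 D1.
have aD x y : enorm (a x - a y) <= D * enorm (x - y) by have := hD x y; rewrite ge_max => /andP[].
have sD x y : opnorm (sigma x - sigma y) <= D * enorm (x - y) by have := hD x y; rewrite ge_max => /andP[].
have [[[J_gt0 _] _] _] := (J_def, tt).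
have [M IM] := I_bounded.
have [ea [ea0 inward]] : exists ea, 0 < ea /\ forall x : 'cV[R]_m, enorm x <= ea -> x <> 0 -> dot (a x) x < 0.
  have [ea ea0 h] := ev_ex ((ev_near _).1 a_inward); exists ea; split=> // x xe; apply: h.
  by rewrite /eball /= subr0.
have [e2 e20 /bounded_away_shrink[c1 c10 cov]] := I_away.
have flow_uni c r (c0 : 0 < c) (r0 : 0 < r) := flow_uniform aD D0 y_flow I_open IM I0 a0 I_attracted ea0 inward c0 r0.
have [c' [T1 [c'0 _ flow_c1]]] := flow_uni _ _ c10 (ltr01 : 0 < (1 : R)).
have [ri ri0 Iri] := open_shrink I_open I0.
(* Strictly below e2 to leave the room used in [path_safe], below ea so that small balls are
   invariant under the flow, and within half the depth of the origin in I. *)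
pose e := Num.min (e2 / 2) (Num.min (ea / 2) (ri / 2)).
pose c := Num.min c' (ri / 2).
have e_gt0 : 0 < e by rewrite !lt_min !divr_gt0.
have c_gt0 : 0 < c by rewrite lt_min c'0 divr_gt0.
have ee2 : e < e2 by rewrite gt_min ltr_pdivrMr// ltr_pMr// ltr1n.
have eea : e < ea by rewrite !gt_min [X in _ || (X || _)]ltr_pdivrMr// ltr_pMr// ltr1n orbT.
have eri : e <= ri / 2 by rewrite /e !ge_min lexx !orbT.
have flow_core rho x s : 0 <= rho <= e / 2 -> enorm x <= rho -> 0 <= s -> enorm (y_ s x) <= rho.
  move=> /andP[rho0 re] xr s0; apply: (flow_ball y_flow inward a0 _ xr s0).
  by rewrite rho0 (le_lt_trans re)// (le_lt_trans _ eea)// ler_pdivrMr// ler_pMr// ler1n.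
have flow_e x s : enorm x <= e -> 0 <= s -> enorm (y_ s x) <= e.
  move=> xr s0; apply: (flow_ball y_flow inward a0 _ xr s0).
  by rewrite (ltW e_gt0).
have ball_safe0 x s : enorm x <= e -> 0 <= s -> shrink I c (y_ s x).
  move=> xe s0; have ye := flow_e x s xe s0.
  have h : enorm (y_ s x - 0) <= ri / 2 by rewrite subr0 (le_trans ye).
  by apply: le_shrink (shrinkD Iri h); rewrite ge_min; apply/orP; right; lra.
have shrink_flow x : shrink I c1 x -> forall t, 0 <= t -> shrink I c (y_ t x).
  by move=> /flow_c1[h _] t /h; apply: le_shrink; rewrite ge_min lexx.
have ball_jump_safe := coverage_ball_jump_safe aD y_flow a0 (ltW e_gt0) ee2 cov shrink_flow.
have [mu [muE mu0 mu_tail muI]] := polar_measure_exists nu_alpha S_sphere.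
have mZ : measurable_fun setT (Z 0%N : Omega -> borel 'cV[R]_d) by have [] := Z_iid.
have [lw lwE] := law_exists P mZ.
have tl_rv := tl_regular lwE Z_rv.
have mean0 i : Ex lw (fun z : borel 'cV[R]_d => (z : 'cV[R]_d) i ord0) = 0 by exact: (law_mean mZ lwE).
have law_cvg g r B kappa := @law_cvg R disp Omega d P (Z 0%N) mZ lw lwE nu alpha S Z_rv mu mu_tail muI g r B kappa.
(* Core states have margin 1/2; the induction halves it once per level, J times, and its last level
   asks for one halving more. *)
pose r0 : R := 1 / 2 / 2 ^+ J.-1.+2 * c.
have r0_gt0 : 0 < r0 by rewrite mulr_gt0// !divr_gt0// exprn_gt0.
pose Cm := Cm sigma y_ b J mu.
have mI : measurable (I : set (borel 'cV[R]_m)) by exact: open_borel.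
have CmE (A : set 'cV[R]_m) : measurable (A : set (borel 'cV[R]_m)) -> A `<=` ~` I -> Cmeas A = (Cm A)%:E /\ 0 <= Cm A.
  move=> mA AI; have [h1 h2] := CmE aD sD D0 y_flow b_gt0 c_gt0 e_gt0 IM ball_safe0 ball_jump_safe flow_uni mu_tail r0_gt0 J_gt0 (lexx r0) flow_core mA AI.
  by split=> //; rewrite -h1 /Cmeas -(prednK J_gt0) (Ccheck_iter_int aD sD D0 y_flow b_gt0 muE).
have mIc : measurable (~` I : set (borel 'cV[R]_m)) by exact: measurableC.
have bI := boundary_sub I_open.
have mb : measurable (boundary I : set (borel 'cV[R]_m)) by exact: measurable_boundary.
have Cb0 : Cm (boundary I) = 0.
  by have [h _] := CmE _ mb bI; move: h; rewrite /Cmeas C_boundary => -[].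
have [CIE C0] := CmE _ mIc (fun _ => id).
have CE : C = Cm (~` I) by rewrite /C /CI CIE.
clearbody C; subst C.
have lam_pos := ev_lam_pos tl_rv.
split; first by rewrite /CI CIE ltry.
  rewrite /CI CIE lte_fin => /andP[Cpos _] e0 t B e00 t0 mB BI.
  have mcB : measurable (closure (B : set 'cV[R]_m) : set (borel 'cV[R]_m)) by exact: measurable_closure.
  have miB : measurable (interior (B : set 'cV[R]_m) : set (borel 'cV[R]_m)) by apply: open_borel; exact: open_interior.
  have cBI := closure_sub I_open BI.
  have iBI : interior (B : set 'cV[R]_m) `<=` ~` I by move=> x /interior_subset/BI.
  have [-> CB0] := CmE _ mcB cBI; have [-> Ci0] := CmE _ miB iBI.
  (* Keeps the lower bound at most 1, as [prob_inf] requires when there is no starting point. *)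
  have CiC : Cm (interior (B : set 'cV[R]_m)) <= Cm (~` I).
    have := Cm_subadditive aD sD D0 y_flow b_gt0 c_gt0 e_gt0 IM ball_safe0 ball_jump_safe flow_uni mu_tail r0_gt0 J_gt0 (lexx r0) flow_core miB mIc mb iBI (fun _ => id) bI.
    by rewrite -/Cm Cb0 addr0; apply=> x /iBI; left.
  pose K := (Cm (~` I))^-1 * expR (- t).
  have K0 : 0 <= K by rewrite mulr_ge0 ?expR_ge0 ?invr_ge0.
  have hu kappa (k0 : 0 < kappa) := gap_upper aD sD D0 y_flow b_gt0 c_gt0 e_gt0 IM ball_safe0 ball_jump_safe flow_uni alpha_gt1 mu_tail r0_gt0 I_open tl_rv
    mean0 law_cvg J_gt0 (lexx r0) flow_core Cb0 mB BI e00 t Cpos k0.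
  have hl kappa (k0 : 0 < kappa) := gap_lower aD sD D0 y_flow b_gt0 c_gt0 e_gt0 IM ball_safe0 ball_jump_safe flow_uni alpha_gt1 mu_tail r0_gt0 I_open tl_rv
    mean0 law_cvg J_gt0 (lexx r0) flow_core Cb0 mB BI e00 Cpos t0 k0.
  split.
    have := late_exit_limsup aD sD D0 b_gt0 Z_iid lwE mI e00 lam_pos mB Cpos t0 (mulr_ge0 CB0 K0).
    rewrite /K mulrA => /(_ J hu); rewrite -EFinM mulrA; exact.
  have L1 : Cm (interior (B : set 'cV[R]_m)) * K <= 1.
    rewrite /K mulrA mulr_ile1 ?expR_ge0 ?mulr_ge0 ?invr_ge0 ?(ltW Cpos)//; first by rewrite ler_pdivrMr// mul1r.
    by rewrite -expR0 ler_expR oppr_le0.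
  have := late_exit_liminf aD sD D0 b_gt0 Z_iid lwE mI e00 lam_pos mB Cpos t0 L1.
  rewrite /K mulrA => /(_ J hl); rewrite -EFinM mulrA; exact.
rewrite /CI CIE lte_fin ltry andbT => /negP; rewrite -leNgt => Cle.
have Ceq : Cm (~` I) = 0 by apply/eqP; rewrite eq_le Cle C0.
split; first by rewrite Ceq.
move=> e0 t e00 t0.
have hs kappa (k0 : 0 < kappa) := exit_slow aD sD D0 y_flow b_gt0 c_gt0 e_gt0 IM ball_safe0 ball_jump_safe flow_uni alpha_gt1 mu_tail r0_gt0 I_open tl_rv
  mean0 law_cvg J_gt0 (lexx r0) flow_core Cb0 mIc (fun _ => id) e00 Ceq t0 k0.
have h := early_exit_lim0 aD sD D0 b_gt0 Z_iid lwE mI lam_pos t0 hs.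
exact: h.
Qed.
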